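(* Fix $j\ge1$. Let $(\lambda_h,\sigma_h,u_h)\in\mathbb{R}\times S_0^h\times S_0^h$ be the $j$-th eigenpair of the discrete problem $$-a_h(\sigma_h,\psi_h)+b(\psi_h,u_h)=0\quad\forall\psi_h\in S_0^h,\qquad b(\sigma_h,v_h)=(\lambda_hu_h,v_h)\quad\forall v_h\in S_0^h,$$ with $\|u_h\|_0=1$, and let $\lambda$ be the $j$-th eigenvalue of the problem: find $(\lambda,\sigma,u)\in\mathbb{R}\times H_0^1(\Omega)\times H_0^1(\Omega)$, $u\ne0$, such that $$-a(\sigma,\psi)+b(\psi,u)=0\quad\forall\psi\in H_0^1(\Omega),\qquad b(\sigma,v)=(\lambda u,v)\quad\forall v\in H_0^1(\Omega).$$ Then, when $h$ is sufficiently small, there exists an eigenfunction $(\sigma,u)$ of the latter problem corresponding to $\lambda$ such that, with a constant $C$ independent of $h$, $$|\lambda-\lambda_h|\le C\big[\eta_0(h)(\|u-\mathcal{P}_hu\|_1+\|\sigma-\mathcal{P}_h\sigma\|_1)+\|\xi-\xi_h\|_0\big],$$ $$\|u-u_h\|_0\le C\big[\eta_0(h)(\|u-\mathcal{P}_hu\|_1+\|\sigma-\mathcal{P}_h\sigma\|_1)+\|\xi-\xi_h\|_0\big],$$ $$\|u-u_h\|_1\le C\big[\|u-\mathcal{P}_hu\|_1+\|\sigma-\mathcal{P}_h\sigma\|_0+\|\xi-\xi_h\|_0\big],$$ $$\|\sigma-\sigma_h\|_0\le C\big[\eta_0(h)(\|u-\mathcal{P}_hu\|_1+\|\sigma-\mathcal{P}_h\sigma\|_1)+\|\xi-\xi_h\|_0\big],$$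 $$\|\sigma-\sigma_h\|_1\le C\big[\eta_0(h)\|u-\mathcal{P}_hu\|_1+\|\sigma-\mathcal{P}_h\sigma\|_1+\|\xi-\xi_h\|_0\big].$$
   Context: Domain. $\Omega\subset\mathbb{R}^2$ is a polygonal domain with exactly one re-entrant corner $Q$, placed at the origin, with interior angle $\omega\in(\pi,2\pi)$. $(r,\theta)$ are polar coordinates centred at $Q$ such that the two sides of $\partial\Omega$ meeting at $Q$ lie on $\theta=0$ and $\theta=\omega$. $(\cdot,\cdot)$ is the $L^2(\Omega)$ inner product, $\|\cdot\|_s$ the $H^s(\Omega)$ norm ($\|\cdot\|_0$ is the $L^2$ norm). The function $\xi$. Fix $\tau\in(0,1)$ and $R>0$ such that the sector $K_\omega^R=\{(r\cos\theta,r\sin\theta):0\le r\le R,\ 0\le\theta\le\omega\}$ is contained in $\Omega$ (up to the two sides of $\partial\Omega$ meeting at $Q$). Let $\chi=\chi(r)$ be a $C^\infty$ cut-off function with $\chi=1$ for $0\le r\le\tau R$ and $\chi=0$ for $r>R$. Put $s^-=\chi(r)\,r^{-\pi/\omega}\sin(\pi\theta/\omega)\in L^2(\Omega)$, let $\zeta\in H_0^1(\Omega)$ solve $-\Delta\zeta=\Delta s^-$ in $\Omega$, $\zeta=0$ on $\partial\Omega$ (here $\Delta s^-$ is taken pointwise in $\Omega$; it vanishes for $r<\tau R$ and $r>R$), and set $\xi=s^-+\zeta\in L^2(\Omega)$. Forms. $b(\psi,v)=(\nabla\psi,\nabla v)$; $c(w)=(w,\xi)/\|\xi\|_0^2$;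 $a(w,\psi)=(w,\psi)-(c(w)\xi,\psi)$. Discretization. $\{\mathcal{T}_h\}$ is a family of shape-regular triangular meshes of $\Omega$: there is a constant $\gamma^*$ with $h_K/d_K\le\gamma^*$ for all $K\in\cup_h\mathcal{T}_h$, where $h_K$ is the diameter of $K$ and $d_K$ the diameter of the biggest ball contained in $K$; $h=\max_{K\in\mathcal{T}_h}h_K$. $S_0^h=\{v\in C^0(\bar\Omega)\cap H_0^1(\Omega): v|_K\in P_1(K)\ \forall K\in\mathcal{T}_h\}$, with $P_1(K)$ the polynomials of degree at most $1$ on $K$. $\zeta_h\in S_0^h$ solves $b(\zeta_h,v_h)=(\Delta s^-,v_h)$ for all $v_h\in S_0^h$; $\xi_h=\zeta_h+s^-$; $c_h(w)=(w,\xi_h)/\|\xi_h\|_0^2$; $a_h(w,\psi)=(w,\psi)-(c_h(w)\xi_h,\psi)$. Operators. $\mathcal{P}_h:H_0^1(\Omega)\to S_0^h$ is the Ritz projection: $b(w-\mathcal{P}_hw,v_h)=0$ for all $v_h\in S_0^h$. $S:L^2(\Omega)\to H_0^1(\Omega)$ is the Poisson solution operator: $b(Sg,v)=(g,v)$ for all $v\in H_0^1(\Omega)$. $\eta_0(h)=\sup_{g\in L^2(\Omega),\,\|g\|_0=1}\ \inf_{\psi\in S_0^h}\|Sg-\psi\|_1$. Eigenvalues (of both problems) are numbered in increasing order, counted with multiplicity. *)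

(* Defs.v *)
From HB Require Import structures.
From mathcomp Require Import all_boot all_order all_algebra.
From mathcomp Require Import all_classical all_reals all_analysis.

Set Implicit Arguments.
Unset Strict Implicit.
Unset Printing Implicit Defensive.

Import Order.TTheory GRing.Theory Num.Theory.
Import numFieldNormedType.Exports.
Local Open Scope classical_set_scope.
Local Open Scope ring_scope.

Notation plane R := (R * R)%type.

(** * Plane geometry *)

(* The library norm of [R * R] is the max norm; lengths here are Euclidean. *)
Definition radius (R : realType) (p : plane R) : R :=
  Num.sqrt (p.1 ^+ 2 + p.2 ^+ 2).

Definition edist (R : realType) (p q : plane R) : R := radius (p - q).

Definition polar (R : realType) (r t : R) : plane R := (r * cos t, r * sin t).

(* The polar angle, with values in [0, 2 pi[. *)
Definition angle (R : realType) (p : plane R) : R :=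
  if 0 <= p.2 then acos (p.1 / radius p) else 2 * pi - acos (p.1 / radius p).

Lemma angle_polar (R : realType) (r t : R) :
  0 < r -> 0 <= t -> t < 2 * pi -> angle (polar r t) = t.
Proof.
move=> r0 t0 t2.
have rE : radius (polar r t) = r.
  by rewrite /radius /= !exprMn -mulrDr cos2Dsin2 mulr1 sqrtr_sqr gtr0_norm.
rewrite /angle rE /= mulrAC divff ?gt_eqF// mul1r pmulr_rge0//.
have [tpi|pit] := leP t pi.
  by rewrite sin_ge0_pi ?cosK ?in_itv/= ?t0.
have spE : sin t = - sin (t - pi) by rewrite -{1}(subrK pi t) sinDpi.
have sp : 0 < sin (t - pi).
  by apply: sin_gt0_pi; rewrite subr_gt0 pit ltrBlDr -mulr2n -mulr_natl.
rewrite spE oppr_ge0 leNgt sp /=.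
have -> : cos t = cos (2 * pi - t).
  by rewrite mulr_natl addrC mulr2n addrA !cosDpi opprK cosN.
rewrite cosK ?subKr// in_itv/= subr_ge0 (ltW t2) /=.
by rewrite lerBlDr mulr_natl mulr2n lerD2l ltW.
Qed.

Definition hull (R : realType) (s : seq (plane R)) : set (plane R) :=
  [set p | exists w : 'I_(size s) -> R,
     [/\ forall i, 0 <= w i, \sum_i w i = 1 & p = \sum_i w i *: s`_i]].

Definition boundary (R : realType) (A : set (plane R)) : set (plane R) :=
  closure A `\` interior A.

(* Near [p], the set [A] is an open sector with apex [p], opening angle [a]
   and first side in the direction [t0], the sector lying counterclockwise
   from that side. *)
Definition interior_angle (R : realType) (A : set (plane R)) (p : plane R)
    (t0 a : R) : Prop :=
  0 < a < 2 * pi /\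
  exists2 e : R, 0 < e &
    A `&` [set q | edist p q < e] =
    [set q | exists r t : R,
       [/\ 0 < r < e, t0 < t < t0 + a & q = p + polar r t]].

Definition polygonal_domain (R : realType) (Om : set (plane R)) : Prop :=
  [/\ Om !=set0, open Om, connected Om, bounded_set Om &
      (exists sides : seq (plane R * plane R),
         boundary Om = \bigcup_(s in [set` sides]) hull [:: s.1; s.2]) /\
      (forall p, boundary Om p -> exists t0 a, interior_angle Om p t0 a)].

(* Exactly one re-entrant corner, at the origin, of interior angle [om] and with
   its sides on theta = 0 and theta = om.  Boundary points which are not corners
   have interior angle [pi]. *)
Definition one_reentrant_corner (R : realType) (Om : set (plane R)) (om : R) :
    Prop :=
  [/\ pi < om < 2 * pi, interior_angle Om 0 0 om &
      forall p t0 a, boundary Om p -> p <> 0 ->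
        interior_angle Om p t0 a -> a <= pi].

(* The closed sector of radius [rho] lies in [Om], except for its two straight
   sides, which lie in the boundary. *)
Definition sector_inside (R : realType) (Om : set (plane R)) (om rho : R) :
    Prop :=
  (forall r t, 0 < r <= rho -> 0 < t < om -> Om (polar r t)) /\
  (forall r, 0 <= r <= rho ->
     boundary Om (polar r 0) /\ boundary Om (polar r om)).

(** * Lebesgue and Sobolev spaces *)

(* Elements of the function spaces are functions on the whole plane of which
   only the restriction to [Om], up to null sets, matters. *)

Definition mu2 (R : realType) := (@lebesgue_measure R \x @lebesgue_measure R)%E.

Definition L2 (R : realType) (Om : set (plane R)) : set (plane R -> R) :=
  [set f : plane R -> R |
     measurable_fun Om f /\ (@mu2 R).-integrable Om (fun x => (f x ^+ 2)%:E)].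

Definition ip (R : realType) (Om : set (plane R)) (f g : plane R -> R) : R :=
  \int[@mu2 R]_(x in Om) (f x * g x).

Definition norm0 (R : realType) (Om : set (plane R)) (f : plane R -> R) : R :=
  Num.sqrt (ip Om f f).

Definition null_on (R : realType) (Om : set (plane R)) (f : plane R -> R) :
    Prop :=
  {ae @mu2 R, forall x, Om x -> f x = 0}.

Definition smooth (R : realType) (f : plane R -> R) : Prop :=
  forall (vs : seq (plane R)) x,
    differentiable (foldr (fun v g => 'D_v g) f vs) x.

Definition test_function (R : realType) (Om : set (plane R)) :
    set (plane R -> R) :=
  [set phi | smooth phi /\
     exists K, [/\ compact K, K `<=` Om & forall x, ~ K x -> phi x = 0]].

Definition e1 (R : realType) : plane R := (1, 0).
Definition e2 (R : realType) : plane R := (0, 1).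

Definition is_weak_deriv (R : realType) (Om : set (plane R)) (v : plane R)
    (w g : plane R -> R) : Prop :=
  L2 Om g /\
  forall phi, test_function Om phi -> ip Om w ('D_v phi) = - ip Om g phi.

Definition weak_deriv (R : realType) (Om : set (plane R)) (v : plane R)
    (w : plane R -> R) : plane R -> R :=
  xget (cst 0) [set g | is_weak_deriv Om v w g].

Definition H1 (R : realType) (Om : set (plane R)) : set (plane R -> R) :=
  [set w | [/\ L2 Om w, exists g, is_weak_deriv Om (e1 R) w g
             & exists g, is_weak_deriv Om (e2 R) w g]].

(* b(psi, v) = (grad psi, grad v) *)
Definition bform (R : realType) (Om : set (plane R)) (psi v : plane R -> R) : R :=
  ip Om (weak_deriv Om (e1 R) psi) (weak_deriv Om (e1 R) v) +
  ip Om (weak_deriv Om (e2 R) psi) (weak_deriv Om (e2 R) v).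

Definition norm1 (R : realType) (Om : set (plane R)) (w : plane R -> R) : R :=
  Num.sqrt (ip Om w w + bform Om w w).

(* The closure of the test functions in H^1. *)
Definition H10 (R : realType) (Om : set (plane R)) : set (plane R -> R) :=
  [set w | H1 Om w /\
     forall e : R, 0 < e ->
       exists2 phi, test_function Om phi & norm1 Om (w \- phi) < e].

(** * The singular function *)

Definition cutoff (R : realType) (tau rho : R) (chi : R -> R) : Prop :=
  [/\ forall n r, 0 < r -> derivable (derive1n n chi) r 1,
      forall r, 0 <= r <= tau * rho -> chi r = 1
    & forall r, rho < r -> chi r = 0].

Definition sing (R : realType) (om : R) (chi : R -> R) (p : plane R) : R :=
  chi (radius p) * radius p `^ (- (pi / om)) * sin (pi * angle p / om).

Definition laplacian (R : realType) (f : plane R -> R) : plane R -> R :=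
  'D_(e1 R) ('D_(e1 R) f) \+ 'D_(e2 R) ('D_(e2 R) f).

(** * Forms and eigenvalue problems *)

Definition cform (R : realType) (Om : set (plane R)) (xi w : plane R -> R) : R :=
  ip Om w xi / norm0 Om xi ^+ 2.

Definition aform (R : realType) (Om : set (plane R)) (xi w psi : plane R -> R) :
    R :=
  ip Om w psi - ip Om (cform Om xi w \*o xi) psi.

(* The eigenvalue problem posed in the space [V], with [xi] in the form a. *)
Definition eigenpair (R : realType) (Om : set (plane R))
    (V : set (plane R -> R)) (xi : plane R -> R)
    (lambda : R) (sigma u : plane R -> R) : Prop :=
  [/\ V sigma, V u, ~ null_on Om u,
      forall psi, V psi -> - aform Om xi sigma psi + bform Om psi u = 0
    & forall v, V v -> bform Om sigma v = ip Om (lambda \*o u) v].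

Definition independent (R : realType) (Om : set (plane R)) (n : nat)
    (u : 'I_n -> plane R -> R) : Prop :=
  forall k : 'I_n -> R,
    null_on Om (fun x => \sum_i k i * u i x) -> forall i, k i = 0.

(* The eigenvalues in the set [J], counted with multiplicity, are at least [n]
   in number.  [sigma] is determined by [u], so that independence of the
   components [u] is independence of the eigenfunctions. *)
Definition eigenvalues_in (R : realType) (Om : set (plane R))
    (V : set (plane R -> R)) (xi : plane R -> R) (J : set R) (n : nat) : Prop :=
  exists (lambda : 'I_n -> R) (sigma u : 'I_n -> plane R -> R),
    (forall i, J (lambda i) /\ eigenpair Om V xi (lambda i) (sigma i) (u i)) /\
    independent Om u.

Definition nth_eigenvalue (R : realType) (Om : set (plane R))
    (V : set (plane R -> R)) (xi : plane R -> R) (j : nat) (lambda : R) : Prop :=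
  [/\ exists sigma u, eigenpair Om V xi lambda sigma u,
      eigenvalues_in Om V xi [set l | l <= lambda] j
    & ~ eigenvalues_in Om V xi [set l | l < lambda] j].

(** * Finite elements *)

(* A triangle is given by the sequence of its three vertices, a mesh by the
   sequence of its triangles. *)
Notation triangle R := (seq (plane R)).
Notation mesh R := (seq (seq (plane R))).

Definition is_triangle (R : realType) (K : triangle R) : Prop :=
  exists p q r : plane R,
    K = [:: p; q; r] /\
    (q.1 - p.1) * (r.2 - p.2) - (q.2 - p.2) * (r.1 - p.1) != 0.

(* Two triangles meet in the hull of their common vertices: the empty set, a
   common vertex, or a common side. *)
Definition mesh_of (R : realType) (Om : set (plane R)) (T : mesh R) : Prop :=
  [/\ forall K, K \in T -> is_triangle K,
      \bigcup_(K in [set` T]) hull K = closure Om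
    & forall K L, K \in T -> L \in T ->
        hull K `&` hull L = hull [seq p <- K | p \in L]].

Definition diam (R : realType) (A : set (plane R)) : R :=
  sup [set d | exists p q, [/\ A p, A q & d = edist p q]].

Definition inball_diam (R : realType) (A : set (plane R)) : R :=
  sup [set d | 0 <= d /\ exists p, [set q | edist p q <= d / 2] `<=` A].

Definition mesh_size (R : realType) (T : mesh R) : R :=
  \big[Num.max/0]_(K <- T) diam (hull K).

Definition shape_regular (R : realType) (gamma : R) (T : mesh R) : Prop :=
  forall K, K \in T -> diam (hull K) / inball_diam (hull K) <= gamma.

(* S_0^h *)
Definition S0 (R : realType) (Om : set (plane R)) (T : mesh R) :
    set (plane R -> R) :=
  [set v | [/\ {within closure Om, continuous v}, H10 Om v
      & forall K, K \in T -> exists k0 k1 k2 : R,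
          forall p, hull K p -> v p = k0 + k1 * p.1 + k2 * p.2]].

Definition ritz_projection (R : realType) (Om : set (plane R)) (T : mesh R)
    (P : (plane R -> R) -> plane R -> R) : Prop :=
  forall w, H10 Om w ->
    S0 Om T (P w) /\ forall v, S0 Om T v -> bform Om (w \- P w) v = 0.

Definition poisson_operator (R : realType) (Om : set (plane R))
    (S : (plane R -> R) -> plane R -> R) : Prop :=
  forall g, L2 Om g ->
    H10 Om (S g) /\ forall v, H10 Om v -> bform Om (S g) v = ip Om g v.

Definition eta0 (R : realType) (Om : set (plane R))
    (S : (plane R -> R) -> plane R -> R) (T : mesh R) : R :=
  sup [set inf [set norm1 Om (S g \- psi) | psi in S0 Om T]
        | g in [set g | L2 Om g /\ norm0 Om g = 1]].

(* Main.v *)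
Require Import Defs.
From HB Require Import structures.
From mathcomp Require Import all_boot all_order all_algebra.
From mathcomp Require Import all_classical all_reals all_analysis.
From mathcomp Require Import measurable_realfun.
From mathcomp Require Import ring lra.
(* [radius] is also the name of a library constant. *)
Import Defs.
Set Implicit Arguments.
Unset Strict Implicit.
Unset Printing Implicit Defensive.
Import Order.TTheory GRing.Theory Num.Theory.
Import numFieldNormedType.Exports.
Local Open Scope classical_set_scope.
Local Open Scope ring_scope.

(* Eliminating [sigma], both problems become eigenvalue problems [A u = u / lambda] for the
   symmetric nonnegative operators [A = S Q S] and [A_h = S_h Q_h S_h] of [L2], where [S] and
   [S_h = P_h S] solve the Poisson equation and [Q], [Q_h] project orthogonally to [xi], [xi_h].
   The operators [A_h] converge to [A] in norm (Rellich's theorem, density of the finite element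
   spaces and duality), so that counting eigenvalues identifies the [j]-th ones; the component of
   [u_h] in the eigenspace of [lambda] is the eigenfunction [u], because [A - 1/lambda] is bounded
   below on the orthogonal complement.  All errors then reduce to [<A_h u - A u, g>], which is a sum
   of Ritz projection errors and of [xi - xi_h]; the Aubin-Nitsche argument gives the factor [eta_0].

   Density of the finite element spaces comes from the nodal interpolation of test functions: the
   interpolant is Lipschitz with compact support, hence a member of [H10].  Finally [xi] is not null
   because the singular function is not in [H^1]: by homogeneity, an integration by parts against
   [phi (2^n x)] has sides of different orders in [n]. *)

(** * Semi-inner products and deflated solution operators *)

(** Elements of the spaces are functions, not classes modulo null sets. All forms are therefore only
    semi-definite, [S] and [P] are chosen functions that are linear only up to null vectors, and
    operator identities are stated tested against an arbitrary [h]. Compactness enters in a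
    quantitative form: up to a small multiple of the energy, finitely many functionals control the
    L^2 norm. Limits are taken along an ultrafilter in L^2, and [S] brings them back to [H10]. [C]
    is independent of h because the gap [c] at [1/lambda] depends only on [A] and [lambda], whatever
    the multiplicity: h has only to bring the norm of [A_h - A] below [c/4] and [1/(2 lambda)],
    after which perturbation terms are absorbed. The abstract estimate bounds every error by one
    sum: the L^2 Ritz errors of [u] and [sigma] plus the error of [xi]. [H10] is a closure of test
    functions, so a Lipschitz function has to be approached by smooth ones; since these have merely
    bounded gradients, an energy minimization supplies the strong convergence. *)

Section SemiInner.
Variables (R : realType) (E : lmodType R).

(** Definiteness is left out because functions that agree almost everywhere remain distinct
    elements; [snorm (x - y) = 0] takes the place of equality. *)
Record semi_inner (f : E -> E -> R) : Prop := SemiInner {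
  si_lin : forall a x y z, f (a *: x + y) z = a * f x z + f y z;
  si_sym : forall x y, f x y = f y x;
  si_ge0 : forall x, 0 <= f x x }.

Variables (f : E -> E -> R) (hf : semi_inner f).

Definition snorm x := Num.sqrt (f x x).

Lemma siDl x y z : f (x + y) z = f x z + f y z.
Proof. by rewrite -[x]scale1r (si_lin hf) mul1r scale1r. Qed.

Lemma si0l z : f 0 z = 0.
Proof. by apply: (@addrI _ (f 0 z)); rewrite -siDl !addr0. Qed.

Lemma siZl a x z : f (a *: x) z = a * f x z.
Proof. by rewrite -[a *: x]addr0 (si_lin hf) si0l addr0. Qed.

Lemma siNl x z : f (- x) z = - f x z.
Proof. by rewrite -scaleN1r siZl mulN1r. Qed.

Lemma siBl x y z : f (x - y) z = f x z - f y z.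
Proof. by rewrite siDl siNl. Qed.

Lemma siDr x y z : f x (y + z) = f x y + f x z.
Proof. by rewrite (si_sym hf) siDl !(si_sym hf x). Qed.

Lemma si0r z : f z 0 = 0. Proof. by rewrite (si_sym hf) si0l. Qed.

Lemma siZr a x z : f z (a *: x) = a * f z x.
Proof. by rewrite (si_sym hf) siZl (si_sym hf z). Qed.

Lemma siNr x z : f z (- x) = - f z x.
Proof. by rewrite (si_sym hf) siNl (si_sym hf z). Qed.

Lemma siBr x y z : f x (y - z) = f x y - f x z.
Proof. by rewrite siDr siNr. Qed.

Lemma si_suml n (x : 'I_n -> E) z : f (\sum_i x i) z = \sum_i f (x i) z.
Proof. by apply: (big_morph (fun x => f x z)) => [? ?|]; rewrite ?siDl ?si0l. Qed.

Lemma si_sumr n (x : 'I_n -> E) z : f z (\sum_i x i) = \sum_i f z (x i).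
Proof. by apply: (big_morph (f z)) => [? ?|]; rewrite ?siDr ?si0r. Qed.

Lemma si_CS x y : f x y ^+ 2 <= f x x * f y y.
Proof.
have H s t : 0 <= s ^+ 2 * f x x - 2 * s * t * f x y + t ^+ 2 * f y y.
  have := si_ge0 hf (s *: x - t *: y).
  rewrite !(siBl, siBr, siZl, siZr) (si_sym hf y x); congr (0 <= _); ring.
have := si_ge0 hf y; rewrite le_eqVlt => /predU1P[y0|y0].
  (* Here [y] is null but possibly nonzero: with s = a = [f x y], c = [f x x] and t = c + 1, the
     quadratic form equals -a^2 (c + 2), and its nonnegativity forces a = 0. *)
  rewrite -y0 mulr0; have := H (f x y) (f x x + 1); rewrite -y0.
  have := si_ge0 hf x; have := sqr_ge0 (f x y).
  move: (f x y) (f x x) => a c a0 c0; nra.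
have := H (f y y) (f x y); set a := f x y; set c := f y y in y0 *.
have -> : c ^+ 2 * f x x - 2 * c * a * a + a ^+ 2 * c = c * (f x x * c - a ^+ 2).
  by ring.
by rewrite pmulr_rge0// subr_ge0.
Qed.

Lemma snorm_ge0 x : 0 <= snorm x. Proof. exact: sqrtr_ge0. Qed.
Hint Resolve snorm_ge0 : core.

Lemma snormE x : snorm x ^+ 2 = f x x.
Proof. by rewrite sqr_sqrtr// (si_ge0 hf). Qed.

Lemma snorm_eq0 x : (snorm x == 0) = (f x x == 0).
Proof. by rewrite -snormE sqrf_eq0. Qed.

Lemma CSn x y : `|f x y| <= snorm x * snorm y.
Proof.
rewrite -(ler_pXn2r (n := 2)) ?nnegrE ?normr_ge0 ?mulr_ge0//.
by rewrite -normrX ger0_norm ?sqr_ge0// exprMn !snormE si_CS.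
Qed.

Lemma snormZ a x : snorm (a *: x) = `|a| * snorm x.
Proof.
rewrite /snorm siZl siZr mulrA -expr2 sqrtrM ?sqr_ge0//.
by rewrite sqrtr_sqr.
Qed.

Lemma snorm0 : snorm 0 = 0. Proof. by rewrite /snorm si0l sqrtr0. Qed.

Lemma snormN x : snorm (- x) = snorm x.
Proof. by rewrite -scaleN1r snormZ normrN1 mul1r. Qed.

Lemma snormBC x y : snorm (x - y) = snorm (y - x).
Proof. by rewrite -snormN opprB. Qed.

Lemma snormD x y : snorm (x + y) <= snorm x + snorm y.
Proof.
rewrite -(ler_pXn2r (n := 2)) ?nnegrE ?addr_ge0// snormE sqrrD !snormE.
rewrite !(siDl, siDr) (si_sym hf y x).
have := CSn x y; have := ler_norm (f x y); rewrite mulr2n; lra.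
Qed.

Lemma snormB x y : snorm (x - y) <= snorm x + snorm y.
Proof. by rewrite -(snormN y) snormD. Qed.

Lemma snorm_dist x y z : snorm (x - z) <= snorm (x - y) + snorm (y - z).
Proof. by rewrite (_ : x - z = (x - y) + (y - z)) ?snormD// addrA subrK. Qed.

Lemma snorm_lerB x y : snorm x - snorm y <= snorm (x - y).
Proof. by rewrite lerBlDr -{1}(subrK y x) snormD. Qed.

Lemma snorm_le c x : 0 <= c -> (forall y, f x y <= c * snorm y) -> snorm x <= c.
Proof.
move=> c0 /(_ x); rewrite -snormE expr2.
have := snorm_ge0 x; rewrite le_eqVlt => /predU1P[<-//|x0].
by rewrite ler_pM2r.
Qed.

(** By Cauchy-Schwarz, null vectors are invisible to [f]. This replaces passing to a quotient:
    vectors at distance zero may be exchanged in either argument. *)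
Lemma si_null x y : snorm x = 0 -> f x y = 0.
Proof.
by move=> x0; apply/eqP; rewrite -normr_le0; have := CSn x y; rewrite x0 mul0r.
Qed.

Lemma si_null_eq x y z : snorm (x - y) = 0 -> f x z = f y z.
Proof. by move=> xy; apply/eqP; rewrite -subr_eq0 -siBl si_null. Qed.

Lemma snorm_null_eq x y : snorm (x - y) = 0 -> snorm x = snorm y.
Proof.
move=> xy; congr Num.sqrt.
by rewrite (si_null_eq _ xy) (si_sym hf) (si_null_eq _ xy).
Qed.

End SemiInner.

(** The left kernel of an m by n matrix with n < m is nonzero. This is the dimension count of the
    min-max principle in [counting]. *)
Lemma lin_dependence (R : fieldType) (m n : nat) (M : 'I_m -> 'I_n -> R) :
  (n < m)%N -> exists2 k : 'I_m -> R, (exists i, k i != 0) &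
    forall j, \sum_i k i * M i j = 0.
Proof.
move=> nm; pose A := \matrix_(i, j) M i j.
have : (kermx A != 0)%R.
  by rewrite -mxrank_eq0 mxrank_ker -lt0n subn_gt0 (leq_ltn_trans (rank_leq_col A)).
move/rowV0Pn => [v /sub_kermxP vA v0]; exists (fun i => v 0 i).
  apply/existsP; rewrite -negb_forall; apply: contra v0 => /forallP v0.
  by apply/eqP/rowP => i; rewrite mxE; apply/eqP.
move=> j; have /rowP/(_ j) := vA; rewrite !mxE => vAj; rewrite -[RHS]vAj.
by apply: eq_bigr => i _; rewrite !mxE.
Qed.

(** * Orthogonal projection off one vector *)

Section Deflation.
Variables (R : realType) (H : lmodType R) (ip : H -> H -> R).
Hypothesis hip : semi_inner ip.
Local Notation nH := (snorm ip).

(** The projection [Q] onto the orthogonal complement of [xi], for which a(w, psi) is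
    [ip (dfl xi w) psi]. For a null [xi] the quotient is 0 and [dfl xi] is the identity. *)
Definition dfl (xi g : H) := g - (ip g xi / ip xi xi) *: xi.

Let siE := (siDl hip, siBl hip, siZl hip, siDr hip, siBr hip, siZr hip,
  siNl hip, siNr hip).

Lemma dfl_lin xi a g h : dfl xi (a *: g + h) = a *: dfl xi g + dfl xi h.
Proof.
rewrite /dfl !siE scalerBr mulrDl scalerDl opprD -mulrA -scalerA.
by rewrite addrACA.
Qed.

Lemma dflZ xi a g : dfl xi (a *: g) = a *: dfl xi g.
Proof. by rewrite /dfl siE scalerBr -mulrA scalerA. Qed.

Lemma dflB xi g h : dfl xi (g - h) = dfl xi g - dfl xi h.
Proof. by rewrite addrC -scaleN1r dfl_lin scaleN1r addrC. Qed.

Lemma dfl_sym xi g h : ip (dfl xi g) h = ip g (dfl xi h).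
Proof. by rewrite /dfl !siE (si_sym hip xi h); ring. Qed.

Lemma dfl_idem xi g h : ip (dfl xi g) (dfl xi h) = ip (dfl xi g) h.
Proof.
rewrite /dfl !siE (si_sym hip xi h); have [->|x0] := eqVneq (ip xi xi) 0.
  by rewrite invr0; ring.
by field.
Qed.

Lemma dfl_norm xi g : nH (dfl xi g) <= nH g.
Proof.
apply: (snorm_le hip) => [|y]; first exact: snorm_ge0.
apply: le_trans (ler_norm _) _.
have H1 : nH (dfl xi g) ^+ 2 <= nH (dfl xi g) * nH g.
  by rewrite snormE// dfl_idem (le_trans (ler_norm _))// CSn.
have H2 : nH (dfl xi g) <= nH g.
  have := snorm_ge0 ip (dfl xi g); have := snorm_ge0 ip g; nra.
by rewrite (le_trans (CSn hip _ _))// ler_wpM2r// snorm_ge0.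
Qed.

Lemma dfl_self xi : nH (dfl xi xi) = 0.
Proof.
apply/eqP; rewrite snorm_eq0// dfl_idem /dfl !siE.
have [->|x0] := eqVneq (ip xi xi) 0; first by rewrite mulr0 subr0.
by rewrite divff// mul1r subrr.
Qed.

(* With [P], [P'] the projections on [x], [y]:
   [P - P' = (1 - P') P - P' (1 - P)], and [1 - P'] annihilates [y]. *)
Lemma dfl_diff (x y g : H) : 0 < nH x -> nH x <= 2 * nH y ->
  nH (dfl y g - dfl x g) <= 3 / nH x * nH (x - y) * nH g.
Proof.
move=> x0 xy; have y0 : 0 < nH y by lra.
have nx0 : ip x x != 0 by rewrite -snorm_eq0// gt_eqF.
have ny0 : ip y y != 0 by rewrite -snorm_eq0// gt_eqF.
have -> : dfl y g - dfl x g =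
    (ip g x / ip x x) *: dfl y x - (ip (dfl x g) y / ip y y) *: y.
  rewrite /dfl opprB addrC addrA subrK scalerBr scalerA -addrA -opprD -scalerDl.
  by congr (_ - _ *: _); rewrite !siE; field; exact/andP.
have -> : dfl y x = dfl y (x - y) + dfl y y by rewrite dflB subrK.
rewrite scalerDr -addrA.
apply: le_trans (snormD hip _ _) _.
have -> : nH ((ip g x / ip x x) *: dfl y y - (ip (dfl x g) y / ip y y) *: y) =
   nH (- ((ip (dfl x g) y / ip y y) *: y)).
  by apply: snorm_null_eq => //; rewrite addrK snormZ// dfl_self mulr0.
rewrite snormN// !snormZ// !normrM !normfV.
rewrite (ger0_norm (si_ge0 hip x)) (ger0_norm (si_ge0 hip y)).
have -> : ip (dfl x g) y = - ip (dfl x g) (x - y).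
  by rewrite (siBr hip) [ip _ x]dfl_sym (si_sym hip g) (si_null hip _ (dfl_self x))
     sub0r opprK.
rewrite normrN -!snormE//.
(* The two summands contribute 1 and 2 to the constant 3; the 2 comes from [nH x <= 2 * nH y]. *)
have A : `|ip g x| / nH x ^+ 2 * nH (dfl y (x - y)) <= nH g / nH x * nH (x - y).
  apply: ler_pM (dfl_norm _ _); rewrite ?divr_ge0 ?sqr_ge0 ?snorm_ge0//.
  rewrite ler_pdivrMr ?exprn_gt0// expr2 mulrA divfK ?gt_eqF//.
  exact: CSn.
have B : `|ip (dfl x g) (x - y)| / nH y ^+ 2 * nH y <= 2 * nH g / nH x * nH (x - y).
  rewrite expr2 invfM mulrA divfK ?gt_eqF//.
  apply: (@le_trans _ _ ((nH g * nH (x - y)) / nH y)).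
    rewrite ler_pM2r ?invr_gt0//; apply: le_trans (CSn hip _ _) _.
    by rewrite ler_wpM2r ?snorm_ge0 ?dfl_norm.
  rewrite -mulrA mulrAC [leRHS]mulrAC [2 * _]mulrC -!mulrA.
  rewrite ler_wpM2l ?snorm_ge0// ler_pdivrMr//.
  rewrite (_ : 2 * _ * _ = nH (x - y) * (2 * nH y / nH x)); last by ring.
  by rewrite ler_peMr ?snorm_ge0// ler_pdivlMr// mul1r.
apply: le_trans (lerD A B) _.
by rewrite le_eqVlt; apply/orP; left; apply/eqP; ring.
Qed.

End Deflation.

(** * Galerkin solution operators and the operator [S Q S] *)

Section Solver.
Variables (R : realType) (H V : lmodType R) (ip : H -> H -> R) (b : V -> V -> R).
Variable io : {linear V -> H}.
Hypotheses (hip : semi_inner ip) (hb : semi_inner b).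
Local Notation nH := (snorm ip).
Local Notation nV := (snorm b).
Variable Cp : R.
Hypothesis Cp0 : 0 < Cp.
Hypothesis poincare : forall v, nH (io v) <= Cp * nV v.

Let siE := (siDl hip, siBl hip, siZl hip, siDr hip, siBr hip, siZr hip,
  siNl hip, siNr hip).

(** [SW] is the Galerkin solution operator on the subspace [W]: the Poisson operator if [W] is
    everything, its Ritz projection if [W] is a finite element space. One theory thus serves both
    problems. *)
Record solver (W : V -> Prop) (SW : H -> V) : Prop := Solver {
  sol_lin : forall a x y, W x -> W y -> W (a *: x + y);
  sol_in : forall g, W (SW g);
  sol_eq : forall g v, W v -> b (SW g) v = ip g (io v) }.

Definition eigen (W : V -> Prop) (xi : H) (l : R) (sg u : V) : Prop :=
  [/\ W sg, W u, ip (io u) (io u) != 0,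
      forall psi, W psi -> b psi u = ip (dfl ip xi (io sg)) (io psi) &
      forall v, W v -> b sg v = l * ip (io u) (io v)].

Definition indep n (x : 'I_n -> H) : Prop :=
  forall k : 'I_n -> R, nH (\sum_i k i *: x i) = 0 -> forall i, k i = 0.

Definition eigs (W : V -> Prop) (xi : H) (J : set R) (n : nat) : Prop :=
  exists (l : 'I_n -> R) (sg u : 'I_n -> V),
    (forall i, J (l i) /\ eigen W xi (l i) (sg i) (u i)) /\
    indep (fun i => io (u i)).

(** The operator [S Q S] of L^2. One [S] on each side of [Q] makes it symmetric and nonnegative:
    [ip (A g) h] is the product of [Q (S g)] with [S h]. *)
Definition op (SW : H -> V) (xi g : H) : H :=
  io (SW (dfl ip xi (io (SW g)))).

Section OneSolver.
Variables (W : V -> Prop) (SW : H -> V) (hS : solver W SW) (xi : H).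
Local Notation A := (op SW xi).

Lemma solB x y : W x -> W y -> W (x - y).
Proof. by move=> Wx Wy; rewrite addrC -scaleN1r; exact: (sol_lin hS). Qed.

Lemma solZ a x : W x -> W (a *: x).
Proof.
move=> Wx; rewrite -[a *: x]addr0; apply: (sol_lin hS) => //.
by rewrite -(subrr x); exact: solB.
Qed.

Lemma ip_sol g h : ip h (io (SW g)) = b (SW h) (SW g).
Proof. by rewrite (sol_eq hS)//; exact: sol_in hS _. Qed.

Lemma sol_sym g h : ip h (io (SW g)) = ip g (io (SW h)).
Proof. by rewrite !ip_sol (si_sym hb). Qed.

Lemma sol_bound g : nV (SW g) <= Cp * nH g.
Proof.
apply: snorm_le => // [|y]; first by rewrite mulr_ge0 ?snorm_ge0// ltW.
(* the energy of [SW g] is its pairing with [g] *)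
have : nV (SW g) ^+ 2 <= nH g * (Cp * nV (SW g)).
  rewrite snormE// -ip_sol (le_trans (ler_norm _))// (le_trans (CSn hip _ _))//.
  by rewrite ler_wpM2l ?snorm_ge0.
have := snorm_ge0 b (SW g); have := snorm_ge0 ip g; move=> g0 s0 H1.
have H2 : nV (SW g) <= Cp * nH g.
  move: s0; rewrite le_eqVlt => /predU1P[<-|s0]; first by rewrite mulr_ge0// ltW.
  by rewrite -(ler_pM2r s0) -expr2 (le_trans H1)// mulrCA mulrA.
rewrite (le_trans (ler_norm _))// (le_trans (CSn hb _ _))//.
by rewrite ler_wpM2r ?snorm_ge0.
Qed.

Lemma iosol_bound g : nH (io (SW g)) <= Cp ^+ 2 * nH g.
Proof.
rewrite (le_trans (poincare _))// expr2 -mulrA ler_wpM2l ?sol_bound//.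
exact: ltW.
Qed.

Lemma opE g h : ip (A g) h = ip (dfl ip xi (io (SW g))) (io (SW h)).
Proof. by rewrite /op (si_sym hip) sol_sym. Qed.

Lemma op_sym g h : ip (A g) h = ip g (A h).
Proof. by rewrite [RHS](si_sym hip) !opE dfl_sym// (si_sym hip). Qed.

Lemma op_ge0 g : 0 <= ip (A g) g.
Proof. by rewrite opE -dfl_idem// (si_ge0 hip). Qed.

(** [SW] selects solutions that are unique only up to null vectors, so [A] is linear only when
    tested; symmetry moves the argument to the linear side. *)
Lemma opDl a g g' h : ip (A (a *: g + g')) h = a * ip (A g) h + ip (A g') h.
Proof. by rewrite !op_sym !siE. Qed.

Lemma opZl a g h : ip (A (a *: g)) h = a * ip (A g) h.
Proof. by rewrite !op_sym !siE. Qed.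

Lemma opBl g g' h : ip (A (g - g')) h = ip (A g) h - ip (A g') h.
Proof. by rewrite !op_sym !siE. Qed.

Lemma sol2_bound g : nV (SW (dfl ip xi (io (SW g)))) <= Cp ^+ 3 * nH g.
Proof.
rewrite (le_trans (sol_bound _))// exprS -mulrA ler_pM2l//.
by rewrite (le_trans (dfl_norm hip _ _))// iosol_bound.
Qed.

Lemma op_bound g : nH (A g) <= Cp ^+ 4 * nH g.
Proof.
rewrite (le_trans (poincare _))// [Cp ^+ 4]exprS -mulrA ler_pM2l//.
exact: sol2_bound.
Qed.

Lemma opB_bound g g' : nH (A g - A g') <= Cp ^+ 4 * nH (g - g').
Proof.
apply: snorm_le => // [|y].
  by rewrite mulr_ge0 ?snorm_ge0 ?exprn_ge0// ltW.
rewrite (siBl hip) -opBl (le_trans (ler_norm _))// (le_trans (CSn hip _ _))//.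
by rewrite ler_wpM2r ?snorm_ge0 ?op_bound.
Qed.

(** Up to null vectors the second equation gives [sg = l S u] and the first [u = S Q sg], whence
    [A u = u / l]. Since [A] is nonnegative and [u] is not null, [l] is positive. *)
Lemma eigen_op l sg u : eigen W xi l sg u ->
  0 < l /\ forall h, l * ip (A (io u)) h = ip (io u) h.
Proof.
move=> [Wsg Wu u0 eu es].
have WS : W (l *: SW (io u)) by apply: solZ; exact: sol_in hS _.
have null v : W v -> b (sg - l *: SW (io u)) v = 0.
  by move=> Wv; rewrite (siBl hb) (siZl hb) es// (sol_eq hS)// subrr.
have z0 : nH (io (sg - l *: SW (io u))) = 0.
  apply/eqP; rewrite eq_le snorm_ge0 andbT (le_trans (poincare _))//.
  by rewrite /snorm null ?sqrtr0 ?mulr0//; exact: solB.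
have H1 h : l * ip (A (io u)) h = ip (io u) h.
  rewrite opE dfl_sym// -(siZl hip) -linearZ.
  rewrite -(si_null_eq hip (x := io sg)); last by rewrite -linearB.
  rewrite -dfl_sym// -eu; last exact: sol_in hS _.
  by rewrite (sol_eq hS)// (si_sym hip).
split=> //; have uu : 0 < ip (io u) (io u) by rewrite lt0r u0 (si_ge0 hip).
have := op_ge0 (io u); move: uu; rewrite -(H1 (io u)) => uu.
rewrite le_eqVlt => /predU1P[A0|A0]; first by move: uu; rewrite -A0 mulr0 ltxx.
by rewrite -(pmulr_lgt0 _ A0).
Qed.

(** The converse of [eigen_op]. The vector [z] need not come from [V]; the eigenfunction is its
    representative [S Q sg], that is [A z / nu] seen in [V]. *)
Lemma op_eigen z nu : ip z z != 0 -> nu != 0 ->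
  (forall h, ip (A z) h = nu * ip z h) ->
  let sg := nu^-1 *: SW z in let u := SW (dfl ip xi (io sg)) in
  eigen W xi nu^-1 sg u /\ nH (io u - z) = 0.
Proof.
move=> z0 nu0 Az sg u.
have uz h : ip (io u) h = ip z h.
  rewrite (si_sym hip) sol_sym /sg linearZ/= dflZ// siE -opE Az.
  by rewrite mulrA mulVf// mul1r.
have uz0 : nH (io u - z) = 0.
  by apply/eqP; rewrite snorm_eq0//; rewrite (siBl hip) uz subrr.
split=> //; split; [exact/solZ/(sol_in hS)|exact: (sol_in hS)| | |].
- by rewrite uz (si_sym hip) uz.
- by move=> psi Wp; rewrite (si_sym hb) (sol_eq hS).
- by move=> v Wv; rewrite (siZl hb) (sol_eq hS)// uz.
Qed.

End OneSolver.
End Solver.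

(** * Spectral theory of compact solution operators *)

Lemma le0_eps (R : realType) (a K : R) : 0 <= K ->
  (forall e, 0 < e -> a <= K * e) -> a <= 0.
Proof.
move=> K0 H; apply/ler_addgt0Pl => e e0; rewrite addr0.
have K1 : 0 < K + 1 by lra.
have /H/le_trans : 0 < e / (K + 1) by rewrite divr_gt0.
apply; rewrite mulrA ler_pdivrMr// mulrC ler_wpM2l ?(ltW e0)//; lra.
Qed.

(** Bisection: an ultrafilter contains the indices falling in one of the two halves of an interval,
    so the interval can be halved until its length is at most [d]. *)
Lemma ultra_bounded (R : realType) (U : set_system nat) (u : nat -> R) (B d : R) :
  UltraFilter U -> (forall n, `|u n| <= B) -> 0 < d ->
  exists2 A, U A & forall n m, A n -> A m -> `|u n - u m| <= d.
Proof.
move=> UU uB d0.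
have H k : exists a, U [set n | a <= u n <= a + 2 * B / 2 ^+ k].
  elim: k => [|k [a Ua]].
    exists (- B); apply: filterS filterT => n _ /=.
    have := uB n; rewrite ler_norml expr0 divr1; lra.
  have [Um|Um] := in_ultra_setVsetC [set n | u n <= a + 2 * B / 2 ^+ k.+1] UU.
    exists a; apply: filterS (filterI Ua Um) => n /= [/andP[-> _] ->//].
  exists (a + 2 * B / 2 ^+ k.+1); apply: filterS (filterI Ua Um) => n /=.
  move=> [/andP[_ un]] /negP; rewrite -ltNge => /ltW ->/=.
  rewrite (le_trans un)// -addrA lerD2l le_eqVlt; apply/orP; left; apply/eqP.
  by rewrite exprS; field; rewrite expf_neq0.
have [k kd] : exists k, 2 * B / 2 ^+ k <= d.
  have B0 : 0 <= B := le_trans (normr_ge0 _) (uB 0%N).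
  exists (Num.bound (2 * B / d)); rewrite ler_pdivrMr ?exprn_gt0// [leRHS]mulrC.
  rewrite -ler_pdivrMr//.
  apply: (@le_trans _ _ (Num.bound (2 * B / d))%:R).
    by rewrite ltW// archi_boundP// divr_ge0 ?mulr_ge0// ltW.
  by rewrite -natrX ler_nat ltnW// ltn_expl.
have [a Ua] := H k; exists [set n | a <= u n <= a + 2 * B / 2 ^+ k] => //.
move=> n m /= /andP[n1 n2] /andP[m1 m2]; rewrite ler_norml; lra.
Qed.

Section Spectral.
Variables (R : realType) (H V : lmodType R) (ip : H -> H -> R) (b : V -> V -> R).
Variable io : {linear V -> H}.
Hypotheses (hip : semi_inner ip) (hb : semi_inner b).
Local Notation nH := (snorm ip).
Local Notation nV := (snorm b).
Variable Cp : R.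
Hypothesis Cp0 : 0 < Cp.
Hypothesis poincare : forall v, nH (io v) <= Cp * nV v.
(* Compactness of [io]: up to a small multiple of the energy, the norm is
   controlled by finitely many functionals. *)
Hypothesis rellich : forall e : R, 0 < e -> exists s : seq H, forall v,
  nH (io v) ^+ 2 <= e * nV v ^+ 2 + \sum_(g <- s) ip (io v) g ^+ 2.
Hypothesis complete : forall x : nat -> H,
  (forall m, nH (x m.+1 - x m) <= 4^-1 ^+ m) ->
  exists l, forall e : R, 0 < e -> exists N, forall m, (N <= m)%N -> nH (x m - l) <= e.

Let siE := (siDl hip, siBl hip, siZl hip, siDr hip, siBr hip, siZr hip,
  siNl hip, siNr hip).
Let snH_ge0 x : 0 <= nH x := snorm_ge0 ip x.
Hint Resolve snH_ge0 : core.

Variables (W : V -> Prop) (SW : H -> V) (hS : solver ip b io W SW) (xi : H).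
Local Notation A := (op ip io SW xi).
Local Notation eigs := (eigs ip b io W xi).
Local Notation eigen := (eigen ip b io W xi).

(** In [rellich] the differences have bounded energy, so their energy term is made small by the
    choice of [e], while each of the finitely many functionals is Cauchy along [U] by
    [ultra_bounded]. *)
Lemma ultra_cauchy (U : set_system nat) (y : nat -> V) (B d : R) :
  UltraFilter U -> (forall n, nV (y n) <= B) -> 0 < d ->
  exists2 D, U D & forall n m, D n -> D m -> nH (io (y n) - io (y m)) <= d.
Proof.
move=> UU yB d0.
have B0 : 0 <= B := le_trans (snorm_ge0 _ _) (yB 0%N).
(* Differences have energy norm at most 2 B, so this [e] keeps the energy term below [d ^+ 2 / 2];
   the added 1 covers B = 0. *)
pose e := d ^+ 2 / 2 / (4 * B ^+ 2 + 1).
have B1 : 0 < 4 * B ^+ 2 + 1 by rewrite ltr_wpDl// mulr_ge0// sqr_ge0.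
have e0 : 0 < e by rewrite !divr_gt0// exprn_gt0.
have [s sP] := rellich e0.
have [D UD HD] : exists2 D, U D & forall n m, D n -> D m ->
    \sum_(g <- s) ip (io (y n - y m)) g ^+ 2 <= d ^+ 2 / 2.
  have : 0 < d ^+ 2 / 2 by rewrite divr_gt0// exprn_gt0.
  move: (d ^+ 2 / 2); elim: s {sP} => [|g s IH] c c0.
    by exists setT; [exact: filterT|move=> n m _ _; rewrite big_nil ltW].
  have c2 : 0 < c / 2 by rewrite divr_gt0.
  have [D1 UD1 H1] := IH _ c2.
  have [c3 c30 c3c] : exists2 c3 : R, 0 < c3 & c3 ^+ 2 <= c / 2.
    by exists (Num.sqrt (c / 2)); rewrite ?sqrtr_gt0// sqr_sqrtr// ltW.
  have [|D2 UD2 H2] := @ultra_bounded _ U (fun n => ip (io (y n)) g)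
      (Cp * B * nH g) _ UU _ c30.
    move=> n; rewrite (le_trans (CSn hip _ _))// ler_wpM2r//.
    by rewrite (le_trans (poincare _))// ler_pM2l.
  exists (D1 `&` D2); first exact: filterI.
  move=> n m [n1 n2] [m1 m2]; rewrite big_cons [leRHS]splitr lerD//; last exact: H1.
  rewrite (le_trans _ c3c)// linearB (siBl hip) -ler_sqrt ?sqr_ge0//.
  by rewrite !sqrtr_sqr (ger0_norm (ltW c30)) H2.
exists D => // n m Dn Dm.
rewrite -(ler_pXn2r (n := 2)) ?nnegrE ?(ltW d0)// -linearB.
apply: le_trans (sP _) _; rewrite [leRHS]splitr lerD//; last exact: HD.
rewrite /e -mulrA ler_piMr ?divr_ge0 ?sqr_ge0// mulrC ler_pdivrMr// mul1r.
have : nV (y n - y m) <= 2 * B.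
  by rewrite (le_trans (snormB hb _ _))// mulr_natl mulr2n lerD.
have := snorm_ge0 b (y n - y m); nra.
Qed.

(* Approximate eigenvectors for a nonzero value yield an eigenvector, since [A]
   maps bounded sequences to sequences which are Cauchy along an ultrafilter. *)
Lemma weyl (nu : R) n (f : 'I_n -> H) : 0 < nu ->
  (forall e, 0 < e -> exists z, [/\ nH z = 1, forall i, ip z (f i) = 0 &
     nH (A z - nu *: z) <= e]) ->
  exists z, [/\ nH z = 1, forall i, ip z (f i) = 0 &
    forall h, ip (A z) h = nu * ip z h].
Proof.
move=> nu0 Hz.
have q0 m : (0 : R) < 4^-1 ^+ m by rewrite exprn_gt0.
have [z zP] := boolp.choice (fun m => Hz _ (q0 m)).
(* The preimage of [A (z m)] in [V]: its energy is bounded, as [ultra_cauchy] requires. *)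
pose v m := SW (dfl ip xi (io (SW (z m)))).
have vB m : nV (v m) <= Cp ^+ 3.
  rewrite (le_trans (sol2_bound hip hb Cp0 poincare hS xi (z m)))//.
  by have [-> _ _] := zP m; rewrite mulr1.
have [U [UU sU]] := @ultraFilterLemma nat \oo _.
have HD m : exists D, U D /\ forall i j, D i -> D j ->
    nH (io (v i) - io (v j)) <= 4^-1 ^+ m.
  by have [D UD HD] := ultra_cauchy UU vB (q0 m); exists D.
have [D DP] := boolp.choice HD.
(* A diagonal choice: an index in [E m] is good for all tolerances up to the m-th and is at least m,
   so that the sequence [io (v (N m))] is rapidly Cauchy. *)
pose E m := [set i | forall k, (k <= m)%N -> D k i] `&` [set i | (m <= i)%N].
have UE m : U (E m).
  apply: filterI; last by apply: sU; exists m.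
  elim: m => [|m IH].
    by apply: filterS (DP 0%N).1 => i Di k; rewrite leqn0 => /eqP->.
  apply: filterS (filterI IH (DP m.+1).1) => i [Di Dm] k.
  by rewrite leq_eqVlt => /predU1P[->//|]; exact: Di.
have HN m : exists k, E m k by have /filter_ex := UE m.
have [N NP] := boolp.choice HN.
have [|l lP] := complete (x := fun m => io (v (N m))).
  move=> m; apply: (DP m).2.
    exact: (NP m.+1).1.
  exact: (NP m).1.
(* Along [N], [A z] tends to [l] and [A z - nu z] to 0, so that [z] tends to [l / nu]. *)
pose y := nu^-1 *: l.
have yl : nu *: y = l by rewrite scalerA divff ?gt_eqF// scale1r.
have close e : 0 < e -> exists m, nH (z m - y) <= e /\ nH (A (z m) - nu *: z m) <= e.
  move=> e0; have e1 : 0 < nu * e / 2 by rewrite divr_gt0// mulr_gt0.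
  have e2 : 0 < Num.min e (nu * e / 2) by rewrite lt_min e0.
  have [k1 k1P] := lP _ e1.
  have [k2 k2P] : exists k, 4^-1 ^+ k <= Num.min e (nu * e / 2).
    have := cvg_geometric (1 : R) (z := 4^-1 : R).
    rewrite ger0_norm// invf_lt1// ltr1n => /(_ isT)/cvgrPdist_le/(_ _ e2).
    move=> [k _ /(_ k (leqnn k))]; rewrite sub0r normrN /= mul1r => H1.
    by exists k; apply: le_trans (ler_norm _) H1.
  pose k := maxn k1 k2; exists (N k).
  have [_ _ Hk] := zP (N k).
  have Hk' : nH (A (z (N k)) - nu *: z (N k)) <= Num.min e (nu * e / 2).
    rewrite (le_trans Hk)// (le_trans _ k2P)// ler_wiXn2l ?invr_ge0// ?invf_le1 ?ler1n//.
    by rewrite (leq_trans (leq_maxr k1 k2))//; exact: (NP k).2.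
  move: Hk'; rewrite le_min => /andP[He Hk']; split => //.
  rewrite -(ler_pM2l nu0) -{1}(gtr0_norm nu0) -snormZ// scalerBr yl.
  apply: (@le_trans _ _ (nH (nu *: z (N k) - A (z (N k))) + nH (A (z (N k)) - l))).
    exact: snorm_dist.
  rewrite (splitr (nu * e)) lerD//; first by rewrite snormBC.
  exact: k1P (leq_maxl _ _).
exists y; split.
- apply/eqP; rewrite -subr_eq0 -normr_le0; apply: (@le0_eps _ _ 1) => // e e0.
  have [m [zy _]] := close _ e0; have [z1 _ _] := zP m; rewrite mul1r.
  rewrite (le_trans _ zy)// ler_norml -z1 (snormBC hip) snorm_lerB// andbT.
  by rewrite lerNl opprB (snormBC hip) snorm_lerB.
- move=> i; apply/eqP; rewrite -normr_le0; apply: (@le0_eps _ _ (nH (f i))) => // e e0.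
  have [m [zy _]] := close _ e0; have [_ zf _] := zP m.
  rewrite -[ip y (f i)]subr0 -(zf i) -(siBl hip) (le_trans (CSn hip _ _))//.
  by rewrite mulrC ler_wpM2l// snormBC.
- move=> h; apply/eqP; rewrite -subr_eq0 -(siZl hip) -(siBl hip) -normr_le0.
  apply: (@le0_eps _ _ ((Cp ^+ 4 + 1 + nu) * nH h)) => [|e e0].
    by rewrite mulr_ge0// !addr_ge0 ?exprn_ge0 ?ltW.
  have [m [zy Az]] := close _ e0.
  rewrite (le_trans (CSn hip _ _))// mulrAC ler_wpM2r//.
  apply: le_trans (snorm_dist hip _ (A (z m)) _) _.
  rewrite !mulrDl -addrA lerD//.
    rewrite (le_trans (opB_bound hip hb Cp0 poincare hS xi _ _))// ler_pM2l ?exprn_gt0//.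
    by rewrite snormBC.
  apply: le_trans (snorm_dist hip _ (nu *: z m) _) _.
  rewrite mul1r lerD// -scalerBr snormZ// gtr0_norm// ler_pM2l//.
Qed.

Lemma si_unit z : nH z != 0 -> nH ((nH z)^-1 *: z) = 1.
Proof.
by move=> z0; rewrite snormZ// ger0_norm ?invr_ge0 ?mulVf.
Qed.

(** Let [nu] be the supremum of the Rayleigh quotient over the orthogonal complement of the [f i],
    which [A] leaves invariant; [z0] shows that it exceeds [mu]. It is an eigenvalue because
    near-maximizers are approximate eigenvectors, to which [weyl] applies. *)
Lemma max_principle mu n (f : 'I_n -> H) z0 : 0 < mu ->
  (forall z, (forall i, ip z (f i) = 0) -> forall i, ip (A z) (f i) = 0) ->
  (forall i, ip z0 (f i) = 0) -> mu * ip z0 z0 < ip (A z0) z0 ->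
  exists2 nu, mu < nu & exists z, [/\ nH z = 1, forall i, ip z (f i) = 0 &
    forall h, ip (A z) h = nu * ip z h].
Proof.
move=> mu0 fA fz0 muz0.
have Asym := op_sym hip hb hS xi.
pose Q := [set ip (A z) z | z in [set z | nH z = 1 /\ forall i, ip z (f i) = 0]].
have fZ a z : (forall i, ip z (f i) = 0) -> forall i, ip (a *: z) (f i) = 0.
  by move=> fz i; rewrite siE fz mulr0.
have AZ a z : ip (A (a *: z)) (a *: z) = a ^+ 2 * ip (A z) z.
  by rewrite siE (opZl hip hb hS) mulrA expr2.
have n0 : nH z0 != 0.
  apply/eqP => z00; move: muz0; rewrite -snormE// z00 expr0n/= mulr0.
  by rewrite (si_sym hip) (si_null hip _ z00) ltxx.
have Qub : ubound Q (Cp ^+ 4).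
  move=> _ [z [z1 _] <-]; rewrite (le_trans (ler_norm _))//.
  rewrite (le_trans (CSn hip _ _))// z1 mulr1.
  by rewrite (le_trans (op_bound hip hb Cp0 poincare hS xi z))// z1 mulr1.
have Q0 : Q (ip (A ((nH z0)^-1 *: z0)) ((nH z0)^-1 *: z0)).
  by exists ((nH z0)^-1 *: z0) => //; split; [exact: si_unit|exact: fZ].
have supQ : has_sup Q by split; [eexists; exact: Q0|exists (Cp ^+ 4)].
pose nu := sup Q.
have munu : mu < nu.
  apply: lt_le_trans (ub_le_sup supQ.2 Q0).
  rewrite AZ exprVn snormE// mulrC ltr_pdivlMr// -snormE//.
  by rewrite exprn_gt0// lt0r n0 snH_ge0.
have nu0 : 0 < nu by exact: lt_trans munu.
exists nu => //.
have gM x : (forall i, ip x (f i) = 0) -> ip (A x) x <= nu * ip x x.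
  move=> fx; have [x0|x0] := eqVneq (nH x) 0.
    rewrite (si_sym hip (A x)) (si_null hip _ x0) mulr_ge0 ?(ltW nu0)//.
    exact: si_ge0 hip x.
  have : ip (A ((nH x)^-1 *: x)) ((nH x)^-1 *: x) <= nu.
    apply: (ub_le_sup supQ.2); exists ((nH x)^-1 *: x) => //.
    by split; [exact: si_unit|exact: fZ].
  rewrite AZ exprVn snormE// mulrC ler_pdivrMr// -snormE//.
  by rewrite exprn_gt0// lt0r x0 snH_ge0.
apply: weyl => // e e0.
have e1 : 0 < e ^+ 2 / nu by rewrite divr_gt0// exprn_gt0.
have [_ [z [z1 fz] <-] Az] := sup_adherent e1 supQ.
exists z; split => //; have [y yE] : exists y, y = A z - nu *: z by exists (A z - nu *: z).
rewrite -yE.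
have fy i : ip y (f i) = 0 by rewrite yE !siE fA// fz mulr0 subr0.
(* Let y = A z - nu z. Maximality of [nu], applied at z + y / nu with the term (A y, y) >= 0
   dropped, gives |y|^2 / nu <= nu - (A z, z), and [z] was chosen to make the right side less than
   e^2 / nu. *)
have := gM (z + nu^-1 *: y) _.
have -> : ip (A (z + nu^-1 *: y)) (z + nu^-1 *: y) =
    ip (A z) z + 2 * nu^-1 * ip (A z) y + nu^-1 ^+ 2 * ip (A y) y.
  rewrite [z + _]addrC (opDl hip hb hS) !siE (Asym y z) (si_sym hip y); ring.
move=> /(_ _)/wrap[|H1]; first by move=> i; rewrite !siE fz fy mulr0 addr0.
have Ay0 := op_ge0 hip hb hS xi y.
have zz : ip z z = 1 by rewrite -snormE// z1 expr1n.
have Azy : ip (A z) y = nH y ^+ 2 + nu * ip z y.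
  by rewrite snormE// {2}yE !siE; ring.
have H2 : ip (z + nu^-1 *: y) (z + nu^-1 *: y) =
   1 + 2 * nu^-1 * ip z y + nu^-1 ^+ 2 * nH y ^+ 2.
  by rewrite snormE// !siE zz (si_sym hip y z); ring.
have H3 : nH y ^+ 2 <= e ^+ 2.
  move: H1; rewrite H2 Azy; move: Az; rewrite -/nu => Az H1.
  have H4 : nu - e ^+ 2 / nu + 2 * nu^-1 * nH y ^+ 2 <= nu + nu^-1 * nH y ^+ 2.
    have -> : nu + nu^-1 * nH y ^+ 2 = nu * (1 + 2 * nu^-1 * ip z y + nu^-1 ^+ 2 * nH y ^+ 2)
       - 2 * nu^-1 * (nu * ip z y) by field; rewrite gt_eqF.
    have : 0 <= nu^-1 ^+ 2 * ip (A y) y by rewrite mulr_ge0// sqr_ge0.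
    lra.
  have H5 : nu^-1 * nH y ^+ 2 <= nu^-1 * e ^+ 2 by lra.
  by move: H5; rewrite ler_pM2l ?invr_gt0.
by rewrite -(ler_pXn2r (n := 2)) ?nnegrE ?(ltW e0).
Qed.

Definition fcons T n (x : T) (f : 'I_n -> T) (i : 'I_n.+1) : T :=
  oapp f x (unlift ord0 i).

Lemma fcons0 T n (x : T) (f : 'I_n -> T) : fcons x f ord0 = x.
Proof. by rewrite /fcons unlift_none. Qed.

Lemma fconsS T n (x : T) (f : 'I_n -> T) i : fcons x f (lift ord0 i) = f i.
Proof. by rewrite /fcons liftK. Qed.

Lemma fconsP T n (x : T) (f : 'I_n -> T) (Q : T -> Prop) :
  Q x -> (forall i, Q (f i)) -> forall i, Q (fcons x f i).
Proof.
by move=> Qx Qf i; case: (unliftP ord0 i) => [j ->|->]; rewrite (fconsS, fcons0).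
Qed.

Lemma eigs0 J : eigs J 0.
Proof.
exists (fun=> 0), (fun=> 0), (fun=> 0); split; first by case.
by move=> k _; case.
Qed.

Lemma eigsS (J : set R) n l sg u z : (forall i : 'I_n, J (l i) /\ eigen (l i) (sg i) (u i)) ->
  indep ip (fun i => io (u i)) -> nH z = 1 -> (forall i, ip z (io (u i)) = 0) ->
  forall nu, nu != 0 -> (forall h, ip (A z) h = nu * ip z h) -> J nu^-1 -> eigs J n.+1.
Proof.
move=> lP iu z1 zu nu nu0 Az Jnu.
have zz : ip z z = 1 by rewrite -snormE// z1 expr1n.
have zz0 : ip z z != 0 by rewrite zz oner_neq0.
have [] := op_eigen hip hb hS zz0 nu0 Az.
set s' := _ *: _; set u' := SW _ => eu' u'z.
exists (fcons nu^-1 l), (fcons s' sg), (fcons u' u); split.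
  by move=> i; case: (unliftP ord0 i) => [j ->|->]; rewrite ?(fconsS, fcons0).
move=> k; rewrite big_ord_recl fcons0.
under eq_bigr do rewrite fconsS.
set X := \sum_i _ => kX.
have uX h : ip (io u') h = ip z h by exact: si_null_eq.
have k0 : k ord0 = 0.
  have := si_null hip z kX; rewrite !siE uX zz mulr1 /X si_suml// big1 ?addr0//.
  by move=> i _; rewrite siE (si_sym hip) zu mulr0.
move: kX; rewrite k0 scale0r add0r => /iu kX i.
by case: (unliftP ord0 i) => [j ->|->].
Qed.

Lemma eigen_orth l s u l' s' u' : eigen l s u -> eigen l' s' u' -> l != l' ->
  ip (io u) (io u') = 0.
Proof.
move=> /(eigen_op hip hb poincare hS)[l0 H1].
move=> /(eigen_op hip hb poincare hS)[l0' H2] ll'.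
have /eqP : (l - l') * ip (A (io u)) (io u') = 0.
  rewrite mulrBl H1 (op_sym hip hb hS) (si_sym hip (io u) (A _)) H2.
  by rewrite (si_sym hip) subrr.
rewrite mulf_eq0 subr_eq0 (negbTE ll') => /eqP H3.
by rewrite -H1 H3 mulr0.
Qed.

(** Half of the min-max principle. Let n < j be the exact number of eigenvalues below [lam]. Some
    nontrivial combination X of the [x i] is orthogonal to their eigenvectors, and a Rayleigh
    quotient above [1/lam] at X would yield, by [max_principle], one more eigenvalue below [lam]. *)
Lemma counting lam j (x : 'I_j -> H) : 0 < lam -> ~ eigs [set l | l < lam] j ->
  exists2 k : 'I_j -> R, (exists i, k i != 0) &
    let X := \sum_i k i *: x i in ip (A X) X <= lam^-1 * ip X X.
Proof.
move=> lam0 nj.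
have [n [nj' [l [sg [u [lP iu]]]] nn]] : exists n, [/\ (n < j)%N,
    eigs [set l | l < lam] n & ~ eigs [set l | l < lam] n.+1].
  have : exists n, `[< ~ eigs [set l | l < lam] n >] by exists j; exact/asboolP.
  move=> /ex_minnP[[|n] /asboolP nn nmin]; first by have := eigs0 [set l | l < lam].
  exists n; split => //; first by apply: nmin; exact/asboolP.
  by apply: contrapT => /asboolP/nmin; rewrite ltnn.
have [k k0 kP] := lin_dependence (fun i m => ip (x i) (io (u m))) nj'.
exists k => // X.
have Xu i : ip X (io (u i)) = 0.
  by rewrite si_suml// -[RHS](kP i); apply: eq_bigr => m _; rewrite siE.
rewrite leNgt; apply/negP => XX.
have mu0 : 0 < lam^-1 by rewrite invr_gt0.
have [|nu munu [z [z1 zu Az]]] := max_principle mu0 _ Xu XX.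
  move=> z zu i; rewrite (op_sym hip hb hS).
  have [l0 lu] := eigen_op hip hb poincare hS (lP i).2.
  apply: (mulfI (lt0r_neq0 l0)); rewrite mulr0 -(siZr hip) (si_sym hip) (siZl hip).
  by rewrite lu (si_sym hip).
apply: nn; have nu0 : 0 < nu by exact: lt_trans munu.
apply: (eigsS lP iu z1 zu _ Az); first by rewrite gt_eqF.
by rewrite /= -[ltRHS]invrK ltf_pV2 ?posrE.
Qed.

Lemma span_lower lam j : eigs [set l | l <= lam] j ->
  exists2 x : 'I_j -> H, indep ip x &
    forall k X, X = \sum_i k i *: x i -> lam^-1 * ip X X <= ip (A X) X.
Proof.
move=> [l [sg [u [lP iu]]]]; exists (fun i => io (u i)); first by [].
move=> k X XE.
have l0 i := (eigen_op hip hb poincare hS (lP i).2).1.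
have lu i := (eigen_op hip hb poincare hS (lP i).2).2.
have lP' i : l i <= lam := (lP i).1.
pose s i := Num.sqrt ((l i)^-1 - lam^-1).
have sE i : s i ^+ 2 = (l i)^-1 - lam^-1.
  by rewrite sqr_sqrtr// subr_ge0 lef_pV2 ?posrE// (lt_le_trans (l0 i)).
(* eigenvectors for distinct eigenvalues being orthogonal, [A - 1/lam] acts on
   the span as a square *)
have : 0 <= ip (\sum_i (k i * s i) *: io (u i)) (\sum_i (k i * s i) *: io (u i)).
  exact: si_ge0.
have AX h : ip (A X) h = \sum_i k i * (l i)^-1 * ip (io (u i)) h.
  rewrite (op_sym hip hb hS) XE si_suml//; apply: eq_bigr => i _.
  rewrite siE -(op_sym hip hb hS) -mulrA; congr (_ * _).
  by rewrite -(lu i) mulKf// gt_eqF.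
rewrite -subr_ge0 [leRHS](_ : _ = ip (A X) X - lam^-1 * ip X X)//.
have -> : ip X X = \sum_i k i * ip (io (u i)) X.
  by rewrite {1}XE si_suml//; apply: eq_bigr => i _; rewrite siE.
rewrite si_suml// AX mulr_sumr -sumrB; apply: eq_bigr => i _.
rewrite (siZl hip) XE !(si_sumr hip) !mulr_sumr -sumrB; apply: eq_bigr => m _.
rewrite !(siZr hip).
have [lim|lim] := eqVneq (l i) (l m).
  have -> : s m = s i by rewrite /s lim.
  by have -> : (l i)^-1 = s i ^+ 2 + lam^-1 by [rewrite sE subrK]; ring.
by rewrite (eigen_orth (lP i).2 (lP m).2 lim); ring.
Qed.

Definition orthonormal n (e : 'I_n -> H) :=
  forall i m, ip (e i) (e m) = (i == m)%:R.

Definition oproj n (e : 'I_n -> H) g := \sum_i ip g (e i) *: e i.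

Lemma oprojE n (e : 'I_n -> H) g h :
  ip (oproj e g) h = \sum_i ip g (e i) * ip (e i) h.
Proof. by rewrite si_suml//; apply: eq_bigr => i _; rewrite siE. Qed.

Lemma oproj_orth n (e : 'I_n -> H) g i : orthonormal e ->
  ip (g - oproj e g) (e i) = 0.
Proof.
move=> oe; rewrite (siBl hip) oprojE (bigD1 i)//= oe eqxx mulr1 big1 ?addr0 ?subrr//.
by move=> m /negbTE mi; rewrite oe mi mulr0.
Qed.

Lemma oproj_norm n (e : 'I_n -> H) g : orthonormal e -> nH (oproj e g) <= nH g.
Proof.
move=> oe; rewrite -(ler_pXn2r (n := 2)) ?nnegrE//.
have E : ip (oproj e g) (oproj e g) = ip g (oproj e g).
  rewrite oprojE (si_sym hip g) oprojE; apply: eq_bigr => i _.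
  have := oproj_orth g i oe; rewrite (siBl hip) => /eqP; rewrite subr_eq0 => /eqP E.
  by rewrite (si_sym hip (e i)) -E (si_sym hip (e i)).
have : 0 <= ip (g - oproj e g) (g - oproj e g) by exact: si_ge0.
by rewrite !(siBl hip, siBr hip) (si_sym hip (oproj e g) g) E subrr subr0 !snormE// E subr_ge0.
Qed.

Lemma bessel n (e : 'I_n -> H) g : orthonormal e ->
  \sum_i ip (e i) g ^+ 2 <= nH g ^+ 2.
Proof.
move=> oe.
have -> : \sum_i ip (e i) g ^+ 2 = ip (oproj e g) g.
  by rewrite oprojE; apply: eq_bigr => i _; rewrite (si_sym hip g).
rewrite (le_trans (ler_norm _))// (le_trans (CSn hip _ _))// expr2.
by rewrite ler_wpM2r// oproj_norm.
Qed.

Definition opeigen mu z := forall h, ip (A z) h = mu * ip z h.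

(** Eigenvectors for [mu] come from vectors of energy norm at most [K], so in [rellich] the energy
    term is at most 1/2 and the squared functionals of each unit eigenvector sum to at least 1/2.
    Bessel's inequality bounds the total over all eigenvectors by [B], whence n <= 2 B. *)
Lemma orthonormal_bound mu : 0 < mu -> exists N, forall n (e : 'I_n -> H),
  orthonormal e -> (forall i, opeigen mu (e i)) -> (n <= N)%N.
Proof.
move=> mu0; pose K := mu^-1 * Cp ^+ 3.
have K1 : 0 < 2 * (K ^+ 2 + 1) by rewrite mulr_gt0// ltr_wpDl// sqr_ge0.
have [|s sP] := rellich (e := (2 * (K ^+ 2 + 1))^-1); first by rewrite invr_gt0.
pose B := \sum_(g <- s) nH g ^+ 2.
have B0 : 0 <= B by apply: sumr_ge0 => g _; exact: sqr_ge0.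
exists (Num.bound (2 * B)) => n e oe ee.
pose v i := mu^-1 *: SW (dfl ip xi (io (SW (e i)))).
have ve i h : ip (io (v i)) h = ip (e i) h.
  by have := ee i h; rewrite /v linearZ (siZl hip) /op => ->; rewrite mulKf// gt_eqF.
have e1 i : nH (e i) = 1 by rewrite /snorm oe eqxx sqrtr1.
have vK i : nV (v i) <= K.
  rewrite snormZ// gtr0_norm ?invr_gt0// ler_pM2l ?invr_gt0//.
  by rewrite (le_trans (sol2_bound hip hb Cp0 poincare hS xi _))// e1 mulr1.
have half i : 2^-1 <= \sum_(g <- s) ip (e i) g ^+ 2.
  have := sP (v i); rewrite snormE// ve (si_sym hip) ve -snormE// e1 expr1n.
  under eq_bigr do rewrite ve.
  have : (2 * (K ^+ 2 + 1))^-1 * nV (v i) ^+ 2 <= 2^-1.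
    rewrite mulrC ler_pdivrMr// mulrA mulVf// mul1r.
    have := vK i; have := snorm_ge0 b (v i); nra.
  lra.
rewrite -(ler_nat R) (le_trans _ (ltW (archi_boundP _)))// ?mulr_ge0//.
rewrite mulrC -ler_pdivrMr//.
apply: (@le_trans _ _ (\sum_(i < n) \sum_(g <- s) ip (e i) g ^+ 2)).
  by rewrite mulr_natl -[n in X in X <= _]card_ord -sumr_const ler_sum.
by rewrite exchange_big; apply: ler_sum => g _; exact: bessel.
Qed.

(** Take an orthonormal family of eigenvectors of maximal size. If no [c] worked, [weyl] would
    produce one more eigenvector orthogonal to the family. *)
Lemma spectral_gap mu : 0 < mu -> exists n (e : 'I_n -> H) (c : R),
  [/\ orthonormal e, forall i, opeigen mu (e i), 0 < c &
      forall z, (forall i, ip z (e i) = 0) -> c * nH z <= nH (A z - mu *: z)].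
Proof.
move=> mu0; have [N NP] := orthonormal_bound mu0.
pose fam n := exists e : 'I_n -> H, orthonormal e /\ forall i, opeigen mu (e i).
have [n [[e [oe ee]] nn]] : exists n, fam n /\ ~ fam n.+1.
  have : exists n, `[< ~ fam n >].
    by exists N.+1; apply/asboolP => -[e [oe /(NP _ _ oe)]]; rewrite ltnn.
  move=> /ex_minnP[[|n] /asboolP nn nmin].
    by case: nn; exists (fun=> 0); split; case.
  exists n; split => //; apply: contrapT => /asboolP/nmin; by rewrite ltnn.
exists n, e; apply: contrapT => nc; apply: nn.
have [|z [z1 ze Az]] := weyl (f := e) mu0.
  move=> c c0; apply: contrapT => nz; apply: nc; exists c; split => // z ze.
  have [z0|z0] := eqVneq (nH z) 0; first by rewrite z0 mulr0.
  rewrite leNgt; apply/negP => Az; apply: nz; exists ((nH z)^-1 *: z); split.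
  - exact: si_unit.
  - by move=> i; rewrite siE ze mulr0.
  - have zp : 0 < nH z by rewrite lt0r z0 snH_ge0.
    have -> : nH (A ((nH z)^-1 *: z) - mu *: ((nH z)^-1 *: z)) =
       nH ((nH z)^-1 *: (A z - mu *: z)).
      apply: snorm_null_eq => //; apply/eqP; rewrite snorm_eq0//.
      set d := (X in ip X X); suff d0 h : ip d h = 0 by rewrite d0.
      by rewrite /d !(siBl hip, siZl hip, opZl hip hb hS); ring.
    rewrite snormZ// ger0_norm ?invr_ge0// mulrC ler_pdivrMr// ltW//.
exists (fcons z e); split; last exact: (fconsP (Q := opeigen mu)).
have zz : ip z z = 1 by rewrite -snormE// z1 expr1n.
move=> i m; case: (unliftP ord0 i) => [i' ->|->]; case: (unliftP ord0 m) => [m' ->|->];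
  rewrite ?(fconsS, fcons0) ?zz ?eqxx//.
by rewrite (si_sym hip) ze.
Qed.

End Spectral.

(** * Comparison of eigenpairs *)

Section Comparison.
Variables (R : realType) (H V : lmodType R) (ip : H -> H -> R) (b : V -> V -> R).
Variable io : {linear V -> H}.
Hypotheses (hip : semi_inner ip) (hb : semi_inner b).
Local Notation nH := (snorm ip).
Local Notation nV := (snorm b).
Variable Cp : R.
Hypothesis Cp0 : 0 < Cp.
Hypothesis poincare : forall v, nH (io v) <= Cp * nV v.
Hypothesis rellich : forall e : R, 0 < e -> exists s : seq H, forall v,
  nH (io v) ^+ 2 <= e * nV v ^+ 2 + \sum_(g <- s) ip (io v) g ^+ 2.
Hypothesis complete : forall x : nat -> H,
  (forall m, nH (x m.+1 - x m) <= 4^-1 ^+ m) ->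
  exists l, forall e : R, 0 < e -> exists N, forall m, (N <= m)%N -> nH (x m - l) <= e.
Let snH_ge0 x : 0 <= nH x := snorm_ge0 ip x.
Hint Resolve snH_ge0 : core.
Let snV_ge0 x : 0 <= nV x := snorm_ge0 b x.
Hint Resolve snV_ge0 : core.

(** The eigenvectors of the first problem are fed to [counting] for the second: at one X the two
    Rayleigh quotients obey opposite bounds. Used in both directions, this bounds |1/lambda -
    1/lambda_h| by the norm of the difference of the operators. *)
Lemma eigenvalue_compare W1 S1 xi1 W2 S2 xi2 l1 l2 j d :
  solver ip b io W1 S1 -> solver ip b io W2 S2 -> 0 < l2 ->
  eigs ip b io W1 xi1 [set l | l <= l1] j ->
  ~ eigs ip b io W2 xi2 [set l | l < l2] j ->
  (forall z, nH (op ip io S1 xi1 z - op ip io S2 xi2 z) <= d * nH z) ->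
  l1^-1 - l2^-1 <= d.
Proof.
move=> hS1 hS2 l20 /(span_lower hip hb poincare hS1)[x ix xP] ne hd.
have [k [i ki] kP] := counting hip hb Cp0 poincare rellich complete hS2 x l20 ne.
move: kP; set X := \sum_i _ => kP.
have X0 : 0 < nH X.
  rewrite lt0r snH_ge0 andbT; apply: contra ki => /eqP X0; apply/eqP.
  exact: ix X0 i.
have XX : 0 < ip X X by rewrite -snormE// exprn_gt0.
have H1 : ip (op ip io S1 xi1 X - op ip io S2 xi2 X) X <= d * ip X X.
  rewrite (le_trans (ler_norm _))// (le_trans (CSn hip _ _))//.
  by rewrite -snormE// expr2 mulrA ler_wpM2r.
have H2 := xP k X erefl.
rewrite -(ler_pM2r XX) mulrBl; rewrite (siBl hip) in H1.
exact: le_trans (lerB H2 kP) H1.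
Qed.

Variables (S : H -> V) (hS : solver ip b io (fun=> True) S).
Variables (xi : H) (xi0 : 0 < nH xi).

Section OneSpace.
Variables (W : V -> Prop) (P : V -> V) (xih : H).
Hypothesis Wlin : forall a x y, W x -> W y -> W (a *: x + y).
Hypothesis PW : forall v, W (P v).
Hypothesis PE : forall v w, W w -> b (v - P v) w = 0.
Hypothesis xih0 : nH xi <= 2 * nH xih.

Let Sh g := P (S g).
Local Notation A := (op ip io S xi).
Local Notation Ah := (op ip io Sh xih).
Local Notation Q := (dfl ip xi).
Local Notation Qh := (dfl ip xih).
Let K3 := 3 / nH xi.
Let exi := nH (xi - xih).

Lemma ritz_eq v w : W w -> b (P v) w = b v w.
Proof. by move=> Ww; apply/esym/eqP; rewrite -subr_eq0 -(siBl hb) PE. Qed.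

Lemma ritz_sym v w : b (P v) w = b v (P w).
Proof. by rewrite -(ritz_eq v (PW w)) [RHS](si_sym hb) (ritz_eq w (PW v)) (si_sym hb). Qed.

Lemma ritz_solver : solver ip b io W Sh.
Proof.
split => // [g|g v Wv]; first exact: PW.
by rewrite /Sh ritz_eq// (sol_eq hS).
Qed.

Lemma ritz_contr v : nV (v - P v) <= nV v.
Proof.
have : nV (v - P v) ^+ 2 <= nV v * nV (v - P v).
  by rewrite snormE// (siBr hb) [b _ (P v)]PE// subr0 (si_sym hb) (le_trans (ler_norm _))// CSn.
have [->//|v0] := eqVneq (nV (v - P v)) 0.
by rewrite expr2 ler_pM2r// lt0r v0 snV_ge0.
Qed.

(** [P] is linear only up to null vectors: the two errors differ by an element of [W] that is
    orthogonal to [W]. *)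
Lemma ritz_scale a v : nH (io (a *: v - P (a *: v))) = `|a| * nH (io (v - P v)).
Proof.
rewrite -snormZ// -linearZ; apply: snorm_null_eq => //; rewrite -linearB.
set d := _ - _ - _.
have dE : d = a *: P v - P (a *: v).
  by rewrite /d scalerBr opprB addrC addrA subrK.
have Wd : W d.
  by rewrite dE -scaleN1r addrC; apply: Wlin => //; rewrite -[a *: _]addr0;
    apply: Wlin => //; have := Wlin (-1) (PW 0) (PW 0); rewrite scaleN1r addNr.
have d0 : nV d = 0.
  apply/eqP; rewrite snorm_eq0// {1}/d (siBl hb) (siZl hb) !PE// mulr0 subr0//.
by apply/eqP; rewrite eq_le snH_ge0 andbT (le_trans (poincare _))// d0 mulr0.
Qed.

(** The difference splits into the Ritz error of [S z], the change from [Q] to [Q_h], and the Ritz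
    error of [S h]. The last is kept as an energy product with [S (Q w)], so that for an
    eigenfunction it can be moved from [S h] to [u]. *)
Lemma op_diff z h (w := io (S z)) :
  `|ip (Ah z - A z) h| <=
    Cp ^+ 2 * (nH (io (S z - P (S z))) + K3 * exi * nH w) * nH h +
    `|b (S (Q w)) (S h - P (S h))|.
Proof.
have hSh := ritz_solver.
have -> : ip (Ah z - A z) h = ip (Qh (io (P (S z)) - w)) (io (Sh h)) +
    ip (Qh w - Q w) (io (Sh h)) - b (S (Q w)) (S h - P (S h)).
  rewrite (siBl hip) (opE hip hb hSh) (opE hip hb hS) (sol_eq hS)//.
  have -> : io (S h - P (S h)) = io (S h) - io (P (S h)) by rewrite linearB.
  rewrite dflB// -/w /Sh.
  move: (Qh (io _)) (Qh w) (Q w) (io (P (S h))) (io (S h)) => x1 x2 x3 x4 x5.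
  by rewrite !(siBl hip, siBr hip); ring.
apply: le_trans (ler_normB _ _) _; rewrite lerD2r.
apply: le_trans (ler_normD _ _) _.
have Shh : nH (io (Sh h)) <= Cp ^+ 2 * nH h by exact: (iosol_bound hip hb Cp0 poincare hSh).
rewrite mulrDr mulrDl lerD//.
  rewrite (le_trans (CSn hip _ _))// mulrAC mulrC ler_pM//.
  by rewrite (le_trans (dfl_norm hip _ _))// snormBC// -linearB.
rewrite (le_trans (CSn hip _ _))// mulrAC mulrC ler_pM//.
exact: dfl_diff.
Qed.

(** This is the norm convergence of [A_h]. The L^2 Ritz errors of [S z] and, dually, of [S h]
    contribute [Cp ^+ 2 * th] each. *)
Lemma op_close th z : 0 <= th -> (forall g, nH (io (S g - P (S g))) <= th * nH g) ->
  nH (Ah z - A z) <= (Cp ^+ 2 * (2 * th + K3 * exi * Cp ^+ 2)) * nH z.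
Proof.
move=> th0 thP.
have K30 : 0 <= K3 by rewrite divr_ge0.
have exi0 : 0 <= exi by exact: snH_ge0.
apply: snorm_le => // [|h].
  apply: mulr_ge0 => //; apply: mulr_ge0; first exact: sqr_ge0.
  apply: addr_ge0; first exact: mulr_ge0.
  by apply: mulr_ge0; [exact: mulr_ge0|exact: sqr_ge0].
apply: le_trans (ler_norm _) _; apply: le_trans (op_diff _ _) _.
have wz : nH (io (S z)) <= Cp ^+ 2 * nH z by exact: (iosol_bound hip hb Cp0 poincare hS).
have B1 : `|b (S (Q (io (S z)))) (S h - P (S h))| <= Cp ^+ 2 * nH z * (th * nH h).
  rewrite (sol_eq hS)// (le_trans (CSn hip _ _))// ler_pM//.
  by rewrite (le_trans (dfl_norm hip _ _)).
have B2 : Cp ^+ 2 * (nH (io (S z - P (S z))) + K3 * exi * nH (io (S z))) * nH h <=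
   Cp ^+ 2 * (th * nH z + K3 * exi * (Cp ^+ 2 * nH z)) * nH h.
  rewrite ler_wpM2r// ler_wpM2l ?sqr_ge0// lerD// ler_wpM2l// mulr_ge0//.
apply: le_trans (lerD B2 B1) _; rewrite le_eqVlt; apply/orP; left; apply/eqP; ring.
Qed.

(** With e = v - P v, orthogonality gives |e|^2 = b(S e, e) = b(S e - P S e, e), and the first
    factor has energy norm at most [eta] |e|. *)
Lemma aubin_nitsche eta v : 0 <= eta -> (forall g, nV (S g - P (S g)) <= eta * nH g) ->
  nH (io (v - P v)) <= eta * nV (v - P v).
Proof.
move=> eta0 etaP; have [->|e0] := eqVneq (nH (io (v - P v))) 0.
  exact: mulr_ge0.
have ep : 0 < nH (io (v - P v)) by rewrite lt0r e0 snH_ge0.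
rewrite -(ler_pM2l ep) -expr2 snormE// -(sol_eq hS)//.
rewrite (_ : b _ _ = b (S (io (v - P v)) - P (S (io (v - P v)))) (v - P v)).
  rewrite (le_trans (ler_norm _))// (le_trans (CSn hb _ _))// mulrA ler_wpM2r//.
  by rewrite mulrC.
by rewrite [RHS](siBl hb) (si_sym hb (P _)) PE ?subr0.
Qed.

(** A discrete solution is compared with the Ritz projection of the exact one: what remains is the
    difference of the right-hand sides of the two equations. *)
Lemma ritz_gap v w : W w -> nV (P v - w) ^+ 2 = b v (P v - w) - b w (P v - w).
Proof.
move=> Ww; rewrite snormE// (siBl hb) ritz_eq//.
by rewrite addrC -scaleN1r; apply: Wlin.
Qed.

Lemma nV_le c v : 0 <= c -> nV v ^+ 2 <= c * nV v -> nV v <= c.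
Proof.
move=> c0; have [->//|v0] := eqVneq (nV v) 0.
by rewrite expr2 ler_pM2r// lt0r v0 snV_ge0.
Qed.

Variables (lam : R) (lam0 : 0 < lam) (n : nat) (e : 'I_n -> H) (c : R).
Hypotheses (oe : orthonormal ip e)
  (ee : forall i, opeigen ip io S xi lam^-1 (e i)) (c0 : 0 < c)
  (gap : forall z, (forall i, ip z (e i) = 0) -> c * nH z <= nH (A z - lam^-1 *: z)).
Variable d : R.
Hypotheses (d0 : 0 <= d) (dP : forall z, nH (Ah z - A z) <= d * nH z)
  (dc : d <= c / 4) (dlam : d <= lam^-1 / 2).

(** With D the sum in [eigenpair_error], [K0] bounds |(A_h - A) u0| / D, [K] the errors of the
    eigenvalue and of [u] in L^2, [K4] and [K5] the energy distances of [sh] and [uh] from the Ritz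
    projections. They involve the continuous problem only. *)
Let K0 := Cp ^+ 2 * (lam^-1 + K3 * Cp ^+ 2) + lam^-1.
Let K := 16 * lam ^+ 2 * K0 + 2 / c * K0.
Let K4 := Cp * (1 + 2 * lam) * K.
Let K5 := Cp * (K3 * lam * Cp ^+ 2 + 1 + Cp * K4).

(** Split [uh] into its projection [u0] on the eigenspace and the rest [z]. Every error is traced
    back to y = (A_h - A) u0, which is of size D; the duality argument enters only afterwards. *)
Lemma eigenpair_error lamh sh uh :
  eigen ip b io W xih lamh sh uh -> nH (io uh) = 1 ->
  `|lam^-1 - lamh^-1| <= d ->
  exists s u, eigen ip b io (fun=> True) xi lam s u /\
    let D := nH (io (u - P u)) + nH (io (s - P s)) + exi in
    [/\ `|lam - lamh| <= K * D, nH (io (u - uh)) <= K * D,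
        nV (P s - sh) <= K4 * D & nV (P u - uh) <= K5 * D].
Proof.
move=> eh uh1 lamd; have hSh := ritz_solver.
have [lamh0 ehP] := eigen_op hip hb poincare hSh eh.
have [Wsh Wuh _ euh esh] := eh.
have K30 : 0 <= K3 by rewrite divr_ge0.
have exi0 : 0 <= exi by exact: snH_ge0.
have mu0 : 0 < lam^-1 by rewrite invr_gt0.
have muh0 : 0 < lamh^-1 by rewrite invr_gt0.
have Asym := op_sym hip hb hS xi.
have Ahsym := op_sym hip hb hSh xih.
have [u0 u0E] : exists u0, u0 = oproj ip e (io uh) by eexists.
have [z zE] : exists z, z = io uh - u0 by eexists.
have u01 : nH u0 <= 1 by rewrite u0E -uh1; exact: oproj_norm.
have zorth i : ip z (e i) = 0 by rewrite zE u0E; exact: oproj_orth.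
have Au0 h : ip (A u0) h = lam^-1 * ip u0 h.
  rewrite Asym u0E !(oprojE hip) mulr_sumr; apply: eq_bigr => i _.
  by rewrite -Asym ee mulrCA.
have zu0 : ip z u0 = 0.
  by rewrite u0E /oproj (si_sumr hip) big1// => i _; rewrite (siZr hip) zorth mulr0.
have Ahuh h : ip (Ah (io uh)) h = lamh^-1 * ip (io uh) h.
  by rewrite -ehP mulKf// gt_eqF.
have [y yE] : exists y, y = Ah u0 - A u0 by exists (Ah u0 - A u0).
have uhE : io uh = z + u0 by rewrite zE subrK.
have Ahz h : ip (Ah z) h = lamh^-1 * ip z h - ip y h + (lamh^-1 - lam^-1) * ip u0 h.
  rewrite zE (opBl hip hb hSh) Ahuh yE !(siBl hip) Au0.
  by move: (ip (Ah u0) h) (ip u0 h) (ip (io uh) h) => *; ring.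
(* From A_h uh = uh / lamh, the vector r = A z - z / lam equals -y - (A_h - A) z + (1/lamh - 1/lam)
   z up to a multiple of u0, to which r is orthogonal. The gap gives c |z| <= |y| + 2 d |z|, and d
   <= c/4 absorbs the last term. *)
have z_le : nH z <= 2 / c * nH y.
  set r := A z - lam^-1 *: z.
  have r0 : ip u0 r = 0.
    by rewrite /r (siBr hip) (siZr hip) -Asym Au0 subrr.
  have H1 : nH r ^+ 2 <= (nH y + 2 * d * nH z) * nH r.
    have -> : nH r ^+ 2 = - ip y r - ip (Ah z - A z) r + (lamh^-1 - lam^-1) * ip z r.
      rewrite snormE// {1}/r !(siBl hip) (siZl hip) Ahz r0.
      by move: (ip (A z) r) (ip z r) (ip y r) => *; ring.
    have := CSn hip y r; rewrite ler_norml => /andP[H2 _].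
    have : `|ip (Ah z - A z) r| <= d * nH z * nH r.
      by rewrite (le_trans (CSn hip _ _))// ler_wpM2r.
    rewrite ler_norml => /andP[H3 _].
    have H4 : (lamh^-1 - lam^-1) * ip z r <= d * (nH z * nH r).
      rewrite (le_trans (ler_norm _))// normrM ler_pM//; last exact: CSn.
      by rewrite distrC.
    by rewrite mulrDl; lra.
  have H2 : nH r <= nH y + 2 * d * nH z.
    have [->|rn0] := eqVneq (nH r) 0; first by rewrite addr_ge0// !mulr_ge0.
    by rewrite -(ler_pM2r (x := nH r)) -?expr2// lt0r rn0 snH_ge0.
  have H3 := le_trans (gap zorth) H2.
  rewrite mulrAC ler_pdivlMr// mulrC.
  have : 2 * d * nH z <= c / 2 * nH z by rewrite ler_wpM2r//; move: dc; lra.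
  lra.
have y_d : nH y <= d.
  by rewrite yE (le_trans (dP _))// ler_piMr.
(* |y| <= d <= c/4 makes |z| at most 1/2, so that u0 is not null. *)
have z12 : nH z <= 2^-1.
  rewrite (le_trans z_le)// mulrAC ler_pdivrMr//; move: dc; lra.
have u012 : 2^-1 <= nH u0.
  have := snormD hip z u0; rewrite -uhE uh1; lra.
have u00 : ip u0 u0 != 0 by rewrite -snormE// sqrf_eq0 gt_eqF//; lra.
(* Testing A_h uh = uh / lamh with u0 leaves (1/lam - 1/lamh) |u0|^2 = -(y, u0 + z). The right side
   is at most 2 |y| and |u0|^2 at least 1/4, hence the 8. *)
have mu_y : `|lam^-1 - lamh^-1| <= 8 * nH y.
  have H1 : (lam^-1 - lamh^-1) * nH u0 ^+ 2 = - (ip y u0 + ip z y).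
    have := Ahz u0; rewrite Ahsym zu0 mulr0 -snormE//.
    have -> : ip z (Ah u0) = ip z y + lam^-1 * ip z u0.
      rewrite yE (siBr hip) -Asym (si_sym hip (A z)) -Asym Au0 (si_sym hip u0).
      by rewrite subrK.
    by rewrite zu0 mulr0 addr0 sub0r => ->; ring.
  have H2 : `|lam^-1 - lamh^-1| * nH u0 ^+ 2 <= nH y * nH u0 + nH z * nH y.
    rewrite -[X in _ * X](ger0_norm (sqr_ge0 _)) -normrM H1.
    by rewrite normrN (le_trans (ler_normD _ _))// lerD// CSn.
  have H3 : nH y * nH u0 + nH z * nH y <= 2 * nH y.
    by have := snH_ge0 y; nra.
  have H4 : `|lam^-1 - lamh^-1| * 4^-1 <= `|lam^-1 - lamh^-1| * nH u0 ^+ 2.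
    by rewrite ler_wpM2l//; nra.
  by have := le_trans H4 (le_trans H2 H3); rewrite ler_pdivrMr// => H5; lra.
have lamh2 : lamh <= 2 * lam.
  have : lam^-1 / 2 <= lamh^-1 by move: lamd dlam; rewrite ler_norml; lra.
  by rewrite -invfM lef_pV2 ?posrE ?mulr_gt0// mulrC.
have lam_y : `|lam - lamh| <= 16 * lam ^+ 2 * nH y.
  have -> : lam - lamh = lam * lamh * (lamh^-1 - lam^-1).
    by field; rewrite !gt_eqF.
  rewrite normrM gtr0_norm ?mulr_gt0// distrC.
  apply: (@le_trans _ _ (lam * (2 * lam) * (8 * nH y))).
    by rewrite ler_pM// ?ler_pM2l// mulr_ge0// ltW.
  by rewrite le_eqVlt; apply/orP; left; apply/eqP; ring.
(* [u0] lies in L^2 only; the eigenfunction is its representative u = S Q (lam S u0), with s = lam S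
   u0. *)
have [es uu0] := op_eigen hip hb hS u00 (lt0r_neq0 mu0) Au0.
move: es uu0; rewrite invrK; set s := lam *: S u0; set u := S (Q (io s)).
move=> es uu0; exists s, u; split => // D.
have D1 : nH (io (u - P u)) <= D by rewrite /D -addrA lerDl addr_ge0.
have D2 : nH (io (s - P s)) <= D by rewrite /D addrAC lerDr addr_ge0.
have D3 : exi <= D by rewrite /D lerDr addr_ge0.
have D0 : 0 <= D by exact: le_trans D3.
have Su0 : S u0 = lam^-1 *: s by rewrite /s scalerA mulVf ?scale1r// gt_eqF.
have K00 : 0 <= K0.
  rewrite /K0; apply: addr_ge0; last exact: ltW.
  apply: mulr_ge0; first exact: sqr_ge0.
  by apply: addr_ge0; [exact: ltW|apply: mulr_ge0 => //; exact: sqr_ge0].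
have y_D : nH y <= K0 * D.
  apply: snorm_le => // [|h]; first by apply: mulr_ge0 => //; exact: mulr_ge0.
  apply: le_trans (ler_norm _) _; rewrite yE.
  apply: le_trans (op_diff _ _) _.
  (* The Ritz projection is symmetric for [b], so the error passes from [S h] to u = lam S Q S u0
     and appears in the L^2 norm. *)
  have -> : b (S (Q (io (S u0)))) (S h - P (S h)) = lam^-1 * ip (io (u - P u)) h.
    rewrite (sol_eq hS)// {1}Su0 linearZ/= dflZ// (siZl hip) -(sol_eq hS)// -/u.
    by rewrite (siBr hb) -ritz_sym// -(siBl hb) (si_sym hb) (sol_eq hS)// (si_sym hip).
  have -> : nH (io (S u0 - P (S u0))) = lam^-1 * nH (io (s - P s)).
    by rewrite Su0 ritz_scale gtr0_norm.
  have wb : nH (io (S u0)) <= Cp ^+ 2.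
    rewrite (le_trans (iosol_bound hip hb Cp0 poincare hS _))// ler_piMr// sqr_ge0//.
  have B1 : `|lam^-1 * ip (io (u - P u)) h| <= lam^-1 * D * nH h.
    rewrite normrM gtr0_norm// -mulrA ler_pM2l// (le_trans (CSn hip _ _))//.
    by rewrite ler_wpM2r.
  have B2 : Cp ^+ 2 * (lam^-1 * nH (io (s - P s)) + K3 * exi * nH (io (S u0))) * nH h
     <= Cp ^+ 2 * (lam^-1 * D + K3 * D * Cp ^+ 2) * nH h.
    rewrite ler_wpM2r// ler_wpM2l ?sqr_ge0// lerD//.
      by rewrite ler_pM2l.
    by apply: ler_pM => //; [exact: mulr_ge0|exact: ler_wpM2l].
  apply: le_trans (lerD B2 B1) _; rewrite le_eqVlt; apply/orP; left; apply/eqP.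
  by rewrite /K0; ring.
have c20 : 0 <= 2 / c by rewrite divr_ge0// ltW.
have l20 : 0 <= 16 * lam ^+ 2 by rewrite mulr_ge0// sqr_ge0.
have z_D : nH z <= K * D.
  rewrite (le_trans z_le)// (le_trans (ler_wpM2l c20 y_D))// mulrA ler_wpM2r//.
  by rewrite /K lerDr mulr_ge0.
have lam_D : `|lam - lamh| <= K * D.
  rewrite (le_trans lam_y)// (le_trans (ler_wpM2l l20 y_D))// mulrA ler_wpM2r//.
  by rewrite /K lerDl mulr_ge0.
have K_0 : 0 <= K by rewrite /K addr_ge0// mulr_ge0.
have K40 : 0 <= K4 by rewrite /K4 !mulr_ge0// ?addr_ge0// ?mulr_ge0// ltW.
have K50 : 0 <= K5.
  have Cp00 : 0 <= Cp by exact: ltW.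
  rewrite /K5; apply: mulr_ge0 => //; apply: addr_ge0; last exact: mulr_ge0.
  apply: addr_ge0 => //; apply: mulr_ge0; last exact: sqr_ge0.
  by apply: mulr_ge0 => //; exact: ltW.
have Psh : nV (P s - sh) <= K4 * D.
  apply: nV_le; first exact: mulr_ge0.
  rewrite ritz_gap// /s (siZl hb) (sol_eq hS)// esh; last first.
    by rewrite addrC -scaleN1r; apply: Wlin.
  set v := lam *: S u0; set q := io _.
  have -> : lam * ip u0 q - lamh * ip (io uh) q = (lam - lamh) * ip u0 q - lamh * ip z q.
    by rewrite uhE (siDl hip); ring.
  have qb : nH q <= Cp * nV (P v - sh) by exact: poincare.
  apply: le_trans (ler_norm _) _; apply: le_trans (ler_normB _ _) _.
  rewrite !normrM (gtr0_norm lamh0).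
  have B1 : `|lam - lamh| * `|ip u0 q| <= K * D * (1 * (Cp * nV (P v - sh))).
    by rewrite ler_pM// (le_trans (CSn hip _ _))// ler_pM.
  have B2 : lamh * `|ip z q| <= 2 * lam * (K * D * (Cp * nV (P v - sh))).
    by rewrite ler_pM// ?(ltW lamh0)// (le_trans (CSn hip _ _))// ler_pM.
  apply: le_trans (lerD B1 B2) _; rewrite le_eqVlt; apply/orP; left; apply/eqP.
  by rewrite /K4; ring.
have uz : nH (io (u - uh)) = nH z.
  rewrite linearB -(snormN hip z); apply: snorm_null_eq => //.
  by rewrite opprK zE addrA subrK.
split => //; first by rewrite uz.
have es0 : nH (io (s - sh)) <= (1 + Cp * K4) * D.
  rewrite -(subrKA (P s)) linearD (le_trans (snormD hip _ _))// mulrDl mul1r lerD//.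
  by rewrite (le_trans (poincare _))// -mulrA ler_pM2l.
apply: nV_le; first exact: mulr_ge0.
have Wv : W (P u - uh) by rewrite addrC -scaleN1r; apply: Wlin.
rewrite ritz_gap// {1}/u (sol_eq hS)// (si_sym hb uh) euh//.
set q := io (P u - uh).
have -> : ip (Q (io s)) q - ip (Qh (io sh)) q =
    - ip (Qh (io s) - Q (io s)) q + ip (Qh (io (s - sh))) q.
  have -> : io (s - sh) = io s - io sh by rewrite linearB.
  rewrite dflB//; move: (Q _) (Qh (io s)) (Qh (io sh)) => x1 x2 x3.
  by rewrite !(siBl hip); ring.
have qb : nH q <= Cp * nV (P u - uh) by exact: poincare.
apply: le_trans (ler_norm _) _; apply: le_trans (ler_normD _ _) _; rewrite normrN.
have sb : nH (io s) <= lam * Cp ^+ 2.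
  rewrite /s linearZ snormZ// gtr0_norm// ler_pM2l//.
  by rewrite (le_trans (iosol_bound hip hb Cp0 poincare hS _))// ler_piMr// sqr_ge0.
have B1 : `|ip (Qh (io s) - Q (io s)) q| <= K3 * D * (lam * Cp ^+ 2) * (Cp * nV (P u - uh)).
  rewrite (le_trans (CSn hip _ _))// ler_pM//.
  rewrite (le_trans (dfl_diff hip _ xi0 xih0))//.
  by apply: ler_pM => //; [exact: mulr_ge0|exact: ler_wpM2l].
have B2 : `|ip (Qh (io (s - sh))) q| <= (1 + Cp * K4) * D * (Cp * nV (P u - uh)).
  by rewrite (le_trans (CSn hip _ _))// ler_pM// (le_trans (dfl_norm hip _ _)).
apply: le_trans (lerD B1 B2) _; rewrite le_eqVlt; apply/orP; left; apply/eqP.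
by rewrite /K5; ring.
Qed.

End OneSpace.
Variable j : nat.
Hypothesis j0 : (0 < j)%N.

Definition nth_eig (W : V -> Prop) (xi : H) (l : R) :=
  [/\ exists s u, eigen ip b io W xi l s u, eigs ip b io W xi [set l' | l' <= l] j &
      ~ eigs ip b io W xi [set l' | l' < l] j].

Variables (I : Type) (size : I -> R) (W : I -> V -> Prop) (P : I -> V -> V).
Variables (xih : I -> H) (eta : I -> R) (Ceta : R).
Hypothesis Wlin : forall i a x y, W i x -> W i y -> W i (a *: x + y).
Hypothesis PW : forall i v, W i (P i v).
Hypothesis PE : forall i v w, W i w -> b (v - P i v) w = 0.
Hypothesis eta_ge0 : forall i, 0 <= eta i.
Hypothesis etaP : forall i g, nV (S g - P i (S g)) <= eta i * nH g.
Hypothesis eta_le : forall i, eta i <= Ceta.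
Hypothesis dense : forall v e, 0 < e ->
  exists2 h0, 0 < h0 & forall i, size i < h0 -> nV (v - P i v) <= e.
Hypothesis xih_cvg : forall e, 0 < e ->
  exists2 h0, 0 < h0 & forall i, size i < h0 -> nH (xi - xih i) <= e.

(* The error [S g - P (S g)] tests to zero against the finitely many functionals
   of [rellich], by density and duality. *)
Lemma uniform_cvg th : 0 < th -> exists2 h0, 0 < h0 &
  forall i, size i < h0 -> forall g, nH (io (S g - P i (S g))) <= th * nH g.
Proof.
move=> th0.
have Cp1 : 0 < 2 * Cp ^+ 2 by rewrite mulr_gt0// exprn_gt0.
have th20 : 0 < th ^+ 2 by rewrite exprn_gt0.
have [|s sP] := rellich (e := th ^+ 2 / (2 * Cp ^+ 2)); first by rewrite divr_gt0.
have [h0 h00 h0P] : exists2 h0, 0 < h0 & forall i, size i < h0 -> forall g,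
    \sum_(k <- s) ip (io (S g - P i (S g))) k ^+ 2 <= th ^+ 2 / 2 * nH g ^+ 2.
  have : 0 < th ^+ 2 / 2 by rewrite divr_gt0.
  move: (th ^+ 2 / 2); elim: s {sP} => [|k s IH] c c0.
    exists 1 => // i _ g; rewrite big_nil mulr_ge0 ?sqr_ge0// ltW//.
  have c2 : 0 < c / 2 by rewrite divr_gt0.
  have [h1 h10 h1P] := IH _ c2.
  have e0 : 0 < Num.sqrt (c / 2) / Cp by rewrite divr_gt0// sqrtr_gt0.
  have [h2 h20 h2P] := dense (S k) e0.
  exists (Num.min h1 h2) => [|i]; first by rewrite lt_min h10.
  rewrite lt_min => /andP[ih1 ih2] g.
  rewrite big_cons [c]splitr mulrDl lerD//; last exact: h1P.
  rewrite -[c / 2]sqr_sqrtr ?(ltW c2)// -exprMn -ler_sqrt ?sqr_ge0// !sqrtr_sqr.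
  rewrite [leRHS]ger0_norm ?mulr_ge0 ?sqrtr_ge0//.
  have -> : ip (io (S g - P i (S g))) k = b (S k - P i (S k)) (S g - P i (S g)).
    rewrite (si_sym hip) -(sol_eq hS)// [RHS](siBl hb) (si_sym hb (P i _)).
    by rewrite [b (S g - _) _]PE// subr0.
  rewrite (le_trans (CSn hb _ _))//.
  apply: (@le_trans _ _ (Num.sqrt (c / 2) / Cp * (Cp * nH g))).
    rewrite ler_pM ?h2P//.
    by rewrite (le_trans (ritz_contr (PW i) (@PE i) _))// (sol_bound hip hb Cp0 poincare hS).
  by rewrite mulrA divfK ?gt_eqF.
exists h0 => // i /h0P ih g.
rewrite -(ler_pXn2r (n := 2)) ?nnegrE ?mulr_ge0 ?(ltW th0)//.
apply: le_trans (sP _) _.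
have -> : (th * nH g) ^+ 2 = th ^+ 2 / (2 * Cp ^+ 2) * (Cp * nH g) ^+ 2 + th ^+ 2 / 2 * nH g ^+ 2.
  by field; rewrite gt_eqF.
rewrite lerD// ler_pM2l ?divr_gt0// ler_pXn2r ?nnegrE ?mulr_ge0 ?(ltW Cp0)//.
by rewrite (le_trans (ritz_contr (PW i) (@PE i) _))// (sol_bound hip hb Cp0 poincare hS).
Qed.

Let f1 v w := ip (io v) (io w) + b v w.

Lemma f1_si : semi_inner f1.
Proof.
split => [a x y z|x y|x]; rewrite /f1.
- rewrite linearP (si_lin hip) (si_lin hb); ring.
- by rewrite (si_sym hip) (si_sym hb).
- by rewrite addr_ge0 ?(si_ge0 hip) ?(si_ge0 hb).
Qed.

Local Notation n1 := (snorm f1).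

Lemma n1_ge_nH v : nH (io v) <= n1 v.
Proof. by rewrite ler_sqrt ?lerDl ?(si_ge0 hb)// (si_ge0 f1_si). Qed.

Lemma n1_ge_nV v : nV v <= n1 v.
Proof. by rewrite ler_sqrt ?lerDr ?(si_ge0 hip)// (si_ge0 f1_si). Qed.

Lemma n1_le v : n1 v <= (1 + Cp) * nV v.
Proof.
rewrite -(ler_pXn2r (n := 2)) ?nnegrE ?snorm_ge0 ?mulr_ge0 ?addr_ge0 ?(ltW Cp0)//.
rewrite (snormE f1_si) /f1 -!snormE//.
have := poincare v; have := snH_ge0 (io v); have := snV_ge0 v; have := Cp0.
move: (nH (io v)) (nV v) => x y C0 y0 x0 xy.
have : x ^+ 2 <= (Cp * y) ^+ 2 by rewrite ler_pXn2r ?nnegrE// mulr_ge0// ltW.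
have : 0 <= 2 * Cp * y ^+ 2 by rewrite !mulr_ge0 ?sqr_ge0// ltW.
nra.
Qed.

Theorem mixed_eigenpair_error lam : nth_eig (fun=> True) xi lam ->
  exists C h0 : R, [/\ 0 < C, 0 < h0 & forall i lamh sh uh, size i < h0 ->
    nth_eig (W i) (xih i) lamh -> eigen ip b io (W i) (xih i) lamh sh uh ->
    nH (io uh) = 1 -> exists s u, eigen ip b io (fun=> True) xi lam s u /\
      let pu1 := n1 (u - P i u) in let ps1 := n1 (s - P i s) in
      let ps0 := nH (io (s - P i s)) in let exi := nH (xi - xih i) in
      [/\ `|lam - lamh| <= C * (eta i * (pu1 + ps1) + exi),
          nH (io (u - uh)) <= C * (eta i * (pu1 + ps1) + exi),
          n1 (u - uh) <= C * (pu1 + ps0 + exi),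
          nH (io (s - sh)) <= C * (eta i * (pu1 + ps1) + exi) &
          n1 (s - sh) <= C * (eta i * pu1 + ps1 + exi)]].
Proof.
move=> [[s0 [u0 eu0]] le_lam lt_lam].
have [lam0 _] := eigen_op hip hb poincare hS eu0.
have mu0 : 0 < lam^-1 by rewrite invr_gt0.
have [n [e [c [oe ee c0 gap]]]] :=
  spectral_gap hip hb Cp0 poincare rellich complete hS xi mu0.
(* The bound c/4 serves the absorption in [eigenpair_error]; 1/(2 lam) keeps the discrete eigenvalue
   below 2 lam. *)
pose d := Num.min (c / 4) (lam^-1 / 2).
have d0 : 0 < d by rewrite lt_min !divr_gt0.
have Cp2 : 0 < Cp ^+ 2 by rewrite exprn_gt0.
have Cp4 : 0 < Cp ^+ 4 by rewrite exprn_gt0.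
(* The bound of [op_close] is split evenly: [th] and [ex] make its two terms at most d/2 each. The
   second entry of [ex] gives |xi| <= 2 |xih|, which [dfl_diff] requires. *)
pose th := d / 4 / Cp ^+ 2.
pose ex := Num.min (d / 2 / (3 / nH xi) / Cp ^+ 4) (nH xi / 2).
have th0 : 0 < th by rewrite !divr_gt0.
have ex0 : 0 < ex by rewrite lt_min !divr_gt0.
have [h1 h10 h1P] := uniform_cvg th0.
have [h2 h20 h2P] := xih_cvg ex0.
pose K0 := Cp ^+ 2 * (lam^-1 + 3 / nH xi * Cp ^+ 2) + lam^-1.
pose K := 16 * lam ^+ 2 * K0 + 2 / c * K0.
pose K4 := Cp * (1 + 2 * lam) * K.
pose K5 := Cp * (3 / nH xi * lam * Cp ^+ 2 + 1 + Cp * K4).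
have K00 : 0 < K0.
  apply: addr_gt0 => //; apply: mulr_gt0 => //; apply: addr_gt0 => //.
  by apply: mulr_gt0 => //; exact: divr_gt0.
have Kp : 0 < K.
  apply: addr_gt0; apply: mulr_gt0 => //; last exact: divr_gt0.
  by apply: mulr_gt0 => //; exact: exprn_gt0.
have K4p : 0 < K4.
  by apply: mulr_gt0 => //; apply: mulr_gt0 => //; apply: addr_gt0 => //; exact: mulr_gt0.
have K5p : 0 < K5.
  apply: mulr_gt0 => //; apply: addr_gt0; last exact: mulr_gt0.
  by apply: addr_gt0 => //; apply: mulr_gt0 => //; apply: mulr_gt0 => //; exact: divr_gt0.
(* An existing mesh shows that [Ceta] is nonnegative; over an empty family the claim is vacuous. *)
case: (pselect (inhabited I)) => [[i0]|noI]; last first.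
  by exists 1, 1; split => // i; case: noI; exists.
have Ceta0 : 0 <= Ceta by exact: le_trans (eta_ge0 i0) (eta_le i0).
pose C1 := 1 + Cp * K4.
pose C2 := 1 + (1 + Cp) * K5.
pose C3 := 1 + (1 + Cp) * K4 * (1 + Ceta).
have C1p : 0 < C1 by apply: addr_gt0 => //; exact: mulr_gt0.
have C2p : 0 < C2 by apply: addr_gt0 => //; apply: mulr_gt0 => //; exact: addr_gt0.
have C3p : 0 < C3.
  apply: addr_gt0 => //; apply: mulr_gt0; last exact: ltr_wpDr.
  by apply: mulr_gt0 => //; exact: addr_gt0.
exists (K + C1 + C2 + C3), (Num.min h1 h2); split.
- by do 3 apply: addr_gt0 => //.
- by rewrite lt_min h10.
move=> i lamh sh uh; rewrite lt_min => /andP[ih1 ih2] [_ le_lamh lt_lamh] eh uh1.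
have xihx := h2P i ih2.
have xi2 : nH xi <= 2 * nH (xih i).
  have : nH (xi - xih i) <= nH xi / 2 by rewrite (le_trans xihx)// ge_min lexx orbT.
  have := snorm_lerB hip xi (xih i); lra.
have hSh := ritz_solver (@Wlin i) (PW i) (@PE i).
have dP z : nH (op ip io (fun g => P i (S g)) (xih i) z - op ip io S xi z) <= d * nH z.
  have := op_close (@Wlin i) (PW i) (@PE i) xi2 z (ltW th0) (h1P i ih1).
  move/le_trans; apply; rewrite ler_wpM2r//.
  have K3p : 0 < 3 / nH xi by rewrite divr_gt0.
  have H1 : nH (xi - xih i) * (3 / nH xi * Cp ^+ 4) <= d / 2.
    rewrite mulrA -!ler_pdivlMr// (le_trans xihx)// ge_min; apply/orP; left.
    by rewrite mulrAC.
  have H2 : Cp ^+ 2 * (2 * th) = d / 2 by rewrite /th; field; rewrite gt_eqF.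
  rewrite mulrDr H2 [leRHS]splitr lerD2l (le_trans _ H1)// le_eqVlt.
  by apply/orP; left; apply/eqP; ring.
have lamd : `|lam^-1 - lamh^-1| <= d.
  have [lamh0 _] := eigen_op hip hb poincare hSh eh.
  rewrite ler_norml lerNl opprB; apply/andP; split.
    exact: eigenvalue_compare hSh hS lam0 le_lamh lt_lam dP.
  apply: eigenvalue_compare hS hSh lamh0 le_lam lt_lamh _ => z.
  by rewrite snormBC.
have dc : d <= c / 4 by rewrite ge_min lexx.
have dl : d <= lam^-1 / 2 by rewrite ge_min lexx orbT.
have [s [u [eu]]] := eigenpair_error (@Wlin i) (PW i) (@PE i) xi2 lam0 oe ee c0 gap
  (ltW d0) dP dc dl eh uh1 lamd.
rewrite -/K0 -/K -/K4 -/K5; set D := _ + _ + _ => -[E1 E2 E3 E4].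
exists s, u; split => //; set pu1 := n1 _; set ps1 := n1 _; set ps0 := nH _.
set exi := nH _ => /=.
have pu1_ge0 : 0 <= pu1 by exact: snorm_ge0.
have ps1_ge0 : 0 <= ps1 by exact: snorm_ge0.
have exi_ge0 : 0 <= exi by exact: snorm_ge0.
have AN v : nH (io (v - P i v)) <= eta i * n1 (v - P i v).
  rewrite (le_trans (aubin_nitsche (PW i) (@PE i) v (eta_ge0 i) (etaP i)))//.
  by rewrite ler_wpM2l// n1_ge_nV.
have D_eta : D <= eta i * (pu1 + ps1) + exi.
  by rewrite /D mulrDr lerD2r lerD// AN.
have D_1 : D <= pu1 + ps0 + exi by rewrite /D !lerD2r n1_ge_nH.
(* In the last estimate the error of [s] carries no [eta] and that of [u] does, so the bound
   [eta <= Ceta] is spent on [s]. *)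
have D_2 : D <= (1 + Ceta) * (eta i * pu1 + ps1 + exi).
  rewrite (le_trans D_eta)//.
  have : eta i * ps1 <= Ceta * ps1 by rewrite ler_wpM2r.
  have : 0 <= Ceta * (eta i * pu1) by rewrite !mulr_ge0.
  have : 0 <= Ceta * exi by rewrite mulr_ge0.
  lra.
have D0 : 0 <= D by rewrite !addr_ge0.
have weaken k B x : 0 <= B -> k <= K + C1 + C2 + C3 -> x <= k * B ->
    x <= (K + C1 + C2 + C3) * B.
  by move=> B0 kC /le_trans; apply; rewrite ler_wpM2r.
have B1 : 0 <= eta i * (pu1 + ps1) + exi by exact: le_trans D_eta.
have B2 : 0 <= pu1 + ps0 + exi by exact: le_trans D_1.
have B3 : 0 <= eta i * pu1 + ps1 + exi by rewrite !addr_ge0// mulr_ge0.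
have es0 : nH (io (s - sh)) <= C1 * D.
  rewrite -(subrKA (P i s)) linearD (le_trans (snormD hip _ _))// mulrDl mul1r lerD//.
    by rewrite /D addrAC lerDr addr_ge0.
  by rewrite (le_trans (poincare _))// -mulrA ler_pM2l.
split.
- apply: (@weaken K) => //; first lra.
  by rewrite (le_trans E1)// ler_pM2l.
- apply: (@weaken K) => //; first lra.
  by rewrite (le_trans E2)// ler_pM2l.
- apply: (@weaken C2) => //; first lra.
  rewrite -(subrKA (P i u)) (le_trans (snormD f1_si _ _))// mulrDl mul1r lerD//.
    by rewrite -addrA lerDl addr_ge0// snorm_ge0.
  rewrite (le_trans (n1_le _))// -mulrA ler_pM2l ?addr_gt0//.
  by rewrite (le_trans E4)// ler_pM2l.
- apply: (@weaken C1) => //; first lra.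
  by rewrite (le_trans es0)// ler_pM2l.
- apply: (@weaken C3) => //; first lra.
  rewrite -(subrKA (P i s)) (le_trans (snormD f1_si _ _))// mulrDl mul1r lerD//.
    by rewrite addrAC lerDr addr_ge0// mulr_ge0.
  rewrite (le_trans (n1_le _))// -[leRHS]mulrA -[leRHS]mulrA ler_pM2l ?addr_gt0//.
  by rewrite (le_trans E3)// ler_pM2l.
Qed.

End Comparison.

(** * Calculus and integration in the plane *)

Section Smooth1.
Variable R : realType.
Implicit Types (f g : R -> R) (n : nat).

Lemma is_derive1_eq f (x a c : R) : is_derive x (1 : R) f a -> a = c ->
  is_derive x (1 : R) f c.
Proof. by move=> df <-. Qed.

Lemma is_derive1M f g (x a c : R) : is_derive x (1 : R) f a ->
  is_derive x (1 : R) g c -> is_derive x (1 : R) (fun y => f y * g y) (f x * c + g x * a).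
Proof. by move=> df dg; apply: is_deriveM. Qed.

Lemma is_derive1V f (x a : R) : f x != 0 -> is_derive x (1 : R) f a ->
  is_derive x (1 : R) (fun y => (f y)^-1) (- ((f x)^-1 * (f x)^-1) * a).
Proof.
move=> f0 df; apply: (is_derive1_eq (is_deriveV f0 df)).
by rewrite -exprVn expr2.
Qed.

(** n-fold differentiability with the derivative as a witness, so that closure under products,
    inverses and affine changes goes by induction on n. *)
Fixpoint Cn n f : Prop :=
  if n is m.+1 then exists2 f', (forall x : R, is_derive x (1 : R) f (f' x)) & Cn m f'
  else True.

Definition smooth1 f := forall n, Cn n f.

Lemma CnS n f : Cn n.+1 f -> Cn n f.
Proof.
elim: n f => [//|n IH] f [f' df /IH Cf']; by exists f'.
Qed.

Lemma Cn_D n f g : Cn n f -> Cn n g -> Cn n (fun x => f x + g x).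
Proof.
elim: n f g => [//|n IH] f g [f' df Cf'] [g' dg Cg'].
exists (fun x => f' x + g' x); last exact: IH.
by move=> x; apply: is_deriveD.
Qed.

Lemma Cn_M n f g : Cn n f -> Cn n g -> Cn n (fun x => f x * g x).
Proof.
elim: n f g => [//|n IH] f g Cf Cg; have Cf0 := CnS Cf; have Cg0 := CnS Cg.
move: Cf Cg => [f' df Cf'] [g' dg Cg'].
exists (fun x => f x * g' x + g x * f' x); last first.
  by apply: Cn_D; apply: IH.
by move=> x; apply: is_deriveM.
Qed.

Lemma Cn_cst n (c : R) : Cn n (fun=> c).
Proof.
elim: n c => [//|n IH] c; exists (fun=> 0); last exact: IH.
by move=> x; apply: is_derive_cst.
Qed.

Lemma Cn_id n : Cn n (fun x => x).
Proof.
case: n => // n; exists (fun=> 1); last exact: Cn_cst.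
by move=> x; apply: is_derive_id.
Qed.

Lemma Cn_V n f : (forall x, f x != 0) -> Cn n f -> Cn n (fun x => (f x)^-1).
Proof.
move=> f0; elim: n f f0 => [//|n IH] f f0 Cf; have Cf0 := CnS Cf.
move: Cf => [f' df Cf'].
exists (fun x => (- 1) * ((f x)^-1 * (f x)^-1) * f' x).
  by move=> x; apply: (is_derive1_eq (is_derive1V (f0 x) (df x))); rewrite mulN1r.
apply: Cn_M => //; apply: Cn_M; first exact: Cn_cst.
by apply: Cn_M; exact: IH.
Qed.

Lemma Cn_affine n f (a b : R) : Cn n f -> Cn n (fun x => f (a * x + b)).
Proof.
elim: n f => [//|n IH] f [f' df Cf'].
exists (fun x => f' (a * x + b) * a); last first.
  by apply: Cn_M; [exact: IH|exact: Cn_cst].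
move=> x; have H : is_derive x (1 : R) (fun y : R => a * y + b) a.
  have -> : (fun y : R => a * y + b) = cst a * id + cst b by [].
  by apply: is_derive_eq; rewrite addr0 scaler0 addr0 -[_ *: _]/(a * 1) mulr1.
exact: (@is_derive1_comp _ f (fun y => a * y + b) x).
Qed.

Lemma smooth1_derive f : smooth1 f ->
  smooth1 ('D_1 f) /\ forall x : R, is_derive x (1 : R) f ('D_1 f x).
Proof.
move=> sf; split=> [n|x].
  have [f' df Cf'] := sf n.+1; suff -> : 'D_1 f = f' by [].
  by apply/funext => x; have [] := df x.
by have [f' df _] := sf 1%N; split => //; have [] := df x.
Qed.

Lemma smooth1_cont f : smooth1 f -> continuous f.
Proof.
move=> /smooth1_derive[_ df] x; apply: differentiable_continuous.
by apply/derivable1_diffP; have [] := df x.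
Qed.

Lemma smooth1D f g : smooth1 f -> smooth1 g -> smooth1 (fun x => f x + g x).
Proof. by move=> sf sg n; exact: Cn_D. Qed.

Lemma smooth1M f g : smooth1 f -> smooth1 g -> smooth1 (fun x => f x * g x).
Proof. by move=> sf sg n; exact: Cn_M. Qed.

Lemma smooth1_cst c : smooth1 (fun=> c).
Proof. by move=> n; exact: Cn_cst. Qed.

Lemma smooth1_id : smooth1 (fun x => x).
Proof. by move=> n; exact: Cn_id. Qed.

Lemma smooth1V f : (forall x, f x != 0) -> smooth1 f -> smooth1 (fun x => (f x)^-1).
Proof. by move=> f0 sf n; exact: Cn_V. Qed.

Lemma smooth1_affine f a b : smooth1 f -> smooth1 (fun x => f (a * x + b)).
Proof. by move=> sf n; exact: Cn_affine. Qed.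

(* The derivative of [flat k] is [flat k.+2 - k flat k.+1]: the family is closed under
   differentiation. *)
Definition flat k (x : R) : R := if 0 < x then x^-1 ^+ k * expR (- x^-1) else 0.

(** exp(1/x) dominates the term (1/x)^(k+2) / (k+2)! of its series. The resulting bound in x^2 makes
    the derivative at 0 vanish. *)
Lemma flat_le k x : `|flat k x| <= (k.+2)`!%:R * x ^+ 2.
Proof.
rewrite /flat; case: ifPn => [x0|_]; last by rewrite normr0 mulr_ge0 ?sqr_ge0.
rewrite ger0_norm ?mulr_ge0 ?expR_ge0 ?exprn_ge0 ?invr_ge0 ?(ltW x0)//.
have xi0 : 0 < x^-1 by rewrite invr_gt0.
have f0 : 0 < (k.+2)`!%:R :> R by rewrite ltr0n fact_gt0.
have := expR_ge1Dxn k.+1 (ltW xi0) => /(le_trans _) H.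
have {}H : x^-1 ^+ k.+2 / (k.+2)`!%:R <= expR x^-1.
  by apply: H; rewrite lerDr.
rewrite expRN.
rewrite ler_pdivrMr ?expR_gt0//; move: H; rewrite ler_pdivrMr// => H.
apply: (@le_trans _ _ (x ^+ 2 * x^-1 ^+ k.+2)).
  rewrite le_eqVlt; apply/orP; left; apply/eqP.
  by rewrite (exprS _ k.+1) (exprS _ k) !mulrA expr2 -(mulrA x) divff ?mulr1 ?divff ?mul1r ?gt_eqF.
by rewrite [leRHS](_ : _ = x ^+ 2 * (expR x^-1 * (k.+2)`!%:R)) ?ler_pM2l ?exprn_gt0//; ring.
Qed.

Lemma is_derive_invX k (x : R) : x != 0 ->
  is_derive x (1 : R) (fun y => y^-1 ^+ k) (- k%:R * x^-1 ^+ k.+1).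
Proof.
move=> x0; elim: k => [|k IH].
  by rewrite oppr0 mul0r; under eq_fun do rewrite expr0; exact: is_derive_cst.
under eq_fun do rewrite exprS.
have dV := @is_derive1V id x 1 x0 (is_derive_id x (1 : R)).
apply: (is_derive1_eq (is_derive1M dV IH)).
by rewrite -natr1 !exprS /=; ring.
Qed.

Lemma is_derive_flat k x :
  is_derive x (1 : R) (flat k) (- k%:R * flat k.+1 x + flat k.+2 x).
Proof.
have [x0|x0|->] := ltgtP x 0.
- have E : {near x, cst 0 =1 flat k}.
    near=> y; rewrite /flat ltNge ifN// negbK; apply: ltW.
    by near: y; exact: lt_nbhsl.
  rewrite /flat ltNge (ltW x0)/= mulr0 addr0.
  exact: (near_eq_is_derive E).
- have E : {near x, (fun y : R => y^-1 ^+ k * expR (- y^-1)) =1 flat k}.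
    near=> y; rewrite /flat ifT//.
    by near: y; exact: lt_nbhsr.
  apply: (near_eq_is_derive E); rewrite /flat x0.
  have xn0 : x != 0 by rewrite gt_eqF.
  have dV := @is_derive1V id x 1 xn0 (is_derive_id x (1 : R)).
  have dE := @is_derive1_comp _ expR (fun y : R => - y^-1) x _ _ (is_derive_expR _)
    (is_deriveN dV).
  apply: (is_derive1_eq (is_derive1M (is_derive_invX k xn0) dE)).
  by rewrite /= !exprS; ring.
- rewrite /flat ltxx mulr0 addr0.
  have H : h^-1 *: ((flat k \o shift 0) (h *: (1 : R)) - flat k 0) @[h --> (0 : R)^'] --> (0 : R).
    apply/(@cvgrPdist_le _ R^o) => e e0; near=> h.
    have h0 : h != 0 by near: h; exact: nbhs_dnbhs_neq.
    rewrite sub0r normrN /= addr0 -[_ *: 1]/(h * 1) mulr1 [flat k 0]/flat ltxx subr0.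
    rewrite normrM normfV ler_pdivrMl ?normr_gt0// (le_trans (flat_le _ _))//.
    rewrite -real_normK ?num_real// expr2 mulrCA ler_wpM2l// -ler_pdivlMl ?ltr0n ?fact_gt0//.
    by near: h; apply: dnbhs0_le; rewrite mulr_gt0// invr_gt0 ltr0n fact_gt0.
  by split; [apply/cvg_ex; exists 0|exact/cvg_lim].
Unshelve. all: by end_near. Qed.

Lemma flat_smooth k : smooth1 (flat k).
Proof.
move=> n; elim: n k => [//|n IH] k.
exists (fun x => - k%:R * flat k.+1 x + flat k.+2 x); first exact: is_derive_flat.
by apply: Cn_D => //; apply: Cn_M => //; exact: Cn_cst.
Qed.

(* Vanishes on the negative axis and is 1 to the right of 1. *)
Definition step (x : R) : R := flat 0 x / (flat 0 x + flat 0 (- 1 * x + 1)).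

Lemma flat0_ge0 x : 0 <= flat 0 x.
Proof. by rewrite /flat; case: ifP => // _; rewrite expr0 mul1r expR_ge0. Qed.

Lemma flat0_gt0 x : 0 < x -> 0 < flat 0 x.
Proof. by rewrite /flat => ->; rewrite expr0 mul1r expR_gt0. Qed.

Lemma flat0_eq0 x : x <= 0 -> flat 0 x = 0.
Proof. by rewrite /flat ltNge => ->. Qed.

Lemma step_den x : 0 < flat 0 x + flat 0 (- 1 * x + 1).
Proof.
have [x0|x0] := ltP 0 x; first by rewrite ltr_pwDl ?flat0_gt0 ?flat0_ge0.
by rewrite ltr_wpDl ?flat0_gt0 ?flat0_ge0//; lra.
Qed.

Lemma step_smooth : smooth1 step.
Proof.
apply: smooth1M; first exact: flat_smooth.
apply: smooth1V => [x|]; first by rewrite gt_eqF ?step_den.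
by apply: smooth1D; [exact: flat_smooth|apply: smooth1_affine; exact: flat_smooth].
Qed.

Lemma step_eq0 x : x <= 0 -> step x = 0.
Proof. by move=> x0; rewrite /step flat0_eq0// mul0r. Qed.

Lemma step_eq1 x : 1 <= x -> step x = 1.
Proof.
move=> x1; rewrite /step [X in _ / (_ + X)]flat0_eq0 ?addr0; last lra.
by rewrite divff// gt_eqF// flat0_gt0// (lt_le_trans ltr01).
Qed.

Lemma step_ge0 x : 0 <= step x.
Proof. by rewrite divr_ge0 ?flat0_ge0// ltW// step_den. Qed.

Lemma step_le1 x : step x <= 1.
Proof. by rewrite ler_pdivrMr ?step_den// mul1r lerDl flat0_ge0. Qed.

End Smooth1.

(** * Lebesgue measure on the plane and affine changes of variable *)

Section PlaneMeasure.
Variable R : realType.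
Local Notation mu := (@mu2 R).
Local Notation leb := (@lebesgue_measure R).
Implicit Types (A B : set (plane R)) (f g h : plane R -> R).

Lemma measurable_box (a b c d : R) : measurable (`]a, b[ `*` `]c, d[ : set (plane R)).
Proof. exact: measurableX. Qed.

Lemma plane_nbhs (p : plane R) A : nbhs p A ->
  exists2 e : R, 0 < e & forall q, `|p.1 - q.1| < e -> `|p.2 - q.2| < e -> A q.
Proof.
move=> /nbhs_ballP[e e0 eA]; exists e => // q q1 q2; apply: eA; split => //=.
Qed.

(** Countably many rational boxes suffice, which makes open sets measurable for the product
    sigma-algebra on which [mu2] lives. *)
Lemma open_boxes A : open A -> A = \bigcup_(r in [set r : rat * rat * (rat * rat) |
    `]ratr r.1.1, ratr r.1.2[ `*` `]ratr r.2.1, ratr r.2.2[ `<=` A])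
    (`]ratr r.1.1, ratr r.1.2[ `*` `]ratr r.2.1, ratr r.2.2[).
Proof.
move=> oA; apply/seteqP; split => [p Ap|p [r rA rp]]; last exact: rA.
have [e e0 eA] : exists2 e : R, 0 < e & forall q, `|p.1 - q.1| < e ->
    `|p.2 - q.2| < e -> A q by apply: plane_nbhs; exact: open_nbhs_nbhs.
have lt1 x : x - e < x :> R by rewrite ltrBlDr ltrDl.
have lt2 x : x < x + e :> R by rewrite ltrDl.
have [a /[!in_itv]/= a1] := rat_in_itvoo (lt1 p.1).
have [b /[!in_itv]/= b1] := rat_in_itvoo (lt2 p.1).
have [c /[!in_itv]/= c1] := rat_in_itvoo (lt1 p.2).
have [d /[!in_itv]/= d1] := rat_in_itvoo (lt2 p.2).
exists ((a, b), (c, d)) => /=; last first.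
  by split => /=; rewrite in_itv/=; lra.
move=> q [/= q1 q2]; move: q1 q2; rewrite !in_itv/= => q1 q2.
by apply: eA; rewrite ltr_norml; lra.
Qed.

Lemma open_measurable2 A : open A -> measurable A.
Proof.
move=> oA; rewrite (open_boxes oA) bigcup_mkcond.
apply: countable_bigcupT_measurable => [|r]; first exact: countableP.
by case: ifPn => // _; exact: measurable_box.
Qed.

Lemma closed_measurable2 A : closed A -> measurable A.
Proof.
by move=> cA; rewrite -(setCK A); apply: measurableC; apply: open_measurable2;
  exact: closed_openC.
Qed.

Lemma open_continuous_measurable2 A f : open A -> (forall p, A p -> {for p, continuous f}) ->
  measurable_fun A f.
Proof.
move=> oA cf; apply: (measurability _ (RGenOInfty.measurableE R)).
move=> _ [_ [x ->] <-]; apply: open_measurable2; rewrite openE => p [Ap /= fp].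
have fpx : x < f p by move: fp; rewrite in_itv/= andbT.
have : \forall q \near p, x < f q by apply: (cvgr_gt (f p) (cf p Ap)).
have : \forall q \near p, A q by exact: open_nbhs_nbhs.
by apply: filterS2 => q Aq xq; split => //=; rewrite in_itv/= xq.
Qed.

Lemma continuous_measurable2 f : continuous f -> measurable_fun setT f.
Proof. by move=> cf; apply: open_continuous_measurable2 => [|p _]; [exact: openT|exact: cf]. Qed.

Definition aff (c : R) (t : plane R) (p : plane R) : plane R := (c * p.1 + t.1, c * p.2 + t.2).

Lemma measurable_aff1 (c t : R) : measurable_fun setT (fun x : R => c * x + t).
Proof.
apply: continuous_measurable_fun; apply: smooth1_cont.
apply: (@smooth1_affine _ id); exact: smooth1_id.
Qed.

Lemma measurable_aff c t : measurable_fun setT (aff c t).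
Proof.
apply: measurable_fun_pair.
- by apply: (@measurableT_comp _ _ _ _ _ _ (fun x => c * x + t.1)) => //;
    exact: measurable_aff1.
- by apply: (@measurableT_comp _ _ _ _ _ _ (fun x => c * x + t.2)) => //;
    exact: measurable_aff1.
Qed.

(** c times the push-forward under x -> c x + t is a measure that agrees with Lebesgue measure on
    half-open intervals, and these determine it. [mu2_aff] repeats the argument with uniqueness of
    product measures. *)
Lemma lebesgue_affine (c t : R) (X : set R) : 0 < c -> measurable X ->
  (leb X = c%:E * leb ((fun x => (c * x + t)%R) @^-1` X))%E.
Proof.
move=> c0 mX.
rewrite (_ : (_ * _)%E = mscale (NngNum (ltW c0)) (pushforward leb
   (fun x : measurableTypeR R => c * x + t : measurableTypeR R)) X)//.
  exact: measurable_aff1.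
move=> mg; apply: lebesgue_measure_unique => //.
move=> _ [[a b] _ <-]; rewrite /mscale /pushforward /=.
set F := (fun x : measurableTypeR R => _).
have FE : F @^-1` `]a, b] = `](a - t) / c, (b - t) / c]%classic.
  by apply/seteqP; split => x /=;
    rewrite !in_itv/= ltr_pdivrMr// ler_pdivlMr// [x * c]mulrC ltrBlDr lerBrDr.
rewrite -[RHS]/(c%:E * leb (F @^-1` `]a, b]))%E FE !lebesgue_measure_itv/= !lte_fin ltr_pM2r ?invr_gt0// ltrD2r.
case: ifP => ab; last by rewrite mule0.
by rewrite -!EFinD -EFinM; congr EFin; field; rewrite gt_eqF.
Qed.

Lemma mu2_aff c t A : 0 < c -> measurable A ->
  (mu A = (c ^+ 2)%:E * mu (aff c t @^-1` A))%E.
Proof.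
move=> c0 mA.
pose g : measurableTypeR R * measurableTypeR R -> measurableTypeR R * measurableTypeR R :=
  aff c t.
have mg : measurable_fun setT g by exact: measurable_aff.
pose m1 := mscale (NngNum (sqr_ge0 c))
  (measure_function_pushforward__canonical__measure_function_Measure mu mg).
rewrite -[RHS]/(m1 A); apply: product_measure_unique => // X Y mX mY.
rewrite -[LHS]/((c ^+ 2)%:E * mu (g @^-1` (X `*` Y)))%E.
have -> : g @^-1` (X `*` Y) = ((fun x => c * x + t.1) @^-1` X) `*`
   ((fun x => c * x + t.2) @^-1` Y) by apply/seteqP; split.
rewrite /mu2 product_measure1E//; last 2 first.
- by rewrite -[X in measurable X]setTI; exact: measurable_aff1.
- by rewrite -[X in measurable X]setTI; exact: measurable_aff1.
have EX := lebesgue_affine t.1 c0 mX; have EY := lebesgue_affine t.2 c0 mY.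
transitivity ((c%:E * leb ((fun x => (c * x + t.1)%R) @^-1` X)) *
  (c%:E * leb ((fun x => (c * x + t.2)%R) @^-1` Y)))%E; last first.
  by congr (_ * _)%E; exact: esym.
rewrite expr2 EFinM -!muleA; congr (_ * _)%E.
exact: muleCA.
Qed.

Lemma Rintegral_shift f t : mu.-integrable setT (EFin \o f) ->
  mu.-integrable setT (EFin \o (f \o aff 1 t)) /\
  \int[mu]_p f (aff 1 t p) = \int[mu]_p f p.
Proof.
move=> fi; have mf : measurable_fun setT f by apply/measurable_EFinP; case/integrableP: fi.
have mg := measurable_aff 1 t.
pose g : measurableTypeR R * measurableTypeR R -> measurableTypeR R * measurableTypeR R :=
  aff 1 t.
have mg' : measurable_fun setT g by exact: measurable_aff.
pose m1 := measure_function_pushforward__canonical__measure_function_Measure mu mg'.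
have E A : measurable A -> A `<=` setT -> mu A = m1 A.
  by move=> mA _; rewrite (mu2_aff t ltr01 mA) expr1n mul1e.
have mfg : measurable_fun setT (f \o aff 1 t) by exact: measurableT_comp.
have I1 : mu.-integrable setT (EFin \o (f \o aff 1 t)).
  apply/integrableP; split; first exact/measurable_EFinP.
  have /integrableP[_] := fi.
  rewrite (eq_measure_integral m1 E)/=.
  rewrite ge0_integral_pushforward//.
  by do 2 apply: measurableT_comp => //.
split => //; rewrite /Rintegral; congr fine.
rewrite [RHS](eq_measure_integral m1 E)/=.
by rewrite integral_pushforward//; exact/measurable_EFinP.
Qed.

End PlaneMeasure.

(** * Integrals and square-integrable functions *)

Section L2Space.
Variable R : realType.
Local Notation mu := (@mu2 R).
Local Notation M2 := (measurableTypeR R * measurableTypeR R)%type.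
Local Notation meas2 D := (measurable (D : set M2)).
Local Notation measf2 D f := (measurable_fun (D : set M2) f).
Implicit Types (D : set (plane R)) (f g h w G : plane R -> R).

Definition itg D f := mu.-integrable D (EFin \o f).
Definition int D f := \int[mu]_(p in D) f p.

Lemma itg_meas D f : itg D f -> measf2 D f.
Proof. by case/integrableP => /measurable_EFinP. Qed.

Lemma itg_eq D f g : meas2 D -> (forall p, D p -> f p = g p) -> itg D f -> itg D g.
Proof.
move=> mD fg; apply: (@eq_integrable _ M2 R mu D mD) => p; rewrite inE => Dp.
by rewrite /= fg.
Qed.

Lemma aeS (P Q : plane R -> Prop) : (forall p, P p -> Q p) ->
  {ae mu, forall p, P p} -> {ae mu, forall p, Q p}.
Proof.
by move=> PQ [N [mN N0 sN]]; exists N; split => // p nQ; apply: sN => /= Pp; exact/nQ/PQ.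
Qed.

Lemma itg_le D f g : meas2 D -> itg D g -> measf2 D f ->
  (forall p, D p -> `|f p| <= g p) -> itg D f.
Proof.
move=> mD gi mf fg; apply: (le_integrable mD _ _ gi); first exact/measurable_EFinP.
by move=> p Dp; rewrite /= lee_fin (le_trans (fg _ Dp))// ler_norm.
Qed.

Lemma itgD D f g : meas2 D -> itg D f -> itg D g -> itg D (fun p => f p + g p).
Proof. by move=> mD fi gi; apply: (integrableD mD fi gi). Qed.

Lemma itgZ D (a : R) f : meas2 D -> itg D f -> itg D (fun p => a * f p).
Proof. by move=> mD fi; apply: (integrableZl mD a fi). Qed.

Lemma itgB D f g : meas2 D -> itg D f -> itg D g -> itg D (fun p => f p - g p).
Proof. by move=> mD fi gi; apply: (integrableB mD fi gi). Qed.

Lemma int_eq D f g : (forall p, D p -> f p = g p) -> int D f = int D g.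
Proof. by move=> fg; apply: eq_Rintegral => p; rewrite inE => Dp; rewrite fg. Qed.

Lemma intD D f g : meas2 D -> itg D f -> itg D g -> int D (fun p => f p + g p) = int D f + int D g.
Proof. by move=> mD fi gi; exact: RintegralD. Qed.

Lemma intB D f g : meas2 D -> itg D f -> itg D g -> int D (fun p => f p - g p) = int D f - int D g.
Proof. by move=> mD fi gi; exact: RintegralB. Qed.

Lemma intZ D (a : R) f : meas2 D -> itg D f -> int D (fun p => a * f p) = a * int D f.
Proof. by move=> mD fi; exact: RintegralZl. Qed.

Lemma int_ge0 D f : (forall p, D p -> 0 <= f p) -> 0 <= int D f.
Proof. exact: (@Rintegral_ge0 _ M2 R mu D f). Qed.

Lemma int_le D f g : meas2 D -> itg D f -> itg D g -> (forall p, D p -> f p <= g p) ->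
  int D f <= int D g.
Proof. by move=> mD fi gi; exact: (@le_Rintegral _ M2 R mu D f g). Qed.

Lemma int_abs_le D f g : meas2 D -> itg D f -> itg D g -> (forall p, D p -> `|f p| <= g p) ->
  `|int D f| <= int D g.
Proof.
move=> mD fi gi fg; apply: le_trans (_ : int D (fun p => `|f p|) <= _).
  exact: le_normr_Rintegral.
apply: int_le => //; apply: (itg_le mD gi) => [|p Dp]; last by rewrite normr_id fg.
by apply: measurableT_comp => //; exact: itg_meas.
Qed.

Lemma int_EFin D f : meas2 D -> itg D f -> (int D f)%:E = (\int[mu]_(p in D) (f p)%:E)%E.
Proof. by move=> mD fi; rewrite /int /Rintegral fineK//; exact: (@integrable_fin_num _ M2 R mu). Qed.

Lemma int_eq0P D f : meas2 D -> itg D f -> (forall p, D p -> 0 <= f p) ->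
  null_on D f <-> int D f = 0.
Proof.
move=> mD fi f0; have mf : measf2 D (EFin \o f) by case/integrableP: fi.
have E : (\int[mu]_(p in D) `|(EFin \o f) p|)%E = (int D f)%:E.
  rewrite int_EFin//; apply: eq_integral => p; rewrite inE => Dp.
  by rewrite /= ger0_norm// f0.
split => [n0|i0].
- apply/eqP; rewrite -eqe -E; apply/eqP; apply/(ae_eq_integral_abs _ mD mf).
  by apply: aeS n0 => p H Dp; rewrite /= H.
- have /(ae_eq_integral_abs _ mD mf) : (\int[mu]_(p in D) `|(EFin \o f) p|)%E = 0 by rewrite E i0.
  by apply: aeS => p H Dp; have [] := H Dp.
Qed.

Lemma dct D (u : nat -> plane R -> R) G g : meas2 D -> (forall n, measf2 D (u n)) ->
  measf2 D G -> {ae mu, forall p, D p -> u n p @[n --> \oo] --> G p} -> itg D g ->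
  (forall n p, D p -> `|u n p| <= g p) ->
  itg D G /\ int D (u n) @[n --> \oo] --> int D G.
Proof.
move=> mD mu_ mG ae ig ug.
have [] := @dominated_convergence _ M2 R mu D mD
   (fun n => EFin \o u n) (EFin \o G) (EFin \o g).
- by move=> n; exact/measurable_EFinP.
- exact/measurable_EFinP.
- by apply: aeS ae => p H Dp; apply: cvg_EFin; [exact: nearW|exact: H].
- exact: ig.
- by apply: aeW => p n Dp /=; rewrite lee_fin ug.
move=> IG _ cv; split => //.
apply: fine_cvg; rewrite int_EFin//; exact: cv.
Qed.

Lemma L2_itg D f : L2 D f -> itg D (fun p => f p ^+ 2).
Proof. by case. Qed.

Lemma L2M D f g : meas2 D -> L2 D f -> L2 D g -> itg D (fun p => f p * g p).
Proof.
move=> mD [mf If] [mg Ig].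
apply: (itg_le mD (itgD mD If Ig)); first exact: measurable_funM.
move=> p _; rewrite normrM.
rewrite -(real_normK (num_real (f p))) -(real_normK (num_real (g p))).
have := sqr_ge0 (`|f p| - `|g p|); have := normr_ge0 (f p); have := normr_ge0 (g p).
nra.
Qed.

Lemma L2_lin D (a : R) f g : meas2 D -> L2 D f -> L2 D g -> L2 D (a *: f + g).
Proof.
move=> mD Lf Lg; have [mf If] := Lf; have [mg Ig] := Lg.
have mfg : measf2 D (a *: f + g).
  by apply: measurable_funD => //; exact: measurable_funM.
split => //; apply: (itg_le mD (itgD mD (itgZ (2 * a ^+ 2) mD If) (itgZ 2 mD Ig))).
  exact: measurable_funX.
move=> p _; rewrite ger0_norm ?sqr_ge0//.
rewrite -[(a *: f + g) p]/(a * f p + g p).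
have := sqr_ge0 (a * f p - g p); nra.
Qed.

Lemma L2B D f g : meas2 D -> L2 D f -> L2 D g -> L2 D (f - g).
Proof. by move=> mD Lf Lg; rewrite addrC -scaleN1r; exact: L2_lin. Qed.

Lemma L2_0 D : meas2 D -> L2 D 0.
Proof.
move=> mD; split; first exact: measurable_cst.
rewrite (_ : (fun x => _) = cst 0%E); first exact: integrable0.
by apply/funext => p; rewrite expr0n.
Qed.

Lemma ip_int D f g : ip D f g = int D (fun p => f p * g p).
Proof. by []. Qed.

Lemma ip_lin D (a : R) f g h : meas2 D -> L2 D f -> L2 D g -> L2 D h ->
  ip D (a *: f + g) h = a * ip D f h + ip D g h.
Proof.
move=> mD Lf Lg Lh; rewrite !ip_int -intZ//; last exact: L2M.
rewrite -intD//; last 2 first.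
- by apply: (itgZ _ mD); exact: L2M.
- exact: L2M.
by apply: int_eq => p _ /=; rewrite mulrDl -mulrA.
Qed.

Lemma ip_sym D f g : ip D f g = ip D g f.
Proof. by apply: int_eq => p _; rewrite mulrC. Qed.

Lemma ip_ge0 D f : 0 <= ip D f f.
Proof. by apply: int_ge0 => p _; rewrite -expr2 sqr_ge0. Qed.

Lemma null_onP D f : meas2 D -> L2 D f -> null_on D f <-> ip D f f = 0.
Proof.
move=> mD Lf; rewrite ip_int -int_eq0P//; last 2 first.
- exact: L2M.
- by move=> p _; rewrite -expr2 sqr_ge0.
split; apply: aeS => p H Dp; first by rewrite H// mulr0.
by apply/eqP; have /eqP := H Dp; rewrite mulf_eq0 orbb.
Qed.

Definition box (L : R) : set (plane R) := `[- L, L] `*` `[- L, L].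

Lemma boxE L p : box L p <-> `|p.1| <= L /\ `|p.2| <= L.
Proof. by rewrite /box /= !in_itv/= !ler_norml; split. Qed.

Lemma measurable_boxc L : meas2 (box L).
Proof. exact: measurableX. Qed.

Lemma mu_box_fin L : (mu (box L) < +oo)%E.
Proof.
rewrite /mu2 product_measure1E//= !lebesgue_measure_itv/=.
by case: ifP => _; rewrite ?mule0 ?ltry// -EFinD -EFinM ltry.
Qed.

Lemma bounded_set_box D : bounded_set D -> exists2 L, 0 < L & D `<=` box L.
Proof.
move=> [M [Mr MP]]; exists (`|M| + 1) => [|p Dp]; first by rewrite ltr_wpDl.
have /(MP (`|M| + 1))/(_ p Dp) : M < `|M| + 1.
  by rewrite (le_lt_trans (ler_norm _))// ltrDl.
by rewrite /= prod_normE ge_max => /andP[? ?]; exact/boxE.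
Qed.

Lemma bounded_integrable D f L M : meas2 D -> D `<=` box L -> measf2 D f ->
  (forall p, D p -> `|f p| <= M) -> itg D f.
Proof.
move=> mD DL mf fM; apply: measurable_bounded_integrable => //.
  apply: le_lt_trans (mu_box_fin L); apply: le_measure => //; rewrite inE//.
  exact: measurable_boxc.
exists M; split; first exact: num_real.
by move=> x Mx p /= Dp; rewrite (le_trans (fM _ Dp))// ltW.
Qed.

Lemma bounded_L2 D f L M : meas2 D -> D `<=` box L -> measf2 D f ->
  (forall p, D p -> `|f p| <= M) -> L2 D f.
Proof.
move=> mD DL mf fM; split => //.
apply: (bounded_integrable (f := fun p => f p ^+ 2) (M := M ^+ 2) mD DL).
  exact: measurable_funX.
move=> p Dp; rewrite normrX ler_pXn2r ?nnegrE ?fM//.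
exact: le_trans (fM _ Dp).
Qed.

Lemma box_integrable f L M : measf2 setT f -> (forall p, `|f p| <= M) ->
  (forall p, ~ box L p -> f p = 0) -> itg setT f.
Proof.
move=> mf fM f0.
rewrite /itg; have -> : EFin \o f = (EFin \o f) \_ (box L).
  apply/funext => p; rewrite patchE; case: ifPn => //=.
  by rewrite notin_setE => /f0 ->.
apply/(integrable_mkcond _ (measurable_boxc L)).
apply: (bounded_integrable (L := L) (M := M)) => //; first exact: measurable_boxc.
exact: measurable_funTS.
Qed.

Lemma Rintegral_restrict D f : (forall p, ~ D p -> f p = 0) ->
  \int[mu]_(p in D) f p = \int[mu]_p f p.
Proof.
move=> f0; rewrite Rintegral_mkcond; congr Rintegral; apply/funext => p.
by rewrite patchE; case: ifPn => //; rewrite notin_setE => /f0.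
Qed.

(** The steps run through the sequence 1/(n+1), to which dominated convergence applies; they are at
    most 1, which bounds the growth of the supports. *)
Definition quot (v : plane R) w (n : nat) (p : plane R) : R :=
  n.+1%:R * (w (p + n.+1%:R^-1 *: v) - w p).

Lemma affE (t p : plane R) : aff 1 t p = p + t.
Proof. by case: t p => [t1 t2] [p1 p2]; rewrite /aff /= !mul1r. Qed.

Lemma measurable_fun_shift w t : measf2 setT w -> measf2 setT (fun p => w (p + t)).
Proof.
move=> mw; rewrite (_ : (fun p => _) = w \o aff 1 t); last first.
  by apply/funext => p; rewrite /= affE.
by apply: measurableT_comp => //; exact: measurable_aff.
Qed.

(* The difference quotients of [w] have zero integral, by translation
   invariance. *)
Lemma slope_integral v w G (L M K : R) :
  measf2 setT w -> (forall p, `|w p| <= M) -> (forall p, ~ box L p -> w p = 0) ->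
  (forall p t, `|w (p + t *: v) - w p| <= K * `|t|) ->
  measf2 setT G -> {ae mu, forall p, quot v w n p @[n --> \oo] --> G p} ->
  itg setT G /\ \int[mu]_p G p = 0.
Proof.
move=> mw wM w0 wK mG ae.
pose N := `|v.1| + `|v.2|.
have mq n : measf2 setT (quot v w n).
  apply: measurable_funM => //; apply: measurable_funB => //.
  exact: measurable_fun_shift.
have K0 : 0 <= K by have := wK 0 1; rewrite normr1 mulr1; exact: le_trans.
have qK n p : `|quot v w n p| <= K.
  rewrite /quot normrM ger0_norm// -ler_pdivlMl ?ltr0n//.
  by rewrite (le_trans (wK _ _))// mulrC ger0_norm ?invr_ge0.
have q0 n p : ~ box (L + N) p -> quot v w n p = 0.
  move=> bp; rewrite /quot !w0 ?subr0 ?mulr0//.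
    move=> /boxE[b1 b2]; apply: bp; apply/boxE; rewrite /N.
    have := normr_ge0 v.1; have := normr_ge0 v.2; lra.
  have n1 : n.+1%:R^-1 <= 1 :> R by rewrite invf_le1 ?ltr0n// ler1n.
  have n0 : 0 <= n.+1%:R^-1 :> R by rewrite invr_ge0.
  move=> /boxE[]; rewrite /= => b1 b2; apply: bp; apply/boxE; rewrite /N.
  have A (a c : R) : `|a| <= `|a + n.+1%:R^-1 * c| + `|c|.
    rewrite -{1}(addrK (n.+1%:R^-1 * c) a) (le_trans (ler_normB _ _))// lerD2l.
    by rewrite normrM ger0_norm// ler_piMl.
  have := A p.1 v.1; have := A p.2 v.2; have := normr_ge0 v.1; have := normr_ge0 v.2.
  split; lra.
have Iw : mu.-integrable setT (EFin \o w) by exact: box_integrable mw wM w0.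
have iq n : \int[mu]_p quot v w n p = 0.
  have [I1 I2] := Rintegral_shift (n.+1%:R^-1 *: v) Iw.
  rewrite /quot RintegralZl//.
    rewrite RintegralB//.
      under eq_Rintegral do rewrite -affE.
      by rewrite I2 subrr mulr0.
    apply: eq_integrable I1 => // p _ /=; by rewrite affE.
  apply: (@integrableB _ _ _ mu setT _ (EFin \o (fun p => w (p + n.+1%:R^-1 *: v))) (EFin \o w)) => //.
  by apply: eq_integrable I1 => // p _ /=; rewrite affE.
have cq n p : `|quot v w n p| <= K * \1_(box (L + N)) p.
  rewrite indicE; case: (boolP (p \in _)) => pb; first by rewrite mulr1 qK.
  by rewrite mulr0 q0 ?normr0//; rewrite notin_setE in pb.
have IK : itg setT (fun p => K * \1_(box (L + N)) p).
  apply: (box_integrable (L := L + N) (M := K)).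
  + by apply: measurable_funM => //; apply: measurable_indic; exact: measurable_boxc.
  + move=> p; rewrite normrM ger0_norm// ler_piMr// indicE.
    by case: (_ \in _); rewrite ?normr1 ?normr0.
  + by move=> p bp; rewrite indicE memNset// mulr0.
have [|iG cv] := dct (@measurableT _ M2) mq mG _ IK (fun n p _ => cq n p).
  exact: aeS ae.
split => //; apply/esym; apply: (cvg_unique _ _ cv) => //.
rewrite [X in X @ _](_ : _ = cst 0); first exact: cvg_cst.
by apply/funext => n; exact: iq.
Qed.

End L2Space.

(** * Directional derivatives and smooth functions of two variables *)

Section SmoothPlane.
Variable R : realType.
Implicit Types (f g : plane R -> R) (a b : R -> R) (p v : plane R).

Lemma line_quot f p v (t : R) :
  (fun h => h^-1 *: (((fun s => f (p + s *: v)) \o shift t) (h *: (1 : R)) - f (p + t *: v))) =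
  (fun h => h^-1 *: ((f \o shift (p + t *: v)) (h *: v) - f (p + t *: v))).
Proof.
apply/funext => h /=; congr (_ *: (f _ - _)).
by rewrite [h *: 1]mulr1 scalerDl addrCA.
Qed.

Lemma derivable_line f p v (t : R) : derivable (fun s : R => f (p + s *: v)) t 1 <->
  derivable f (p + t *: v) v.
Proof. by rewrite /derivable line_quot. Qed.

Lemma derive_line f p v (t : R) : 'D_1 (fun s : R => f (p + s *: v)) t = 'D_v f (p + t *: v).
Proof. by rewrite /derive line_quot. Qed.

Lemma is_derive_line f p v (t : R) : differentiable f (p + t *: v) ->
  is_derive t (1 : R) (fun s => f (p + s *: v)) ('D_v f (p + t *: v)).
Proof.
move=> df; apply: DeriveDef; last exact: derive_line.
by apply/derivable_line; exact: diff_derivable.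
Qed.

Lemma differentiable_fst p : differentiable (fst : plane R -> R) p.
Proof.
apply: (@linear_differentiable _ _ _ (fst : plane R -> R)).
by move=> q; exact: cvg_fst.
Qed.
Lemma differentiable_snd p : differentiable (snd : plane R -> R) p.
Proof.
apply: (@linear_differentiable _ _ _ (snd : plane R -> R)).
by move=> q; exact: cvg_snd.
Qed.

Lemma differentiable_tensor a b p : smooth1 a -> smooth1 b ->
  differentiable (fun p => a p.1 * b p.2) p.
Proof.
move=> /smooth1_derive[_ da] /smooth1_derive[_ db].
apply: (@differentiableM _ _ (a \o fst) (b \o snd)).
- apply: (@differentiable_comp _ _ _ _ fst a); first exact: differentiable_fst.
  by apply/derivable1_diffP; have [] := da p.1.
- apply: (@differentiable_comp _ _ _ _ snd b); first exact: differentiable_snd.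
  by apply/derivable1_diffP; have [] := db p.2.
Qed.

Lemma is_derive1_affine a (c d t : R) : smooth1 a ->
  is_derive t (1 : R) (fun s => a (d + s * c)) ('D_1 a (d + t * c) * c).
Proof.
move=> sa; have [_ da] := smooth1_derive sa.
have H : is_derive t (1 : R) (fun s : R => d + s * c) c.
  have -> : (fun s : R => d + s * c) = cst c * id + cst d.
    by apply/funext => s; rewrite addrC mulrC.
  by apply: is_derive_eq; rewrite addr0 scaler0 addr0 -[_ *: _]/(c * 1) mulr1.
exact: (@is_derive1_comp _ a (fun s => d + s * c) t).
Qed.

Lemma derive_tensor a b v p : smooth1 a -> smooth1 b ->
  'D_v (fun p => a p.1 * b p.2) p =
  v.1 * ('D_1 a p.1 * b p.2) + v.2 * (a p.1 * 'D_1 b p.2).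
Proof.
move=> sa sb; have := derive_line (fun p => a p.1 * b p.2) p v 0.
rewrite scale0r addr0 => <-.
have [_ ->] := is_derive1M (is_derive1_affine v.1 p.1 0 sa) (is_derive1_affine v.2 p.2 0 sb).
by rewrite !mul0r !addr0; ring.
Qed.

(** Finite sums of products a(x) b(y) are stable under directional derivatives, which gives [smooth]
    at once for all functions built from one-variable steps. *)
Inductive tensor_sum : (plane R -> R) -> Prop :=
| tensor1 a b : smooth1 a -> smooth1 b -> tensor_sum (fun p => a p.1 * b p.2)
| tensorD f g : tensor_sum f -> tensor_sum g -> tensor_sum (fun p => f p + g p).

Lemma tensor_differentiable f p : tensor_sum f -> differentiable f p.
Proof.
elim=> [a b sa sb|g h _ dg _ dh]; first exact: differentiable_tensor.
exact: differentiableD.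
Qed.

Lemma tensor_scale (k : R) f : tensor_sum f -> tensor_sum (fun p => k * f p).
Proof.
elim=> [a b sa sb|g h _ dg _ dh].
- rewrite (_ : (fun p => _) = (fun p => (k * a p.1) * b p.2)); last first.
    by apply/funext => p; rewrite mulrA.
  by apply: (@tensor1 (fun x => k * a x) b) => //; apply: smooth1M => //; exact: smooth1_cst.
- under eq_fun do rewrite mulrDr.
  exact: tensorD.
Qed.

Lemma tensor_cst (k : R) : tensor_sum (fun=> k).
Proof.
rewrite (_ : (fun=> k) = (fun p => k * 1)); last by apply/funext => p; rewrite mulr1.
by apply: (@tensor1 (fun=> k) (fun=> 1)); exact: smooth1_cst.
Qed.

Lemma tensor_derive f v : tensor_sum f -> tensor_sum ('D_v f).
Proof.
elim=> [a b sa sb|g h tg dg th dh].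
- rewrite (_ : 'D_v _ = (fun p => v.1 * ('D_1 a p.1 * b p.2) + v.2 * (a p.1 * 'D_1 b p.2))).
    have [sa' _] := smooth1_derive sa; have [sb' _] := smooth1_derive sb.
    by apply: tensorD; apply: tensor_scale;
      [exact: (@tensor1 ('D_1 a) b)|exact: (@tensor1 a ('D_1 b))].
  by apply/funext => p; exact: derive_tensor.
- rewrite (_ : 'D_v _ = (fun p => 'D_v g p + 'D_v h p)); first exact: tensorD.
  by apply/funext => p; rewrite -[LHS]/('D_v (g + h) p) deriveD//;
    apply: diff_derivable; exact: tensor_differentiable.
Qed.

Lemma tensor_smooth f : tensor_sum f -> smooth f.
Proof.
move=> tf vs p; apply: tensor_differentiable.
by elim: vs => //= v vs IH; exact: tensor_derive.
Qed.

Lemma smooth_differentiable f : smooth f -> forall p, differentiable f p.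
Proof. by move=> sf p; exact: (sf [::]). Qed.

Lemma smooth_derive f v : smooth f -> smooth ('D_v f).
Proof. by move=> sf vs p; have := sf (rcons vs v) p; rewrite foldr_rcons. Qed.

Lemma smooth_continuous f : smooth f -> continuous f.
Proof. by move=> sf p; apply: differentiable_continuous; exact: smooth_differentiable. Qed.

Lemma smooth_lin (k : R) f g : smooth f -> smooth g -> smooth (k *: f + g).
Proof.
move=> sf sg vs.
have [<- //] : foldr (fun v h => 'D_v h) (k *: f + g) vs =
  k *: foldr (fun v h => 'D_v h) f vs + foldr (fun v h => 'D_v h) g vs /\
  forall p, differentiable (k *: foldr (fun v h => 'D_v h) f vs + foldr (fun v h => 'D_v h) g vs) p.
split; last by move=> p; apply: differentiableD => //; exact: differentiableZ.
elim: vs => //= v vs ->; apply/funext => p.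
rewrite deriveD; last 2 first.
- by apply: diff_derivable; apply: differentiableZ.
- exact: diff_derivable.
by rewrite deriveZ//; exact: diff_derivable.
Qed.

Lemma diff_lip f v (K : R) : (forall p, differentiable f p) -> (forall p, `|'D_v f p| <= K) ->
  forall p t, `|f (p + t *: v) - f p| <= K * `|t|.
Proof.
move=> sf K1 p t; wlog t0 : p t / 0 <= t.
  move=> H; have [|/ltW t0] := leP 0 t; first exact: H.
  have := H (p + t *: v) (- t); rewrite oppr_ge0 => /(_ t0).
  by rewrite scaleNr addrK normrN distrC.
rewrite [`|t|]ger0_norm//.
pose F s := f (p + s *: v).
have dF x : is_derive x (1 : R) F ('D_v f (p + x *: v)).
  exact: is_derive_line.
have [c _ E] : exists2 c, c \in `[0, t]%R & F t - F 0 = 'D_v f (p + c *: v) * (t - 0).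
  apply: MVT_segment => //.
  apply: continuous_subspaceT => x; apply: differentiable_continuous.
  by apply/derivable1_diffP; have [] := dF x.
move: E; rewrite /F scale0r addr0 subr0 => ->.
by rewrite normrM (ger0_norm t0) ler_wpM2r.
Qed.

Lemma smooth_lip f v (K : R) : smooth f -> (forall p, `|'D_v f p| <= K) ->
  forall p t, `|f (p + t *: v) - f p| <= K * `|t|.
Proof. by move=> /smooth_differentiable; exact: diff_lip. Qed.

End SmoothPlane.

(** * Test functions and weak derivatives *)

Section TestFunctions.
Variable R : realType.
Local Notation mu := (@mu2 R).
Local Notation M2 := (measurableTypeR R * measurableTypeR R)%type.
Local Notation meas2 D := (measurable (D : set M2)).
Local Notation measf2 D f := (measurable_fun (D : set M2) f).
Implicit Types (Om K : set (plane R)) (f g w G phi : plane R -> R).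

Lemma measf2_smooth f : smooth f -> measf2 setT f.
Proof. by move=> /smooth_continuous; exact: continuous_measurable2. Qed.

Lemma smooth_support_derive f K (v : plane R) : closed K -> (forall p, ~ K p -> f p = 0) ->
  forall p, ~ K p -> 'D_v f p = 0.
Proof.
move=> cK f0 p Kp; rewrite -[RHS](derive_cst (0 : R) p v); apply: near_eq_derive.
have : \forall q \near p, (~` K) q by apply: open_nbhs_nbhs; split => //; exact: closed_openC.
by apply: filterS => q; exact: f0.
Qed.

Lemma compact_plane_closed K : compact K -> closed K.
Proof. by apply: compact_closed; exact: norm_hausdorff. Qed.

Lemma test_derive Om phi v : test_function Om phi -> test_function Om ('D_v phi).
Proof.
move=> [sp [K [cK KO p0]]]; split; first exact: smooth_derive.
exists K; split => //; apply: smooth_support_derive p0; exact: compact_plane_closed.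
Qed.

Lemma test_lin Om (k : R) phi psi : test_function Om phi -> test_function Om psi ->
  test_function Om (k *: phi + psi).
Proof.
move=> [sp [K [cK KO p0]]] [sq [L [cL LO q0]]]; split; first exact: smooth_lin.
exists (K `|` L); split; first exact: compactU.
- by move=> p [/KO|/LO].
- move=> p Kp; rewrite -[LHS]/(k * phi p + psi p) p0 ?q0 ?mulr0 ?addr0//.
  + by move=> ?; apply: Kp; right.
  + by move=> ?; apply: Kp; left.
Qed.

Lemma test_0 Om : test_function Om 0.
Proof.
split; first by apply: tensor_smooth; exact: tensor_cst.
by exists set0; split => //; exact: compact0.
Qed.

Lemma test_out Om phi p : test_function Om phi -> ~ Om p -> phi p = 0.
Proof. by move=> [_ [K [_ KO p0]]] Op; apply: p0 => /KO. Qed.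

Lemma test_bounded Om phi : test_function Om phi ->
  exists M, [/\ 0 < M, forall p, `|phi p| <= M & forall p, ~ box M p -> phi p = 0].
Proof.
move=> [sp [K [cK KO p0]]].
have [L L0 KL] := bounded_set_box (compact_bounded cK).
have : bounded_set (phi @` K).
  apply: compact_bounded; apply: continuous_compact cK.
  by apply: continuous_subspaceT; exact: smooth_continuous.
move=> [M [Mr MP]]; exists (Num.max L (`|M| + 1)).
have M1 : M < `|M| + 1 by rewrite (le_lt_trans (ler_norm _))// ltrDl.
split => [|p|p bp].
- by rewrite lt_max L0.
- have [Kp|Kp] := pselect (K p); last by rewrite p0// normr0 le_max (ltW L0).
  by rewrite le_max (MP _ M1) ?orbT//; exists p.
- apply: p0 => /KL/boxE[b1 b2]; apply/bp/boxE.
  by rewrite !le_max b1 b2.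
Qed.

Lemma test_measurable Om phi : test_function Om phi -> measf2 setT phi.
Proof. by move=> [sp _]; exact: measf2_smooth. Qed.

Lemma test_L2 Om D phi : meas2 D -> test_function Om phi -> L2 D phi.
Proof.
move=> mD tp; have [M [M0 pM p0]] := test_bounded tp; have mp := test_measurable tp.
split; first exact: measurable_funTS.
apply: (itg_le mD (g := fun p => M ^+ 2 * \1_(box M) p)).
- rewrite /itg; apply: (@integrableS _ M2 R mu setT D); rewrite ?measurableT//.
  apply: (box_integrable (L := M) (M := M ^+ 2)).
  + by apply: measurable_funM => //; apply: measurable_indic; exact: measurable_boxc.
  + move=> p; rewrite normrM ger0_norm ?sqr_ge0// ler_piMr ?sqr_ge0// indicE.
    by case: (_ \in _); rewrite ?normr1 ?normr0.
  + by move=> p bp; rewrite indicE memNset// mulr0.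
- by apply: measurable_funX; exact: measurable_funTS.
- move=> p _; rewrite indicE; case: (boolP (p \in _)) => pb.
    by rewrite mulr1 normrX ler_pXn2r ?nnegrE ?(ltW M0).
  by rewrite notin_setE in pb; rewrite p0// expr0n normr0 mulr0.
Qed.

Lemma derivable_quot f p v : derivable f p v -> quot v f n p @[n --> \oo] --> 'D_v f p.
Proof.
move=> df; pose F := (fun h => h^-1 *: ((f \o shift p) (h *: v) - f p)).
have cF : F @ 0^' --> 'D_v f p by exact: df.
have cu : (n.+1%:R^-1 : R) @[n --> \oo] --> (0 : R)^'.
  move=> A A0; have H : \forall n \near \oo, (n.+1%:R^-1 : R) != 0 -> A n.+1%:R^-1.
    exact: (@cvg_harmonic R _ A0).
  suff : \forall n \near \oo, A n.+1%:R^-1 by [].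
  apply: filterS H => n; apply.
  by rewrite /= invr_eq0 pnatr_eq0.
have := cvg_comp _ _ cu cF; apply: cvg_trans.
rewrite (_ : (fun n => _) = F \o (fun n => n.+1%:R^-1))//.
by apply/funext => n; rewrite /quot /F /= invrK [p + _]addrC.
Qed.

Lemma test_quot Om phi v p : test_function Om phi -> quot v phi n p @[n --> \oo] --> 'D_v phi p.
Proof.
move=> [sp _]; apply: derivable_quot; apply: diff_derivable.
exact: smooth_differentiable.
Qed.

(* Integration by parts against a test function: the product is Lipschitz with
   compact support, so its difference quotients have zero mean. *)
Lemma lipschitz_weak_deriv Om v w G (M K : R) : meas2 Om -> L2 Om w -> L2 Om G ->
  measf2 setT w -> (forall p, `|w p| <= M) ->
  (forall p t, `|w (p + t *: v) - w p| <= K * `|t|) ->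
  measf2 setT G -> {ae mu, forall p, quot v w n p @[n --> \oo] --> G p} ->
  is_weak_deriv Om v w G.
Proof.
move=> mO Lw LG mw wM wK mG ae; split => // phi tp.
have [B [B0 pB p0]] := test_bounded tp.
have td := test_derive v tp; have [B' [B'0 pB' _]] := test_bounded td.
have mp := test_measurable tp; have md := test_measurable td.
pose W p := w p * phi p; pose H p := G p * phi p + w p * 'D_v phi p.
have sp : smooth phi by case: tp.
have Wlip p t : `|W (p + t *: v) - W p| <= (K * B + M * B') * `|t|.
  have -> : W (p + t *: v) - W p = (w (p + t *: v) - w p) * phi (p + t *: v) +
     w p * (phi (p + t *: v) - phi p) by rewrite /W; ring.
  apply: le_trans (ler_normD _ _) _; rewrite !normrM mulrDl; apply: lerD.
    by rewrite mulrAC; apply: ler_pM => //; exact: wK.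
  rewrite -mulrA; apply: ler_pM => //.
  by apply: smooth_lip => // q; exact: pB'.
have [||p bp||||_ H0] := @slope_integral R v W H B (M * B) (K * B + M * B').
- exact: measurable_funM.
- by move=> p; rewrite normrM; apply: ler_pM.
- by rewrite /W p0 ?mulr0.
- exact: Wlip.
- by apply: measurable_funD; apply: measurable_funM.
- apply: aeS ae => p cw.
  have cp : quot v phi n p @[n --> \oo] --> 'D_v phi p by exact: test_quot tp.
  (* A discrete Leibniz rule: [w] and [phi] are differenced in turn, and the shifted value of [phi]
     is rewritten as [phi] plus the step times its quotient. *)
  have -> : quot v W ^~ p = (fun n => quot v w n p * (phi p + n.+1%:R^-1 * quot v phi n p)
     + w p * quot v phi n p).
    by apply/funext => n; rewrite /quot /W; field; rewrite addrC natr1 pnatr_eq0.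
  rewrite /H; apply: cvgD; last by apply: cvgM => //; exact: cvg_cst.
  apply: cvgM => //; rewrite -[X in _ --> X]addr0; apply: cvgD; first exact: cvg_cst.
  by rewrite -(mul0r ('D_v phi p)); apply: cvgM => //; exact: cvg_harmonic.
have {}H0 : int Om H = 0.
  rewrite -H0; apply: Rintegral_restrict => p Op.
  by rewrite /H (test_out tp Op) (test_out td Op) !mulr0 addr0.
have Lp := test_L2 mO tp; have Ld := test_L2 mO td.
move: H0; rewrite /H intD//; [|exact: L2M|exact: L2M].
by rewrite !ip_int => /eqP; rewrite addr_eq0 => /eqP ->; rewrite opprK.
Qed.

Lemma test_weak_deriv Om phi v : meas2 Om -> test_function Om phi ->
  is_weak_deriv Om v phi ('D_v phi).
Proof.
move=> mO tp; have [B [B0 pB p0]] := test_bounded tp.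
have td := test_derive v tp; have [B' [B'0 pB' _]] := test_bounded td.
apply: (lipschitz_weak_deriv (M := B) (K := B')) => //.
- exact: test_L2 tp.
- exact: test_L2 td.
- exact: test_measurable tp.
- by apply: smooth_lip pB'; case: tp.
- exact: test_measurable td.
- by apply: aeW => p; exact: test_quot tp.
Qed.

End TestFunctions.

(** * The fundamental lemma of the calculus of variations *)

Section FundamentalLemma.
Variable R : realType.
Local Notation mu := (@mu2 R).
Local Notation M2 := (measurableTypeR R * measurableTypeR R)%type.
Local Notation meas2 D := (measurable (D : set M2)).
Local Notation measf2 D f := (measurable_fun (D : set M2) f).

(** A smooth plateau: 0 outside [a + 1/(n+1), b - 1/(n+1)] and 1 on the interval shrunk twice as
    much. As n grows it tends to the indicator of ]a, b[ from inside. *)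
Definition bump1 (a b : R) n (x : R) : R :=
  step (n.+1%:R * x + - (n.+1%:R * a + 1)) * step (- n.+1%:R * x + (n.+1%:R * b - 1)).

Lemma bump1_smooth a b n : smooth1 (bump1 a b n).
Proof. by apply: smooth1M; apply: smooth1_affine; exact: step_smooth. Qed.

Lemma bump1_ge0 a b n x : 0 <= bump1 a b n x.
Proof. by apply: mulr_ge0; exact: step_ge0. Qed.

Lemma bump1_le1 a b n x : bump1 a b n x <= 1.
Proof. by rewrite -[leRHS]mulr1; apply: ler_pM; rewrite ?step_ge0 ?step_le1. Qed.

Lemma bump1_out a b n x : ~ (a + n.+1%:R^-1 <= x <= b - n.+1%:R^-1) -> bump1 a b n x = 0.
Proof.
move=> H; have n0 : 0 < n.+1%:R :> R by [].
have e : n.+1%:R * n.+1%:R^-1 = 1 :> R by rewrite mulfV.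
rewrite /bump1; have [h1|h1] := lerP (a + n.+1%:R^-1) x; last first.
  rewrite step_eq0 ?mul0r//; move: h1; rewrite -(ltr_pM2l n0) mulrDr e; lra.
have [h2|h2] := lerP x (b - n.+1%:R^-1); first by case: H; rewrite h1.
rewrite [step (- _ * _ + _)]step_eq0 ?mulr0//.
by move: h2; rewrite -(ltr_pM2l n0) mulrBr e; lra.
Qed.

Lemma bump1_in a b n x : a + 2 * n.+1%:R^-1 <= x <= b - 2 * n.+1%:R^-1 -> bump1 a b n x = 1.
Proof.
move=> /andP[h1 h2]; have n0 : 0 < n.+1%:R :> R by [].
have e : n.+1%:R * (2 * n.+1%:R^-1) = 2 :> R by rewrite mulrCA mulfV// mulr1.
rewrite /bump1 !step_eq1 ?mulr1//.
  by rewrite -(ler_pM2l n0) mulrBr e in h2; lra.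
by rewrite -(ler_pM2l n0) mulrDr e in h1; lra.
Qed.

Lemma bump1_cvg a b x : a < x < b -> \forall n \near \oo, bump1 a b n x = 1.
Proof.
move=> /andP[ax xb].
pose e := Num.min (x - a) (b - x) / 2.
have e0 : 0 < e by rewrite divr_gt0// lt_min !subr_gt0 ax.
near=> n; apply: bump1_in.
have : n.+1%:R^-1 < e by near: n; exact: (near_infty_natSinv_lt (PosNum e0)).
rewrite /e ltr_pdivlMr// lt_min => /andP[].
move: (n.+1%:R^-1) => t; lra.
Unshelve. all: by end_near. Qed.

Definition bump2 (a b c d : R) n (p : plane R) : R := bump1 a b n p.1 * bump1 c d n p.2.

Lemma bump2_smooth a b c d n : smooth (bump2 a b c d n).
Proof. by apply: tensor_smooth; apply: tensor1; exact: bump1_smooth. Qed.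

Lemma bump2_test Om a b c d n : `]a, b[ `*` `]c, d[ `<=` Om -> test_function Om (bump2 a b c d n).
Proof.
move=> sub; split; first exact: bump2_smooth.
exists (`[a + n.+1%:R^-1, b - n.+1%:R^-1] `*` `[c + n.+1%:R^-1, d - n.+1%:R^-1]); split.
- by apply: compact_setX; exact: segment_compact.
- move=> p [/=]; rewrite !in_itv/= => h1 h2; apply: sub; split; rewrite /= in_itv/=.
    by have : 0 < n.+1%:R^-1 :> R by []; move: (n.+1%:R^-1) h1 => t; lra.
  by have : 0 < n.+1%:R^-1 :> R by []; move: (n.+1%:R^-1) h2 => t; lra.
- move=> p H; rewrite /bump2.
  have [h1|h1] := pselect (a + n.+1%:R^-1 <= p.1 <= b - n.+1%:R^-1); last first.
    by rewrite bump1_out// mul0r.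
  rewrite [X in _ * X]bump1_out ?mulr0// => h2; apply: H.
  by split => /=; rewrite in_itv/=.
Qed.

Lemma bump2_norm a b c d n p : `|bump2 a b c d n p| <= \1_(`]a, b[ `*` `]c, d[) p.
Proof.
rewrite ger0_norm; last by apply: mulr_ge0; exact: bump1_ge0.
rewrite indicE; case: (boolP (p \in _)) => pb.
  by rewrite -[leRHS]mulr1; apply: ler_pM; rewrite ?bump1_ge0 ?bump1_le1.
have [_ [K [_ Ks p0]]] := @bump2_test _ a b c d n (@subset_refl _ _).
by rewrite p0// => /Ks; rewrite notin_setE in pb.
Qed.

Lemma bump2_cvg a b c d p : bump2 a b c d n p @[n --> \oo] --> (\1_(`]a, b[ `*` `]c, d[) p : R).
Proof.
rewrite indicE; case: (boolP (p \in _)) => pb.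
  move: pb; rewrite inE => -[/=]; rewrite !in_itv/= => h1 h2.
  apply: cvg_near_cst; have := bump1_cvg h1; have := bump1_cvg h2.
  by apply: filterS2 => n b2 b1; rewrite /bump2 b1 b2 mulr1.
rewrite (_ : (fun n => _) = cst 0); first exact: cvg_cst.
apply/funext => n; apply/eqP; rewrite -normr_le0 (le_trans (bump2_norm _ _ _ _ _ _))//.
by rewrite indicE (negbTE pb).
Qed.

Definition open_rects : set (set M2) :=
  [set A | exists a b c d : R, A = `]a, b[ `*` `]c, d[].

(** Dynkin's theorem wants a generator stable under intersection. Both coordinates are measurable
    for the sigma-algebra of bounded open rectangles, since open half-planes are countable unions of
    these. *)
Lemma open_rects_generate : @measurable _ M2 = <<s open_rects >>.
Proof.
apply/seteqP; split; last first.
  apply: smallest_sub; first exact: sigma_algebra_measurable.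
  by move=> _ [a [b [c [d ->]]]]; apply: measurableX.
have m1 : measurable_fun setT (fst : g_sigma_algebraType open_rects -> measurableTypeR R).
  apply: (measurability _ (RGenOInfty.measurableE R)).
  move=> _ [_ [x ->] <-]; rewrite setTI.
  rewrite [X in measurable X](_ : _ = \bigcup_n (`]x, n%:R[ `*` `]- n%:R, n%:R[)).
    by apply: bigcupT_measurable => n; apply: sub_sigma_algebra; exists x, n%:R, (- n%:R), n%:R.
  apply/seteqP; split => [p /=|p [n _ [/=]]]; rewrite !in_itv/= ?andbT; last by case/andP.
  move=> xp; exists (Num.trunc (`|p.1| + `|p.2|)).+1 => //=.
  have := truncnS_gt (`|p.1| + `|p.2|); set N := _.+1%:R => NP.
  split => /=; rewrite in_itv/= ?xp/=.
    by rewrite (le_lt_trans (ler_norm _))// (le_lt_trans _ NP)// lerDl.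
  by rewrite -ltr_norml (le_lt_trans _ NP)// lerDr.
have m2 : measurable_fun setT (snd : g_sigma_algebraType open_rects -> measurableTypeR R).
  apply: (measurability _ (RGenOInfty.measurableE R)).
  move=> _ [_ [x ->] <-]; rewrite setTI.
  rewrite [X in measurable X](_ : _ = \bigcup_n (`]- n%:R, n%:R[ `*` `]x, n%:R[)).
    by apply: bigcupT_measurable => n; apply: sub_sigma_algebra; exists (- n%:R), n%:R, x, n%:R.
  apply/seteqP; split => [p /=|p [n _ [/=]]]; rewrite !in_itv/= ?andbT; last first.
    by move=> _ /andP[].
  move=> xp; exists (Num.trunc (`|p.1| + `|p.2|)).+1 => //=.
  have := truncnS_gt (`|p.1| + `|p.2|); set N := _.+1%:R => NP.
  split => /=; rewrite in_itv/= ?xp/=.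
    by rewrite -ltr_norml (le_lt_trans _ NP)// lerDl.
  by rewrite (le_lt_trans (ler_norm _))// (le_lt_trans _ NP)// lerDr.
have mi := measurable_fun_pair m1 m2.
move=> A mA; have := mi measurableT A mA; rewrite setTI.
by rewrite (_ : _ @^-1` A = A)//; apply/seteqP; split => -[].
Qed.

Lemma open_rects_setI : setI_closed open_rects.
Proof.
move=> _ _ [a [b [c [d ->]]]] [a' [b' [c' [d' ->]]]].
exists (Num.max a a'), (Num.min b b'), (Num.max c c'), (Num.min d d').
apply/seteqP; split => p /=; rewrite !in_itv/= !gt_max !lt_min.
  by move=> [[/andP[-> ->] /andP[-> ->]] [/andP[-> ->] /andP[-> ->]]].
by move=> [/andP[/andP[-> ->] /andP[-> ->]] /andP[/andP[-> ->] /andP[-> ->]]].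
Qed.

Section Null.
Variables (Om : set (plane R)) (L : R) (g : plane R -> R).
Hypotheses (oOm : open Om) (OmL : Om `<=` box L) (Lg : L2 Om g).
Hypothesis g0 : forall phi, test_function Om phi -> ip Om g phi = 0.

Let mO : meas2 Om. Proof. exact: open_measurable2. Qed.

Lemma rect_int0 a b c d : `]a, b[ `*` `]c, d[ `<=` Om ->
  (\int[mu]_(x in `]a, b[ `*` `]c, d[) (g x)%:E = 0)%E.
Proof.
move=> sub; set B := `]a, b[ `*` `]c, d[.
have mB : meas2 B by exact: measurable_box.
have L1 : L2 Om (\1_B : plane R -> R).
  apply: (bounded_L2 (L := L) (M := 1)) => //.
  by move=> p _; rewrite indicE; case: (_ \in _); rewrite ?normr1 ?normr0.
have mg : measf2 Om g by case: Lg.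
have Ld : itg Om (fun p => `|g p * \1_B p|).
  apply: (itg_le mO (g := fun p => `|g p * \1_B p|)) => [||p _]; last by rewrite normr_id.
    by have := L2M mO Lg L1; rewrite /itg => /integrable_abse.
  apply: measurableT_comp => //; apply: measurable_funM => //.
have [|||n p _|i1 cv] := dct (u := fun n p => g p * bump2 a b c d n p)
    (G := fun p => g p * \1_B p) mO _ _ _ Ld.
- move=> n; apply: measurable_funM => //; apply: measurable_funTS.
  by apply: measf2_smooth; exact: bump2_smooth.
- apply: measurable_funM => //; apply: measurable_funTS; exact: measurable_indic.
- apply: aeW => p _; apply: cvgM; [exact: cvg_cst|exact: bump2_cvg].
- rewrite [leLHS]normrM [leRHS]normrM; apply: ler_wpM2l => //.
  by rewrite (le_trans (bump2_norm _ _ _ _ _ _))// ler_norm.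
have {cv} : int Om (fun p => g p * \1_B p) = 0.
  apply/esym; apply: (cvg_unique _ _ cv) => //.
  rewrite [X in X @ _](_ : _ = cst 0); first exact: cvg_cst.
  by apply/funext => n; apply: g0; exact: bump2_test.
move=> H; rewrite -[RHS](congr1 EFin H) int_EFin//.
rewrite [LHS]integral_mkcond [RHS]integral_mkcond; apply: eq_integral => p _.
rewrite !patchE indicE; case: (boolP (p \in B)) => pB.
  by rewrite mem_set ?mulr1//; apply: sub; rewrite inE in pB.
by case: ifP => //; rewrite mulr0.
Qed.

(** The integral of [g] vanishes over the trace on the rectangle of every measurable set: for
    rectangles by [rect_int0], in general by Dynkin's theorem. The set where g > 0 is one of
    them. *)
Lemma rect_null_pos a b c d : `]a, b[ `*` `]c, d[ `<=` Om ->
  null_on (`]a, b[ `*` `]c, d[ `&` [set p | 0 < g p]) g.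
Proof.
move=> sub; set B := `]a, b[ `*` `]c, d[.
have mB : meas2 B by exact: measurable_box.
have mg : measf2 Om g by case: Lg.
have iB : itg B g.
  apply: (@integrableS _ M2 R mu Om B) => //.
  apply: (itg_eq mO (f := fun p => g p * 1)); first by move=> p _; rewrite mulr1.
  apply: L2M => //; apply: (bounded_L2 (L := L) (M := 1)) => // p _; first by rewrite normr1.
have iS A : meas2 A -> itg (A `&` B) g.
  by move=> mA; apply: (@integrableS _ M2 R mu B (A `&` B)) => //; exact: measurableI.
have all0 A : meas2 A -> (\int[mu]_(x in (A `&` B)) (g x)%:E = 0)%E.
  move=> mA; have := mA; rewrite open_rects_generate => HA.
  apply: (@dynkin_induction _ M2 open_rects
     (fun A => (\int[mu]_(x in (A `&` B)) (g x)%:E = 0)%E) open_rects_generate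
     open_rects_setI) HA.
  - by rewrite setTI; exact: rect_int0.
  - move=> X GX.
    have [a' [b' [c' [d' E]]]] : open_rects (X `&` B).
      by apply: open_rects_setI => //; exists a, b, c, d.
    by rewrite E; apply: rect_int0; rewrite -E => p [_ /sub].
  - move=> X mX X0; have mXC : meas2 (~` X) by exact: measurableC.
    have := rect_int0 sub; rewrite -/B.
    have BE : B = (X `&` B) `|` (~` X `&` B) by rewrite -setIUl setUv setTI.
    rewrite {1}BE integral_setU_EFin//.
    + by rewrite X0 add0e.
    + exact: measurableI.
    + exact: measurableI.
    + by rewrite -setIUl setUv setTI; case/integrableP: iB => /measurable_EFinP.
    + by apply/disj_setPS => p [[Xp _] []].
  - move=> F mF tF F0; rewrite setI_bigcupl integral_bigcup.
    + by apply: eseries0 => k _ _; exact: F0.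
    + exact: trivIset_setIr.
    + by move=> k; exact: measurableI.
    + by rewrite -setI_bigcupl; apply: iS; exact: bigcupT_measurable.
have mP : meas2 ([set p | 0 < g p] `&` Om).
  have := mg mO `]0, +oo[%classic (measurable_itv _); rewrite setIC.
  by congr measurable; apply/seteqP; split => p [/= h1 h2]; split => //; move: h1; rewrite in_itv/= andbT.
have := all0 _ mP.
have -> : [set p | 0 < g p] `&` Om `&` B = B `&` [set p | 0 < g p].
  apply/seteqP; split => [p [[? ?] ?]//|p [Bp ?]]; split => //; split => //; exact: sub.
move=> H; have mPB : meas2 (B `&` [set p | 0 < g p]).
  have -> : B `&` [set p | 0 < g p] = [set p | 0 < g p] `&` Om `&` B.
    apply/seteqP; split => [p [Bp ?]|p [[? ?] ?]//]; split => //; split => //; exact: sub.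
  exact: measurableI.
have iP : itg (B `&` [set p | 0 < g p]) g by exact: (@integrableS _ M2 R mu B).
apply/int_eq0P => //; first by move=> p [_ /ltW].
by rewrite /int /Rintegral H.
Qed.

End Null.

Lemma aeI (P Q : plane R -> Prop) : {ae mu, forall p, P p} -> {ae mu, forall p, Q p} ->
  {ae mu, forall p, P p /\ Q p}.
Proof.
move=> [N [mN N0 sN]] [N' [mN' N'0 sN']]; exists (N `|` N'); split.
- exact: measurableU.
- by apply: null_set_setU.
- by move=> p /= H; apply: contrapT => /not_orP[h1 h2]; apply: H; split; apply: contrapT => H;
    [apply/h1/sN|apply/h2/sN'].
Qed.

(** [rect_null_pos] for g and for -g excludes both signs on every rational rectangle inside [Om],
    and countably many of these cover [Om]. *)
Lemma fundamental_lemma Om (L : R) g : open Om -> Om `<=` box L -> L2 Om g ->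
  (forall phi, test_function Om phi -> ip Om g phi = 0) -> null_on Om g.
Proof.
move=> oO OL Lg g0; have mO : meas2 Om by exact: open_measurable2.
have Lh : L2 Om (- g).
  have := L2_lin (-1) mO Lg (L2_0 mO); rewrite scaleN1r addr0; exact.
have h0 phi : test_function Om phi -> ip Om (- g) phi = 0.
  move=> tp; have Lp := test_L2 mO tp.
  have := ip_lin (-1) mO Lg (L2_0 mO) Lp; rewrite scaleN1r addr0 => ->.
  have := ip_lin (-1) mO (L2_0 mO) (L2_0 mO) Lp; rewrite scaler0 addr0 mulN1r => ?.
  rewrite g0// mulr0 add0r; lra.
pose P (r : rat * rat * (rat * rat)) p :=
  `]ratr r.1.1, ratr r.1.2[ `*` `]ratr r.2.1, ratr r.2.2[ `<=` Om ->
  (`]ratr r.1.1, ratr r.1.2[ `*` `]ratr r.2.1, ratr r.2.2[) p -> g p = 0.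
have PP n : {ae mu, forall p, if unpickle n is Some r then P r p else True}.
  case: (unpickle n) => [r|]; last exact: aeW.
  rewrite /P.
  have [s|s] := pselect (`]ratr r.1.1, ratr r.1.2[ `*` `]ratr r.2.1, ratr r.2.2[ `<=` Om); last first.
    by apply: aeW.
  have n1 := rect_null_pos oO OL Lg g0 s.
  have n2 := rect_null_pos oO OL Lh h0 s.
  apply: aeS (aeI n1 n2) => p [h1 h2] _ Bp.
  have [g0p|g0p|//] := ltgtP (g p) 0; last exact: h1.
  by apply/eqP; rewrite -oppr_eq0; apply/eqP; apply: h2; split => //=; rewrite oppr_gt0.
have : {ae mu, forall p n, if unpickle n is Some r then P r p else True} by apply/ae_foralln.
apply: aeS => p H Op; have := open_boxes oO => E; move: Op; rewrite {1}E => -[r rO rp].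
by have := H (pickle r); rewrite pickleK; apply.
Qed.

End FundamentalLemma.

(** * Linear sets of functions as modules *)

Section FunctionSpaces.
Variable R : realType.

(** Such a set becomes an [lmodType], to which the abstract theory of semi-inner products
    applies. *)
Record fspace := FSpace {
  fset_of : set (plane R -> R);
  fspace0 : fset_of 0;
  fspace_lin : forall (k : R) f g, fset_of f -> fset_of g -> fset_of (k *: f + g) }.

Definition fpred (F : fspace) : {pred (plane R -> R)} := fun f => `[< fset_of F f >].

Definition elt (F : fspace) := {f : plane R -> R | f \in fpred F}.

Lemma fpredP (F : fspace) f : reflect (fset_of F f) (f \in fpred F).
Proof. exact: asboolP. Qed.

Lemma fpred_submod (F : fspace) : GRing.subsemimod_closed (fpred F).
Proof.
have Z (k : R) f : f \in fpred F -> k *: f \in fpred F.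
  move=> /fpredP Ff; apply/fpredP; rewrite -[_ *: _]addr0; apply: fspace_lin => //.
  exact: fspace0.
split; last by move=> k f; exact: Z.
split; first by apply/fpredP; exact: fspace0.
by move=> f g /fpredP Ff /fpredP Fg; apply/fpredP; rewrite -[f]scale1r; exact: fspace_lin.
Qed.

HB.instance Definition _ (F : fspace) := SubType.copy (elt F) {f : plane R -> R | f \in fpred F}.
HB.instance Definition _ (F : fspace) := Choice.copy (elt F) {f : plane R -> R | f \in fpred F}.
HB.instance Definition _ (F : fspace) :=
  GRing.SubChoice_isSubLmodule.Build R (plane R -> R) (fpred F) (elt F) (fpred_submod F).

Definition mkelt (F : fspace) f (Ff : fset_of F f) : elt F := exist _ f (introT (fpredP F f) Ff).

Lemma eltP (F : fspace) (x : elt F) : fset_of F (val x).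
Proof. by apply/fpredP; case: x. Qed.

Lemma val_lin (F : fspace) (k : R) (x y : elt F) : val (k *: x + y) = k *: val x + val y.
Proof. by []. Qed.

Section Incl.
Variables (F G : fspace) (FG : fset_of F `<=` fset_of G).
Definition incl (x : elt F) : elt G := mkelt (FG (eltP x)).
Lemma incl_linear : linear incl.
Proof. by move=> k x y; apply: val_inj. Qed.
HB.instance Definition _ := GRing.isLinear.Build R (elt F) (elt G) _ incl incl_linear.
End Incl.

Definition eform (F : fspace) (b : (plane R -> R) -> (plane R -> R) -> R) (x y : elt F) : R :=
  b (val x) (val y).

End FunctionSpaces.

(** * Weak derivatives and the Sobolev spaces *)

Section WeakDerivatives.
Variable R : realType.
Local Notation mu := (@mu2 R).
Local Notation M2 := (measurableTypeR R * measurableTypeR R)%type.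
Local Notation meas2 D := (measurable (D : set M2)).
Local Notation measf2 D f := (measurable_fun (D : set M2) f).
Variables (Om : set (plane R)) (L : R).
Hypotheses (oOm : open Om) (OmL : Om `<=` box L).
Implicit Types (f g h w : plane R -> R) (v : plane R).

Let mO : meas2 Om. Proof. exact: open_measurable2. Qed.

Definition L2s : fspace R := FSpace (L2_0 mO) (fun k f g => L2_lin k mO (f:=f) (g:=g)).

Lemma L2sP (x : elt L2s) : L2 Om (val x). Proof. exact: (eltP x). Qed.

Definition eip : elt L2s -> elt L2s -> R := eform (ip Om).

Lemma eip_semi : semi_inner eip.
Proof.
split => [k x y z|x y|x]; rewrite /eip /eform.
- by rewrite val_lin ip_lin//; exact: L2sP.
- exact: ip_sym.
- exact: ip_ge0.
Qed.

Local Notation "x ~~ y" := (null_on Om (x - y)) (at level 70).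

Lemma null_snorm (x y : elt L2s) : val x ~~ val y <-> snorm eip (x - y) = 0.
Proof.
rewrite null_onP//; last by apply: L2B => //; exact: L2sP.
split => [H|/eqP]; first by rewrite /snorm [eip _ _]H sqrtr0.
by rewrite snorm_eq0; [move/eqP|exact: eip_semi].
Qed.

Lemma ip_nulll f g h : L2 Om f -> L2 Om g -> L2 Om h -> f ~~ g -> ip Om f h = ip Om g h.
Proof.
move=> Lf Lg Lh fg; pose x : elt L2s := mkelt (F := L2s) Lf; pose y : elt L2s := mkelt (F := L2s) Lg.
pose z : elt L2s := mkelt (F := L2s) Lh.
by apply: (@si_null_eq _ _ _ eip_semi x y z); apply/null_snorm.
Qed.

Lemma ip_nullr f g h : L2 Om f -> L2 Om g -> L2 Om h -> f ~~ g -> ip Om h f = ip Om h g.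
Proof. by move=> *; rewrite !(ip_sym Om h); exact: ip_nulll. Qed.

Lemma ipBl f g h : L2 Om f -> L2 Om g -> L2 Om h -> ip Om (f - g) h = ip Om f h - ip Om g h.
Proof. by move=> Lf Lg Lh; rewrite addrC -scaleN1r ip_lin// mulN1r addrC. Qed.

Lemma weak_deriv_unique v w g g' : is_weak_deriv Om v w g -> is_weak_deriv Om v w g' -> g ~~ g'.
Proof.
move=> [Lg Hg] [Lg' Hg']; apply: (fundamental_lemma oOm OmL); first exact: L2B.
move=> phi tp; rewrite ipBl//; last exact: test_L2 tp.
by have := Hg _ tp; rewrite Hg'// => /oppr_inj ->; rewrite subrr.
Qed.

Lemma weak_deriv_lin v w w' g g' (k : R) : L2 Om w -> L2 Om w' ->
  is_weak_deriv Om v w g -> is_weak_deriv Om v w' g' ->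
  is_weak_deriv Om v (k *: w + w') (k *: g + g').
Proof.
move=> Lw Lw' [Lg Hg] [Lg' Hg']; split; first exact: L2_lin.
move=> phi tp; have Lp := test_L2 mO tp; have Ld := test_L2 mO (test_derive v tp).
by rewrite !ip_lin// Hg// Hg'// opprD mulrN.
Qed.

Lemma weak_derivP v w : (exists g, is_weak_deriv Om v w g) ->
  is_weak_deriv Om v w (weak_deriv Om v w).
Proof. by move=> [g wg]; rewrite /weak_deriv; case: xgetP => // /(_ g). Qed.

Lemma weak_deriv_eq v w g : is_weak_deriv Om v w g -> weak_deriv Om v w ~~ g.
Proof. by move=> wg; apply: (weak_deriv_unique _ wg); apply: weak_derivP; exists g. Qed.

Lemma is_weak_deriv0 v : is_weak_deriv Om v 0 0.
Proof.
split => [|phi tp]; first exact: L2_0.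
have L0 := L2_0 mO.
have Z h : L2 Om h -> ip Om 0 h = 0.
  move=> Lh; have := ip_lin 1 mO L0 L0 Lh; rewrite scale1r addr0 mul1r => ?; lra.
rewrite !Z ?oppr0//; [exact: test_L2 tp|].
by apply: (test_L2 mO); exact: test_derive tp.
Qed.

Lemma H1_0 : H1 Om 0.
Proof. by split; [exact: L2_0|exists 0; exact: is_weak_deriv0|exists 0; exact: is_weak_deriv0]. Qed.

Lemma H1_lin (k : R) w w' : H1 Om w -> H1 Om w' -> H1 Om (k *: w + w').
Proof.
move=> [Lw [g wg] [h wh]] [Lw' [g' wg'] [h' wh']]; split.
- exact: L2_lin.
- by exists (k *: g + g'); exact: weak_deriv_lin.
- by exists (k *: h + h'); exact: weak_deriv_lin.
Qed.

Definition H1s : fspace R := FSpace H1_0 H1_lin.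

Lemma H1sP (x : elt H1s) : H1 Om (val x). Proof. exact: (eltP x). Qed.

Lemma H1_L2 w : H1 Om w -> L2 Om w. Proof. by case. Qed.

Lemma H1_wd1 w : H1 Om w -> is_weak_deriv Om (e1 R) w (weak_deriv Om (e1 R) w).
Proof. by case=> _ ? _; exact: weak_derivP. Qed.

Lemma H1_wd2 w : H1 Om w -> is_weak_deriv Om (e2 R) w (weak_deriv Om (e2 R) w).
Proof. by case=> _ _ ?; exact: weak_derivP. Qed.

(** [bform] is defined through an arbitrary choice of weak derivatives; by uniqueness almost
    everywhere, any others may replace them. *)
Lemma bformE w w' g1 g2 h1 h2 :
  is_weak_deriv Om (e1 R) w g1 -> is_weak_deriv Om (e2 R) w g2 ->
  is_weak_deriv Om (e1 R) w' h1 -> is_weak_deriv Om (e2 R) w' h2 ->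
  bform Om w w' = ip Om g1 h1 + ip Om g2 h2.
Proof.
move=> wg1 wg2 wh1 wh2; rewrite /bform.
have E v w1 w2 g h : is_weak_deriv Om v w1 g -> is_weak_deriv Om v w2 h ->
    ip Om (weak_deriv Om v w1) (weak_deriv Om v w2) = ip Om g h.
  move=> hg hh; have [Lg _] := hg; have [Lh _] := hh.
  have [L1 _] : is_weak_deriv Om v w1 (weak_deriv Om v w1) by apply: weak_derivP; exists g.
  have [L2' _] : is_weak_deriv Om v w2 (weak_deriv Om v w2) by apply: weak_derivP; exists h.
  rewrite (ip_nulll _ _ _ (weak_deriv_eq hg))// (ip_nullr _ _ _ (weak_deriv_eq hh))//.
congr (_ + _); exact: E.
Qed.

Lemma bform_lin (k : R) f g h : H1 Om f -> H1 Om g -> H1 Om h ->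
  bform Om (k *: f + g) h = k * bform Om f h + bform Om g h.
Proof.
move=> Hf Hg Hh.
have f1 := H1_wd1 Hf; have f2 := H1_wd2 Hf; have g1 := H1_wd1 Hg; have g2 := H1_wd2 Hg.
have h1 := H1_wd1 Hh; have h2 := H1_wd2 Hh.
have [Lf _ _] := Hf; have [Lg _ _] := Hg.
set f1' := weak_deriv Om (e1 R) f in f1; set f2' := weak_deriv Om (e2 R) f in f2.
set g1' := weak_deriv Om (e1 R) g in g1; set g2' := weak_deriv Om (e2 R) g in g2.
set h1' := weak_deriv Om (e1 R) h in h1; set h2' := weak_deriv Om (e2 R) h in h2.
rewrite (bformE (weak_deriv_lin k Lf Lg f1 g1) (weak_deriv_lin k Lf Lg f2 g2) h1 h2).
have [? _] := f1; have [? _] := f2; have [? _] := g1; have [? _] := g2.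
have [? _] := h1; have [? _] := h2.
transitivity ((k * ip Om f1' h1' + ip Om g1' h1') + (k * ip Om f2' h2' + ip Om g2' h2')).
  by congr (_ + _); exact: ip_lin.
by rewrite addrACA -mulrDr.
Qed.

Lemma bform_sym f g : bform Om f g = bform Om g f.
Proof. exact: (congr2 +%R (ip_sym Om _ _) (ip_sym Om _ _)). Qed.

Lemma bform_ge0 f : 0 <= bform Om f f.
Proof. by rewrite addr_ge0// ip_ge0. Qed.

Definition n1form f g := ip Om f g + bform Om f g.

Lemma n1_semi : semi_inner (eform (F := H1s) n1form).
Proof.
split => [k x y z|x y|x]; rewrite /eform /n1form.
- have hx := H1sP x; have hy := H1sP y; have hz := H1sP z.
  rewrite val_lin; transitivity ((k * ip Om (val x) (val z) + ip Om (val y) (val z)) +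
    (k * bform Om (val x) (val z) + bform Om (val y) (val z))).
    by congr (_ + _); [apply: ip_lin => //; exact: H1_L2|exact: bform_lin].
  by rewrite addrACA -mulrDr.
- exact: (congr2 +%R (ip_sym Om _ _) (bform_sym _ _)).
- by rewrite addr_ge0// ?ip_ge0 ?bform_ge0.
Qed.

Lemma norm1E (x : elt H1s) : norm1 Om (val x) = snorm (eform (F := H1s) n1form) x.
Proof. by []. Qed.

Lemma test_H1 phi : test_function Om phi -> H1 Om phi.
Proof.
move=> tp; split; first exact: test_L2 tp.
- by exists ('D_(e1 R) phi); exact: test_weak_deriv.
- by exists ('D_(e2 R) phi); exact: test_weak_deriv.
Qed.

Lemma H10_H1 w : H10 Om w -> H1 Om w. Proof. by case. Qed.

Lemma test_H10 phi : test_function Om phi -> H10 Om phi.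
Proof.
move=> tp; split; first exact: test_H1.
move=> e e0; exists phi => //.
have -> : phi \- phi = val (0 : elt H1s) by exact: subrr.
suff -> : norm1 Om (val (0 : elt H1s)) = 0 by [].
exact: (snorm0 n1_semi).
Qed.

Lemma H10_lin (k : R) w w' : H10 Om w -> H10 Om w' -> H10 Om (k *: w + w').
Proof.
move=> [Hw Dw] [Hw' Dw']; split; first exact: H1_lin.
move=> e e0; have k1 : 0 < `|k| + 1 by rewrite ltr_wpDl.
have [phi tp wp] := Dw (e / 2 / (`|k| + 1)) (divr_gt0 (divr_gt0 e0 (ltr0Sn _ _)) k1).
have [psi ts ws] := Dw' (e / 2) (divr_gt0 e0 (ltr0Sn _ _)).
exists (k *: phi + psi); first exact: test_lin.
pose x : elt H1s := mkelt (F := H1s) Hw; pose y : elt H1s := mkelt (F := H1s) Hw'.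
pose x' : elt H1s := mkelt (F := H1s) (test_H1 tp).
pose y' : elt H1s := mkelt (F := H1s) (test_H1 ts).
have := norm1E ((k *: x + y) - (k *: x' + y')); rewrite /= => E.
rewrite [X in X < _](_ : _ = snorm (eform (F := H1s) n1form) ((k *: x + y) - (k *: x' + y')))//.
have -> : (k *: x + y) - (k *: x' + y') = k *: (x - x') + (y - y').
  by rewrite scalerBr opprD addrACA.
apply: le_lt_trans (snormD n1_semi _ _) _; rewrite (snormZ n1_semi).
rewrite [e]splitr; apply: ler_ltD; last exact: ws.
rewrite -[leRHS](divfK (lt0r_neq0 k1)) mulrC; apply: ler_pM => //.
- exact: snorm_ge0.
- exact: ltW wp.
- by rewrite lerDl.
Qed.

Lemma H10_0 : H10 Om 0. Proof. by apply: test_H10; exact: test_0. Qed.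

Definition H10s : fspace R := FSpace H10_0 H10_lin.

Lemma H10sP (x : elt H10s) : H10 Om (val x). Proof. exact: (eltP x). Qed.

Definition eb : elt H10s -> elt H10s -> R := eform (bform Om).

Lemma eb_semi : semi_inner eb.
Proof.
split => [k x y z|x y|x]; rewrite /eb /eform.
- by rewrite val_lin bform_lin//; apply: H10_H1; exact: H10sP.
- exact: bform_sym.
- exact: bform_ge0.
Qed.

Lemma H10_L2 : fset_of H10s `<=` fset_of L2s.
Proof. by move=> w /H10_H1/H1_L2. Qed.

End WeakDerivatives.

(** * Sobolev inequalities and completeness *)

Section Poincare.
Variable R : realType.
Local Notation mu := (@mu2 R).
Local Notation M2 := (measurableTypeR R * measurableTypeR R)%type.
Local Notation meas2 D := (measurable (D : set M2)).
Local Notation measf2 D f := (measurable_fun (D : set M2) f).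
Variables (Om : set (plane R)) (L : R).
Hypotheses (oOm : open Om) (OmL : Om `<=` box L) (L0 : 0 < L).
Implicit Types (f g h w phi : plane R -> R) (v t : plane R).

Let mO : meas2 Om. Proof. exact: open_measurable2. Qed.

(** Integration by parts of the derivative of x phi against phi gives |phi|^2 = -2 (x phi, D1 phi),
    and |x| <= L on [Om]. *)
Lemma test_poincare phi : test_function Om phi ->
  norm0 Om phi <= 2 * L * norm0 Om ('D_(e1 R) phi).
Proof.
move=> tp; set D := 'D_(e1 R) phi.
have [M [M0 pM p0]] := test_bounded tp.
have td := test_derive (e1 R) tp; have [B [B0 dB d0]] := test_bounded td.
have sp : smooth phi by case: tp.
have Lp := test_L2 mO tp; have Ld := test_L2 mO td.
have mp := test_measurable tp; have md := test_measurable td.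
have df q : differentiable (fun p : plane R => p.1 * phi p) q.
  by apply: differentiableM; [exact: differentiable_fst|exact: smooth_differentiable].
have m1 : measf2 setT (fun p : plane R => p.1) by exact: measurable_fst.
pose w p := p.1 * phi p; pose G p := phi p + p.1 * D p.
have dw q : 'D_(e1 R) w q = G q.
  have := derive_line w q (e1 R) 0; rewrite scale0r addr0 => <-.
  have dp : differentiable phi (q + 0 *: e1 R) by exact: smooth_differentiable.
  have [_ ->] := is_derive1M (is_derive1_affine (e1 R).1 q.1 0 (@smooth1_id R)) (is_derive_line dp).
  have -> : 'D_1 (fun x : R => x) (q.1 + 0 * (e1 R).1) = 1 by exact: derive_id.
  rewrite scale0r addr0 mul0r addr0 mul1r mulr1; exact: addrC.
have bw p : `|w p| <= L * M.
  have [Op|Op] := pselect (Om p); last first.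
    by rewrite /w (test_out tp Op) mulr0 normr0 mulr_ge0// ltW.
  by have /boxE[? _] := OmL Op; rewrite normrM; apply: ler_pM.
have bG p : `|G p| <= M + L * B.
  have [Op|Op] := pselect (Om p); last first.
    rewrite /G (test_out tp Op) /D (test_out td Op) mulr0 addr0 normr0.
    by apply: addr_ge0; [exact: ltW|apply: mulr_ge0; exact: ltW].
  have /boxE[? _] := OmL Op; apply: le_trans (ler_normD _ _) _.
  by rewrite normrM; apply: lerD => //; apply: ler_pM => //; exact: dB.
have mw : measf2 setT w by exact: measurable_funM.
have mG : measf2 setT G by apply: measurable_funD => //; exact: measurable_funM.
have Lw : L2 Om w.
  by apply: (bounded_L2 mO OmL (M := L * M)) => //; exact: measurable_funTS.
have LG : L2 Om G.
  by apply: (bounded_L2 mO OmL (M := M + L * B)) => //; exact: measurable_funTS.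
have [_ /(_ _ tp)] : is_weak_deriv Om (e1 R) w G.
  apply: (lipschitz_weak_deriv mO Lw LG mw bw _ mG (K := M + L * B)).
    by apply: diff_lip => // p; rewrite dw; exact: bG.
  by apply: aeW => p; rewrite -dw; apply: derivable_quot; exact: diff_derivable.
rewrite -/D => E.
have LxD : L2 Om (fun p => p.1 * D p).
  apply: (bounded_L2 mO OmL (M := L * B)) => [|p Op].
    by apply: measurable_funTS; exact: measurable_funM.
  by have /boxE[? _] := OmL Op; rewrite normrM; apply: ler_pM => //; exact: dB.
have E2 : ip Om G phi = ip Om phi phi + ip Om w D.
  rewrite !ip_int -intD//; [|exact: L2M|exact: L2M].
  by apply: int_eq => p _; rewrite /G /w; ring.
have E3 : ip Om phi phi = - 2 * ip Om w D by move: E; rewrite E2; lra.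
pose x : elt (L2s oOm) := mkelt (F := L2s oOm) Lw.
pose y : elt (L2s oOm) := mkelt (F := L2s oOm) Ld.
pose z : elt (L2s oOm) := mkelt (F := L2s oOm) Lp.
have hs := eip_semi oOm.
have CS := CSn hs x y.
have nw : snorm (eip (oOm := oOm)) x <= L * norm0 Om phi.
  rewrite -(ler_pXn2r (n := 2)) ?nnegrE ?snorm_ge0//; last first.
    by apply: mulr_ge0; [exact: ltW|exact: sqrtr_ge0].
  rewrite snormE// exprMn sqr_sqrtr ?ip_ge0// -[X in X <= _]/(ip Om w w).
  rewrite !ip_int -intZ//; last exact: L2M.
  apply: int_le => //; [exact: L2M|by apply: itgZ => //; exact: L2M|].
  move=> p Op; have /boxE[xL _] := OmL Op.
  rewrite /w mulrACA -!expr2 -[p.1 ^+ 2]real_normK ?num_real//.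
  by apply: ler_wpM2r; rewrite ?sqr_ge0// ler_pXn2r ?nnegrE// ltW.
have : norm0 Om phi ^+ 2 <= 2 * L * norm0 Om D * norm0 Om phi.
  rewrite sqr_sqrtr ?ip_ge0// E3.
  apply: le_trans (ler_norm _) _; rewrite normrM normrN (ger0_norm (ler0n _ 2)).
  rewrite -!mulrA ler_pM2l//; apply: le_trans CS _.
  by rewrite [norm0 Om D * _]mulrC mulrA; apply: ler_wpM2r => //; exact: sqrtr_ge0.
have := sqrtr_ge0 (ip Om phi phi); rewrite -/(norm0 Om phi) le_eqVlt => /predU1P[<- _|n0].
  by rewrite !mulr_ge0 ?sqrtr_ge0// ltW.
by rewrite expr2 ler_pM2r.
Qed.

(* [N m u = ||phi(. + m u) - phi||] is at most [m N u] by translation invariance, so [N v] is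
   at most the norm of the n-th difference quotient for every [n]. *)
Lemma test_translation phi v : test_function Om phi ->
  int setT (fun p => (phi (p + v) - phi p) ^+ 2) <= int setT (fun p => 'D_v phi p ^+ 2).
Proof.
move=> tp; have td := test_derive v tp.
have mp := test_measurable tp; have md := test_measurable td.
have LT f : test_function Om f -> L2 setT f by move=> tf; exact: test_L2 tf.
have mT : meas2 setT by exact: measurableT.
have Ls t : L2 setT (fun p => phi (p + t)).
  split; first exact: measurable_fun_shift.
  have [H _] := Rintegral_shift t (L2_itg (LT _ tp)).
  by apply: itg_eq H => // p _; rewrite /= affE.
have Ld t u : L2 setT (fun p => phi (p + t) - phi (p + u)) by exact: (L2B measurableT).
have inv t u : int setT (fun p => (phi (p + t + u) - phi (p + t)) ^+ 2) =
    int setT (fun p => (phi (p + u) - phi p) ^+ 2).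
  have L1 : L2 setT (fun p => phi (p + u) - phi p).
    by apply: (@L2B _ setT) => //; exact: LT.
  have [_] := Rintegral_shift t (L2_itg L1).
  move=> H; apply: etrans H; apply: int_eq => p _ /=; by rewrite affE.
pose N u := int setT (fun p => (phi (p + u) - phi p) ^+ 2).
have Nn m u : N (m%:R *: u) <= m%:R ^+ 2 * N u.
  (* The square of a telescoping sum of m terms is at most m times the sum of the squares; the
     induction step is (y - k x)^2 / k >= 0. *)
  have S1 p : (phi (p + m%:R *: u) - phi p) ^+ 2 <=
     m%:R * \sum_(i < m) (phi (p + i%:R *: u + u) - phi (p + i%:R *: u)) ^+ 2.
    elim: m => [|m IH]; first by rewrite scale0r addr0 subrr big_ord0 mulr0 expr0n.
    rewrite big_ord_recr /=; move: IH; set S := \sum_(i < m) _.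
    set a := phi (p + m%:R *: u); set b := phi (p + _ + u).
    have -> : phi (p + m.+1%:R *: u) = b by rewrite /b -addrA -natr1 scalerDl scale1r.
    have -> : b - phi p = (b - a) + (a - phi p) by ring.
    move: (b - a) (a - phi p) => x y; rewrite -natr1.
    have S0 : 0 <= S by apply: sumr_ge0 => i _; exact: sqr_ge0.
    clearbody S; clear a b; case: m => [|m]; first by rewrite mul0r expr2; nra.
    have : 0 < m.+1%:R :> R by []; move: (m.+1%:R) => k k0 yS.
    have : 0 <= (y - k * x) ^+ 2 / k by rewrite divr_ge0 ?sqr_ge0 ?ltW.
    have -> : (y - k * x) ^+ 2 / k = y ^+ 2 / k - 2 * x * y + k * x ^+ 2 by field; rewrite gt_eqF.
    have : y ^+ 2 / k <= S by rewrite ler_pdivrMr// mulrC.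
    nra.
  have Li (i : nat) : itg setT (fun p => (phi (p + i%:R *: u + u) - phi (p + i%:R *: u)) ^+ 2).
    by under eq_fun do rewrite -addrA; exact: (L2_itg (Ld _ _)).
  have Is k : itg setT (fun p => \sum_(i < k) (phi (p + i%:R *: u + u) - phi (p + i%:R *: u)) ^+ 2) /\
     int setT (fun p => \sum_(i < k) (phi (p + i%:R *: u + u) - phi (p + i%:R *: u)) ^+ 2) = k%:R * N u.
    elim: k => [|k [IH1 IH2]].
      under eq_fun do rewrite big_ord0.
      split; first exact: integrable0.
      by rewrite mul0r /int /Rintegral integral0.
    under eq_fun do rewrite big_ord_recr/=.
    by split; [exact: itgD|rewrite intD// IH2 inv -natr1 mulrDl mul1r].
  have [I1 I2] := Is m.
  rewrite expr2 -mulrA -I2 -intZ//; apply: int_le => //; last exact: itgZ.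
  by apply: L2_itg; apply: (@L2B _ setT) => //; exact: LT.
have Nq n : N v <= int setT (fun p => quot v phi n p ^+ 2).
  have := Nn n.+1 (n.+1%:R^-1 *: v).
  rewrite scalerA mulfV// scale1r /N -intZ//.
    move/le_trans; apply; rewrite le_eqVlt; apply/orP; left; apply/eqP.
    by apply: int_eq => p _; rewrite /quot exprMn.
  by apply: L2_itg; apply: (@L2B _ setT) => //; exact: LT.
have [B [B0 dB d0]] := test_bounded td; have [M [M0 pM p0]] := test_bounded tp.
have sp : smooth phi by case: tp.
have qB n p : `|quot v phi n p| <= B.
  rewrite /quot normrM ger0_norm// -ler_pdivlMl ?ltr0n//.
  by rewrite (le_trans (smooth_lip _ dB _ _))// mulrC ger0_norm ?invr_ge0.
pose V := M + `|v.1| + `|v.2|.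
have q0 n p : ~ box V p -> quot v phi n p = 0.
  move=> bp; rewrite /quot !p0 ?subr0 ?mulr0//.
    move=> /boxE[b1 b2]; apply: bp; apply/boxE; rewrite /V.
    have := normr_ge0 v.1; have := normr_ge0 v.2; lra.
  have n1 : n.+1%:R^-1 <= 1 :> R by rewrite invf_le1 ?ltr0n// ler1n.
  have n0 : 0 <= n.+1%:R^-1 :> R by rewrite invr_ge0.
  move=> /boxE[]; rewrite /= => b1 b2; apply: bp; apply/boxE; rewrite /V.
  have A (a c : R) : `|a| <= `|a + n.+1%:R^-1 * c| + `|c|.
    rewrite -{1}(addrK (n.+1%:R^-1 * c) a) (le_trans (ler_normB _ _))// lerD2l.
    by rewrite normrM ger0_norm// ler_piMl.
  have := A p.1 v.1; have := A p.2 v.2; have := normr_ge0 v.1; have := normr_ge0 v.2.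
  split; lra.
have mq n : measf2 setT (quot v phi n).
  apply: measurable_funM => //; apply: measurable_funB => //.
  exact: measurable_fun_shift.
have IB : itg setT (fun p => B ^+ 2 * \1_(box V) p).
  apply: (box_integrable (L := V) (M := B ^+ 2)).
  + by apply: measurable_funM => //; apply: measurable_indic; exact: measurable_boxc.
  + move=> p; rewrite normrM ger0_norm ?sqr_ge0// ler_piMr ?sqr_ge0// indicE.
    by case: (_ \in _); rewrite ?normr1 ?normr0.
  + by move=> p bp; rewrite indicE memNset// mulr0.
have [|||n p _|_ cv] := dct (u := fun n p => quot v phi n p ^+ 2)
   (G := fun p => 'D_v phi p ^+ 2) mT _ _ _ IB.
- by move=> n; exact: measurable_funX.
- exact: measurable_funX.
- apply: aeW => p _; apply: (@cvgM _ _ _ _ (quot v phi ^~ p) (quot v phi ^~ p)); exact: test_quot tp.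
- rewrite indicE; case: (boolP (p \in _)) => pb.
    by rewrite mulr1 normrX ler_pXn2r ?nnegrE ?(ltW B0).
  by rewrite notin_setE in pb; rewrite q0// expr0n normr0 mulr0.
by apply: (cvgr_to_ge cv); apply: nearW => n; exact: Nq.
Qed.

End Poincare.

Lemma plane_basis (R : realType) (t : plane R) : t = t.1 *: e1 R + t.2 *: e2 R.
Proof.
by case: t => x y; congr pair;
  [rewrite -[RHS]/(x * 1 + y * 0)|rewrite -[RHS]/(x * 0 + y * 1)]; ring.
Qed.

Lemma derive_basis (R : realType) (f : plane R -> R) (t p : plane R) : differentiable f p ->
  'D_t f p = t.1 * 'D_(e1 R) f p + t.2 * 'D_(e2 R) f p.
Proof. by move=> df; rewrite !deriveE// {1}(plane_basis t) linearP linearZ. Qed.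

Lemma sqr_lincomb_le (R : realDomainType) (a b x y c : R) : a ^+ 2 <= c -> b ^+ 2 <= c ->
  (a * x + b * y) ^+ 2 <= 2 * c * (x ^+ 2 + y ^+ 2).
Proof.
move=> ac bc; have ax : a ^+ 2 * x ^+ 2 <= c * x ^+ 2 by rewrite ler_wpM2r ?sqr_ge0.
have bx : b ^+ 2 * y ^+ 2 <= c * y ^+ 2 by rewrite ler_wpM2r ?sqr_ge0.
have := sqr_ge0 (a * x - b * y); nra.
Qed.

(** * Tonelli's theorem on the product of the plane with itself *)

Section PlaneTonelli.
Variable R : realType.
Local Notation mu := (@mu2 R).
Local Notation M2 := (measurableTypeR R * measurableTypeR R)%type.

Lemma mu2_sigma_finite : sigma_finite (setT : set M2) mu.
Proof.
exists (fun n => box n%:R).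
  apply/seteqP; split => // p _; exists (Num.trunc (`|p.1| + `|p.2|)).+1 => //.
  have := truncnS_gt (`|p.1| + `|p.2|) => /ltW h; apply/boxE.
  by split; apply: le_trans h; rewrite ?lerDl ?lerDr.
by move=> n; split; [exact: measurable_boxc|exact: mu_box_fin].
Qed.
(** [mu2] equipped with its sigma-finiteness, the structure in which Tonelli's theorem is
    phrased. *)
Let sfm : {sigma_finite_measure set M2 -> \bar R} :=
  HB.pack_for {sigma_finite_measure set M2 -> \bar R} (@lebesgue_measure R \x @lebesgue_measure R)%E
    (Measure_isSigmaFinite.Build _ _ _ (@lebesgue_measure R \x @lebesgue_measure R)%E mu2_sigma_finite).
Lemma plane_tonelli (F : M2 * M2 -> \bar R) : measurable_fun setT F -> (forall z, 0 <= F z)%E ->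
  (\int[mu]_p \int[mu]_t F (p, t) = \int[mu]_t \int[mu]_p F (p, t))%E.
Proof. 
move=> mF F0. exact: (@fubini_tonelli _ _ M2 M2 R sfm sfm F).
Qed.
Lemma plane_tonelli_F (F : M2 * M2 -> \bar R) : measurable_fun setT F -> (forall z, 0 <= F z)%E ->
  measurable_fun setT (fun p : M2 => \int[mu]_t F (p, t))%E.
Proof.
move=> mF F0.
exact: (@measurable_fun_fubini_tonelli_F _ _ M2 M2 R sfm F).
Qed.
Lemma plane_tonelli_G (F : M2 * M2 -> \bar R) : measurable_fun setT F -> (forall z, 0 <= F z)%E ->
  measurable_fun setT (fun t : M2 => \int[mu]_p F (p, t))%E.
Proof.
move=> mF F0.
exact: (@measurable_fun_fubini_tonelli_G _ _ M2 M2 R sfm F).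
Qed.

End PlaneTonelli.

(** There are n + 2 indices because the endpoint x = L falls into the cell of index n + 1. *)
Lemma grid_index (R : realType) (L d : R) n (x : R) : d = 2 * L / n.+1%:R -> 0 < d -> `|x| <= L ->
  exists i : 'I_n.+2, - L + i%:R * d <= x <= - L + i%:R * d + d.
Proof.
move=> dE d0; rewrite ler_norml => /andP[x1 x2].
have xL : 0 <= x + L by lra.
have x0 : 0 <= (x + L) / d by apply: divr_ge0 => //; exact: ltW.
have /andP[t1 t2] := trunc_itv x0.
have nd : n.+1%:R * d = 2 * L by rewrite dE mulrCA mulfV// mulr1.
have tn : (Num.trunc ((x + L) / d) < n.+2)%N.
  rewrite -(ltr_nat R); apply: le_lt_trans t1 _.
  by rewrite ltr_pdivrMr// -natr1 mulrDl mul1r nd; lra.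
rewrite ler_pdivlMr// in t1; rewrite ltr_pdivrMr// -[_.+1%:R]natr1 mulrDl mul1r in t2.
exists (Ordinal tn) => /=; move: t1 t2; set T := _%:R * d; lra.
Qed.

(** * Rellich's inequality for test functions *)

Section Rellich.
Variable R : realType.
Local Notation mu := (@mu2 R).
Local Notation M2 := (measurableTypeR R * measurableTypeR R)%type.
Local Notation meas2 D := (measurable (D : set M2)).
Local Notation measf2 D f := (measurable_fun (D : set M2) f).
Variables (Om : set (plane R)) (L : R).
Hypotheses (oOm : open Om) (OmL : Om `<=` box L) (L0 : 0 < L).
Implicit Types (f g h w phi : plane R -> R) (v t : plane R).

Let mO : meas2 Om. Proof. exact: open_measurable2. Qed.

Lemma mu_rect (a b c d : R) : a <= b -> c <= d ->
  mu (`[a, b] `*` `[c, d]) = ((b - a) * (d - c))%:E.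
Proof.
move=> ab cd; rewrite /mu2 product_measure1E//= !lebesgue_measure_itv/= !lte_fin.
move: ab; rewrite le_eqVlt => /predU1P[->|ab]; first by rewrite ltxx mul0e subrr mul0r.
move: cd; rewrite le_eqVlt => /predU1P[->|cd]; first by rewrite ltxx mule0 subrr mulr0.
by rewrite ab cd -!EFinB -EFinM.
Qed.

Lemma int_cst D (k a : R) : meas2 D -> mu D = a%:E -> itg D (fun=> k) /\ int D (fun=> k) = k * a.
Proof.
move=> mD Da; have iD : itg D (fun=> k).
  have fD : (mu D < +oo)%E by rewrite Da ltry.
  apply: measurable_bounded_integrable => //.
  exists `|k|; split; first exact: num_real.
  by move=> x kx p _ /=; exact: ltW.
by split => //; apply/EFin_inj; rewrite int_EFin// EFinM -Da; exact: integral_cst.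
Qed.

(** The variance of [f] over [D] is nonnegative. *)
Lemma jensen_sq D f (a : R) : meas2 D -> mu D = a%:E -> 0 < a -> itg D f ->
  itg D (fun p => f p ^+ 2) -> int D f ^+ 2 <= a * int D (fun p => f p ^+ 2).
Proof.
move=> mD Da a0 if1 if2; pose m := int D f / a.
have [i1 e1] := int_cst (m ^+ 2) mD Da.
have H : 0 <= int D (fun p => (f p - m) ^+ 2) by apply: int_ge0 => p _; exact: sqr_ge0.
have E : int D (fun p => (f p - m) ^+ 2) =
    int D (fun p => f p ^+ 2) + (- 2 * m * int D f + m ^+ 2 * a).
  rewrite -e1 -intZ// -intD//; last exact: itgZ.
  rewrite -intD//; last by apply: itgD => //; exact: itgZ.
  by apply: int_eq => p _; ring.
move: H; rewrite E.
have -> : - 2 * m * int D f + m ^+ 2 * a = - (int D f ^+ 2 / a).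
  by rewrite /m; field; rewrite gt_eqF.
by rewrite subr_ge0 ler_pdivrMr// mulrC.
Qed.

Variable phi : plane R -> R.
Hypothesis tp : test_function Om phi.

Let cell d (a b : R) : set (plane R) := `[a, a + d] `*` `[b, b + d].

(** The box has half-side [d], so that its translate to p contains every cell of side [d] through
    p. *)
Definition osc (d : R) (p : plane R) : R :=
  int (box d) (fun t => (phi (p + t) - phi p) ^+ 2).

Let mcell d a b : meas2 (cell d a b). Proof. exact: measurableX. Qed.

Let mucell d a b : 0 <= d -> mu (cell d a b) = (d ^+ 2)%:E.
Proof.
move=> d0; rewrite mu_rect ?lerDl//; congr EFin.
ring.
Qed.

(** phi(p) is the mean of phi over the cell plus the mean of phi(p) - phi; Jensen's inequality
    bounds the latter by the oscillation. *)
Lemma cell_bound d a b p : 0 < d -> cell d a b p ->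
  phi p ^+ 2 <= 2 * (int (cell d a b) phi / d ^+ 2) ^+ 2 + 2 / d ^+ 2 * osc d p.
Proof.
move=> d0 cp; set Q := cell d a b; have mQ := mcell d a b; rewrite -/Q in mQ.
have d2 : 0 < d ^+ 2 by rewrite exprn_gt0.
have muQ := mucell a b (ltW d0); rewrite -/Q in muQ.
have [M [M0 pM p0]] := test_bounded tp; have mp := test_measurable tp.
have QV : Q `<=` box (`|a| + `|b| + d).
  move=> q [/=]; rewrite !in_itv/= => q1 q2; apply/boxE; rewrite !ler_norml.
  have := ler_norm a; have := ler_norm b; have := ler_norm (- a); have := ler_norm (- b).
  rewrite !normrN; have := normr_ge0 a; have := normr_ge0 b; split; lra.
have BQ f B : measf2 setT f -> (forall p, `|f p| <= B) -> itg Q f.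
  move=> mf fB; apply: (bounded_integrable (M := B) mQ QV) => //.
  exact: measurable_funTS.
have ip1 : itg Q phi by exact: BQ pM.
pose f q := phi p - phi q.
have mf : measf2 setT f by exact: measurable_funB.
have fM q : `|f q| <= M + M by rewrite (le_trans (ler_normB _ _))// lerD.
have if1 : itg Q f by exact: BQ fM.
have f2M q : `|f q ^+ 2| <= (M + M) ^+ 2.
  by rewrite normrX ler_pXn2r ?nnegrE// addr_ge0// ltW.
have mf2 : measf2 setT (fun q => f q ^+ 2) by exact: measurable_funX.
have if2 : itg Q (fun q => f q ^+ 2) by exact: BQ f2M.
have J := jensen_sq mQ muQ d2 if1 if2.
have [i1 e1] := int_cst (phi p) mQ muQ.
have Ef : int Q f = phi p * d ^+ 2 - int Q phi by rewrite -e1 -intB.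
have osc_ge : int Q (fun q => f q ^+ 2) <= osc d p.
  pose F q := f q ^+ 2 * \1_Q q.
  have IF : itg setT F.
    apply: (box_integrable (L := `|a| + `|b| + d) (M := (M + M) ^+ 2)).
    - by apply: measurable_funM => //; apply: measurable_indic.
    - move=> q; rewrite normrM -[leRHS]mulr1; apply: ler_pM => //.
      by rewrite indicE; case: (_ \in _); rewrite ?normr1 ?normr0.
    - by move=> q bq; rewrite /F indicE memNset ?mulr0// => /QV.
  have [I2 E2] := Rintegral_shift p IF.
  have -> : int Q (fun q => f q ^+ 2) = int setT F.
    rewrite -[RHS](@Rintegral_restrict _ Q).
      by apply: int_eq => q Qq; rewrite /F indicE mem_set// mulr1.
    by move=> q Qq; rewrite /F indicE memNset// mulr0.
  rewrite -[leLHS]E2.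
  pose G t := (phi (p + t) - phi p) ^+ 2 * \1_(box d) t.
  have mG1 : measf2 setT (fun t => (phi (p + t) - phi p) ^+ 2).
    apply: measurable_funX; apply: measurable_funB => //.
    by under eq_fun do rewrite addrC; exact: measurable_fun_shift.
  have G1M t : `|(phi (p + t) - phi p) ^+ 2| <= (M + M) ^+ 2.
    rewrite normrX ler_pXn2r ?nnegrE//; first by rewrite (le_trans (ler_normB _ _))// lerD.
    by rewrite addr_ge0// ltW.
  have IG : itg setT G.
    apply: (box_integrable (L := d) (M := (M + M) ^+ 2)).
    - by apply: measurable_funM => //; apply: measurable_indic; exact: measurable_boxc.
    - move=> q; rewrite normrM -[leRHS]mulr1; apply: ler_pM => //.
      by rewrite indicE; case: (_ \in _); rewrite ?normr1 ?normr0.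
    - by move=> q bq; rewrite /G indicE memNset ?mulr0.
  have -> : osc d p = int setT G.
    rewrite -[RHS](@Rintegral_restrict _ (box d)).
      by apply: int_eq => q Qq; rewrite /G indicE mem_set// mulr1.
    by move=> q Qq; rewrite /G indicE memNset// mulr0.
  apply: (int_le (@measurableT _ M2) I2 IG).
  move=> t _; rewrite /= /F /G affE /f [t + p]addrC.
  have [Qt|Qt] := pselect (Q (p + t)); last first.
    by rewrite [\1_Q _]indicE memNset// mulr0 mulr_ge0 ?sqr_ge0// indicE.
  have bt : box d t.
    move: Qt cp => [/=]; rewrite !in_itv/= => t1 t2 [/=]; rewrite !in_itv/= => p1 p2.
    by apply/boxE; rewrite !ler_norml; split; lra.
  by rewrite !indicE !mem_set// !mulr1 -[leRHS]sqrrN opprB.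
have E : phi p = int Q phi / d ^+ 2 + int Q f / d ^+ 2.
  by rewrite Ef; field; rewrite gt_eqF.
have H1 : (int Q f / d ^+ 2) ^+ 2 <= osc d p / d ^+ 2.
  have -> : (int Q f / d ^+ 2) ^+ 2 = int Q f ^+ 2 / d ^+ 2 / d ^+ 2.
    by field; rewrite gt_eqF.
  rewrite ler_pM2r ?invr_gt0// ler_pdivrMr//.
  by apply: le_trans J _; rewrite mulrC; apply: ler_wpM2r => //; exact: ltW.
rewrite {1}E; have -> : 2 / d ^+ 2 * osc d p = 2 * (osc d p / d ^+ 2) by ring.
move: H1; move: (int Q f / d ^+ 2) (int Q phi / d ^+ 2) (osc d p / d ^+ 2) => x y z.
have := sqr_ge0 (x - y); nra.
Qed.

(* Tonelli's theorem turns the mean of the oscillation into a mean of squared translation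
   differences. *)
Lemma osc_integral d : 0 < d ->
  itg setT (osc d) /\ int setT (osc d) <= 8 * d ^+ 4 * bform Om phi phi.
Proof.
move=> d0; have dp := ltW d0; have mT : meas2 setT by exact: measurableT.
have [M [M0 pM p0]] := test_bounded tp; have mp := test_measurable tp.
have LT f : test_function Om f -> L2 setT f by move=> tf; exact: test_L2 tf.
pose F (z : M2 * M2) : \bar R :=
  ((phi (z.1 + z.2) - phi z.1) ^+ 2 * \1_(box d) z.2)%:E.
have F0 z : (0 <= F z)%E by rewrite lee_fin mulr_ge0 ?sqr_ge0// indicE.
have mF : measurable_fun setT F.
  apply/measurable_EFinP; apply: measurable_funM; last first.
    apply: (@measurableT_comp _ _ _ _ _ _ (\1_(box d) : M2 -> R) _ (snd : M2 * M2 -> M2)) => //.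
    by apply: measurable_indic; exact: measurable_boxc.
  apply: measurable_funX; apply: measurable_funB; last first.
    exact: (@measurableT_comp _ _ _ _ _ _ (phi : M2 -> R) _ (fst : M2 * M2 -> M2)).
  apply: (@measurableT_comp _ _ _ _ _ _ (phi : M2 -> R) _
    (fun z : M2 * M2 => (z.1 + z.2 : plane R) : M2)) => //.
  have m11 : measurable_fun setT (fun z : M2 * M2 => z.1.1 : R).
    exact: (@measurableT_comp _ _ _ _ _ _ (fst : M2 -> measurableTypeR R) _ (fst : M2 * M2 -> M2)).
  have m12 : measurable_fun setT (fun z : M2 * M2 => z.1.2 : R).
    exact: (@measurableT_comp _ _ _ _ _ _ (snd : M2 -> measurableTypeR R) _ (fst : M2 * M2 -> M2)).
  have m21 : measurable_fun setT (fun z : M2 * M2 => z.2.1 : R).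
    exact: (@measurableT_comp _ _ _ _ _ _ (fst : M2 -> measurableTypeR R) _ (snd : M2 * M2 -> M2)).
  have m22 : measurable_fun setT (fun z : M2 * M2 => z.2.2 : R).
    exact: (@measurableT_comp _ _ _ _ _ _ (snd : M2 -> measurableTypeR R) _ (snd : M2 * M2 -> M2)).
  by apply: measurable_fun_pair; exact: measurable_funD.
have IG p : itg setT (fun t => (phi (p + t) - phi p) ^+ 2 * \1_(box d) t).
  apply: (box_integrable (L := d) (M := (M + M) ^+ 2)).
  - apply: measurable_funM; last by apply: measurable_indic; exact: measurable_boxc.
    apply: measurable_funX; apply: measurable_funB => //.
    by under eq_fun do rewrite addrC; exact: measurable_fun_shift.
  - move=> q; rewrite normrM -[leRHS]mulr1; apply: ler_pM => //.
      rewrite normrX ler_pXn2r ?nnegrE//; first by rewrite (le_trans (ler_normB _ _))// lerD.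
      by rewrite addr_ge0// ltW.
    by rewrite indicE; case: (_ \in _); rewrite ?normr1 ?normr0.
  - by move=> q bq; rewrite indicE memNset ?mulr0.
have oscE p : (\int[mu]_t F (p, t) = (osc d p)%:E)%E.
  have -> : osc d p = int setT (fun t => (phi (p + t) - phi p) ^+ 2 * \1_(box d) t).
    rewrite -[RHS](@Rintegral_restrict _ (box d)).
      by apply: int_eq => q Qq; rewrite indicE mem_set// mulr1.
    by move=> q Qq; rewrite indicE memNset// mulr0.
  by rewrite int_EFin.
have t1 := test_derive (e1 R) tp; have t2 := test_derive (e2 R) tp.
have Lt1 := LT _ t1; have Lt2 := LT _ t2.
set b := bform Om phi phi.
have bE : b = int setT (fun p => 'D_(e1 R) phi p ^+ 2) + int setT (fun p => 'D_(e2 R) phi p ^+ 2).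
  have w1 := test_weak_deriv (e1 R) mO tp; have w2 := test_weak_deriv (e2 R) mO tp.
  rewrite /b (bformE oOm OmL w1 w2 w1 w2).
  have E f : test_function Om f -> ip Om f f = int setT (fun p => f p ^+ 2).
    move=> tf; rewrite -[RHS](@Rintegral_restrict _ Om).
      by apply: int_eq => p _; rewrite expr2.
    by move=> p /(test_out tf) ->; rewrite expr0n.
  by congr (_ + _); exact: E.
(* Expanding D_t phi in the two directions costs 2 d^2; integrated over the box, of area 4 d^2, this
   gives the constant 8 d^4. *)
have Nt t : box d t -> int setT (fun p => (phi (p + t) - phi p) ^+ 2) <= 2 * d ^+ 2 * b.
  move=> /boxE[td1 td2]; apply: le_trans (test_translation t tp) _.
  rewrite bE -intD//; [|exact: L2_itg..].
  rewrite -intZ//; last by apply: itgD => //; exact: L2_itg.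
  apply: int_le => //.
  - by apply: L2_itg; apply: LT; exact: test_derive.
  - by apply: itgZ => //; apply: itgD => //; exact: L2_itg.
  move=> p _; have sp : smooth phi by case: tp.
  have -> : 'D_t phi p = t.1 * 'D_(e1 R) phi p + t.2 * 'D_(e2 R) phi p.
    exact/derive_basis/smooth_differentiable.
  have h1 : t.1 ^+ 2 <= d ^+ 2 by rewrite -real_normK ?num_real// ler_pXn2r ?nnegrE.
  have h2 : t.2 ^+ 2 <= d ^+ 2 by rewrite -real_normK ?num_real// ler_pXn2r ?nnegrE.
  exact: sqr_lincomb_le.
have b0 : 0 <= b by exact: bform_ge0.
have mb : mu (box d) = (4 * d ^+ 2)%:E.
  have dd : - d <= d by rewrite (le_trans _ dp)// oppr_le0.
  by rewrite mu_rect//; congr EFin; ring.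
have H : (\int[mu]_p (osc d p)%:E <= (8 * d ^+ 4 * b)%:E)%E.
  under eq_integral do rewrite -oscE.
  rewrite [leLHS](plane_tonelli mF F0).
  have [i1 e1] := int_cst (2 * d ^+ 2 * b) (measurable_boxc d) mb.
  have -> : 8 * d ^+ 4 * b = int setT (fun t => 2 * d ^+ 2 * b * \1_(box d) t).
    rewrite -[RHS](@Rintegral_restrict _ (box d)).
      transitivity (int (box d) (fun=> 2 * d ^+ 2 * b)); first by rewrite e1; ring.
      by apply: int_eq => q Qq; rewrite indicE mem_set// mulr1.
    by move=> q Qq; rewrite indicE memNset// mulr0.
  have I1 : itg setT (fun t => 2 * d ^+ 2 * b * \1_(box d) t).
    apply: (box_integrable (L := d) (M := 2 * d ^+ 2 * b)).
    - by apply: measurable_funM => //; apply: measurable_indic; exact: measurable_boxc.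
    - move=> q; rewrite normrM -[leRHS]mulr1; apply: ler_pM => //.
        by rewrite ger0_norm// !mulr_ge0// sqr_ge0.
      by rewrite indicE; case: (_ \in _); rewrite ?normr1 ?normr0.
    - by move=> q bq; rewrite indicE memNset ?mulr0.
  rewrite int_EFin//; apply: ge0_le_integral => //.
  - by move=> t _; exact: integral_ge0.
  - exact: plane_tonelli_G mF F0.
  - by case/integrableP: I1.
  move=> t _; rewrite indicE.
  have [bt|bt] := pselect (box d t); last first.
    rewrite memNset// mulr0 integral0_eq// => p _.
    by rewrite /F /= indicE memNset// mulr0.
  rewrite mem_set// mulr1; have := Nt t bt; rewrite -lee_fin int_EFin//; last first.
    apply: L2_itg; apply: L2B => //; last exact: LT.
    split; first exact: measurable_fun_shift.
    have [H _] := Rintegral_shift t (L2_itg (LT _ tp)).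
    by apply: itg_eq H => // p _; rewrite /= affE.
  apply: le_trans; rewrite le_eqVlt; apply/orP; left; apply/eqP.
  by apply: eq_integral => p _; rewrite /F /= indicE mem_set// mulr1.
have io : itg setT (osc d).
  apply/integrableP; split.
    rewrite (_ : EFin \o osc d = fun p => \int[mu]_t F (p, t))%E.
      exact: plane_tonelli_F mF F0.
    by apply/funext => p; rewrite oscE.
  apply: le_lt_trans (ltry (8 * d ^+ 4 * b)).
  apply: le_trans H; rewrite le_eqVlt; apply/orP; left; apply/eqP.
  apply: eq_integral => p _ /=; rewrite ger0_norm//; apply: int_ge0 => t _; exact: sqr_ge0.
by split => //; rewrite -lee_fin int_EFin.
Qed.

(** [cell_bound] is integrated over the cells of a grid. The weight sqrt 2 / d turns the square of
    the integral over a cell Q into 2 (int_Q phi)^2 / d^2, and 16 d^2 is 2 / d^2 times the 8 d^4 of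
    [osc_integral]. *)
Lemma rellich_bound (d : R) n : d = 2 * L / n.+1%:R ->
  ip Om phi phi <= 16 * d ^+ 2 * bform Om phi phi +
    \sum_(k : 'I_n.+2 * 'I_n.+2) ip Om phi
      (fun p => Num.sqrt 2 / d * \1_(`[- L + k.1%:R * d, - L + k.1%:R * d + d] `*`
                                     `[- L + k.2%:R * d, - L + k.2%:R * d + d]) p) ^+ 2.
Proof.
move=> dE; have d0 : 0 < d by rewrite dE divr_gt0// mulr_gt0.
have mT : meas2 setT by exact: measurableT.
have mp := test_measurable tp; have LT : L2 setT phi by exact: test_L2 tp.
pose Q (k : 'I_n.+2 * 'I_n.+2) := cell d (- L + k.1%:R * d) (- L + k.2%:R * d).
have d2 : 0 < d ^+ 2 by rewrite exprn_gt0.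
pose c k := 2 * (int (Q k) phi / d ^+ 2) ^+ 2.
have c0 k : 0 <= c k by rewrite mulr_ge0// sqr_ge0.
have gE k : ip Om phi (fun p => Num.sqrt 2 / d * \1_(Q k) p) ^+ 2 = c k * d ^+ 2.
  have -> : ip Om phi (fun p => Num.sqrt 2 / d * \1_(Q k) p) = Num.sqrt 2 / d * int (Q k) phi.
    have iQ : itg (Q k) phi.
      have [M [M0 pM p0]] := test_bounded tp.
      apply: measurable_bounded_integrable => //; first exact: mcell.
      - by apply: (@le_lt_trans _ _ (mu (Q k))) => //; rewrite mucell ?ltry// ltW.
      - exact: measurable_funTS.
      - exists M; split; first exact: num_real.
        by move=> x Mx p _ /=; exact: le_trans (ltW Mx).
    rewrite -intZ//; last exact: mcell.
    rewrite ip_int; transitivity (int setT (fun p => phi p * (Num.sqrt 2 / d * \1_(Q k) p))).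
      by apply: Rintegral_restrict => p Op; rewrite (test_out tp Op) mul0r.
    rewrite -[LHS](@Rintegral_restrict _ (Q k)).
      by apply: int_eq => p Qp; rewrite indicE mem_set// mulr1 mulrC.
    by move=> p Qp; rewrite indicE memNset// !mulr0.
  rewrite /c !exprMn sqr_sqrtr// !exprVn; field; rewrite gt_eqF//.
have [io ho] := osc_integral d0.
have IQ k : itg setT (fun p => c k * \1_(Q k) p) /\ int setT (fun p => c k * \1_(Q k) p) = c k * d ^+ 2.
  have [i1 e1] := int_cst (c k) (mcell _ _ _) (mucell (- L + k.1%:R * d) (- L + k.2%:R * d) (ltW d0)).
  have H : itg setT (fun p => c k * \1_(Q k) p).
    rewrite /itg (_ : EFin \o _ = (EFin \o (fun=> c k)) \_ (Q k)).
      by apply/(integrable_mkcond _ (mcell _ _ _)).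
    by apply/funext => p; rewrite patchE /= indicE; case: ifP; rewrite ?mulr1 ?mulr0.
  split => //; rewrite -e1 -[LHS](@Rintegral_restrict _ (Q k)).
    by apply: int_eq => p Qp; rewrite indicE mem_set// mulr1.
  by move=> p Qp; rewrite indicE memNset// mulr0.
have IS : forall r : seq ('I_n.+2 * 'I_n.+2), itg setT (fun p => \sum_(k <- r) c k * \1_(Q k) p) /\
    int setT (fun p => \sum_(k <- r) c k * \1_(Q k) p) = \sum_(k <- r) c k * d ^+ 2.
  elim=> [|k r [IH1 IH2]].
    under eq_fun do rewrite big_nil.
    split; first exact: integrable0.
    by rewrite big_nil /int /Rintegral integral0.
  under eq_fun do rewrite big_cons.
  have [h1 h2] := IQ k; rewrite big_cons.
  by split; [exact: itgD|rewrite intD// h2 IH2].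
have [IS1 IS2] := IS (index_enum _).
have pw p : phi p ^+ 2 <= \sum_k c k * \1_(Q k) p + 2 / d ^+ 2 * osc d p.
  have o0 : 0 <= osc d p by apply: int_ge0 => t _; exact: sqr_ge0.
  have [Op|Op] := pselect (Om p); last first.
    rewrite (test_out tp Op) expr0n addr_ge0//; last first.
      by rewrite mulr_ge0// divr_ge0// ltW.
    by apply: sumr_ge0 => k _; rewrite mulr_ge0// indicE.
  have /boxE[p1 p2] := OmL Op.
  have idx := grid_index dE d0.
  have [i ip1] := idx _ p1; have [j jp2] := idx _ p2.
  have Qp : Q (i, j) p by split; rewrite /= in_itv/=.
  apply: le_trans (cell_bound d0 Qp) _; rewrite lerD2r.
  rewrite (bigD1 (i, j))//= indicE mem_set// mulr1 lerDl.
  by apply: sumr_ge0 => k _; rewrite mulr_ge0// indicE.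
under eq_bigr do rewrite gE.
have -> : ip Om phi phi = int setT (fun p => phi p ^+ 2).
  rewrite -[RHS](@Rintegral_restrict _ Om).
    by apply: int_eq => p _; rewrite expr2.
  by move=> p /(test_out tp) ->; rewrite expr0n.
have iz : itg setT (fun p => 2 / d ^+ 2 * osc d p) by exact: itgZ.
apply: le_trans (int_le mT (L2_itg LT) (itgD mT IS1 iz) (fun p _ => pw p)) _.
rewrite intD// IS2 addrC lerD2r intZ//.
have -> : 16 * d ^+ 2 * bform Om phi phi = 2 / d ^+ 2 * (8 * d ^+ 4 * bform Om phi phi).
  by field; rewrite gt_eqF.
by rewrite ler_wpM2l// divr_ge0// ltW.
Qed.

End Rellich.

(** * Completeness of L^2 along rapidly Cauchy sequences *)

Section L2Complete.
Variable R : realType.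
Local Notation mu := (@mu2 R).
Local Notation M2 := (measurableTypeR R * measurableTypeR R)%type.
Local Notation meas2 D := (measurable (D : set M2)).
Local Notation measf2 D f := (measurable_fun (D : set M2) f).
Implicit Types (D : set (plane R)) (f g : plane R -> R).

Lemma int_ae D f g : meas2 D -> itg D f -> itg D g ->
  {ae mu, forall p, D p -> f p = g p} -> int D f = int D g.
Proof.
move=> mD fi gi fg; pose h p := `|f p - g p|.
have hi0 : itg D (fun p => f p - g p) by exact: itgB.
have hi : itg D h.
  by apply: (integrable_norm hi0).
have : int D h = 0.
  apply/int_eq0P => //; first by move=> p _; exact: normr_ge0.
  by apply: aeS fg => p H Dp; rewrite /h H// subrr normr0.
move=> h0; apply/eqP; rewrite -subr_eq0 -intB// -normr_le0 -h0.
by apply: int_abs_le.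
Qed.

Lemma geometric_tail (u : nat -> R) (c : R) : (forall k, `|u k.+1 - u k| <= c * 2^-1 ^+ k) ->
  forall m n, (m <= n)%N -> `|u n - u m| <= 2 * c * 2^-1 ^+ m - 2 * c * 2^-1 ^+ n.
Proof.
move=> H m n; elim: n => [|n IH]; first by rewrite leqn0 => /eqP->; rewrite !subrr normr0.
rewrite leq_eqVlt => /predU1P[->|]; first by rewrite !subrr normr0.
rewrite ltnS => /IH {}IH.
have -> : u n.+1 - u m = (u n.+1 - u n) + (u n - u m) by ring.
apply: le_trans (ler_normD _ _) _; have := H n; move: IH.
rewrite [in X in _ -> _ -> X]exprS; lra.
Qed.

Lemma geometric_cvg (u : nat -> R) (c : R) : 0 <= c ->
  (forall k, `|u k.+1 - u k| <= c * 2^-1 ^+ k) ->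
  exists2 l, u n @[n --> \oo] --> l & forall m, `|u m - l| <= 2 * c * 2^-1 ^+ m.
Proof.
move=> c0 H; have T := geometric_tail H.
have T2 m n : (m <= n)%N -> `|u n - u m| <= 2 * c * 2^-1 ^+ m.
  by move=> /T /le_trans; apply; rewrite gerBl !mulr_ge0// exprn_ge0.
have cu : cvg (u n @[n --> \oo]).
  apply/cauchy_cvgP/cauchy_ballP => e e0.
  have [N _ NP] : \forall n \near \oo, 2 * c * 2^-1 ^+ n < e / 2.
    have : (2 * c * 2^-1 ^+ n) @[n --> \oo] --> 2 * c * 0.
      apply: cvgM; first exact: cvg_cst.
      by apply: cvg_expr; rewrite ger0_norm// invf_lt1// ltr1n.
    by rewrite mulr0 => /cvgr_lt; apply; rewrite divr_gt0.
  exists (u @` [set n | (N <= n)%N], u @` [set n | (N <= n)%N]) => /=.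
    by split; exists N => // n Nn; exists n.
  move=> [_ _] [/= [m Nm <-] [n Nn <-]]; rewrite /ball /=.
  have -> : u m - u n = (u m - u N) - (u n - u N) by ring.
  apply: le_lt_trans (ler_normB _ _) _; rewrite [e]splitr.
  have NN := NP N (leqnn N).
  by apply: ltr_leD; [apply: le_lt_trans NN; exact: T2|apply: le_trans (ltW NN); exact: T2].
exists (lim (u n @[n --> \oo])) => // m.
have cv : `|u m - u n| @[n --> \oo] --> `|u m - lim (u n @[n --> \oo])|.
  by apply: cvg_norm; apply: cvgB => //; exact: cvg_cst.
apply: (cvgr_to_le cv); exists m => // n mn /=.
by rewrite distrC; exact: T2.
Qed.

(** The functions f_k = 4^k (x_{k+1} - x_k)^2 have integrals at most 4^-k, so their sum H has
    integral at most 2. Where H is finite, |x_{k+1} - x_k| <= sqrt(H) 2^-k, so the sequence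
    converges with (x_m - l)^2 <= 4 H / 4^m; integrating gives the 8. *)
Lemma L2_complete D (x : nat -> plane R -> R) : meas2 D -> (forall m, L2 D (x m)) ->
  (forall m, ip D (x m.+1 - x m) (x m.+1 - x m) <= 16^-1 ^+ m) ->
  exists2 l, L2 D l & forall m, ip D (x m - l) (x m - l) <= 8 * 4^-1 ^+ m.
Proof.
move=> mD Lx Hx.
pose f k p := 4 ^+ k * (x k.+1 p - x k p) ^+ 2.
have f0 k p : 0 <= f k p by apply: mulr_ge0; [exact: exprn_ge0|exact: sqr_ge0].
have fi k : itg D (f k) by apply: itgZ => //; exact: (L2_itg (L2B mD (Lx _) (Lx _))).
have mf k : measf2 D (EFin \o f k) by case/integrableP: (fi k).
have fk k : int D (f k) <= 4^-1 ^+ k.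
  rewrite intZ//; last exact: (L2_itg (L2B mD (Lx _) (Lx _))).
  have -> : 4^-1 ^+ k = 4 ^+ k * 16^-1 ^+ k :> R by rewrite -exprMn; congr (_ ^+ _); field.
  apply: ler_wpM2l; first exact: exprn_ge0.
  apply: le_trans (Hx k); rewrite le_eqVlt; apply/orP; left; apply/eqP.
  by apply: int_eq => p _; rewrite expr2.
pose H p := (\sum_(k <oo) (f k p)%:E)%E.
have HI : (\int[mu]_(p in D) H p <= 2%:E)%E.
  rewrite integral_nneseries//; last by move=> *; rewrite lee_fin.
  apply: lime_le; first by apply: is_cvg_nneseries => n _ _; apply: integral_ge0 => p _; rewrite lee_fin.
  apply: nearW => n.
  have -> : (\sum_(0 <= k < n) \int[mu]_(p in D) (f k p)%:E = (\sum_(0 <= k < n) int D (f k))%:E)%E.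
    by rewrite -sumEFin; apply: eq_bigr => k _; rewrite int_EFin.
  rewrite lee_fin; apply: le_trans (_ : \sum_(0 <= k < n) 4^-1 ^+ k <= _); first exact: ler_sum.
  have : \sum_(0 <= k < n) 4^-1 ^+ k <= 2 - 2 * 4^-1 ^+ n :> R.
    elim: n => [|n IH]; first by rewrite big_nil expr0; lra.
    rewrite big_nat_recr//= exprS; have : 0 <= 4^-1 ^+ n :> R by exact: exprn_ge0.
    move: IH; set a := \sum_(_ <= _ < _) _; lra.
  by move/le_trans; apply; rewrite gerBl mulr_ge0// exprn_ge0.
have H0 p : (0 <= H p)%E by apply: nneseries_ge0 => n _ _; rewrite lee_fin.
have mH : measf2 D H.
  by apply: (@ge0_emeasurable_sum _ M2 R D (fun k => EFin \o f k) xpredT) => // k p _ _; rewrite /= lee_fin.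
have iH : mu.-integrable D H.
  apply/integrableP; split => //.
  apply: le_lt_trans (ltry 2); apply: le_trans HI; rewrite le_eqVlt; apply/orP; left; apply/eqP.
  by apply: eq_integral => p _; rewrite gee0_abs.
have aeH : {ae mu, forall p, D p -> H p \is a fin_num}.
  exact: (@integrable_ae _ M2 R mu D mD H iH).
pose E p := `[< H p \is a fin_num >].
pose S p := fine (H p).
have S0 p : 0 <= S p by exact: fine_ge0.
have mS : measf2 D S by exact: measurableT_comp.
have iS : itg D S.
  apply: (le_integrable mD _ _ iH); first exact/measurable_EFinP.
  move=> p _; rewrite /S /=; case: (H p) (H0 p) => [r|//|//] /=; last by rewrite normr0 leey.
  by move=> _; rewrite lexx.
have IS : int D S <= 2.
  rewrite -lee_fin int_EFin//; apply: le_trans HI; apply: ge0_le_integral => //.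
  - by move=> p _; rewrite lee_fin.
  - exact/measurable_EFinP.
  - move=> p _; rewrite /S; case: (H p) (H0 p) => [r|//|//] /=; by rewrite ?leey ?lexx.
have key p : E p -> forall k, `|x k.+1 p - x k p| <= Num.sqrt (S p) * 2^-1 ^+ k.
  move=> /asboolP Ep k; have : ((f k p)%:E <= H p)%E.
    apply: le_trans (@nneseries_lim_ge R (fun k => (f k p)%:E) xpredT 0%N k.+1 _).
      rewrite big_nat_recr//=; apply: leeDr; apply: sume_ge0 => i _; by rewrite lee_fin.
    by move=> n _ _; rewrite lee_fin.
  rewrite -[H p]fineK// lee_fin -/(S p) /f => fS.
  rewrite -(ler_pXn2r (n := 2)) ?nnegrE//.
  rewrite real_normK ?num_real// exprMn sqr_sqrtr// -exprM mulnC exprM.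
  have -> : 2^-1 ^+ 2 = 4^-1 :> R by field.
  by rewrite exprVn ler_pdivlMr ?exprn_gt0// mulrC.
have lP p : exists l : R, (E p -> x n p @[n --> \oo] --> l /\
    forall m, `|x m p - l| <= 2 * Num.sqrt (S p) * 2^-1 ^+ m) /\ (~~ E p -> l = 0).
  case: (boolP (E p)) => Ep; last by exists 0.
  by have [l l1 l2] := geometric_cvg (sqrtr_ge0 _) (key p Ep); exists l.
have [l {}lP] := choice lP.
(* On the null set where H is infinite the sequence is replaced by 0, so that it converges
   everywhere and [l] is measurable. *)
pose h m p := if E p then x m p else 0.
have El p (Ep : E p) := (lP p).1 Ep.
have l0 p (Ep : ~~ E p) := (lP p).2 Ep.
have hm m p : (h m p - l p) ^+ 2 <= 4 * 4^-1 ^+ m * S p.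
  rewrite /h; case: (boolP (E p)) => Ep; last first.
    by rewrite l0// subrr expr0n !mulr_ge0// exprn_ge0.
  have [_ /(_ m)] := El p Ep; rewrite -(ler_pXn2r (n := 2)) ?nnegrE//.
  rewrite real_normK ?num_real// !exprMn sqr_sqrtr// -exprM mulnC exprM.
  move/le_trans; apply; rewrite le_eqVlt; apply/orP; left; apply/eqP.
  have -> : 2^-1 ^+ 2 = 4^-1 :> R by field.
  by rewrite mulrAC; congr (_ * _ * _); ring.
have mE : measurable (D `&` [set p | E p] : set M2).
  have := emeasurable_fin_num mD mH.
  by congr measurable; apply/seteqP; split => p [Dp] /=; [move=> Ep; split => //; exact/asboolP|move=> /asboolP].
have mh m : measf2 D (h m).
  apply: (@eq_measurable_fun _ _ M2 _ D (fun p => x m p * \1_(D `&` [set p | E p]) p)).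
    move=> p; rewrite inE => Dp; rewrite /h indicE.
    case: (boolP (E p)) => Ep; first by rewrite mem_set ?mulr1.
    by rewrite memNset ?mulr0// => -[_] /=; exact/negP.
  by apply: measurable_funM; [case: (Lx m)|exact: measurable_indic].
have ml : measf2 D l.
  apply: (@measurable_fun_cvg _ M2 R D h) => // p Dp.
  rewrite /h; case: (boolP (E p)) => Ep; last by rewrite l0//; exact: cvg_cst.
  by have [] := El p Ep.
have Lh m : L2 D (h m).
  split; first exact: mh.
  apply: (itg_le mD (L2_itg (Lx m))); first exact: measurable_funX.
  move=> p _; rewrite ger0_norm ?sqr_ge0// /h; case: ifP => // _.
  by rewrite expr0n sqr_ge0.
have Lhl m : L2 D (h m - l).
  have mhl : measf2 D (h m - l) by apply: measurable_funB => //; exact: mh.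
  split => //; apply: (itg_le mD (itgZ (4 * 4^-1 ^+ m) mD iS)); first exact: measurable_funX.
  by move=> p _; rewrite ger0_norm ?sqr_ge0//; exact: hm.
have Ll : L2 D l.
  rewrite (_ : l = h 0%N - (h 0%N - l)); first exact: L2B.
  by rewrite opprB addrC subrK.
exists l => // m; have LB := L2B mD (Lx m) Ll.
have -> : ip D (x m - l) (x m - l) = int D (fun p => (h m p - l p) ^+ 2).
  apply: int_ae => //; [exact: L2M|exact: (L2_itg (Lhl m))|].
  apply: aeS aeH => p Hp Dp; rewrite -expr2 /h.
  by have -> : E p by apply/asboolP; exact: Hp.
apply: le_trans (int_le mD (L2_itg (Lhl m)) (itgZ (4 * 4^-1 ^+ m) mD iS) (fun p _ => hm m p)) _.
rewrite intZ//; have -> : 8 * 4^-1 ^+ m = 4 * 4^-1 ^+ m * 2 :> R by ring.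
by rewrite ler_wpM2l// mulr_ge0// exprn_ge0.
Qed.

End L2Complete.

Section SemiInnerOperations.
Variables (R : realType) (E F : lmodType R).
Implicit Types f g : E -> E -> R.

Lemma semi_innerD f g : semi_inner f -> semi_inner g -> semi_inner (fun x y => f x y + g x y).
Proof.
move=> hf hg; split=> [a x y z|x y|x].
- by rewrite (si_lin hf) (si_lin hg); ring.
- by rewrite (si_sym hf) (si_sym hg).
- by rewrite addr_ge0 ?(si_ge0 hf) ?(si_ge0 hg).
Qed.

Lemma semi_innerZ c f : 0 <= c -> semi_inner f -> semi_inner (fun x y => c * f x y).
Proof.
move=> c0 hf; split=> [a x y z|x y|x].
- by rewrite (si_lin hf); ring.
- by rewrite (si_sym hf).
- by rewrite mulr_ge0 ?(si_ge0 hf).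
Qed.

Lemma semi_inner_comp (u : {linear F -> E}) f : semi_inner f ->
  semi_inner (fun x y => f (u x) (u y)).
Proof.
move=> hf; split=> [a x y z|x y|x].
- by rewrite linearP (si_lin hf).
- exact: si_sym.
- exact: si_ge0.
Qed.

Lemma semi_inner_squares (I : finType) (l : I -> E -> R) :
  (forall i a x y, l i (a *: x + y) = a * l i x + l i y) ->
  semi_inner (fun x y => \sum_i l i x * l i y).
Proof.
move=> hl; split=> [a x y z|x y|x].
- by rewrite mulr_sumr -big_split/=; apply: eq_bigr => i _; rewrite hl; ring.
- by apply: eq_bigr => i _; rewrite mulrC.
- by apply: sumr_ge0 => i _; rewrite -expr2 sqr_ge0.
Qed.

End SemiInnerOperations.

(** * Extension of the inequalities from test functions to [H10] *)

Section SobolevInequalities.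
Variable R : realType.
Local Notation M2 := (measurableTypeR R * measurableTypeR R)%type.
Local Notation meas2 D := (measurable (D : set M2)).
Variables (Om : set (plane R)) (L : R).
Hypotheses (oOm : open Om) (OmL : Om `<=` box L) (L0 : 0 < L).

Let mO : meas2 Om. Proof. exact: open_measurable2. Qed.
Local Notation H := (elt (L2s oOm)).
Local Notation V := (elt (H10s oOm OmL)).
Local Notation nH := (snorm (eip (oOm := oOm))).
Local Notation nV := (snorm (eb (oOm := oOm) (OmL := OmL))).

Definition io : {linear V -> H} := incl (@H10_L2 R Om L oOm OmL).

Definition n1V (v w : V) : R := eip (io v) (io w) + eb v w.

Lemma norm1_n1V (v : V) : norm1 Om (val v) = snorm n1V v.
Proof. by []. Qed.

(* An inequality between seminorms continuous on H^1 passes from the test functions to their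
   closure. *)
Lemma H10_density (p q : V -> V -> R) (K : R) : semi_inner p -> semi_inner q -> 0 <= K ->
  (forall v, snorm p v <= K * snorm n1V v) -> (forall v, snorm q v <= K * snorm n1V v) ->
  (forall v : V, test_function Om (val v) -> snorm p v <= snorm q v) ->
  forall v, snorm p v <= snorm q v.
Proof.
move=> hp hq K0 pK qK pq v; apply/ler_addgt0Pr => e e0.
have [_ /(_ (e / (2 * K + 1)))] := H10sP v.
have K1 : 0 < 2 * K + 1 by rewrite ltr_wpDl// mulr_ge0.
case; first by rewrite divr_gt0.
move=> phi tp vphi; pose f : V := mkelt (F := H10s oOm OmL) (test_H10 oOm OmL tp).
have d : snorm n1V (v - f) < e / (2 * K + 1) by [].
have h1 : snorm p v <= snorm p f + snorm p (v - f).
  by rewrite -[X in snorm p X <= _](subrK f) addrC (snormD hp).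
have h2 : snorm q f <= snorm q v + snorm q (v - f).
  by rewrite -[X in snorm q X <= _](subKr v) (snormB hq).
have h3 := pq f tp; have h4 := pK (v - f); have h5 := qK (v - f).
have h6 : (2 * K + 1) * snorm n1V (v - f) <= e by rewrite -ler_pdivlMl// mulrC ltW.
have h7 := snorm_ge0 n1V (v - f).
move: h1 h2 h3 h4 h5 h6 h7; rewrite mulrDl -mulrA mul1r.
move: (K * snorm n1V (v - f)) (snorm n1V (v - f)) => s t; lra.
Qed.

Lemma n1V_ge0 v : nH (io v) <= snorm n1V v.
Proof.
have hb := eb_semi oOm OmL; apply: ler_wsqrtr; rewrite /n1V lerDl (si_ge0 hb) //.
Qed.

Lemma n1V_ge1 v : nV v <= snorm n1V v.
Proof.
have hs := eip_semi oOm; apply: ler_wsqrtr; rewrite /n1V lerDr (si_ge0 hs) //.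
Qed.

Lemma H10_poincare v : nH (io v) <= 2 * L * nV v.
Proof.
have hs := eip_semi oOm; have hb := eb_semi oOm OmL.
pose p (v w : V) := eip (io v) (io w).
pose q (v w : V) := (2 * L) ^+ 2 * eb v w.
have hp : semi_inner p by exact: semi_inner_comp.
have LL : 0 <= 2 * L by rewrite mulr_ge0// ltW.
have hq : semi_inner q by apply: semi_innerZ => //; exact: sqr_ge0.
have qE w : snorm q w = 2 * L * nV w.
  by rewrite /snorm /q sqrtrM ?sqr_ge0// sqrtr_sqr ger0_norm.
rewrite -[X in X <= _]/(snorm p v) -qE.
apply: (H10_density (K := 2 * L + 1)) => //.
- by rewrite addr_ge0.
- by move=> w; apply: le_trans (n1V_ge0 w) _; rewrite ler_peMl ?snorm_ge0// lerDr.
- by move=> w; rewrite qE; apply: ler_pM; rewrite ?snorm_ge0 ?n1V_ge1// lerDl ler01.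
move=> w tw; rewrite qE; apply: le_trans (test_poincare oOm OmL L0 tw) _.
apply: ler_wpM2l => //; apply: ler_wsqrtr; rewrite /eb /eform.
have w1 := test_weak_deriv (e1 R) mO tw; have w2 := test_weak_deriv (e2 R) mO tw.
by rewrite (bformE oOm OmL w1 w2 w1 w2) lerDl ip_ge0.
Qed.

Lemma H10_rellich (e : R) : 0 < e -> exists s : seq H, forall v,
  nH (io v) ^+ 2 <= e * nV v ^+ 2 + \sum_(g <- s) eip (io v) g ^+ 2.
Proof.
move=> e0; have hs := eip_semi oOm; have hb := eb_semi oOm OmL.
(* The grid is taken fine enough for the energy coefficient 16 d^2 of [rellich_bound] to be at most
   e. *)
have [n nP] : exists n, 16 * (2 * L / n.+1%:R) ^+ 2 <= e.
  pose a := Num.min 1 (e / (16 * (2 * L) ^+ 2)).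
  have L2 : 0 < 16 * (2 * L) ^+ 2 by rewrite mulr_gt0// exprn_gt0// mulr_gt0.
  have a0 : 0 < a by rewrite lt_min ltr01 divr_gt0.
  have [n _ /(_ n (leqnn n)) na] := near_infty_natSinv_lt (PosNum a0).
  exists n; rewrite exprMn mulrA -ler_pdivlMl//.
  apply: le_trans (_ : n.+1%:R^-1 <= _).
    by rewrite expr2 ler_piMr// invf_le1// ler1n.
  by apply: le_trans (ltW na) _; rewrite /a ge_min mulrC lexx orbT.
set d := 2 * L / n.+1%:R in nP.
pose g (k : 'I_n.+2 * 'I_n.+2) (p : plane R) : R := Num.sqrt 2 / d *
  \1_(`[- L + k.1%:R * d, - L + k.1%:R * d + d] `*` `[- L + k.2%:R * d, - L + k.2%:R * d + d]) p.
have Lg k : L2 Om (g k).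
  apply: (bounded_L2 mO OmL (M := `|Num.sqrt 2 / d|)).
    by apply: measurable_funTS; apply: measurable_funM => //; apply: measurable_indic;
      exact: measurableX.
  move=> p _; rewrite normrM -[leRHS]mulr1; apply: ler_pM => //.
  by rewrite indicE; case: (_ \in _); rewrite ?normr1 ?normr0.
pose G k : H := mkelt (F := L2s oOm) (Lg k).
exists [seq G k | k <- index_enum ('I_n.+2 * 'I_n.+2)%type] => v.
pose p (v w : V) := eip (io v) (io w).
pose q (v w : V) := e * eb v w + \sum_k eip (io v) (G k) * eip (io w) (G k).
have hp : semi_inner p by exact: semi_inner_comp.
have hq : semi_inner q.
  apply: semi_innerD; first by apply: semi_innerZ => //; exact: ltW.
  by apply: semi_inner_squares => i a x y; rewrite linearP (si_lin hs).
have qE w : snorm q w ^+ 2 = e * nV w ^+ 2 + \sum_k eip (io w) (G k) ^+ 2.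
  by rewrite !snormE//; congr (_ + _); apply: eq_bigr => i _; rewrite expr2.
rewrite big_map -qE ler_pXn2r ?nnegrE ?snorm_ge0// -[X in X <= _]/(snorm p v).
pose K := 1 + e + \sum_k nH (G k) ^+ 2.
have SG0 : 0 <= \sum_k nH (G k) ^+ 2 by apply: sumr_ge0 => k _; rewrite sqr_ge0.
have K1 : 1 <= K by rewrite /K -addrA lerDl addr_ge0// ltW.
have K0 : 0 <= K by exact: le_trans K1.
apply: (H10_density (K := K)) => //.
- by move=> w; apply: le_trans (n1V_ge0 w) _; rewrite ler_peMl ?snorm_ge0.
- move=> w; rewrite -(ler_pXn2r (n := 2)) ?nnegrE ?snorm_ge0//; last first.
    by rewrite mulr_ge0// snorm_ge0.
  rewrite qE exprMn; apply: le_trans (_ : K * snorm n1V w ^+ 2 <= _); last first.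
    by rewrite ler_wpM2r ?sqr_ge0// expr2 ler_peMl.
  rewrite /K mulrDl mulr_suml; apply: lerD.
    apply: ler_pM; rewrite ?sqr_ge0 ?(ltW e0)//; first by rewrite lerDr.
    by rewrite ler_pXn2r ?nnegrE ?snorm_ge0// n1V_ge1.
  apply: ler_sum => k _; have := si_CS hs (io w) (G k).
  rewrite -(snormE hs) -(snormE hs) => /le_trans; apply; rewrite mulrC.
  by rewrite ler_wpM2l ?sqr_ge0// ler_pXn2r ?nnegrE ?snorm_ge0// n1V_ge0.
- move=> w tw; rewrite -(ler_pXn2r (n := 2)) ?nnegrE ?snorm_ge0// qE (snormE hp) (snormE hb).
  apply: le_trans (rellich_bound oOm OmL L0 tw (erefl d)) _.
  by rewrite lerD2r ler_wpM2r// bform_ge0.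
Qed.

Lemma eL2_complete (x : nat -> H) : (forall m, nH (x m.+1 - x m) <= 4^-1 ^+ m) ->
  exists l, forall e : R, 0 < e -> exists N, forall m, (N <= m)%N -> nH (x m - l) <= e.
Proof.
move=> Hx; have hs := eip_semi oOm.
have [|l Ll lP] := L2_complete mO (fun m => L2sP (x m)).
  move=> m; have := Hx m; rewrite -(ler_pXn2r (n := 2)) ?nnegrE ?snorm_ge0 ?exprn_ge0//.
  rewrite snormE// -exprM mulnC exprM.
  by have -> : 4^-1 ^+ 2 = 16^-1 :> R by field.
pose l' : H := mkelt (F := L2s oOm) Ll.
exists l' => e e0.
have : (8 * 4^-1 ^+ n) @[n --> \oo] --> (8 * 0 : R).
  apply: cvgM; first exact: cvg_cst.
  by apply: cvg_expr; rewrite ger0_norm// invf_lt1// ltr1n.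
rewrite mulr0 => /cvgr_lt /(_ (e ^+ 2)); rewrite exprn_gt0// => /(_ isT)[N _ NP].
exists N => m Nm; rewrite -(ler_pXn2r (n := 2)) ?nnegrE ?snorm_ge0 ?(ltW e0)//.
by rewrite snormE//; apply: le_trans (lP m) _; exact: ltW (NP m Nm).
Qed.

End SobolevInequalities.

(** * Finite element interpolation *)

Section Triangles.
Variable R : realType.
Implicit Types (p q r x y z : plane R) (s : seq (plane R)).

Lemma radius_ge p : `|p.1| <= radius p /\ `|p.2| <= radius p.
Proof.
by split; rewrite -sqrtr_sqr; apply: ler_wsqrtr; rewrite ?lerDl ?lerDr sqr_ge0.
Qed.

Lemma radius_le p : radius p <= `|p.1| + `|p.2|.
Proof.
have n1 := normr_ge0 p.1; have n2 := normr_ge0 p.2.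
rewrite -[leRHS]ger0_norm ?addr_ge0// -sqrtr_sqr; apply: ler_wsqrtr.
rewrite -(real_normK (num_real p.1)) -(real_normK (num_real p.2)) sqrrD mulr2n.
have := mulr_ge0 n1 n2; lra.
Qed.

Definition affn (k : R * R * R) (z : plane R) : R := k.1.1 + k.1.2 * z.1 + k.2 * z.2.

Lemma affn_hull k s z : hull s z -> exists w : 'I_(size s) -> R,
  [/\ forall i, 0 <= w i, \sum_i w i = 1 & affn k z = \sum_i w i * affn k s`_i].
Proof.
move=> [w [w0 w1 zE]]; exists w; split => //.
have E1 : z.1 = \sum_i w i * (s`_i).1.
  rewrite zE (big_morph (fun z : plane R => z.1) (id1 := 0) (op1 := +%R))//.
have E2 : z.2 = \sum_i w i * (s`_i).2.
  rewrite zE (big_morph (fun z : plane R => z.2) (id1 := 0) (op1 := +%R))//.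
rewrite /affn E1 E2 !mulr_sumr -{1}[k.1.1]mulr1 -w1 mulr_sumr -!big_split/=.
by apply: eq_bigr => i _; ring.
Qed.

(** Affine functions commute with barycentric combinations. Applied to the common vertices of two
    triangles, this makes the interpolant single-valued. *)
Lemma affn_hull_eq k k' s z : {in s, affn k =1 affn k'} -> hull s z -> affn k z = affn k' z.
Proof.
move=> kk hz; pose d := (k.1.1 - k'.1.1, k.1.2 - k'.1.2, k.2 - k'.2).
have dE x : affn d x = affn k x - affn k' x by rewrite /affn /=; ring.
have [w [_ _ E]] := affn_hull d hz.
apply/eqP; rewrite -subr_eq0 -dE E big1// => i _.
by rewrite dE kk ?mem_nth// subrr mulr0.
Qed.

Lemma affn_hull_le k s z (M : R) : {in s, forall x, `|affn k x| <= M} -> hull s z ->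
  `|affn k z| <= M.
Proof.
move=> kM hz; have [w [w0 w1 ->]] := affn_hull k hz.
apply: le_trans (ler_norm_sum _ _ _) _; rewrite -[M]mul1r -w1 mulr_suml.
apply: ler_sum => i _; rewrite normrM ger0_norm//; apply: ler_wpM2l => //.
by apply: kM; rewrite mem_nth.
Qed.

Lemma hull_mem s x : x \in s -> hull s x.
Proof.
move=> xs; have xs' : (index x s < size s)%N by rewrite index_mem.
exists (fun i => (i == Ordinal xs')%:R); split.
- by move=> i.
- by rewrite (bigD1 (Ordinal xs'))//= eqxx big1 ?addr0// => i /negbTE ->.
- rewrite (bigD1 (Ordinal xs'))//= eqxx scale1r nth_index// big1 ?addr0// => i /negbTE ->.
  by rewrite scale0r.
Qed.

Lemma hull_bounded s : exists M, forall z, hull s z -> `|z.1| <= M /\ `|z.2| <= M.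
Proof.
exists (\sum_(x <- s) (`|x.1| + `|x.2|)) => z hz.
have bd x : x \in s -> `|x.1| + `|x.2| <= \sum_(x <- s) (`|x.1| + `|x.2|).
  by move=> xs; rewrite (big_rem x)//= lerDl sumr_ge0// => y _; rewrite addr_ge0.
split.
- have := @affn_hull_le (0, 1, 0) s z _ _ hz; rewrite /affn /= => H.
  have -> : z.1 = 0 + 1 * z.1 + 0 * z.2 by ring.
  apply: H => x xs; rewrite mul1r mul0r add0r addr0.
  by apply: le_trans (bd x xs); rewrite lerDl.
- have := @affn_hull_le (0, 0, 1) s z _ _ hz; rewrite /affn /= => H.
  have -> : z.2 = 0 + 0 * z.1 + 1 * z.2 by ring.
  apply: H => x xs; rewrite mul1r mul0r !add0r.
  by apply: le_trans (bd x xs); rewrite lerDr.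
Qed.

Lemma edist_le_diam s x y : hull s x -> hull s y -> edist x y <= diam (hull s).
Proof.
move=> hx hy; apply: ub_le_sup; last by exists x, y.
have [M MP] := hull_bounded s; exists (4 * M) => _ [a [b [/MP[a1 a2] /MP[b1 b2] ->]]].
apply: le_trans (radius_le _) _; rewrite /=.
have := ler_normB a.1 b.1; have := ler_normB a.2 b.2; lra.
Qed.

Lemma diam_coord s x y : hull s x -> hull s y ->
  `|x.1 - y.1| <= diam (hull s) /\ `|x.2 - y.2| <= diam (hull s).
Proof.
move=> hx hy; have := edist_le_diam hx hy; have [] := radius_ge (x - y).
by rewrite /edist => h1 h2 h3; split; [exact: le_trans h1 h3|exact: le_trans h2 h3].
Qed.

Section OneTriangle.
Variables p q r : plane R.
Let D := (q.1 - p.1) * (r.2 - p.2) - (q.2 - p.2) * (r.1 - p.1).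
Hypothesis D0 : D != 0.

(** [bar1] and [bar2] are the barycentric coordinates belonging to q and r, by Cramer's rule. *)
Definition bar1 z : R := ((z.1 - p.1) * (r.2 - p.2) - (z.2 - p.2) * (r.1 - p.1)) / D.
Definition bar2 z : R := ((q.1 - p.1) * (z.2 - p.2) - (q.2 - p.2) * (z.1 - p.1)) / D.

Lemma hull3 z : hull [:: p; q; r] z <-> [/\ 0 <= bar1 z, 0 <= bar2 z & bar1 z + bar2 z <= 1].
Proof.
split=> [[w [w0 w1 zE]]|[b1 b2 b12]].
- move: w1 zE; rewrite !big_ord_recl !big_ord0 /= => w1 zE.
  set a := w ord0 in w1 zE; set b := w (lift ord0 ord0) in w1 zE.
  set c := w _ in w1 zE.
  have aE : a = 1 - b - c by rewrite -w1; ring.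
  have z1 : z.1 = a * p.1 + (b * q.1 + (c * r.1 + 0)) by rewrite zE.
  have z2 : z.2 = a * p.2 + (b * q.2 + (c * r.2 + 0)) by rewrite zE.
  have B1 : bar1 z = b by apply: (canLR (mulfK D0)); rewrite /D z1 z2 aE; ring.
  have B2 : bar2 z = c by apply: (canLR (mulfK D0)); rewrite /D z1 z2 aE; ring.
  rewrite B1 B2; split; rewrite ?w0//.
  by have := w0 ord0; rewrite -/a aE; lra.
- exists (fun i => [:: 1 - bar1 z - bar2 z; bar1 z; bar2 z]`_i); split.
  + by case=> -[|[|[|]]]//= _; lra.
  + by rewrite !big_ord_recl !big_ord0 /=; ring.
  + rewrite !big_ord_recl !big_ord0 /= addr0.
    have D1 : (q.1 - p.1) * (r.2 - p.2) - (q.2 - p.2) * (r.1 - p.1) != 0 by exact: D0.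
    by case: z b1 b2 b12 => z1 z2 _ _ _; congr pair;
      rewrite /bar1 /bar2 /= /D; [rewrite -[RHS]/(_ * p.1 + (_ * q.1 + _ * r.1))|
        rewrite -[RHS]/(_ * p.2 + (_ * q.2 + _ * r.2))]; field.
Qed.

Definition interp (a b c : R) : R * R * R :=
  let k1 := ((b - a) * (r.2 - p.2) - (c - a) * (q.2 - p.2)) / D in
  let k2 := ((q.1 - p.1) * (c - a) - (r.1 - p.1) * (b - a)) / D in
  (a - k1 * p.1 - k2 * p.2, k1, k2).

Lemma interpE a b c : [/\ affn (interp a b c) p = a, affn (interp a b c) q = b &
  affn (interp a b c) r = c].
Proof.
have D1 : (q.1 - p.1) * (r.2 - p.2) - (q.2 - p.2) * (r.1 - p.1) != 0 by exact: D0.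
by rewrite /affn /interp /= /D; split; field.
Qed.

(** Barycentric coordinates equal 1/3 at the centroid, and M controls their slopes: within radius
    1/(6 (M + 1)) they move by at most 1/6, so [bar1] and [bar2] stay between 1/6 and 1/2. *)
Lemma triangle_ball : exists d x, 0 < d /\ [set z | edist x z <= d / 2] `<=` hull [:: p; q; r].
Proof.
pose M := (`|r.2 - p.2| + `|r.1 - p.1| + `|q.1 - p.1| + `|q.2 - p.2|) / `|D|.
have Dp : 0 < `|D| by rewrite normr_gt0.
have M0 : 0 <= M by rewrite divr_ge0// !addr_ge0.
pose x : plane R := ((p.1 + q.1 + r.1) / 3, (p.2 + q.2 + r.2) / 3).
pose d := (6 * (M + 1))^-1.
have d0 : 0 < d by rewrite invr_gt0 mulr_gt0// ltr_wpDl.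
exists (2 * d), x; split; first by rewrite mulr_gt0.
move=> z /=; rewrite mulrC mulrA mulVf// mul1r => zd.
have [] := radius_ge (x - z); rewrite -/(edist x z) /= => u1 u2.
have {}u1 := le_trans u1 zd; have {}u2 := le_trans u2 zd.
have key a b : `|a| + `|b| <= M * `|D| -> `|((x.1 - z.1) * a + (x.2 - z.2) * b) / D| <= 6^-1.
  move=> ab; rewrite normrM normfV ler_pdivrMr//.
  apply: le_trans (ler_normD _ _) _; rewrite !normrM.
  apply: le_trans (_ : d * (`|a| + `|b|) <= _).
    by rewrite mulrDr; apply: lerD; apply: ler_wpM2r.
  apply: le_trans (_ : d * (M * `|D|) <= _); first by rewrite ler_wpM2l// ltW.
  rewrite mulrA ler_wpM2r//; rewrite /d invfM -mulrA ler_piMr//.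
  by rewrite mulrC ler_pdivrMr ?mul1r ?lerDl// ltr_wpDl.
have MD : M * `|D| = `|r.2 - p.2| + `|r.1 - p.1| + `|q.1 - p.1| + `|q.2 - p.2|.
  by rewrite /M divfK// gt_eqF.
have k1 := key (r.2 - p.2) (- (r.1 - p.1)).
have k2 := key (- (q.2 - p.2)) (q.1 - p.1).
have {}k1 := k1 _; have {}k2 := k2 _.
have E1 : bar1 z = 3^-1 - ((x.1 - z.1) * (r.2 - p.2) + (x.2 - z.2) * - (r.1 - p.1)) / D.
  by rewrite /bar1 /x /= -[3^-1](mulfK D0) -mulrBl /D; congr (_ / _); field.
have E2 : bar2 z = 3^-1 - ((x.1 - z.1) * - (q.2 - p.2) + (x.2 - z.2) * (q.1 - p.1)) / D.
  by rewrite /bar2 /x /= -[3^-1](mulfK D0) -mulrBl /D; congr (_ / _); field.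
have {}k1 : `|3^-1 - bar1 z| <= 6^-1.
  rewrite E1 subKr; apply: k1; rewrite MD normrN.
  by have := normr_ge0 (q.1 - p.1); have := normr_ge0 (q.2 - p.2); lra.
have {}k2 : `|3^-1 - bar2 z| <= 6^-1.
  rewrite E2 subKr; apply: k2; rewrite MD normrN.
  by have := normr_ge0 (r.1 - p.1); have := normr_ge0 (r.2 - p.2); lra.
apply/hull3; move: k1 k2; rewrite !ler_norml => k1 k2; split; lra.
Qed.

End OneTriangle.

(** [inball_diam] is a supremum, positive by [triangle_ball]; an inscribed ball of diameter above
    half of it is chosen, which costs the factor 2. *)
Lemma triangle_nice_ball K (gamma : R) : is_triangle K ->
  diam (hull K) / inball_diam (hull K) <= gamma ->
  0 <= gamma /\ exists d x, [/\ 0 < d, [set z | edist x z <= d / 2] `<=` hull K &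
    diam (hull K) <= 2 * gamma * d].
Proof.
move=> [p [q [r [-> D0]]]]; set K' := [:: p; q; r] => hg.
have [d0 [x0 [d00 x0K]]] := triangle_ball D0.
pose B := [set d : R | 0 <= d /\ exists p, [set q | edist p q <= d / 2] `<=` hull K'].
have Bub d : B d -> d <= diam (hull K').
  move=> [dge [x xK]].
  have -> : d = edist (x.1 + d / 2, x.2) (x.1 - d / 2, x.2).
    rewrite /edist /radius /=; have -> : x.1 + d / 2 - (x.1 - d / 2) = d by field.
    by rewrite subrr expr0n addr0 sqrtr_sqr ger0_norm.
  have ball e : `|e| <= d / 2 -> hull K' (x.1 + e, x.2).
    move=> ed; apply: xK; rewrite /= /edist /radius /= subrr expr0n addr0.
    by rewrite sqrtr_sqr opprD addNKr normrN.
  have dd : 0 <= d / 2 by rewrite divr_ge0.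
  by apply: edist_le_diam; apply: ball; rewrite ?normrN ger0_norm.
have B0 : B d0 by split; [exact: ltW|exists x0].
have hsB : has_sup B by split; [exists d0|exists (diam (hull K')) => d; exact: Bub].
have supE : inball_diam (hull K') = sup B by [].
have sup0 : 0 < sup B by apply: lt_le_trans d00 _; exact: (ub_le_sup hsB.2).
have diam0 : 0 <= diam (hull K') by apply: le_trans (ltW d00) _; exact: Bub.
have g0 : 0 <= gamma by apply: le_trans hg; rewrite supE divr_ge0// ltW.
split => //.
have [|d Bd dB] := @sup_adherent _ B (sup B / 2) _ hsB; first by rewrite divr_gt0.
move: (Bd) => [_ [x xK]].
have dh : sup B < 2 * d by move: dB; lra.
exists d, x; split => //; first by move: dh sup0; lra.
move: hg; rewrite supE ler_pdivrMr// => /le_trans; apply.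
have -> : 2 * gamma * d = gamma * (2 * d) by ring.
by apply: ler_wpM2l => //; exact: ltW.
Qed.

(** The bound at the vertices holds on the whole inscribed ball, and a slope is the difference of
    two values across a diameter of length d. *)
Lemma affn_grad_le s k (M d : R) x : 0 < d -> [set z | edist x z <= d / 2] `<=` hull s ->
  {in s, forall y, `|affn k y| <= M} -> `|k.1.2| <= 2 * M / d /\ `|k.2| <= 2 * M / d.
Proof.
move=> d0 xs kM; have d2 : 0 <= d / 2 by rewrite divr_ge0// ltW.
have H y : edist x y <= d / 2 -> `|affn k y| <= M by move=> /xs; exact: affn_hull_le.
have [h1 h2 h3 h4] : [/\ edist x (x.1 + d / 2, x.2) <= d / 2, edist x (x.1 - d / 2, x.2) <= d / 2,
   edist x (x.1, x.2 + d / 2) <= d / 2 & edist x (x.1, x.2 - d / 2) <= d / 2].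
  rewrite /edist /radius /= !subrr !expr0n/= !addr0 !add0r !sqrtr_sqr !opprD !opprK !addNKr.
  by rewrite !normrN ger0_norm.
have {}h1 := H _ h1; have {}h2 := H _ h2; have {}h3 := H _ h3; have {}h4 := H _ h4.
rewrite !ler_pdivlMr//; split.
- have -> : `|k.1.2| * d = `|affn k (x.1 + d / 2, x.2) - affn k (x.1 - d / 2, x.2)|.
    by rewrite -{1}(ger0_norm (ltW d0)) -normrM; congr (`|_|); rewrite /affn /=; field.
  by apply: le_trans (ler_normB _ _) _; lra.
- have -> : `|k.2| * d = `|affn k (x.1, x.2 + d / 2) - affn k (x.1, x.2 - d / 2)|.
    by rewrite -{1}(ger0_norm (ltW d0)) -normrM; congr (`|_|); rewrite /affn /=; field.
  by apply: le_trans (ler_normB _ _) _; lra.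
Qed.

End Triangles.

(** * Compact margins and gluing of Lipschitz pieces *)

Section Coverings.
Variable R : realType.

Lemma compact_margin (K Om : set (plane R)) : compact K -> open Om -> K `<=` Om ->
  exists2 e : R, 0 < e & forall z x : plane R, K z -> `|x.1 - z.1| <= e -> `|x.2 - z.2| <= e -> Om x.
Proof.
move=> cK oO KO.
have H : \forall e \near (0 : R)^'+, K `<=` [set z | forall x : plane R, `|x.1 - z.1| <= e -> `|x.2 - z.2| <= e -> Om x].
  apply: (compact_near_coveringP K).1 cK _ _ _ _ _ => z Kz.
  have [e e0 eO] : exists2 e : R, 0 < e & forall q : plane R, `|z.1 - q.1| < e -> `|z.2 - q.2| < e -> Om q.
    have /nbhs_ballP[e e0 eA] : nbhs z Om by apply: open_nbhs_nbhs; split => //; exact: KO.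
    by exists e => // q q1 q2; apply: eA.
  have e2 : 0 < e / 2 by rewrite divr_gt0.
  exists (ball z (e / 2), [set t : R | t < e / 2]) => /=.
    split; first exact: nbhsx_ballx.
    by apply: nbhs_right_lt.
  move=> [y t] /= [[y1 y2] te] x x1 x2; apply: eO.
    rewrite (_ : z.1 - x.1 = (z.1 - y.1) - (x.1 - y.1)); last by ring.
    by apply: le_lt_trans (ler_normB _ _) _; rewrite [e]splitr ltrD// (le_lt_trans x1).
  rewrite (_ : z.2 - x.2 = (z.2 - y.2) - (x.2 - y.2)); last by ring.
  by apply: le_lt_trans (ler_normB _ _) _; rewrite [e]splitr ltrD// (le_lt_trans x2).
have : \forall e \near (0 : R)^'+, 0 < e by exact: nbhs_right_gt.
move=> H2; have [e [e0 eP]] := filter_ex (filterI H2 H).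
by exists e => // z x Kz; apply: eP.
Qed.

Definition thicken (K : set (plane R)) (d : R) : set (plane R) :=
  [set z.1 + z.2 | z in K `*` (`[- d, d] `*` `[- d, d] : set (plane R))].

Lemma compact_thicken K d : compact K -> compact (thicken K d).
Proof.
move=> cK; apply: continuous_compact.
  apply: continuous_subspaceT => z; apply: cvgD; [exact: cvg_fst|exact: cvg_snd].
by apply: compact_setX => //; apply: compact_setX; exact: segment_compact.
Qed.

Lemma thickenP K d x : thicken K d x <-> exists2 z, K z & `|x.1 - z.1| <= d /\ `|x.2 - z.2| <= d.
Proof.
split=> [[[z u] [Kz [/= u1 u2]] <-]|[z Kz [x1 x2]]].
  exists z => //=; move: u1 u2; rewrite !in_itv/= -!ler_norml => u1 u2.
  by rewrite ![_ + _ - _]addrAC !subrr !add0r.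
exists (z, x - z); last by rewrite /= addrC subrK.
by split => //; split; rewrite /= in_itv/= -ler_norml.
Qed.

(** Let x be the last point of [s, t] in a piece containing s. From s to x the bound of that piece
    applies; beyond x the piece never occurs again, so the number of pieces drops. *)
Lemma lip_cover n (F : 'I_n -> set R) (f : R -> R) (C : R) : (forall i, closed (F i)) ->
  (forall i s t, F i s -> F i t -> `|f s - f t| <= C * `|s - t|) ->
  forall (A : {set 'I_n}) s t, s <= t ->
  (forall x, s <= x <= t -> exists2 i, i \in A & F i x) -> `|f t - f s| <= C * (t - s).
Proof.
move=> cF lF A; have [m] := ubnP #|A|; elim: m A => // m IH A Am s t st cov.
have [|i iA Fs] := cov s; first by rewrite lexx.
pose X := F i `&` `[s, t]; have X0 : X !=set0 by exists s; split => //=; rewrite in_itv/= lexx.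
have Xt : ubound X t by move=> x [_ /=]; rewrite in_itv/= => /andP[].
have cX : closed X by apply: closedI => //; exact: itv_closed.
pose x := sup X.
have [Fx /=] : X x by rewrite (closure_id X).1//; apply: closure_sup => //; exists t.
rewrite in_itv/= => /andP[sx xt].
have fx : `|f x - f s| <= C * (x - s).
  by have := lF i x s Fx Fs; rewrite [`|x - s|]ger0_norm// subr_ge0.
have [xtE|xtN] := eqVneq x t; first by rewrite -xtE.
have {xtN}xt' : x < t by rewrite lt_neqAle xtN.
have cov' y : x < y <= t -> exists2 i0, i0 \in A :\ i & F i0 y.
  move=> /andP[xy yt]; have [|k kA Fk] := cov y; first by rewrite yt (le_trans sx (ltW xy)).
  exists k => //; rewrite !inE kA andbT; apply: contraPneq Fk => -> Fy.
  have : y <= x by apply: ub_le_sup; [exists t|split => //=; rewrite in_itv/= yt (le_trans sx (ltW xy))].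
  by rewrite leNgt xy.
(* Another piece covers x as well: finitely many closed sets missing x would all miss a right
   neighbourhood of x. *)
have covx : exists2 i0, i0 \in A :\ i & F i0 x.
  apply: contrapT => /forall2NP nF.
  have : \forall y \near x^'+, forall k, k \in A :\ i -> ~ F k y.
    apply: filter_forall => k; have [kA|kA] := boolP (k \in A :\ i); last by near=> y.
    have Fkx : ~ F k x by case: (nF k).
    have : \forall y \near x, (~` F k) y by apply: open_nbhs_nbhs; split => //; exact: closed_openC.
    by rewrite near_withinE; apply: filterS => y Fy _ _.
  move=> H; have H1 : \forall y \near x^'+, x < y by exact: nbhs_right_gt.
  have H2 : \forall y \near x^'+, y < t by exact: nbhs_right_lt.
  have [y [[xy yt] Hy]] := filter_ex (filterI (filterI H1 H2) H).
  have [|k kA Fk] := cov' y; first by rewrite xy ltW.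
  exact: Hy k kA Fk.
have H := IH (A :\ i) _ x t xt _.
rewrite (_ : f t - f s = (f t - f x) + (f x - f s)); last by ring.
apply: le_trans (ler_normD _ _) _.
have {}H : `|f t - f x| <= C * (t - x).
  apply: H; first by move: Am; rewrite (cardsD1 i) iA add1n ltnS.
  move=> y /andP[]; rewrite le_eqVlt => /predU1P[<- _ //|xy yt]; apply: cov'; by rewrite xy.
by move: H fx; rewrite !mulrBr; lra.
Unshelve. all: by end_near. Qed.

End Coverings.

Lemma plane_lip (R : realType) (w : plane R -> R) (K : R) :
  (forall p t, `|w (p + t *: e1 R) - w p| <= K * `|t|) ->
  (forall p t, `|w (p + t *: e2 R) - w p| <= K * `|t|) ->
  forall x y, `|w y - w x| <= K * (`|y.1 - x.1| + `|y.2 - x.2|).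
Proof.
move=> w1 w2 x y; have := w1 x (y.1 - x.1).
have := w2 (x + (y.1 - x.1) *: e1 R) (y.2 - x.2).
have -> : x + (y.1 - x.1) *: e1 R + (y.2 - x.2) *: e2 R = y.
  rewrite -addrA [RHS](_ : y = x + (y - x)); last by rewrite addrC subrK.
  by congr (_ + _); exact: (esym (plane_basis (y - x))).
set a := w (x + _); rewrite mulrDr => h1 h2.
rewrite (_ : w y - w x = (w y - a) + (a - w x)); last by ring.
by apply: le_trans (ler_normD _ _) _; rewrite addrC lerD.
Qed.

(** * First-order Taylor estimate *)

Section Taylor.
Variables (R : realType) (f : plane R -> R) (B : R).
Hypothesis sf : smooth f.

Lemma smooth_lip2 : (forall p, `|'D_(e1 R) f p| <= B) -> (forall p, `|'D_(e2 R) f p| <= B) ->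
  forall x y, `|f y - f x| <= B * (`|y.1 - x.1| + `|y.2 - x.2|).
Proof. by move=> b1 b2; apply: plane_lip; apply: smooth_lip. Qed.

Lemma smooth_taylor :
  (forall x y, `|'D_(e1 R) f y - 'D_(e1 R) f x| <= B * (`|y.1 - x.1| + `|y.2 - x.2|)) ->
  (forall x y, `|'D_(e2 R) f y - 'D_(e2 R) f x| <= B * (`|y.1 - x.1| + `|y.2 - x.2|)) ->
  forall x z, `|f z - (f x + 'D_(e1 R) f x * (z.1 - x.1) + 'D_(e2 R) f x * (z.2 - x.2))| <=
    B * (`|z.1 - x.1| + `|z.2 - x.2|) ^+ 2.
Proof.
move=> b1 b2 x z; pose u : plane R := z - x.
pose F t := f (x + t *: u).
have dF t : is_derive t (1 : R) F ('D_u f (x + t *: u)).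
  by apply: is_derive_line; exact: smooth_differentiable.
have [c] : exists2 c, c \in `[0, 1]%R & F 1 - F 0 = 'D_u f (x + c *: u) * (1 - 0).
  apply: MVT_segment => //.
  apply: continuous_subspaceT => t; apply: differentiable_continuous.
  by apply/derivable1_diffP; have [] := dF t.
rewrite in_itv/= => /andP[c0 c1]; rewrite /F scale0r addr0 scale1r subr0 mulr1.
have -> : x + u = z by rewrite /u addrC subrK.
rewrite derive_basis; last exact: smooth_differentiable.
set y := x + c *: u => E.
have y1 : `|y.1 - x.1| <= `|z.1 - x.1|.
  have -> : y.1 - x.1 = c * (z.1 - x.1).
    by rewrite -[y.1]/(x.1 + c * (z.1 - x.1)) addrAC subrr add0r.
  by rewrite normrM (ger0_norm c0) ler_piMl.
have y2 : `|y.2 - x.2| <= `|z.2 - x.2|.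
  have -> : y.2 - x.2 = c * (z.2 - x.2).
    by rewrite -[y.2]/(x.2 + c * (z.2 - x.2)) addrAC subrr add0r.
  by rewrite normrM (ger0_norm c0) ler_piMl.
rewrite (_ : f z - _ = ('D_(e1 R) f y - 'D_(e1 R) f x) * (z.1 - x.1) +
  ('D_(e2 R) f y - 'D_(e2 R) f x) * (z.2 - x.2)); last first.
  by have -> : f z = f x + (f z - f x) by [ring]; rewrite E /u /=; ring.
set U := `|z.1 - x.1| + `|z.2 - x.2|.
have B0 : B * (`|y.1 - x.1| + `|y.2 - x.2|) <= B * U.
  have := b1 x (x.1 + 1, x.2); rewrite /= subrr normr0 addr0 addrAC subrr add0r normr1 mulr1.
  by move=> /(le_trans (normr_ge0 _)) B0; apply: ler_wpM2l => //; apply: lerD.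
apply: le_trans (ler_normD _ _) _; rewrite !normrM expr2 mulrA [X in _ <= X]mulrDr.
by apply: lerD; apply: ler_wpM2r => //; apply: le_trans B0; [exact: b1|exact: b2].
Qed.

End Taylor.

(** * Nodal interpolation of a test function *)

Section Interpolant.
Variable R : realType.
Variables (Om : set (plane R)) (phi : plane R -> R) (K0 : set (plane R)).
Variables (T : mesh R) (gamma B1 B r0 : R).
Hypotheses (oOm : open Om) (sphi : smooth phi) (cK0 : compact K0).
Hypothesis phi0 : forall x, ~ K0 x -> phi x = 0.
Hypothesis r0K : forall z x : plane R, K0 z -> `|x.1 - z.1| <= r0 -> `|x.2 - z.2| <= r0 -> Om x.
Hypotheses (b1 : forall p, `|'D_(e1 R) phi p| <= B1) (b2 : forall p, `|'D_(e2 R) phi p| <= B1).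
Hypothesis l1 : forall x y, `|'D_(e1 R) phi y - 'D_(e1 R) phi x| <= B * (`|y.1 - x.1| + `|y.2 - x.2|).
Hypothesis l2 : forall x y, `|'D_(e2 R) phi y - 'D_(e2 R) phi x| <= B * (`|y.1 - x.1| + `|y.2 - x.2|).
Hypotheses (mT : mesh_of Om T) (sT : shape_regular gamma T).
Let h := mesh_size T.
Hypotheses (r00 : 0 < r0) (hr0 : h < r0 / 2).

Lemma diam_le_size K : K \in T -> diam (hull K) <= h.
Proof.
rewrite /h /mesh_size; elim: T => // L T' IH; rewrite inE big_cons le_max.
by case/predU1P => [->|/IH ->]; rewrite ?lexx ?orbT.
Qed.

Let tri K : K \in T -> is_triangle K. Proof. by case: mT => H _ _; exact: H. Qed.

Definition nodal (K : triangle R) : R * R * R := xget (0, 0, 0) [set k | {in K, affn k =1 phi}].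

Lemma nodalP K : is_triangle K -> {in K, affn (nodal K) =1 phi}.
Proof.
move=> [p [q [r [-> D0]]]]; rewrite /nodal; case: xgetP => // /(_ (interp p q r (phi p) (phi q) (phi r))).
case; have [Ep Eq Er] := interpE D0 (phi p) (phi q) (phi r).
by move=> z; rewrite !inE => /or3P[] /eqP ->.
Qed.

(** The nodal interpolant minus the Taylor polynomial of phi at x is affine and at most 4 B diam^2
    at the vertices. [affn_grad_le] gives slopes at most 8 B diam^2 / d, and diam <= 2 gamma d turns
    this into 16 B gamma h. *)
Lemma nodal_grad K x : K \in T -> hull K x ->
  `|(nodal K).1.2 - 'D_(e1 R) phi x| <= 16 * B * gamma * h /\
  `|(nodal K).2 - 'D_(e2 R) phi x| <= 16 * B * gamma * h.
Proof.
move=> KT Kx; have tK := tri KT; set k := nodal K.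
have [g0 [d [c [d0 cK hd]]]] := triangle_nice_ball tK (sT KT).
have dh := diam_le_size KT.
set hK := diam (hull K) in hd dh.
have h0 : 0 <= hK by have [] := diam_coord Kx Kx; rewrite subrr normr0.
have B0 : 0 <= B.
  have := l1 x (x.1 + 1, x.2); rewrite /= subrr normr0 addr0 addrAC subrr add0r normr1 mulr1.
  exact: le_trans.
pose k' := (k.1.1 - (phi x - 'D_(e1 R) phi x * x.1 - 'D_(e2 R) phi x * x.2),
  k.1.2 - 'D_(e1 R) phi x, k.2 - 'D_(e2 R) phi x).
have kM : {in K, forall z, `|affn k' z| <= 4 * B * hK ^+ 2}.
  move=> z zK; have -> : affn k' z = affn k z - (phi x + 'D_(e1 R) phi x * (z.1 - x.1) +
    'D_(e2 R) phi x * (z.2 - x.2)) by rewrite /affn /=; ring.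
  rewrite /k nodalP//; apply: le_trans (smooth_taylor sphi l1 l2 x z) _.
  have [z1 z2] := diam_coord (hull_mem zK) Kx.
  rewrite [4 * B]mulrC -mulrA; apply: ler_wpM2l => //.
  have -> : 4 * hK ^+ 2 = (hK + hK) ^+ 2 by ring.
  by rewrite ler_pXn2r ?nnegrE ?addr_ge0// lerD.
have bd : 2 * (4 * B * hK ^+ 2) / d <= 16 * B * gamma * h.
  rewrite ler_pdivrMr//.
  have -> : 2 * (4 * B * hK ^+ 2) = (8 * B * hK) * hK by ring.
  have -> : 16 * B * gamma * h * d = (8 * B * h) * (2 * gamma * d) by ring.
  have B8 : 0 <= 8 * B by rewrite mulr_ge0.
  by apply: ler_pM => //; [rewrite mulr_ge0|rewrite ler_wpM2l].
have [g1 g2] := affn_grad_le d0 cK kM.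
by split; [exact: le_trans g1 bd|exact: le_trans g2 bd].
Qed.

(** Any triangle containing x may supply the value; [interpolantE] shows by conformity of the mesh
    that the choice does not matter. *)
Definition interpolant x : R :=
  if pselect (exists2 K, K \in T & hull K x) is left H then affn (nodal (projT1 (cid2 H))) x else 0.

Lemma interpolantE K x : K \in T -> hull K x -> interpolant x = affn (nodal K) x.
Proof.
move=> KT Kx; rewrite /interpolant; case: pselect => [H|]; last by case; exists K.
case: cid2 => /= K' K'T K'x.
have [_ _ conf] := mT; have : (hull K `&` hull K') x by [].
rewrite conf// => hx; apply: (affn_hull_eq _ hx) => z; rewrite mem_filter => /andP[zK' zK].
by rewrite !nodalP//; exact: tri.
Qed.

Lemma cover_Om x : Om x -> exists2 K, K \in T & hull K x.
Proof.
move=> Ox; have [_ cov _] := mT; have : closure Om x by exact: subset_closure.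
by rewrite -cov => -[K KT Kx]; exists K.
Qed.

Let K1 := thicken K0 h.

Lemma thicken_Om : K1 `<=` Om.
Proof.
move=> x /thickenP[z Kz [x1 x2]]; have hr : h <= r0 by move: r00 hr0; lra.
by apply: (r0K Kz); [exact: le_trans x1 hr|exact: le_trans x2 hr].
Qed.

(** A triangle with a vertex in [K0] reaches at most [h] beyond it; all other triangles have zero
    nodal values. *)
Lemma interpolant_supp x : ~ K1 x -> interpolant x = 0.
Proof.
move=> Kx; rewrite /interpolant; case: pselect => // H; case: cid2 => /= K KT hx.
suff -> : affn (nodal K) x = affn (0, 0, 0) x by rewrite /affn /= !mul0r !addr0.
apply: (affn_hull_eq _ hx) => z zK; rewrite nodalP//; last exact: tri.
rewrite phi0 ?/affn/= ?mul0r ?addr0//; apply: contra_not Kx => Kz; apply/thickenP.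
exists z => //; have [h1 h2] := diam_coord hx (hull_mem zK).
have dh := diam_le_size KT.
by split; [exact: le_trans h1 dh|exact: le_trans h2 dh].
Qed.

Lemma interpolant_out x : ~ Om x -> interpolant x = 0.
Proof. by move=> Ox; apply: interpolant_supp => /thicken_Om. Qed.

Lemma affn_line k p v (t : R) : affn k (p + t *: v) = affn k p + t * (k.1.2 * v.1 + k.2 * v.2).
Proof.
rewrite /affn -[(p + t *: v).1]/(p.1 + t * v.1) -[(p + t *: v).2]/(p.2 + t * v.2).
by ring.
Qed.

Lemma bar_line a b c p v : exists w, forall t : R,
  bar1 a b c (p + t *: v) = bar1 a b c p + t * w.1 /\
  bar2 a b c (p + t *: v) = bar2 a b c p + t * w.2.
Proof.
exists ((v.1 * (c.2 - a.2) - v.2 * (c.1 - a.1)) /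
    ((b.1 - a.1) * (c.2 - a.2) - (b.2 - a.2) * (c.1 - a.1)),
  ((b.1 - a.1) * v.2 - (b.2 - a.2) * v.1) /
    ((b.1 - a.1) * (c.2 - a.2) - (b.2 - a.2) * (c.1 - a.1))) => t.
rewrite /bar1 /bar2 -[(p + t *: v).1]/(p.1 + t * v.1) -[(p + t *: v).2]/(p.2 + t * v.2).
by split; rewrite /= mulrA -mulrDl; congr (_ / _); ring.
Qed.

Lemma closed_hull_line K p v : is_triangle K -> closed [set t : R | hull K (p + t *: v)].
Proof.
move=> [a [b [c [-> D0]]]].
have cl (u w : R) : closed [set t : R | 0 <= u + t * w].
  apply: (@closed_comp _ _ (fun t : R => u + t * w) [set x | 0 <= x]); last exact: closed_ge.
  move=> t _; apply: cvgD; first exact: cvg_cst.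
  by apply: cvgM; [exact: cvg_id|exact: cvg_cst].
have [[w1 w2] /= E] := bar_line a b c p v.
rewrite (_ : [set t | _] = [set t | 0 <= bar1 a b c p + t * w1] `&`
  ([set t | 0 <= bar2 a b c p + t * w2] `&`
   [set t | 0 <= (1 - bar1 a b c p - bar2 a b c p) + t * (- w1 - w2)])).
  by apply: closedI => //; apply: closedI.
apply/seteqP; split => t /=; have [E1 E2] := E t.
  by move/(hull3 D0); rewrite E1 E2 => -[? ? ?]; split => //; split => //; lra.
by move=> [h1 [h2 h3]]; apply/(hull3 D0); rewrite E1 E2; split => //; lra.
Qed.

Lemma hull_line_convex K p v (s t u : R) : is_triangle K -> hull K (p + s *: v) ->
  hull K (p + t *: v) -> s <= u <= t -> hull K (p + u *: v).
Proof.
move=> [a [b [c [-> D0]]]] /(hull3 D0)[s1 s2 s3] /(hull3 D0)[t1 t2 t3] /andP[su ut].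
have cv (x w : R) : 0 <= x + s * w -> 0 <= x + t * w -> 0 <= x + u * w.
  move=> h1 h2; have [w0|/ltW w0] := leP 0 w.
    by apply: le_trans h1 _; rewrite lerD2l ler_wpM2r.
  by apply: le_trans h2 _; rewrite lerD2l ler_wnM2r.
have [[w1 w2] /= E] := bar_line a b c p v.
move: s1 s2 s3 t1 t2 t3; rewrite !(proj1 (E _)) !(proj2 (E _)) => s1 s2 s3 t1 t2 t3.
have c3 := cv (1 - bar1 a b c p - bar2 a b c p) (- w1 - w2).
apply/(hull3 D0); rewrite (proj1 (E _)) (proj2 (E _)); split; [exact: cv|exact: cv|].
by rewrite -subr_ge0; move: s3 t3 c3; lra.
Qed.

Section Direction.
Variable v : plane R.
Hypothesis v12 : v = e1 R \/ v = e2 R.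
Let C := 16 * B * gamma.
Let kv (k : R * R * R) := k.1.2 * v.1 + k.2 * v.2.

Lemma kv_grad K x : K \in T -> hull K x -> `|kv (nodal K) - 'D_v phi x| <= C * h.
Proof.
move=> KT Kx; have [g1 g2] := nodal_grad KT Kx.
case: v12 => vE.
  have -> : kv (nodal K) = (nodal K).1.2 by rewrite /kv vE /=; ring.
  by rewrite vE.
have -> : kv (nodal K) = (nodal K).2 by rewrite /kv vE /=; ring.
by rewrite vE.
Qed.

(** On a line, the triangles and the complement of [Om], where the interpolant is 0, form a finite
    closed cover with a Lipschitz bound on each piece; [lip_cover] glues them. Index 0 of [F] is the
    complement. *)
Lemma interpolant_lip x t : `|interpolant (x + t *: v) - interpolant x| <= (B1 + `|C * h|) * `|t|.
Proof.
have K0' : 0 <= B1 + `|C * h| by rewrite addr_ge0//; apply: le_trans (b1 x).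
wlog t0 : x t / 0 <= t.
  move=> H; have [|/ltW t0] := leP 0 t; first exact: H.
  have := H (x + t *: v) (- t); rewrite oppr_ge0 => /(_ t0).
  by rewrite scaleNr addrK normrN distrC.
rewrite [`|t|]ger0_norm//; pose f s := interpolant (x + s *: v).
pose F (i : 'I_(size T).+1) : set R := if unlift ord0 i is Some j then
  [set s | hull (nth [::] T j) (x + s *: v)] else [set s | ~ Om (x + s *: v)].
have := @lip_cover R _ F f (B1 + `|C * h|).
have memT (j : 'I_(size T)) : nth [::] T j \in T by rewrite mem_nth.
move/(_ _ _ finset.setT 0 t t0); rewrite /f scale0r addr0 subr0; apply.
- move=> i; rewrite /F; case: unliftP => [j _|_]; first exact/closed_hull_line/tri.
  apply: (@closed_comp _ _ (fun s : R => x + s *: v) (~` Om)); last exact: open_closedC.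
  move=> s _; apply: cvgD; first exact: cvg_cst.
  by apply: cvgZr_tmp.
- move=> i s u; rewrite /F; case: unliftP => [j _|_] /= Fs Fu; last first.
    by rewrite !interpolant_out// subrr normr0 mulr_ge0.
  rewrite !(interpolantE (memT j))// !affn_line.
  rewrite (_ : _ - _ = (s - u) * kv (nodal (nth [::] T j))); last by rewrite /kv; ring.
  rewrite normrM mulrC; apply: ler_wpM2r => //.
  have := kv_grad (memT j) Fs; set g := kv _ => gD.
  have bv : `|'D_v phi (x + s *: v)| <= B1 by case: v12 => ->.
  rewrite -(subrK ('D_v phi (x + s *: v)) g) addrC.
  apply: le_trans (ler_normD _ _) _; apply: lerD => //.
  exact: le_trans gD (ler_norm _).
- move=> s _; have [Os|Os] := pselect (Om (x + s *: v)); last first.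
    by exists ord0 => //; rewrite /F unlift_none.
  have [K KT Ks] := cover_Om Os.
  have iT : (index K T < size T)%N by rewrite index_mem.
  by exists (lift ord0 (Ordinal iT)) => //; rewrite /F liftK /= nth_index.
Qed.

(* A ray issued from [x] stays in one triangle for small times, so that the interpolant has
   one-sided directional derivatives everywhere. *)
Lemma interpolant_slope x : exists2 g, quot v interpolant n x @[n --> \oo] --> g &
  `|g - 'D_v phi x| <= `|C * h|.
Proof.
have cvt : x + n.+1%:R^-1 *: v @[n --> \oo] --> x.
  rewrite -[X in _ --> X]addr0; apply: cvgD; first exact: cvg_cst.
  by rewrite -(scale0r v); apply: cvgZr_tmp; exact: cvg_harmonic.
have [Ox|Ox] := pselect (Om x); last first.
  have Z y : `|y.1 - x.1| <= r0 / 2 -> `|y.2 - x.2| <= r0 / 2 -> interpolant y = 0 /\ phi y = 0.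
    move=> y1 y2; have hh z : K0 z -> `|y.1 - z.1| <= r0 / 2 -> `|y.2 - z.2| <= r0 / 2 -> False.
      move=> Kz z1 z2; apply: Ox; apply: (r0K Kz).
        rewrite (_ : x.1 - z.1 = (y.1 - z.1) - (y.1 - x.1)); last by ring.
        by apply: le_trans (ler_normB _ _) _; lra.
      rewrite (_ : x.2 - z.2 = (y.2 - z.2) - (y.2 - x.2)); last by ring.
      by apply: le_trans (ler_normB _ _) _; lra.
    have r2 : 0 <= r0 / 2 by apply: le_trans y1.
    split; last by apply: phi0 => Ky; apply: (hh y Ky); rewrite subrr normr0.
    apply: interpolant_supp => /thickenP[z Kz [y1' y2']].
    by apply: (hh z Kz); apply: ltW; [exact: le_lt_trans y1' hr0|exact: le_lt_trans y2' hr0].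
  have N : \forall y \near x, `|y.1 - x.1| <= r0 / 2 /\ `|y.2 - x.2| <= r0 / 2.
    have r2 : 0 < r0 / 2 by rewrite divr_gt0.
    apply/nbhs_ballP; exists (r0 / 2) => // y [/= y1 y2].
    by rewrite distrC [`|y.2 - _|]distrC; split; exact: ltW.
  have nx := nbhs_singleton N.
  exists 0.
    have Nn : \forall n \near \oo, `|(x + n.+1%:R^-1 *: v).1 - x.1| <= r0 / 2 /\
      `|(x + n.+1%:R^-1 *: v).2 - x.2| <= r0 / 2 by exact: cvt N.
    apply: cvg_near_cst; apply: filterS Nn => n [y1 y2].
    by rewrite /quot (Z _ y1 y2).1 (Z x nx.1 nx.2).1 subrr mulr0.
  suff -> : 'D_v phi x = 0 by rewrite subrr normr0.
  rewrite -(derive_cst (0 : R) x v); apply: near_eq_derive.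
  by apply: filterS N => y [y1 y2]; exact: (Z y y1 y2).2.
have evO : \forall n \near \oo, Om (x + n.+1%:R^-1 *: v).
  by apply: cvt; exact: open_nbhs_nbhs.
have [K KT [N NP]] : exists2 K, K \in T & exists N, forall n, (N <= n)%N -> hull K (x + n.+1%:R^-1 *: v).
  apply: contrapT => nK.
  (* As n grows, the points approach x along the ray; by convexity, once they have left a triangle
     they never return to it. If no triangle kept them, all would be left for good, although points
     of [Om] are covered. *)
  have out K : K \in T -> \forall n \near \oo, ~ hull K (x + n.+1%:R^-1 *: v).
    move=> KT; have tK := tri KT.
    have [[N KN]|nex] := pselect (exists N, hull K (x + N.+1%:R^-1 *: v)); last first.
      by apply: nearW => n Kn; apply: nex; exists n.
    have [m [Nm nKm]] : exists m, (N <= m)%N /\ ~ hull K (x + m.+1%:R^-1 *: v).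
      apply: contrapT => H; apply: nK; exists K => //; exists N => n Nn.
      by apply: contrapT => nKn; apply: H; exists n.
    exists m => // n /= mn Kn; apply: nKm.
    apply: (hull_line_convex tK Kn KN).
    by rewrite !lef_pV2 ?posrE// !ler_nat !ltnS mn Nm.
  have outT (T' : mesh R) : {subset T' <= T} ->
      \forall n \near \oo, forall K, K \in T' -> ~ hull K (x + n.+1%:R^-1 *: v).
    elim: T' => [_|K T' IH sub]; first by apply: nearW.
    have o1 := out K (sub K (mem_head _ _)).
    have o2 : \forall n \near \oo, forall K, K \in T' -> ~ hull K (x + n.+1%:R^-1 *: v).
      by apply: IH => K' K'T'; apply: sub; rewrite inE K'T' orbT.
    apply: filterS2 o1 o2 => n n1 n2 K'; rewrite inE => /predU1P[->//|]; exact: n2.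
  have [n [On nT]] := filter_ex (filterI evO (outT T (fun K KT => KT))).
  by have [K KT Kn] := cover_Om On; exact: nT K KT Kn.
have Kx : hull K x.
  have cl := closed_hull_line (p := x) (v := v) (tri KT).
  have : [set t : R | hull K (x + t *: v)] 0.
    apply: (closed_cvg (F := \oo) (u_ := fun n => n.+1%:R^-1 : R) _ cl).
    - by exists N => // n /= Nn; exact: NP.
    - exact: cvg_harmonic.
  by rewrite /= scale0r addr0.
exists (kv (nodal K)); last first.
  by apply: le_trans (kv_grad KT Kx) _; exact: ler_norm.
apply: cvg_near_cst; exists N => // n /= Nn.
rewrite /quot !(interpolantE KT)//; last exact: NP.
by rewrite affn_line addrAC subrr add0r mulrA mulfV// mul1r.
Qed.

End Direction.
End Interpolant.

(** * Smooth approximation of Lipschitz functions on square grids *)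

Section Step.
Variable R : realType.
Implicit Types (x y : R) (k m : nat).

(** Outside ]0, 1[ the function takes its minimum 0 or its maximum 1, endpoints included. *)
Lemma step_derive0 x : ~ (0 < x < 1) -> 'D_1 (@step R) x = 0.
Proof.
have [_ ds] := smooth1_derive (@step_smooth R).
have dv t : derivable (@step R) t 1 by have [] := ds t.
have xin : x \in `]x - 1, x + 1[%R by rewrite in_itv/= ltrBlDr ltrDl ltr01.
have le : x - 1 <= x + 1 by rewrite lerBlDr -addrA lerDl.
have [x0 _|x0] := leP x 0.
  have [_ //] : is_derive x 1 (@step R) 0.
  apply: (derive1_at_min le) => // t _.
  by rewrite (step_eq0 x0) step_ge0.
have [x1 _|x1 []//] := leP 1 x.
have [_ //] : is_derive x 1 (@step R) 0.
apply: (derive1_at_max le) => // t _.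
by rewrite (step_eq1 x1) step_le1.
Qed.

Lemma step_derive_bounded : exists2 S : R, 0 < S & forall x, `|'D_1 (@step R) x| <= S.
Proof.
have [ss _] := smooth1_derive (@step_smooth R).
have : bounded_set ('D_1 (@step R) @` `[0, 1]).
  apply: compact_bounded; apply: continuous_compact; last exact: segment_compact.
  by apply: continuous_subspaceT; exact: smooth1_cont.
move=> [M [Mr MP]]; exists (`|M| + 1); first by rewrite ltr_wpDl.
have M1 : M < `|M| + 1 by rewrite (le_lt_trans (ler_norm _))// ltrDl.
move=> x; have [x01|x01] := pselect (0 < x < 1).
  apply: (MP _ M1); exists x => //=; rewrite in_itv/=.
  by case/andP: x01 => ? ?; rewrite !ltW.
by rewrite step_derive0// normr0 addr_ge0.
Qed.

(** The differences t(y - k + 1) - t(y - k) are localized: for y in [j, j + 1] only k = j and k = j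
    + 1 contribute. Used for [step] with c = 1 and for its derivative with c = 0. *)
Lemma telescope_hat m (a : 'I_m -> R) (t : R -> R) (c y : R) (j j' : 'I_m) :
  (forall x, x <= 0 -> t x = 0) -> (forall x, 1 <= x -> t x = c) ->
  (j' = j.+1 :> nat) -> j%:R <= y <= j%:R + 1 ->
  \sum_k a k * (t (y - k%:R + 1) - t (y - k%:R)) = a j * (c - t (y - j%:R)) + a j' * t (y - j%:R).
Proof.
move=> t0 t1 jj /andP[jy yj]; have jj' : j' != j by rewrite -val_eqE/= jj gtn_eqF.
rewrite (bigD1 j)//= (bigD1 j')//= big1 ?addr0 => [|k /andP[kj kj']].
  congr (a _ * (_ - _) + a _ * _).
    by rewrite t1// lerDr subr_ge0.
  rewrite jj -natr1 [X in X - _](_ : _ = t (y - j%:R)); last by congr t; ring.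
  by rewrite [X in _ - X]t0 ?subr0//; lra.
have [kltj|] := ltnP k j.
  have H : k%:R + 1 <= j%:R :> R by rewrite natr1 ler_nat.
  by rewrite !t1 ?subrr ?mulr0//; lra.
rewrite leq_eqVlt => /predU1P[jk|jk]; first by move: kj; rewrite -val_eqE/= jk eqxx.
have H : j%:R + 2 <= k%:R :> R.
  rewrite -natrD ler_nat addn2 ltn_neqAle jk andbT.
  by apply: contraNneq kj' => jk'; rewrite -val_eqE/= jj jk'.
by rewrite !t0 ?subrr ?mulr0//; lra.
Qed.

End Step.

Section Blend.
Variable R : realType.

Lemma tensor_sum_big n (F : 'I_n -> plane R -> R) : (forall i, tensor_sum (F i)) ->
  tensor_sum (fun p => \sum_i F i p).
Proof.
elim: n F => [|n IH] F tF.
  by under eq_fun do rewrite big_ord0; exact: tensor_cst.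
by under eq_fun do rewrite big_ord_recl; apply: tensorD => //; exact: IH.
Qed.

Lemma derive_sum_fun n (F : 'I_n -> plane R -> R) v p : (forall i, tensor_sum (F i)) ->
  'D_v (fun p => \sum_i F i p) p = \sum_i 'D_v (F i) p.
Proof.
move=> tF; rewrite (_ : (fun p => _) = \sum_i F i).
  by rewrite derive_sum// => i; apply: diff_derivable; exact: tensor_differentiable.
by apply/funext => q; rewrite fct_sumE.
Qed.

Definition blend m (c : 'I_m -> 'I_m -> R) (a b : 'I_m -> R -> R) (p : plane R) : R :=
  \sum_i \sum_j c i j * (a i p.1 * b j p.2).

Variables (m : nat) (c : 'I_m -> 'I_m -> R) (a b : 'I_m -> R -> R).
Hypotheses (sa : forall i, smooth1 (a i)) (sb : forall i, smooth1 (b i)).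

Lemma blend_tensor : tensor_sum (blend c a b).
Proof.
apply: tensor_sum_big => i; apply: tensor_sum_big => j; apply: tensor_scale.
exact: tensor1.
Qed.

Lemma blend_derive v p : 'D_v (blend c a b) p =
  v.1 * blend c (fun i => 'D_1 (a i)) b p + v.2 * blend c a (fun j => 'D_1 (b j)) p.
Proof.
rewrite /blend derive_sum_fun => [|i]; last first.
  by apply: tensor_sum_big => j; apply: tensor_scale; exact: tensor1.
rewrite !mulr_sumr -big_split; apply: eq_bigr => i _.
rewrite derive_sum_fun => [|j]; last by apply: tensor_scale; exact: tensor1.
rewrite /= !mulr_sumr -big_split; apply: eq_bigr => j _ /=.
have dt : derivable (fun p : plane R => a i p.1 * b j p.2) p v.
  by apply: diff_derivable; exact: differentiable_tensor.
rewrite -[LHS]/('D_v (c i j *: (fun p : plane R => a i p.1 * b j p.2)) p).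
rewrite deriveZ// derive_tensor// -[LHS]/(c i j * _).
by ring.
Qed.

End Blend.

Lemma mix_le (R : realDomainType) (x y s M : R) : `|x| <= M -> `|y| <= M -> 0 <= s -> s <= 1 ->
  `|x * (1 - s) + y * s| <= M.
Proof.
move=> xM yM s0 s1; apply: le_trans (ler_normD _ _) _; rewrite !normrM (ger0_norm s0).
rewrite [`|1 - s|]ger0_norm ?subr_ge0// -[leRHS](_ : M * (1 - s) + M * s = M); last by ring.
by apply: lerD; apply: ler_wpM2r => //; rewrite subr_ge0.
Qed.

Section LipschitzApproximation.
Variable R : realType.
Variables (L d : R) (m : nat) (w : plane R -> R).
Hypothesis d0 : 0 < d.

(** A smooth hat of half-width d about the node -L + k d; on a cell the two hats that do not vanish
    add up to 1. The arguments have the shape required by [is_derive1_affine]; [hatE] is the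
    readable form. *)
Definition hat (k : nat) (x : R) : R :=
  step ((L / d - k%:R + 1) + x * d^-1) + - 1 * step ((L / d - k%:R) + x * d^-1).

Lemma hat_smooth k : smooth1 (hat k).
Proof.
apply: smooth1D; last apply: smooth1M; [|exact: smooth1_cst|].
- under eq_fun do rewrite addrC mulrC; exact/smooth1_affine/step_smooth.
- under eq_fun do rewrite addrC mulrC; exact/smooth1_affine/step_smooth.
Qed.

Lemma hatE k x : hat k x = step ((x + L) / d - k%:R + 1) - step ((x + L) / d - k%:R).
Proof. by rewrite /hat mulN1r; congr (step _ - step _); ring. Qed.

Lemma hat_derive k x : 'D_1 (hat k) x =
  d^-1 * ('D_1 (@step R) ((x + L) / d - k%:R + 1) - 'D_1 (@step R) ((x + L) / d - k%:R)).
Proof.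
have [_ ds] := smooth1_derive (@step_smooth R).
have D1 := is_derive1_affine d^-1 (L / d - k%:R + 1) x (@step_smooth R).
have D2 := is_derive1_affine d^-1 (L / d - k%:R) x (@step_smooth R).
have D3 := is_deriveD D1 (is_derive1M (is_derive_cst (-1 : R) x 1) D2).
have [_ E] := D3; etransitivity; first exact: E.
rewrite /cst mulr0 addr0 mulN1r -mulNr -mulrDl mulrC.
rewrite (_ : L / d - k%:R + 1 + x / d = (x + L) / d - k%:R + 1); last by ring.
by rewrite (_ : L / d - k%:R + x / d = (x + L) / d - k%:R); last by ring.
Qed.

Lemma hat_out (k : nat) (x : R) : d < `|x - (- L + k%:R * d)| -> hat k x = 0.
Proof.
have -> : x - (- L + k%:R * d) = ((x + L) / d - k%:R) * d by field; rewrite gt_eqF.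
rewrite normrM (gtr0_norm d0) -{1}[d]mul1r ltr_pM2r// hatE; set y := _ - _.
rewrite ltr_normr => /orP[y1|y1].
  by rewrite !step_eq1 ?subrr//; lra.
by rewrite !step_eq0 ?subrr//; lra.
Qed.

Definition node (i j : 'I_m) : plane R := (- L + i%:R * d, - L + j%:R * d).

Definition grid_blend := blend (fun i j => w (node i j)) (fun i => hat i) (fun j => hat j).

Lemma grid_blend_smooth : smooth grid_blend.
Proof. by apply: tensor_smooth; apply: blend_tensor => i; exact: hat_smooth. Qed.

Variable K : R.
Hypotheses (w1 : forall p t, `|w (p + t *: e1 R) - w p| <= K * `|t|).
Hypotheses (w2 : forall p t, `|w (p + t *: e2 R) - w p| <= K * `|t|).

Lemma grid_blend_out p : (forall q, `|q.1 - p.1| <= d -> `|q.2 - p.2| <= d -> w q = 0) ->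
  grid_blend p = 0.
Proof.
move=> wq; rewrite /grid_blend /blend big1// => i _; rewrite big1// => j _.
have [h1|h1] := ltP d `|p.1 - (- L + i%:R * d)|; first by rewrite hat_out// mul0r mulr0.
have [h2|h2] := ltP d `|p.2 - (- L + j%:R * d)|; first by rewrite (hat_out h2) !mulr0.
by rewrite wq ?mul0r//= distrC.
Qed.

Section Cell.
Variables (p : plane R) (i i' j j' : 'I_m).
Hypotheses (ii : i' = i.+1 :> nat) (jj : j' = j.+1 :> nat).
Hypotheses (pi : - L + i%:R * d <= p.1 <= - L + i%:R * d + d).
Hypotheses (pj : - L + j%:R * d <= p.2 <= - L + j%:R * d + d).

Let cellE (k : nat) (x : R) : - L + k%:R * d <= x <= - L + k%:R * d + d ->
  k%:R <= (x + L) / d <= k%:R + 1.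
Proof.
move=> /andP[h1 h2]; rewrite ler_pdivlMr// ler_pdivrMr// mulrDl mul1r.
by apply/andP; split; lra.
Qed.

Let bilin (t r : R -> R) (ct cr : R) :
  (forall x, x <= 0 -> t x = 0) -> (forall x, 1 <= x -> t x = ct) ->
  (forall x, x <= 0 -> r x = 0) -> (forall x, 1 <= x -> r x = cr) ->
  let X := (p.1 + L) / d in let Y := (p.2 + L) / d in
  \sum_k \sum_l w (node k l) * ((t (X - k%:R + 1) - t (X - k%:R)) * (r (Y - l%:R + 1) - r (Y - l%:R))) =
  (w (node i j) * (ct - t (X - i%:R)) + w (node i' j) * t (X - i%:R)) * (cr - r (Y - j%:R)) +
  (w (node i j') * (ct - t (X - i%:R)) + w (node i' j') * t (X - i%:R)) * r (Y - j%:R).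
Proof.
move=> t0 t1 r0 r1 X Y.
have -> : \sum_k \sum_l w (node k l) * ((t (X - k%:R + 1) - t (X - k%:R)) * (r (Y - l%:R + 1) - r (Y - l%:R))) =
  \sum_l (\sum_k w (node k l) * (t (X - k%:R + 1) - t (X - k%:R))) * (r (Y - l%:R + 1) - r (Y - l%:R)).
  rewrite exchange_big; apply: eq_bigr => l _; rewrite mulr_suml; apply: eq_bigr => k _.
  by rewrite mulrA.
rewrite (telescope_hat _ r0 r1 jj (cellE pj)).
by rewrite !(telescope_hat _ t0 t1 ii (cellE pi)).
Qed.

Let step0 := @step_eq0 R.
Let step1 := @step_eq1 R.
Let ds0 x : x <= 0 -> 'D_1 (@step R) x = 0.
Proof. by move=> x0; apply: step_derive0 => /andP[]; rewrite ltNge x0. Qed.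
Let ds1 x : 1 <= x -> 'D_1 (@step R) x = 0.
Proof. by move=> x0; apply: step_derive0 => /andP[_]; rewrite ltNge x0. Qed.

Let le1 k : 0 <= k -> 0 <= K * k.
Proof. by apply: mulr_ge0; have := w1 p 1; rewrite normr1 mulr1; exact: le_trans. Qed.

Let corner q : `|q.1 - p.1| <= d -> `|q.2 - p.2| <= d -> `|w q - w p| <= 2 * K * d.
Proof.
move=> q1 q2; apply: le_trans (plane_lip w1 w2 p q) _.
have H k : 0 <= k -> k <= d -> K * k <= K * d.
  by move=> k0 kd; rewrite -subr_ge0 -mulrBr le1// subr_ge0.
by rewrite mulrDr -mulrA mulr_natl mulr2n lerD// H.
Qed.

(** On a cell the blend is a convex combination of the four corner values of [w]. *)
Lemma grid_blend_near : `|grid_blend p - w p| <= 2 * K * d.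
Proof.
rewrite /grid_blend /blend.
under eq_bigr do under eq_bigr do rewrite !hatE.
rewrite (bilin step0 step1 step0 step1) /=.
have s0 := step_ge0 ((p.1 + L) / d - i%:R); have s1 := step_le1 ((p.1 + L) / d - i%:R).
have r0 := step_ge0 ((p.2 + L) / d - j%:R); have r1 := step_le1 ((p.2 + L) / d - j%:R).
set s := step _ in s0 s1 *; set r := step _ in r0 r1 *.
have [c1 c2 c3 c4] : [/\ `|w (node i j) - w p| <= 2 * K * d, `|w (node i' j) - w p| <= 2 * K * d,
    `|w (node i j') - w p| <= 2 * K * d & `|w (node i' j') - w p| <= 2 * K * d].
  have i1 : i'%:R * d = i%:R * d + d by rewrite ii -natr1 mulrDl mul1r.
  have j1 : j'%:R * d = j%:R * d + d by rewrite jj -natr1 mulrDl mul1r.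
  move: pi pj => /andP[? ?] /andP[? ?].
  by split; apply: corner; rewrite /= ?i1 ?j1 ler_norml; apply/andP; split; lra.
have -> : (w (node i j) * (1 - s) + w (node i' j) * s) * (1 - r) +
    (w (node i j') * (1 - s) + w (node i' j') * s) * r - w p =
  ((w (node i j) - w p) * (1 - s) + (w (node i' j) - w p) * s) * (1 - r) +
    ((w (node i j') - w p) * (1 - s) + (w (node i' j') - w p) * s) * r by ring.
by apply: mix_le => //; apply: mix_le.
Qed.

(** Differentiation leaves 1/d times a slope of [step] times a convex combination of differences of
    neighbouring nodal values. These are at most K d, so the bound is independent of the grid. *)
Lemma grid_blend_derive (S : R) : (forall x, `|'D_1 (@step R) x| <= S) ->
  `|'D_(e1 R) grid_blend p| <= K * S /\ `|'D_(e2 R) grid_blend p| <= K * S.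
Proof.
move=> SP; rewrite !blend_derive; [|by move=> ?; exact: hat_smooth..].
rewrite !mul0r !mul1r addr0 add0r /blend.
have s0 := step_ge0 ((p.1 + L) / d - i%:R); have s1 := step_le1 ((p.1 + L) / d - i%:R).
have r0 := step_ge0 ((p.2 + L) / d - j%:R); have r1 := step_le1 ((p.2 + L) / d - j%:R).
have [K1 K2 K3 K4] : [/\ `|w (node i' j) - w (node i j)| <= K * d,
    `|w (node i' j') - w (node i j')| <= K * d, `|w (node i j') - w (node i j)| <= K * d &
    `|w (node i' j') - w (node i' j)| <= K * d].
  have H1 k : node i' k = node i k + d *: e1 R.
    rewrite -[RHS]/(- L + i%:R * d + d * 1, - L + k%:R * d + d * 0).
    by rewrite mulr1 mulr0 addr0 /node ii -natr1 mulrDl mul1r addrA.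
  have H2 k : node k j' = node k j + d *: e2 R.
    rewrite -[RHS]/(- L + k%:R * d + d * 0, - L + j%:R * d + d * 1).
    by rewrite mulr1 mulr0 addr0 /node jj -natr1 mulrDl mul1r addrA.
  by have -> : K * d = K * `|d| by [rewrite gtr0_norm];
    split; [rewrite H1|rewrite H1|rewrite H2|rewrite H2].
have final x : `|x| <= K * d -> forall y, `|d^-1 * ('D_1 (@step R) y * x)| <= K * S.
  move=> xK y; rewrite normrM [`|d^-1|]gtr0_norm ?invr_gt0// ler_pdivrMl// normrM.
  have -> : d * (K * S) = S * (K * d) by ring.
  by apply: ler_pM.
split.
- rewrite [X in `|X|](_ : _ = d^-1 * (\sum_i \sum_j w (node i j) *
     (('D_1 (@step R) ((p.1 + L) / d - i%:R + 1) - 'D_1 (@step R) ((p.1 + L) / d - i%:R)) *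
      (step ((p.2 + L) / d - j%:R + 1) - step ((p.2 + L) / d - j%:R))))); last first.
    rewrite mulr_sumr; apply: eq_bigr => k _; rewrite mulr_sumr; apply: eq_bigr => l _.
    by rewrite hat_derive hatE -mulrA mulrCA.
  rewrite (bilin ds0 ds1 step0 step1) /=.
  set r := step _ in r0 r1 *; set X := (p.1 + L) / d - i%:R; set s' := derive _ X _.
  have -> : (w (node i j) * (0 - s') + w (node i' j) * s') * (1 - r) +
      (w (node i j') * (0 - s') + w (node i' j') * s') * r =
    s' * ((w (node i' j) - w (node i j)) * (1 - r) + (w (node i' j') - w (node i j')) * r) by ring.
  by apply: final; exact: mix_le.
- rewrite [X in `|X|](_ : _ = d^-1 * (\sum_i \sum_j w (node i j) *
     ((step ((p.1 + L) / d - i%:R + 1) - step ((p.1 + L) / d - i%:R)) *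
      ('D_1 (@step R) ((p.2 + L) / d - j%:R + 1) - 'D_1 (@step R) ((p.2 + L) / d - j%:R))))); last first.
    rewrite mulr_sumr; apply: eq_bigr => k _; rewrite mulr_sumr; apply: eq_bigr => l _.
    by rewrite hat_derive hatE (mulrCA _ d^-1) (mulrCA _ d^-1).
  rewrite (bilin step0 step1 ds0 ds1) /=.
  set s := step _ in s0 s1 *; set Y := (p.2 + L) / d - j%:R; set r' := derive _ Y _.
  have -> : (w (node i j) * (1 - s) + w (node i' j) * s) * (0 - r') +
      (w (node i j') * (1 - s) + w (node i' j') * s) * r' =
    r' * ((w (node i j') - w (node i j)) * (1 - s) + (w (node i' j') - w (node i' j)) * s) by ring.
  by apply: final; exact: mix_le.
Qed.

End Cell.
End LipschitzApproximation.

(** * Near-minimizers of the energy in a convex set *)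

Section ConvexMinimization.
Variables (R : realType) (E : lmodType R) (b n : E -> E -> R) (C : set E) (B : R).
Hypotheses (hb : semi_inner b) (hn : semi_inner n).
Hypothesis midC : forall x y, C x -> C y -> C (2^-1 *: (x + y)).
Hypothesis exC : forall e : R, 0 < e -> exists x, [/\ C x, snorm n x <= e & b x x <= B].

(* Near-minimizers of the energy [b] over the elements of [C] of small norm [n] form a Cauchy
   sequence, by the parallelogram identity. *)
Lemma convex_cauchy : exists x : nat -> E, forall k,
  [/\ C (x k), snorm n (x k) <= 16^-1 ^+ k & b (x k.+1 - x k) (x k.+1 - x k) <= 16^-1 ^+ k].
Proof.
pose F (e : R) := [set b x x | x in [set x | C x /\ snorm n x <= e]].
have hF e : 0 < e -> has_inf (F e).
  move=> /exC[x [Cx nx _]]; split; first by exists (b x x); exists x.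
  by exists 0 => _ [y _ <-]; exact: si_ge0.
(* The infimum of the energy at norm level e increases as e decreases and stays below B; M is its
   limit. *)
pose G := [set inf (F e) | e in [set e : R | 0 < e]].
have hG : has_sup G.
  split; first by exists (inf (F 1)); exists 1 => //=.
  exists B => _ [e /= e0 <-]; have [x [Cx nx bx]] := exC e0.
  by apply: le_trans bx; apply: ge_inf; [exact: (hF e e0).2|exists x].
pose M := sup G; pose d k : R := 16^-1 ^+ k / 8.
have d0 k : 0 < d k by rewrite divr_gt0// exprn_gt0// invr_gt0.
have /choice[xe xeP] : forall k, exists xe : E * R, [/\ C xe.1, snorm n xe.1 <= xe.2, xe.2 <= 16^-1 ^+ k,
    forall y, C y -> snorm n y <= xe.2 -> M - d k <= b y y & b xe.1 xe.1 <= M + d k].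
  move=> k; have [_ [e' /= e'0 <-] e'M] := sup_adherent (d0 k) hG.
  pose e := Num.min e' (16^-1 ^+ k); have e0 : 0 < e by rewrite lt_min e'0 exprn_gt0// invr_gt0.
  have [_ [x [Cx nx] <-] bx] := inf_adherent (d0 k) (hF e e0).
  have eM : inf (F e) <= M by apply: ub_le_sup; [exact: hG.2|exists e].
  exists (x, e); split => //=.
  - by rewrite ge_min lexx orbT.
  - move=> y Cy ny; apply: le_trans (ltW e'M) _; apply: ge_inf; first exact: (hF e' e'0).2.
    by exists y => //; split => //; apply: le_trans ny _; rewrite ge_min lexx.
  - by apply: ltW; apply: lt_le_trans bx _; rewrite lerD2r.
exists (fun k => (xe k).1) => k; have [Cx nx ek Mx bx] := xeP k.
split => //; first exact: le_trans nx ek.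
have [Cy ny _ My by_] := xeP k.+1.
set x := (xe k).1 in Cx nx bx *; set y := (xe k.+1).1 in Cy ny by_ *.
have dk : d k.+1 <= d k.
  by rewrite /d exprS ler_pM2r ?invr_gt0// ler_piMl ?exprn_ge0 ?invr_ge0// invf_le1 ?ler1n.
pose z := 2^-1 *: (x + y).
have nz e : snorm n x <= e -> snorm n y <= e -> snorm n z <= e.
  move=> xe' ye; rewrite (snormZ hn) ger0_norm ?invr_ge0//.
  by have := snormD hn x y; lra.
have Mz : M - d k <= b z z.
  have [le|/ltW le] := leP (xe k).2 (xe k.+1).2.
    apply: le_trans (My z (midC Cx Cy) _); first by rewrite lerD2l lerN2.
    by apply: nz => //; exact: le_trans le.
  by apply: Mx; [exact: midC|apply: nz => //; exact: le_trans le].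
(* The parallelogram identity. The energies of x and y are at most M + d_k and that of the midpoint
   z is at least M - d_k, so the left side is at most 8 d_k = 16^-k. *)
have E1 : b (y - x) (y - x) = 2 * b x x + 2 * b y y - 4 * b z z.
  rewrite (siZl hb) (siZr hb) !(siDl hb, siDr hb, siBl hb, siBr hb, siNl hb, siNr hb).
  by rewrite (si_sym hb y x); field.
have d8 : 8 * d k = 16^-1 ^+ k by rewrite /d; field.
by rewrite E1 -d8; move: bx by_ Mz dk; lra.
Qed.

End ConvexMinimization.

(** * [H10] is closed under L^2 limits of bounded energy *)

Section WeakClosure.
Variable R : realType.
Local Notation M2 := (measurableTypeR R * measurableTypeR R)%type.
Local Notation meas2 D := (measurable (D : set M2)).
Local Notation measf2 D f := (measurable_fun (D : set M2) f).
Variables (Om : set (plane R)) (L : R).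
Hypotheses (oOm : open Om) (OmL : Om `<=` box L).
Let mO : meas2 Om. Proof. exact: open_measurable2. Qed.

Lemma L2_CS f g : L2 Om f -> L2 Om g -> `|ip Om f g| <= norm0 Om f * norm0 Om g.
Proof.
move=> Lf Lg; pose x : elt (L2s oOm) := mkelt (F := L2s oOm) Lf.
pose y : elt (L2s oOm) := mkelt (F := L2s oOm) Lg.
exact: (CSn (eip_semi oOm) x y).
Qed.

Lemma half_pow_small (e : R) : 0 < e -> exists N, forall k, (N <= k)%N -> 2^-1 ^+ k < e.
Proof.
move=> e0; have : (2^-1 ^+ k : R) @[k --> \oo] --> (0 : R).
  by apply: cvg_expr; rewrite ger0_norm ?invr_ge0// invf_lt1// ltr1n.
move=> /cvgrPdist_lt /(_ e e0)[N _ NP]; exists N => k Nk.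
by have := NP k Nk; rewrite /= sub0r normrN ger0_norm ?exprn_ge0 ?invr_ge0.
Qed.

(** Weak differentiation is a closed operator: the L^2 limit [l] of the [g k] is a weak derivative
    of the limit 0 of the [f k], hence null. *)
Lemma weak_deriv_vanish v (f g : nat -> plane R -> R) : (forall k, L2 Om (f k)) ->
  (forall k, is_weak_deriv Om v (f k) (g k)) -> (forall k, norm0 Om (f k) <= 16^-1 ^+ k) ->
  (forall k, ip Om (g k.+1 - g k) (g k.+1 - g k) <= 16^-1 ^+ k) ->
  forall e : R, 0 < e -> exists N, forall k, (N <= k)%N -> ip Om (g k) (g k) <= e.
Proof.
move=> Lf fg f0 gC.
have Lg k : L2 Om (g k) by have [] := fg k.
have [l Ll gl] := L2_complete mO Lg gC.
have Lgl k : L2 Om (g k - l) by exact: L2B.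
have l0 : null_on Om l.
  apply: (fundamental_lemma oOm OmL) => // psi tp.
  have Lp := test_L2 mO tp; have Ld := test_L2 mO (test_derive v tp).
  apply/eqP; rewrite -normr_le0.
  apply: (@le0_eps _ _ (3 * norm0 Om psi + norm0 Om ('D_v psi))).
    by rewrite addr_ge0// ?mulr_ge0// sqrtr_ge0.
  move=> e /half_pow_small[k /(_ k (leqnn k))/ltW ek].
  have h1 : ip Om l psi = ip Om (g k) psi - ip Om (g k - l) psi.
    by rewrite (ipBl oOm (Lg k) Ll Lp) opprB addrC subrK.
  have h2 : ip Om (g k) psi = - ip Om (f k) ('D_v psi).
    by have [_ ->] := fg k; rewrite ?opprK.
  rewrite h1 h2; apply: le_trans (ler_normB _ _) _; rewrite normrN.
  have h3 := L2_CS (Lf k) Ld; have h4 := L2_CS (Lgl k) Lp.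
  have h5 : norm0 Om (f k) <= e.
    apply: le_trans (f0 k) _; apply: le_trans ek; rewrite lerXn2r ?nnegrE ?invr_ge0//.
    by rewrite lef_pV2 ?posrE// ler_nat.
  (* [L2_complete] bounds the square of this norm by 8 / 4^k, and 8 <= 3^2. *)
  have h6 : norm0 Om (g k - l) <= 3 * e.
    apply: le_trans (_ : 3 * 2^-1 ^+ k <= _); last by rewrite ler_pM2l.
    rewrite /norm0 -[leRHS]ger0_norm ?mulr_ge0 ?exprn_ge0 ?invr_ge0// -sqrtr_sqr ler_wsqrtr//.
    apply: le_trans (gl k) _; rewrite exprMn exprAC.
    have -> : 2^-1 ^+ 2 = 4^-1 :> R by rewrite exprVn; congr (_^-1); ring.
    by apply: ler_wpM2r; rewrite ?exprn_ge0 ?invr_ge0//; lra.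
  have p0 : 0 <= norm0 Om psi := sqrtr_ge0 _.
  have p1 : 0 <= norm0 Om ('D_v psi) := sqrtr_ge0 _.
  rewrite mulrDl addrC; apply: lerD.
    by apply: le_trans h4 _; rewrite mulrAC; apply: ler_wpM2r.
  by apply: le_trans h3 _; rewrite mulrC; apply: ler_wpM2l.
move=> e e0; have [N NP] := half_pow_small (divr_gt0 e0 (ltr0n R 8)).
exists N => k Nk.
pose x : elt (L2s oOm) := mkelt (F := L2s oOm) (Lg k).
pose y : elt (L2s oOm) := mkelt (F := L2s oOm) Ll.
have y0 : snorm (eip (oOm := oOm)) (x - (x - y)) = 0.
  apply/null_snorm; apply: aeS l0 => p lp /lp; rewrite /= => lp0.
  by rewrite -[LHS]/(g k p - (g k p - l p)) lp0 subr0 subrr.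
have E := snorm_null_eq (eip_semi oOm) y0.
have -> : ip Om (g k) (g k) = ip Om (g k - l) (g k - l).
  rewrite -[LHS](snormE (eip_semi oOm) x) -[RHS](snormE (eip_semi oOm) (x - y)).
  by rewrite E.
apply: le_trans (gl k) _; rewrite mulrC -ler_pdivlMr//.
apply: le_trans (ltW (NP k Nk)); rewrite lerXn2r ?nnegrE ?invr_ge0//.
by rewrite lef_pV2 ?posrE// ler_nat.
Qed.

Lemma weak_derivB v w w' g g' : L2 Om w -> L2 Om w' ->
  is_weak_deriv Om v w g -> is_weak_deriv Om v w' g' -> is_weak_deriv Om v (w - w') (g - g').
Proof.
have E (x y : plane R -> R) : x - y = (-1) *: y + x by rewrite scaleN1r addrC.
by move=> Lw Lw' wg wg'; rewrite !E; exact: (weak_deriv_lin oOm).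
Qed.

Lemma H1_bform_semi : semi_inner (eform (F := H1s oOm) (bform Om)).
Proof.
split => [k x y z|x y|x]; first exact: (bform_lin oOm OmL k (H1sP x) (H1sP y) (H1sP z)).
  exact: bform_sym.
exact: bform_ge0.
Qed.

Lemma bform_sub_le f g : H1 Om f -> H1 Om g ->
  bform Om (f - g) (f - g) <= 2 * bform Om f f + 2 * bform Om g g.
Proof.
move=> Hf Hg; have hb := H1_bform_semi.
pose x : elt (H1s oOm) := mkelt (F := H1s oOm) Hf; pose y : elt (H1s oOm) := mkelt (F := H1s oOm) Hg.
have : 0 <= eform (F := H1s oOm) (bform Om) (x + y) (x + y) by exact: si_ge0.
move=> h0.
rewrite -[X in X <= _]/(eform (F := H1s oOm) (bform Om) (x - y) (x - y)).
rewrite -[bform Om f f]/(eform (F := H1s oOm) (bform Om) x x).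
rewrite -[bform Om g g]/(eform (F := H1s oOm) (bform Om) y y).
rewrite !(siDl hb, siDr hb, siBl hb, siBr hb, siNl hb, siNr hb) (si_sym hb y x).
move: h0; rewrite !(siDl hb, siDr hb) (si_sym hb y x).
by move: (eform _ x x) (eform _ x y) (eform _ y y) => a b c; lra.
Qed.

Lemma ip_bounded f (M : R) : 0 < L -> 0 <= M -> L2 Om f -> (forall p, Om p -> `|f p| <= M) ->
  ip Om f f <= M ^+ 2 * (4 * L ^+ 2).
Proof.
move=> L0 M0 Lf fM.
have le : (@mu2 R Om <= (4 * L ^+ 2)%:E)%E.
  have -> : (4 * L ^+ 2)%:E = @mu2 R (box L).
    by rewrite /box mu_rect ?ge0_cp ?(ltW L0)//; congr (_%:E); ring.
  by apply: le_measure; rewrite ?inE//; exact: measurable_boxc.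
have fin : @mu2 R Om = (fine (@mu2 R Om))%:E.
  rewrite fineK// ge0_fin_numE; last exact: measure_ge0.
  by apply: le_lt_trans le _; exact: ltry.
have [ic iE] := int_cst (M ^+ 2) mO fin.
rewrite ip_int; apply: le_trans (_ : int Om (fun=> M ^+ 2) <= _).
  apply: int_le => //; first exact: L2M.
  by move=> p Op; rewrite -[f p * f p]expr2 -real_normK ?num_real// lerXn2r ?nnegrE ?fM.
by rewrite iE ler_wpM2l ?sqr_ge0// -lee_fin -fin.
Qed.

(** A form of Mazur's lemma. The differences w - phi form a convex set, in which [convex_cauchy]
    finds a sequence tending to 0 in L^2 with Cauchy gradients; these tend to 0 by
    [weak_deriv_vanish]. *)
Lemma H10_weak_closure w (B : R) : H1 Om w -> (forall e : R, 0 < e -> exists phi,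
  [/\ test_function Om phi, norm0 Om (w - phi) <= e & bform Om (w - phi) (w - phi) <= B]) ->
  H10 Om w.
Proof.
move=> Hw wB; split => // e e0.
pose E := elt (H1s oOm); pose b := eform (F := H1s oOm) (bform Om).
pose n := eform (F := H1s oOm) (ip Om).
have hb : semi_inner b := H1_bform_semi.
have hn : semi_inner n.
  split => [k x y z|x y|x]; first exact: (ip_lin k mO (H1_L2 (H1sP x)) (H1_L2 (H1sP y)) (H1_L2 (H1sP z))).
    exact: ip_sym.
  exact: ip_ge0.
pose C := [set x : E | exists2 phi, test_function Om phi & val x = w - phi].
have [|d d0|x xP] := convex_cauchy (C := C) (B := B) hb hn.
- move=> x y [phi tp xE] [psi ts yE]; exists (2^-1 *: phi + 2^-1 *: psi).
    apply: test_lin => //; rewrite -[X in test_function Om X]addr0.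
    by apply: test_lin => //; exact: test_0.
  rewrite -[LHS]/(2^-1 *: (val x + val y)) xE yE -scalerDr.
  apply/funext => p; rewrite -[LHS]/(2^-1 * ((w p - phi p) + (w p - psi p))).
  by rewrite -[RHS]/(w p - 2^-1 * (phi p + psi p)); field.
- have [phi [tp np bp]] := wB d d0.
  have Hx : H1 Om (w - phi).
    rewrite -[X in X - _]scale1r -[- phi]scaleN1r addrC.
    by apply: (H1_lin oOm); [exact: test_H1|rewrite scale1r].
  by exists (mkelt (F := H1s oOm) Hx); split => //; exists phi.
have xH k : H1 Om (val (x k)) by exact: H1sP.
pose f k := val (x k).
have Lf k : L2 Om (f k) by exact: (H1_L2 (xH k)).
have f0 k : norm0 Om (f k) <= 16^-1 ^+ k by have [_ ? _] := xP k.
have bC k : bform Om (f k.+1 - f k) (f k.+1 - f k) <= 16^-1 ^+ k by have [_ _] := xP k.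
have [g1 [g2 [w1 w2 bE]]] : exists g1 g2 : nat -> plane R -> R,
  [/\ forall k, is_weak_deriv Om (e1 R) (f k) (g1 k), forall k, is_weak_deriv Om (e2 R) (f k) (g2 k) &
      forall k, bform Om (f k) (f k) = ip Om (g1 k) (g1 k) + ip Om (g2 k) (g2 k)].
  exists (fun k => weak_deriv Om (e1 R) (f k)), (fun k => weak_deriv Om (e2 R) (f k)).
  by split => // k; [exact: (H1_wd1 (xH k))|exact: (H1_wd2 (xH k))].
have bC' k := bformE oOm OmL (weak_derivB (Lf k.+1) (Lf k) (w1 k.+1) (w1 k)) (weak_derivB (Lf k.+1) (Lf k) (w2 k.+1) (w2 k))
  (weak_derivB (Lf k.+1) (Lf k) (w1 k.+1) (w1 k)) (weak_derivB (Lf k.+1) (Lf k) (w2 k.+1) (w2 k)).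
have e2 : 0 < e ^+ 2 / 4 by rewrite divr_gt0// exprn_gt0.
have [|N1 NP1] := weak_deriv_vanish Lf w1 f0 _ e2.
  by move=> k; apply: le_trans (bC k); rewrite bC' lerDl ip_ge0.
have [|N2 NP2] := weak_deriv_vanish Lf w2 f0 _ e2.
  by move=> k; apply: le_trans (bC k); rewrite bC' lerDr ip_ge0.
have [N3 NP3] := half_pow_small e2.
pose k := (N1 + (N2 + N3))%N.
have [phi tp fE] : C (x k) by have [] := xP k.
exists phi => //; rewrite [X in norm1 Om X](_ : _ = f k); last by rewrite /f fE.
have k1 := NP1 k (leq_addr _ _).
have k2 : ip Om (g2 k) (g2 k) <= e ^+ 2 / 4 by apply: NP2; rewrite /k addnCA leq_addr.
have k3 : ip Om (f k) (f k) <= e ^+ 2 / 4.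
  rewrite -[leLHS](snormE hn (x k)); apply: le_trans (_ : norm0 Om (f k) * 1 <= _).
    rewrite expr2; apply: ler_wpM2l; first exact: sqrtr_ge0.
    by apply: le_trans (f0 k) _; rewrite exprn_ile1// ?invr_ge0// invf_le1// ler1n.
  rewrite mulr1; apply: le_trans (f0 k) _.
  apply: le_trans (ltW (NP3 k _)); last by rewrite /k addnA leq_addl.
  by rewrite lerXn2r ?nnegrE ?invr_ge0// lef_pV2 ?posrE// ler_nat.
rewrite /norm1 -[ltRHS]ger0_norm ?(ltW e0)// -sqrtr_sqr ltr_sqrt ?exprn_gt0// bE.
by move: e2 k1 k2 k3; lra.
Qed.

(* [w] is the limit in [L2] of smooth interpolants on square grids, whose gradients are only
   bounded; strong convergence comes from [H10_weak_closure]. *)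
Lemma lipschitz_H10 w (K : R) (K1 : set (plane R)) : 0 < L -> H1 Om w ->
  (forall p t, `|w (p + t *: e1 R) - w p| <= K * `|t|) ->
  (forall p t, `|w (p + t *: e2 R) - w p| <= K * `|t|) ->
  compact K1 -> K1 `<=` Om -> (forall p, ~ K1 p -> w p = 0) -> H10 Om w.
Proof.
move=> L0 Hw wl1 wl2 cK KO w0.
have [r r0 rP] := compact_margin cK oOm KO.
have [S S0 SP] := step_derive_bounded R.
have K0 : 0 <= K by have := wl1 0 1; rewrite normr1 mulr1; exact: le_trans.
pose Q := (K * S) ^+ 2 * (4 * L ^+ 2).
apply: (@H10_weak_closure _ (2 * bform Om w w + 2 * (Q + Q)) Hw) => e e0.
(* d < r keeps the support of the approximant inside [Om]; the second bound makes 4 K L d, an L^2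
   error over a box of side 2 L, at most e. *)
pose T := Num.min r (e / (2 * (K + 1) * (2 * L + 1))).
have T0 : 0 < T by rewrite lt_min r0 !(divr_gt0, mulr_gt0)// ltr_wpDl ?mulr_ge0// ltW.
have [n nT] : exists n, 2 * L / n.+1%:R < T.
  exists (Num.truncn (T^-1 * (2 * L))); rewrite ltr_pdivrMr// -ltr_pdivrMl//.
  exact: truncnS_gt.
pose d := 2 * L / n.+1%:R; have d0 : 0 < d by rewrite divr_gt0 ?mulr_gt0.
have dr : d < r by apply: lt_le_trans nT _; rewrite ge_min lexx.
(* [grid_index] locates points with n + 2 indices, and the last cell needs one more node at its far
   end. *)
pose phi := @grid_blend R L d n.+3 w.
have phi_out p : ~ Om p -> phi p = 0.
  move=> Op; apply: grid_blend_out => // q q1 q2; apply: w0 => Kq; apply: Op.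
  by apply: (rP q) => //; rewrite distrC ltW// (le_lt_trans _ dr).
have phi_cell p : Om p -> `|phi p - w p| <= 2 * K * d /\
    (`|'D_(e1 R) phi p| <= K * S /\ `|'D_(e2 R) phi p| <= K * S).
  move=> /OmL/boxE[p1 p2].
  have [i ip] := grid_index (erefl d) d0 p1; have [j jp] := grid_index (erefl d) d0 p2.
  have i2 : (i.+1 < n.+3)%N by rewrite ltnS ltn_ord.
  have j2 : (j.+1 < n.+3)%N by rewrite ltnS ltn_ord.
  pose i1 := Ordinal (ltnW i2); pose j1 := Ordinal (ltnW j2).
  split; first exact: (@grid_blend_near R L d n.+3 w d0 K wl1 wl2 p i1 (Ordinal i2) j1 (Ordinal j2)).
  exact: (@grid_blend_derive R L d n.+3 w d0 K wl1 wl2 p i1 (Ordinal i2) j1 (Ordinal j2)).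
have tp : test_function Om phi.
  split; first exact: grid_blend_smooth.
  exists (thicken K1 d); split; first exact: compact_thicken.
    move=> p /thickenP[z Kz [z1 z2]]; apply: (rP z) => //.
      exact: le_trans z1 (ltW dr).
    exact: le_trans z2 (ltW dr).
  move=> p np; apply: grid_blend_out => // q q1 q2; apply: w0 => Kq; apply: np.
  by apply/thickenP; exists q => //; rewrite distrC [`|p.2 - _|]distrC.
have Lw : L2 Om w by case: Hw.
have Lp : L2 Om phi by exact: test_L2 tp.
exists phi; split => //.
  have h1 := @ip_bounded (w - phi) (2 * K * d) L0 _ (L2B mO Lw Lp).
  rewrite /norm0 -[leRHS]ger0_norm ?(ltW e0)// -sqrtr_sqr ler_wsqrtr//.
  apply: le_trans (h1 _ _) _.
  - by rewrite !mulr_ge0// ltW.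
  - by move=> p /phi_cell[+ _]; rewrite distrC.
  have -> : (2 * K * d) ^+ 2 * (4 * L ^+ 2) = (4 * K * L * d) ^+ 2 by ring.
  have dT : d <= e / (2 * (K + 1) * (2 * L + 1)).
    by apply: le_trans (ltW nT) _; rewrite ge_min lexx orbT.
  have KL0 : 0 <= 4 * K * L by rewrite !mulr_ge0// ltW.
  rewrite ler_pXn2r ?nnegrE ?(ltW e0)//; last by rewrite mulr_ge0// ltW.
  apply: le_trans (ler_wpM2l KL0 dT) _.
  rewrite mulrA ler_pdivrMr ?mulr_gt0 ?ltr_wpDl ?(ltW L0) ?mulr_ge0 ?(ltW L0)// mulrC ler_pM2l//.
  by have := mulr_ge0 K0 (ltW L0); move: L0 K0; rewrite mulrDr mulrDl; lra.
apply: le_trans (bform_sub_le Hw (test_H1 oOm tp)) _; rewrite lerD2l ler_pM2l//.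
have KS : 0 <= K * S by rewrite mulr_ge0// ltW.
rewrite (bformE oOm OmL (test_weak_deriv (e1 R) mO tp) (test_weak_deriv (e2 R) mO tp)
  (test_weak_deriv (e1 R) mO tp) (test_weak_deriv (e2 R) mO tp)).
have bQ v : (forall p, Om p -> `|'D_v phi p| <= K * S) -> ip Om ('D_v phi) ('D_v phi) <= Q.
  by move=> vp; exact: (ip_bounded L0 KS (test_L2 mO (test_derive v tp)) vp).
by apply: lerD; apply: bQ => p /phi_cell[_ []].
Qed.

End WeakClosure.

(** * Density of the finite element spaces *)

Section Density.
Variable R : realType.
Local Notation mu := (@mu2 R).
Local Notation M2 := (measurableTypeR R * measurableTypeR R)%type.
Local Notation meas2 D := (measurable (D : set M2)).
Local Notation measf2 D f := (measurable_fun (D : set M2) f).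
Variables (Om : set (plane R)) (L : R).
Hypotheses (oOm : open Om) (OmL : Om `<=` box L) (L0 : 0 < L).
Let mO : meas2 Om. Proof. exact: open_measurable2. Qed.

Lemma lip_continuous (w : plane R -> R) (K : R) :
  (forall x y, `|w y - w x| <= K * (`|y.1 - x.1| + `|y.2 - x.2|)) -> continuous w.
Proof.
move=> wK x; apply/cvgrPdist_lt => e e0.
have K1 : 0 < `|K| + 1 by rewrite ltr_wpDl.
have d0 : 0 < e / (2 * (`|K| + 1)) by rewrite divr_gt0// mulr_gt0.
suff : nbhs (x : plane R) [set t | `|w x - w t| < e] by [].
apply/nbhs_ballP; exists (e / (2 * (`|K| + 1))) => // y [/= y1 y2].
have {}y1 : `|y.1 - x.1| < e / (2 * (`|K| + 1)) by rewrite distrC.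
have {}y2 : `|y.2 - x.2| < e / (2 * (`|K| + 1)) by rewrite distrC.
rewrite distrC; apply: le_lt_trans (wK x y) _.
set u := `|y.1 - x.1| + _; have u0 : 0 <= u by rewrite addr_ge0.
apply: le_lt_trans (_ : (`|K| + 1) * u < _).
  by apply: ler_wpM2r => //; rewrite -[leLHS]addr0; apply: lerD => //; exact: ler_norm.
rewrite -ltr_pdivlMl// mulrC; apply: lt_le_trans (ltrD y1 y2) _.
by rewrite invfM; rewrite le_eqVlt; apply/orP; left; apply/eqP; field; rewrite gt_eqF.
Qed.

Lemma test_bound2 phi : test_function Om phi -> exists B : R,
  [/\ forall p, `|'D_(e1 R) phi p| <= B, forall p, `|'D_(e2 R) phi p| <= B,
   forall x y, `|'D_(e1 R) phi y - 'D_(e1 R) phi x| <= B * (`|y.1 - x.1| + `|y.2 - x.2|) &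
   forall x y, `|'D_(e2 R) phi y - 'D_(e2 R) phi x| <= B * (`|y.1 - x.1| + `|y.2 - x.2|)].
Proof.
move=> tp; have D v : exists B : R, 0 < B /\ forall p, `|'D_v phi p| <= B.
  by have [B [? ? _]] := test_bounded (test_derive v tp); exists B.
have DD v u : exists B : R, 0 < B /\ forall p, `|'D_u ('D_v phi) p| <= B.
  by have [B [? ? _]] := test_bounded (test_derive u (test_derive v tp)); exists B.
have [b1 [b10 B1]] := D (e1 R); have [b2 [b20 B2]] := D (e2 R).
have [c1 [c10 C1]] := DD (e1 R) (e1 R); have [c2 [c20 C2]] := DD (e1 R) (e2 R).
have [c3 [c30 C3]] := DD (e2 R) (e1 R); have [c4 [c40 C4]] := DD (e2 R) (e2 R).
have sD v : smooth ('D_v phi) by apply: smooth_derive; case: tp.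
pose B := b1 + b2 + c1 + c2 + c3 + c4.
have [h1 h2] : b1 <= B /\ b2 <= B by rewrite /B; split; lra.
have [h3 h4] : c1 <= B /\ c2 <= B by rewrite /B; split; lra.
have [h5 h6] : c3 <= B /\ c4 <= B by rewrite /B; split; lra.
exists B; split.
- by move=> p; exact: le_trans (B1 p) h1.
- by move=> p; exact: le_trans (B2 p) h2.
- by apply: (smooth_lip2 (sD _)) => p; [exact: le_trans (C1 p) h3|exact: le_trans (C2 p) h4].
- by apply: (smooth_lip2 (sD _)) => p; [exact: le_trans (C3 p) h5|exact: le_trans (C4 p) h6].
Qed.

(** By [interpolant_slope] the slopes of the interpolant are within |c h| of those of phi. Their
    squares, integrated over a box of area 4 L^2 in two directions, give 8 L^2 c^2 h^2, which is
    below (4 L |c| h)^2. *)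
Lemma interpolation_error phi (gamma : R) : test_function Om phi -> exists C h1 : R,
  [/\ 0 <= C, 0 < h1 & forall T, mesh_of Om T -> shape_regular gamma T -> mesh_size T < h1 ->
    exists2 w, S0 Om T w & bform Om (phi - w) (phi - w) <= (C * mesh_size T) ^+ 2].
Proof.
move=> tp; have [sp [K0 [cK KO p0]]] := tp.
have [B [b1 b2 l1 l2]] := test_bound2 tp.
have [M [M0 pM _]] := test_bounded tp.
have [r r0 rP] := compact_margin cK oOm KO.
pose c := 16 * B * gamma.
exists (4 * L * `|c|), (r / 2); split; first by rewrite mulr_ge0// mulr_ge0// ltW.
  by rewrite divr_gt0.
move=> T mT sT hr; set h := mesh_size T in hr *; pose w := interpolant phi T.
have wlip v : v = e1 R \/ v = e2 R -> forall x t, `|w (x + t *: v) - w x| <= (B + `|c * h|) * `|t|.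
  by move=> v12; exact: (interpolant_lip oOm sp p0 rP b1 b2 l1 l2 mT sT r0 hr v12).
have w1 := wlip _ (or_introl erefl); have w2 := wlip _ (or_intror erefl).
have cw := lip_continuous (plane_lip w1 w2).
have wM p : `|w p| <= M.
  have [[K KT Kp]|nK] := pselect (exists2 K, K \in T & hull K p); last first.
    rewrite /w /interpolant; case: pselect => [//|_]; by rewrite normr0 ltW.
  rewrite /w (interpolantE phi mT KT Kp); apply: affn_hull_le Kp => z zK.
  by rewrite nodalP//; case: mT => H _ _; exact: H.
have mw : measf2 setT w by exact: continuous_measurable2.
have Lw : L2 Om w by apply: (bounded_L2 mO OmL (M := M)) => //; exact: measurable_funTS.
(* The slopes are limits of difference quotients, hence measurable; for a bounded Lipschitz function
   they form a weak derivative by [lipschitz_weak_deriv]. *)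
have HG v : v = e1 R \/ v = e2 R -> exists G : plane R -> R,
    is_weak_deriv Om v w G /\ forall x, `|G x - 'D_v phi x| <= `|c * h|.
  move=> v12; have sl x := interpolant_slope oOm sp p0 rP l1 l2 mT sT r0 hr v12 x.
  pose G x := s2val (cid2 (sl x)).
  have Gq x : quot v w n x @[n --> \oo] --> G x by rewrite /G; case: cid2.
  have GD x : `|G x - 'D_v phi x| <= `|c * h| by rewrite /G; case: cid2.
  exists G; split => //.
  have mG : measf2 setT G.
    apply: (measurable_fun_cvg (h := quot v w)) => // m.
    apply: measurable_funM => //; apply: measurable_funB => //.
    exact: measurable_fun_shift.
  have GM x : `|G x| <= B + `|c * h|.
    rewrite -(subrK ('D_v phi x) (G x)) addrC; apply: le_trans (ler_normD _ _) _.
    by apply: lerD => //; case: v12 => ->.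
  apply: (lipschitz_weak_deriv (M := M) (K := B + `|c * h|)) => //.
  - by apply: (bounded_L2 mO OmL (M := B + `|c * h|)) => //; exact: measurable_funTS.
  - exact: wlip.
  - exact: aeW.
have [G1 [wG1 D1]] := HG _ (or_introl erefl); have [G2 [wG2 D2]] := HG _ (or_intror erefl).
have Hw : H1 Om w by split => //; [exists G1|exists G2].
exists w.
  split; first exact: continuous_subspaceT.
  - have sub : thicken K0 h `<=` Om by exact: (thicken_Om rP r0 hr).
    have cK' : compact (thicken K0 h) by exact: compact_thicken.
    have w0 p : ~ thicken K0 h p -> w p = 0 by move=> Kp; exact: (interpolant_supp p0 mT Kp).
    exact: (lipschitz_H10 oOm OmL L0 Hw w1 w2 cK' sub w0).
  - move=> K KT; exists (nodal phi K).1.1, (nodal phi K).1.2, (nodal phi K).2 => p Kp.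
    exact: (interpolantE phi mT KT Kp).
have Lp := test_L2 mO tp.
have E1 := weak_derivB oOm Lp Lw (test_weak_deriv (e1 R) mO tp) wG1.
have E2 := weak_derivB oOm Lp Lw (test_weak_deriv (e2 R) mO tp) wG2.
rewrite (bformE oOm OmL E1 E2 E1 E2).
have [L1 _] := E1; have [L2 _] := E2.
have := ip_bounded oOm OmL L0 (normr_ge0 (c * h)) L1 _ => i1.
have := ip_bounded oOm OmL L0 (normr_ge0 (c * h)) L2 _ => i2.
apply: le_trans (lerD (i1 _) (i2 _)) _.
- by move=> p _; rewrite -[(_ - _) p]/('D_(e1 R) phi p - G1 p) distrC.
- by move=> p _; rewrite -[(_ - _) p]/('D_(e2 R) phi p - G2 p) distrC.
rewrite !exprMn !(real_normK (num_real _)) exprMn.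
by have := mulr_ge0 (mulr_ge0 (sqr_ge0 c) (sqr_ge0 h)) (sqr_ge0 L); lra.
Qed.

Local Notation V := (elt (H10s oOm OmL)).
Local Notation nV := (snorm (eb (oOm := oOm) (OmL := OmL))).

Lemma fe_dense (gamma : R) (v : V) (e : R) : 0 < e -> exists2 h0 : R, 0 < h0 &
  forall T, mesh_of Om T -> shape_regular gamma T -> mesh_size T < h0 ->
    exists w : V, S0 Om T (val w) /\ nV (v - w) <= e.
Proof.
move=> e0; have [_ /(_ _ (divr_gt0 e0 (ltr0n R 2)))[phi tp vp]] := H10sP v.
have [C [h1 [C0 h10 Cw]]] := interpolation_error gamma tp.
have C1 : 0 < C + 1 by rewrite ltr_wpDl.
exists (Num.min h1 (e / (2 * (C + 1)))).
  by rewrite lt_min h10 divr_gt0// mulr_gt0.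
move=> T mT sT; rewrite lt_min => /andP[hh1 he].
have [w Sw bw] := Cw T mT sT hh1.
have [_ Hw _] := Sw.
exists (mkelt (F := H10s oOm OmL) Hw); split => //.
pose u : V := mkelt (F := H10s oOm OmL) (test_H10 oOm OmL tp).
have hb := eb_semi oOm OmL.
apply: le_trans (snorm_dist hb v u _) _; rewrite [e]splitr; apply: lerD.
  by apply: le_trans (n1V_ge1 (v - u)) _; rewrite -norm1_n1V; exact: ltW.
have h0 : 0 <= mesh_size T.
  rewrite /mesh_size; elim: T {mT sT hh1 he bw Sw} => [|K T IH]; first by rewrite big_nil.
  by rewrite big_cons le_max IH orbT.
apply: le_trans (_ : C * mesh_size T <= _).
  by rewrite -[leRHS]ger0_norm ?mulr_ge0// -sqrtr_sqr ler_wsqrtr.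
apply: le_trans (_ : (C + 1) * mesh_size T <= _); first by rewrite ler_wpM2r// lerDl.
by rewrite -ler_pdivlMl//; apply: le_trans (ltW he) _; rewrite invfM mulrA mulrC.
Qed.

End Density.

(** * The singular function *)

Section AffineChange.
Variable R : realType.
Local Notation mu := (@mu2 R).
Local Notation M2 := (measurableTypeR R * measurableTypeR R)%type.
Local Notation meas2 D := (measurable (D : set M2)).
Local Notation measf2 D f := (measurable_fun (D : set M2) f).

Lemma int_aff_ge0 (f : plane R -> R) (c : R) t : 0 < c -> itg setT f -> (forall p, 0 <= f p) ->
  itg setT (f \o aff c t) /\ int setT f = c ^+ 2 * int setT (f \o aff c t).
Proof.
move=> c0 fi f0; have mf : measf2 setT f := itg_meas fi.
pose g : M2 -> M2 := aff c t.
have mg : measurable_fun setT g by exact: measurable_aff.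
pose m0 := measure_function_pushforward__canonical__measure_function_Measure mu mg.
pose m1 := mscale (NngNum (sqr_ge0 c)) m0.
have E A : meas2 A -> A `<=` setT -> mu A = m1 A.
  by move=> mA _; rewrite (mu2_aff t c0 mA).
have mfg : measf2 setT (f \o aff c t) by exact: measurableT_comp.
have E1 : (\int[mu]_p (f p)%:E = (c ^+ 2)%:E * \int[mu]_p (f (aff c t p))%:E)%E.
  have mF : measurable_fun (setT : set M2) (fun p => (f p)%:E) by exact/measurable_EFinP.
  have F0 p : (setT : set M2) p -> (0 <= (f p)%:E)%E by rewrite lee_fin.
  transitivity (\int[m1]_p (f p)%:E)%E; first exact: eq_measure_integral.
  transitivity ((c ^+ 2)%:E * \int[m0]_p (f p)%:E)%E.
    exact: (@ge0_integral_mscale _ M2 R m0 setT measurableT (NngNum (sqr_ge0 c)) _ mF F0).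
  apply: (congr1 (fun x => ((c ^+ 2)%:E * x)%E)).
  have F0' : {in (setT : set M2), forall p, (0 <= (f p)%:E)%E} by move=> p _; rewrite lee_fin.
  exact: (@ge0_integral_pushforward _ _ M2 M2 R g mg mu setT _ measurableT mF F0').
have c2 : 0 < c ^+ 2 by rewrite exprn_gt0.
have I1 : itg setT (f \o aff c t).
  apply/integrableP; split; first exact/measurable_EFinP.
  have /integrableP[_] := fi.
  under eq_integral => p _ do rewrite /= ger0_norm//.
  rewrite E1 => H; under eq_integral => p _ do rewrite /= ger0_norm//.
  set X := (\int[mu]_p (f (aff c t p))%:E)%E in H; rewrite -[ltLHS]/X.
  by case: X H => [r||]//; rewrite ?ltry// gt0_muley ?lte_fin.
split => //; apply/EFin_inj; rewrite EFinM !int_EFin//.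
Qed.

(** Writing f = (|f| + f) - |f| reduces the claim to nonnegative integrands. *)
Lemma int_aff (f : plane R -> R) (c : R) t : 0 < c -> itg setT f ->
  itg setT (f \o aff c t) /\ int setT f = c ^+ 2 * int setT (f \o aff c t).
Proof.
move=> c0 fi; have mT : meas2 setT by exact: measurableT.
pose F p := `|f p| + f p; pose G p := `|f p|.
have Gi : itg setT G by exact: (integrable_abse fi).
have Fi : itg setT F by exact: itgD.
have F0 p : 0 <= F p by rewrite /F; have := ler_norm (- f p); rewrite normrN; lra.
have [F1 FE] := int_aff_ge0 t c0 Fi F0.
have [G1 GE] := int_aff_ge0 t c0 Gi (fun p => normr_ge0 (f p)).
have fE : f = (fun p => F p - G p) by apply/funext => p; rewrite /F /G addrAC subrr add0r.
split; first by rewrite fE; exact: itgB.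
rewrite {1}fE intB// FE GE -mulrBr -intB//; congr (_ * _); apply: int_eq => p _ /=.
by rewrite /F /G addrAC subrr add0r.
Qed.

End AffineChange.

(** * Measurability, homogeneity and square-integrability of the singular function *)

Section Singular.
Variable R : realType.
Local Notation mu := (@mu2 R).
Local Notation M2 := (measurableTypeR R * measurableTypeR R)%type.
Local Notation meas2 D := (measurable (D : set M2)).
Local Notation measf2 D f := (measurable_fun (D : set M2) f).
Implicit Types p : plane R.

Lemma radius_continuous : continuous (@radius R).
Proof.
move=> p; apply: (continuous_comp (f := fun q : plane R => q.1 ^+ 2 + q.2 ^+ 2) (g := Num.sqrt)).
  by apply: cvgD; rewrite !expr2; apply: cvgM; (exact: cvg_fst || exact: cvg_snd).
exact: sqrt_continuous.
Qed.

Lemma radius_gt0 p : (0 < radius p) = (p != 0).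
Proof.
have [->|] := eqVneq p 0; first by rewrite /radius /= expr0n/= addr0 sqrtr0 ltxx.
apply: contraNT; rewrite /radius sqrtr_gt0 -leNgt => h.
have h1 := sqr_ge0 p.1; have h2 := sqr_ge0 p.2.
have z1 : p.1 ^+ 2 = 0 by lra.
have z2 : p.2 ^+ 2 = 0 by lra.
by move: z1 z2 => /eqP; rewrite sqrf_eq0 => /eqP z1 /eqP; rewrite sqrf_eq0 => /eqP z2;
  rewrite [p]surjective_pairing z1 z2.
Qed.

Lemma radius_scale (c : R) p : 0 <= c -> radius (c *: p) = c * radius p.
Proof.
move=> c0; rewrite /radius -[(c *: p).1]/(c * p.1) -[(c *: p).2]/(c * p.2) !exprMn -mulrDr.
by rewrite sqrtrM ?sqr_ge0// sqrtr_sqr ger0_norm.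
Qed.

Lemma angle_scale (c : R) p : 0 < c -> angle (c *: p) = angle p.
Proof.
move=> c0; rewrite /angle radius_scale ?(ltW c0)// -[(c *: p).2]/(c * p.2).
rewrite -[(c *: p).1]/(c * p.1) pmulr_rge0//.
by rewrite -mulf_div divff ?gt_eqF// mul1r.
Qed.

Lemma cos_in p : p.2 != 0 -> -1 < p.1 / radius p < 1.
Proof.
move=> p2; have r0 : 0 < radius p.
  by rewrite radius_gt0; apply: contraNneq p2 => ->.
have lt : `|p.1| < radius p.
  rewrite -sqrtr_sqr ltr_sqrt; first by rewrite ltrDl exprn_even_gt0.
  by rewrite ltr_wpDl ?sqr_ge0// exprn_even_gt0.
by rewrite -ltr_norml normrM normfV (gtr0_norm r0) ltr_pdivrMr// mul1r.
Qed.

Definition acosc p : R := acos (p.1 / radius p).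

Lemma cosc_continuous p : p != 0 -> {for p, continuous (fun q : plane R => q.1 / radius q)}.
Proof.
move=> p0; apply: cvgM; first exact: cvg_fst.
by apply: cvgV; [rewrite gt_eqF// radius_gt0|exact: radius_continuous].
Qed.

Lemma acosc_continuous p : p.2 != 0 -> {for p, continuous acosc}.
Proof.
move=> p2; apply: (continuous_comp (f := fun q : plane R => q.1 / radius q) (g := acos)).
  by apply: cosc_continuous; apply: contraNneq p2 => ->.
by apply: continuous_acos; exact: cos_in.
Qed.

Lemma measurable_fst2 : measf2 setT (fun p => p.1 : R).
Proof. by apply: continuous_measurable2 => p; exact: cvg_fst. Qed.
Lemma measurable_snd2 : measf2 setT (fun p => p.2 : R).
Proof. by apply: continuous_measurable2 => p; exact: cvg_snd. Qed.

(** Off the horizontal axis the function is continuous; on the axis it takes one value on each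
    half-line and one at the origin. *)
Lemma acosc_measurable : measf2 setT acosc.
Proof.
pose U : set (plane R) := [set p | p.2 != 0].
have oU : open U.
  apply: (@open_comp _ _ (fun p : plane R => p.2) [set x | x != 0]) => [p _|].
    exact: cvg_snd.
  exact: open_neq.
have mU : meas2 U := open_measurable2 oU.
rewrite -(setUv U); apply/measurable_funU => //; first exact: measurableC.
split; first by apply: open_continuous_measurable2 => // p; exact: acosc_continuous.
pose F p : R := if 0 < p.1 then acos 1 else if p.1 < 0 then acos (- 1) else acos 0.
apply: (eq_measurable_fun F).
  move=> p; rewrite inE /U /= => /negP; rewrite negbK => /eqP p2.
  rewrite /F /acosc /radius p2 expr0n addr0 sqrtr_sqr.
  have [p1|p1|<-] := ltgtP 0 p.1.
  - by rewrite (gtr0_norm p1) divff// gt_eqF.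
  - by rewrite (ltr0_norm p1) invrN mulrN divff// lt_eqF.
  - by rewrite mul0r.
apply: (@measurable_funS _ _ M2 R setT) => //.
apply: measurable_fun_ifT => //; first exact: (measurable_fun_ltr (measurable_cst _) measurable_fst2).
apply: measurable_fun_ifT => //; exact: (measurable_fun_ltr measurable_fst2 (measurable_cst _)).
Qed.

Lemma angle_measurable : measf2 setT (@angle R).
Proof.
apply: measurable_fun_ifT.
- exact: (measurable_fun_ler (measurable_cst _) measurable_snd2).
- exact: acosc_measurable.
- by apply: measurable_funB => //; exact: acosc_measurable.
Qed.

Variables (om tau rho : R) (chi : R -> R).
Hypotheses (om0 : 0 < om) (tau01 : 0 < tau < 1) (rho0 : 0 < rho) (hchi : cutoff tau rho chi).
Local Notation s := (sing om chi).
Local Notation al := (pi / om).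

Lemma chi_continuous r : 0 < r -> {for r, continuous chi}.
Proof.
have [dchi _ _] := hchi; move=> r0; apply: differentiable_continuous.
by apply/derivable1_diffP; exact: (dchi 0%N r r0).
Qed.

Lemma chi_bounded : exists2 M : R, 0 < M & forall r, 0 <= r -> `|chi r| <= M.
Proof.
have [_ chi1 chi0] := hchi; have /andP[t0 t1] := tau01.
have tr0 : 0 < tau * rho by rewrite mulr_gt0.
have : bounded_set (chi @` `[tau * rho, rho]).
  apply: compact_bounded; apply: continuous_compact; last exact: segment_compact.
  apply: continuous_in_subspaceT => r; rewrite inE/= in_itv/= => /andP[r1 _].
  by apply: chi_continuous; exact: lt_le_trans r1.
move=> [M [Mr MP]]; exists (`|M| + 1); first by rewrite ltr_wpDl.
have M1 : M < `|M| + 1 by rewrite (le_lt_trans (ler_norm _))// ltrDl.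
move=> r r0; have [rt|rt] := leP r (tau * rho).
  by rewrite chi1 ?r0// normr1 lerDr.
have [rr|rr] := leP r rho; last by rewrite chi0// normr0 addr_ge0.
by apply: (MP _ M1); exists r => //=; rewrite in_itv/= rr (ltW rt).
Qed.

Lemma sing_measurable : measf2 setT s.
Proof.
have mr : measf2 setT (@radius R) by apply: continuous_measurable2; exact: radius_continuous.
apply: measurable_funM; first apply: measurable_funM.
- have m1 : meas2 [set (0 : plane R)].
    by apply: closed_measurable2; apply: compact_plane_closed; exact: compact_set1.
  rewrite -(setUv [set (0 : plane R)]); apply/measurable_funU => //; first exact: measurableC.
  split; first exact: measurable_fun_set1.
  apply: open_continuous_measurable2.
    by apply: closed_openC; apply: compact_plane_closed; exact: compact_set1.
  move=> p /eqP p0; apply: continuous_comp; first exact: radius_continuous.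
  by apply: chi_continuous; rewrite radius_gt0.
- by apply: (measurableT_comp (measurable_powR _)).
- apply: measurableT_comp; first by apply: continuous_measurable_fun; exact: continuous_sin.
  by apply: measurable_funM => //; apply: measurable_funM => //; exact: angle_measurable.
Qed.

Lemma sing_le : exists2 M : R, 0 < M & forall p, `|s p| <= M * radius p `^ (- al).
Proof.
have [M M0 MP] := chi_bounded; exists M => // p.
rewrite /sing !normrM (ger0_norm (powR_ge0 _ _)) -[leRHS]mulr1.
apply: ler_pM; rewrite ?mulr_ge0 ?powR_ge0//.
  by apply: ler_wpM2r; [exact: powR_ge0|apply: MP; exact: sqrtr_ge0].
by rewrite ler_norml sin_geN1 sin_le1.
Qed.

(** Near the corner the cut-off is 1, and [angle] is invariant under dilation. *)
Lemma sing_scale (c : R) p : 0 < c -> c <= 1 -> radius p <= tau * rho ->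
  s (c *: p) = c `^ (- al) * s p.
Proof.
move=> c0 c1 pr; have [_ chi1 _] := hchi.
have rp : 0 <= radius p := sqrtr_ge0 _.
rewrite /sing angle_scale// radius_scale ?(ltW c0)// powRM ?(ltW c0)//.
rewrite !chi1 ?rp ?mulr_ge0 ?(ltW c0)//= ?mul1r ?mulrA//.
by apply: le_trans pr; rewrite ler_piMl.
Qed.

Lemma sing_continuous p : 0 < p.2 -> {for p, continuous s}.
Proof.
move=> p2; have p0 : p != 0 by apply: contraTneq p2 => ->; rewrite ltxx.
have r0 : 0 < radius p by rewrite radius_gt0.
have cr := @radius_continuous p.
apply: cvgM; first apply: cvgM.
- by apply: (continuous_comp (f := @radius R) (g := chi)) => //; exact: chi_continuous.
- apply: (continuous_comp (f := @radius R) (g := fun x => x `^ (- al))) => //.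
  apply: differentiable_continuous; apply/derivable1_diffP; apply: derivable_powR.
  by rewrite in_itv/= r0.
- apply: (continuous_comp (f := fun q => pi * angle q / om) (g := sin)); last exact: continuous_sin.
  apply: cvgM; last exact: cvg_cst.
  apply: cvgM; first exact: cvg_cst.
  have : \forall q \near p, acosc q = angle q.
    have : nbhs p [set q : plane R | 0 < q.2].
      apply: open_nbhs_nbhs; split => //.
      apply: (@open_comp _ _ (fun p : plane R => p.2) [set x | 0 < x]) => [q _|].
        exact: cvg_snd.
      exact: open_gt.
    by apply: filterS => q /= q2; rewrite /angle (ltW q2).
  move=> H; rewrite (_ : angle p = acosc p); last by rewrite (nbhs_singleton H).
  apply: cvg_trans (near_eq_cvg H) _.
  by apply: acosc_continuous; rewrite gt_eqF.
Qed.

Lemma sing_annulus_bound (M r : R) (p : plane R) : 0 < r ->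
  (forall p, `|s p| <= M * radius p `^ (- al)) -> 0 < M -> ~ box r p ->
  s p ^+ 2 <= M ^+ 2 * r `^ (- (2 * al)).
Proof.
move=> r0 sM M0 bp; have rp : r <= radius p.
  have [h1 h2] := radius_ge p; rewrite leNgt; apply: contra_notN bp => pr.
  by apply/boxE; split; [exact: le_trans h1 (ltW pr)|exact: le_trans h2 (ltW pr)].
have al0 : 0 <= al by rewrite divr_ge0 ?pi_ge0// ltW.
have le : radius p `^ (- al) <= r `^ (- al).
  rewrite !powRN lef_pV2 ?posrE ?powR_gt0//; last exact: lt_le_trans rp.
  by apply: ge0_ler_powR => //; rewrite nnegrE ?(ltW r0)// (le_trans (ltW r0)).
have -> : r `^ (- (2 * al)) = (r `^ (- al)) ^+ 2.
  rewrite -powR_mulrn ?powR_ge0// -powRrM; congr (_ `^ _); ring.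
rewrite -exprMn -real_normK ?num_real// lerXn2r ?nnegrE//.
  by rewrite mulr_ge0 ?powR_ge0// ltW.
by apply: le_trans (sM p) _; rewrite ler_pM2l.
Qed.

(* On the annulus of max-norm radius about [2^-k] the square of the singular function is of order
   [4^(k al)] and the area of order [4^-k], with [al < 1]. *)
Lemma sing_L2 (Om : set (plane R)) (L : R) : pi < om -> meas2 Om -> Om `<=` box L -> 0 < L ->
  ~ Om 0 -> L2 Om s.
Proof.
move=> pi_om mO OmL L0 O0; split; first exact: measurable_funTS sing_measurable.
have [M M0 sM] := sing_le.
pose r k : R := L * 2^-1 ^+ k.
have r0 k : 0 < r k by rewrite mulr_gt0// exprn_gt0// invr_gt0.
pose A k := Om `&` (box (r k) `\` box (r k.+1)).
have mA k : meas2 (A k).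
  by apply: measurableI => //; apply: measurableD; exact: measurable_boxc.
have rS k : r k.+1 = r k / 2 by rewrite /r exprS mulrCA mulrC.
have sub k l p : (k <= l)%N -> box (r l) p -> box (r k) p.
  move=> kl /boxE[p1 p2]; have le : r l <= r k.
    by rewrite /r ler_pM2l// ler_wiXn2l ?invr_ge0// invf_le1// ler1n.
  by apply/boxE; split; [exact: le_trans p1 le|exact: le_trans p2 le].
have OA : Om = \bigcup_k A k.
  apply/seteqP; split => [p Op|p [k _ []]//].
  have b0 : box (r 0) p by rewrite /r expr0 mulr1; exact: OmL.
  (* The origin is the only point in all the boxes, and it lies outside [Om]. *)
  have [N bN] : exists N, ~ box (r N) p.
    apply: contrapT => /forallNP bp; apply: O0.
    have z (x : R) : (forall k, `|x| <= r k) -> x = 0.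
      move=> xr; apply/eqP; rewrite -normr_le0; apply: (@le0_eps _ _ L) => [|e e0].
        exact: ltW.
      have [N NP] := half_pow_small e0.
      by apply: le_trans (xr N) _; rewrite ler_pM2l// ltW// NP.
    have p1 : p.1 = 0 by apply: z => k; have /contrapT/boxE[] := bp k.
    have p2 : p.2 = 0 by apply: z => k; have /contrapT/boxE[] := bp k.
    suff <- : p = 0 by [].
    by rewrite [LHS]surjective_pairing p1 p2.
  elim: N bN => [//|N IH bN]; have [bN'|] := pselect (box (r N) p); last exact: IH.
  by exists N.
have tA : trivIset setT A.
  apply: ltn_trivIset => k l kl; apply/seteqP; split => // p [[_ [b1 b2]] [_ [b3 b4]]].
  by move: b2 b4 b1 b3 => b2 b4 b1 b3; first [case: b2; exact: sub kl b3|case: b4; exact: sub kl b1].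
pose q : R := 4^-1 * 2 `^ (2 * al).
pose C : R := M ^+ 2 * (L / 2) `^ (- (2 * al)) * (4 * L ^+ 2).
have q0 : 0 < q by rewrite mulr_gt0 ?invr_gt0 ?powR_gt0.
have q1 : `|q| < 1.
  rewrite gtr0_norm// /q mulrC ltr_pdivrMr// mul1r.
  have -> : 4 = 2 `^ 2%:R :> R by rewrite powR_mulrn//; ring.
  rewrite /powR pnatr_eq0/= ltr_expR ltr_pM2r ?ln_gt0 ?ltr1n//.
  by rewrite -[ltRHS]mulr1 ltr_pM2l// ltr_pdivrMr// mul1r.
have mf : measurable_fun (Om : set M2) (fun p => (s p ^+ 2)%:E).
  apply/measurable_EFinP; apply: measurable_funX; exact: measurable_funTS sing_measurable.
apply/integrableP; split => //.
under eq_integral => p _ do rewrite /= ger0_norm ?sqr_ge0//.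
have Ak k : (\int[mu]_(p in A k) (s p ^+ 2)%:E <= (C * q ^+ k)%:E)%E.
  apply: (@le_trans _ _ (\int[mu]_(p in A k) (M ^+ 2 * r k.+1 `^ (- (2 * al)))%:E)%E).
    apply: ge0_le_integral => //.
    - by move=> p _; rewrite lee_fin sqr_ge0.
    - apply/measurable_EFinP; apply: measurable_funX; exact: measurable_funTS sing_measurable.
    by move=> p [_ [_ bp]]; rewrite lee_fin; exact: (sing_annulus_bound (r0 k.+1) sM M0 bp).
  rewrite integral_cst//.
  have le : (mu (A k) <= ((2 * r k) ^+ 2)%:E)%E.
    have -> : ((2 * r k) ^+ 2)%:E = mu (box (r k)).
      by rewrite /box mu_rect ?ge0_cp ?(ltW (r0 k))//; congr (_%:E); ring.
    apply: le_measure; rewrite ?inE//; first exact: measurable_boxc.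
    by move=> p [_ []].
  apply: le_trans (lee_wpmul2l _ le) _.
    by rewrite lee_fin mulr_ge0 ?sqr_ge0 ?powR_ge0.
  rewrite -EFinM lee_fin le_eqVlt; apply/orP; left; apply/eqP.
  have -> : r k.+1 `^ (- (2 * al)) = (L / 2) `^ (- (2 * al)) * (2 `^ (2 * al)) ^+ k.
    have -> : r k.+1 = (L / 2) * 2^-1 ^+ k by rewrite /r exprS; ring.
    rewrite powRM ?exprn_ge0 ?divr_ge0 ?invr_ge0 ?(ltW L0)//; congr (_ * _).
    rewrite exprVn -powR_invn// -powRrM -powR_mulrn ?powR_ge0// -powRrM.
    by congr (_ `^ _); ring.
  have -> : q ^+ k = (2^-1 ^+ k) ^+ 2 * 2 `^ (2 * al) ^+ k.
    rewrite /q exprMn -exprM mulnC exprM; congr (_ ^+ k * _).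
    by rewrite exprVn; congr (_^-1); ring.
  by rewrite /C /r; move: (_ `^ _) (_ `^ _ ^+ k) (2^-1 ^+ k) => x y z; field.
rewrite {1}OA ge0_integral_bigcup//; last 2 first.
- by rewrite -OA.
- by move=> p _; rewrite lee_fin sqr_ge0.
apply: (@le_lt_trans _ _ (\sum_(k <oo) (C * q ^+ k)%:E)%E).
  by apply: lee_nneseries => [k _ _|k _]; [apply: integral_ge0 => p _; rewrite lee_fin sqr_ge0|exact: Ak].
apply: (@le_lt_trans _ _ (C * (1 - q)^-1)%:E); last exact: ltry.
have C0 : 0 <= C.
  by apply: mulr_ge0; apply: mulr_ge0; rewrite ?sqr_ge0 ?powR_ge0.
apply: lime_le.
  by apply: is_cvg_nneseries => k _ _; rewrite lee_fin mulr_ge0// exprn_ge0// ltW.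
apply: nearW => n; rewrite sumEFin lee_fin.
exact: geometric_le_lim.
Qed.

End Singular.

Section StepMonotone.
Variable R : realType.

(** With f and g the two terms of the denominator, the derivative has numerator f' g - f g', where f
    increases and g decreases. [test_profile] uses the sign. *)
Lemma step_derive_ge0 (x : R) : 0 <= 'D_1 (@step R) x.
Proof.
pose f := flat (R := R) 0; pose g y := f (- 1 * y + 1).
have F0 (y : R) : 0 <= flat 2 y.
  by rewrite /flat; case: ifP => // y0; rewrite mulr_ge0 ?exprn_ge0 ?expR_ge0// invr_ge0 ltW.
have df y : is_derive y (1 : R) f (flat 2 y).
  by apply: is_derive1_eq (is_derive_flat 0 y) _; rewrite oppr0 mul0r add0r.
have ff y : 'D_1 f y = flat 2 y by have [] := df y.
have dg : is_derive x (1 : R) g (- flat 2 (- 1 * x + 1)).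
  have H := is_derive1_affine (-1) 1 x (flat_smooth R 0 : smooth1 f).
  move: H; rewrite ff => H.
  have -> : g = (fun s => f (1 + s * -1)) by apply/funext => y; rewrite /g; congr f; ring.
  by apply: is_derive1_eq H _; rewrite mulrN1; congr (- flat 2 _); ring.
have den : f x + g x != 0 by rewrite gt_eqF// step_den.
have H := is_derive1M (df x) (is_derive1V (f := f + g) den (is_deriveD (df x) dg)).
have [_ ->] : is_derive x (1 : R) (@step R) _ := H.
have f0 : 0 <= f x := flat0_ge0 x; have g0 : 0 <= g x := flat0_ge0 _.
have -> : f x * (- ((f x + g x)^-1 * (f x + g x)^-1) * (flat 2 x + - flat 2 (- 1 * x + 1))) +
    (f x + g x)^-1 * flat 2 x =
  (flat 2 x * g x + f x * flat 2 (- 1 * x + 1)) * (f x + g x)^-1 ^+ 2.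
  by move: den; move: (f x) (g x) (flat 2 x) (flat 2 _) => a b c d ?; field.
by rewrite mulr_ge0 ?sqr_ge0// addr_ge0// mulr_ge0.
Qed.

End StepMonotone.

Section PlaneNull.
Variable R : realType.
Local Notation mu := (@mu2 R).
Local Notation M2 := (measurableTypeR R * measurableTypeR R)%type.
Local Notation meas2 D := (measurable (D : set M2)).

Lemma null_on_continuous (Om : set (plane R)) (f : plane R -> R) p : open Om -> Om p ->
  {for p, continuous f} -> null_on Om f -> f p = 0.
Proof.
move=> oOm Op cf [N [mN N0 fN]]; apply/eqP; apply/negPn/negP => fp.
have : nbhs p (Om `&` [set q | f q != 0]).
  apply: filterI; first exact: open_nbhs_nbhs.
  by apply: (cf [set x | x != 0]); apply: open_nbhs_nbhs; split => //; exact: open_neq.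
move=> /plane_nbhs[e e0 eP].
have e2 : 0 < e / 2 by rewrite divr_gt0.
pose B : set (plane R) := `[p.1, p.1 + e / 2] `*` `[p.2, p.2 + e / 2].
have BN : B `<=` N.
  move=> q [/= + +]; rewrite !in_itv/= => /andP[q1 q1'] /andP[q2 q2'].
  have [||Oq /= fq] := eP q.
  - by rewrite ler0_norm ?subr_le0// opprB; lra.
  - by rewrite ler0_norm ?subr_le0// opprB; lra.
  by apply: fN => /(_ Oq) fq0; rewrite fq0 eqxx in fq.
have mB : meas2 B by apply: measurableX.
have : (mu B <= 0)%E by rewrite -N0; apply: le_measure; rewrite ?inE.
rewrite /B mu_rect ?lerDl ?(ltW e2)// lee_fin leNgt => /negP; apply.
by rewrite ![_ + _ - _]addrAC !subrr !add0r mulr_gt0.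
Qed.

End PlaneNull.

(** * The singular function has no weak derivative in L^2 *)

Section NotH1.
Variable R : realType.
Local Notation mu := (@mu2 R).
Local Notation M2 := (measurableTypeR R * measurableTypeR R)%type.
Local Notation meas2 D := (measurable (D : set M2)).
Local Notation measf2 D f := (measurable_fun (D : set M2) f).
Variables (Om : set (plane R)) (L om tau rho : R) (chi : R -> R).
Hypotheses (oOm : open Om) (OmL : Om `<=` box L) (L0 : 0 < L).
Hypotheses (pi_om : pi < om) (tau01 : 0 < tau < 1) (rho0 : 0 < rho).
Hypotheses (hchi : cutoff tau rho chi) (hsector : sector_inside Om om rho).
Let mO : meas2 Om. Proof. exact: open_measurable2. Qed.
Let om0 : 0 < om. Proof. exact: lt_trans (pi_gt0 R) pi_om. Qed.
Local Notation s := (sing om chi).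
Local Notation al := (pi / om).
Let T := tau * rho.
Let T0 : 0 < T. Proof. by have /andP[t0 _] := tau01; rewrite mulr_gt0. Qed.
Let al0 : 0 < al. Proof. by rewrite divr_gt0 ?pi_gt0. Qed.
Let al1 : al < 1. Proof. by rewrite ltr_pdivrMr// mul1r. Qed.

(** The polar angle of such a point lies between 0 and pi, which is below [om]. *)
Lemma upper_sector p : 0 < p.2 -> radius p <= T -> Om p.
Proof.
have [sec _] := hsector; have /andP[t0 t1] := tau01.
move=> p2 pr; have r0 : 0 < radius p.
  by rewrite radius_gt0; apply: contraTneq p2 => ->; rewrite ltxx.
have /andP[c1 c2] := cos_in (lt0r_neq0 p2).
have cE : cos (acosc p) = p.1 / radius p by apply: acosK; rewrite in_itv/= !ltW.
have sE : sin (acosc p) = p.2 / radius p.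
  rewrite /acosc sin_acos ?(ltW c1) ?(ltW c2)//.
  have rr : radius p ^+ 2 = p.1 ^+ 2 + p.2 ^+ 2.
    by rewrite /radius sqr_sqrtr// addr_ge0 ?sqr_ge0.
  have -> : 1 - (p.1 / radius p) ^+ 2 = (p.2 / radius p) ^+ 2.
    by rewrite !exprMn exprVn rr; field; rewrite -rr expf_neq0// gt_eqF.
  by rewrite sqrtr_sqr ger0_norm// divr_ge0// ltW.
have -> : p = polar (radius p) (acosc p).
  by rewrite /polar cE sE ![radius p * _]mulrCA !mulfV ?gt_eqF// !mulr1 -surjective_pairing.
apply: sec.
  by rewrite r0/= (le_trans pr)// ler_piMl// ltW.
have h1 : 0 < acosc p by apply: acos_gt0; rewrite c2 ltW.
have h2 : acosc p < pi by apply: acos_ltpi; rewrite c1 ltW.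
by rewrite h1 (lt_trans h2).
Qed.

Lemma sing_polar r t : 0 < r <= T -> 0 <= t < 2 * pi -> s (polar r t) = r `^ (- al) * sin (al * t).
Proof.
move=> /andP[r0 rT] /andP[t0 t2]; have [_ chi1 _] := hchi.
have rE : radius (polar r t) = r.
  by rewrite /radius /= !exprMn -mulrDr cos2Dsin2 mulr1 sqrtr_sqr gtr0_norm.
rewrite /sing angle_polar// rE chi1 ?mul1r ?(ltW r0)//.
by congr (_ * sin _); rewrite mulrAC.
Qed.

Let r1 := T / 4.
Let x1 := r1 * cos (pi / 4).
Let y0 := r1 * sin (pi / 4).
Let pi0 : 0 < pi :> R := pi_gt0 R.

(** The points have equal radius and polar angles pi/4 and 3 pi/4; the two values differ by a
    positive multiple of cos(al pi / 2) sin(al pi / 4), which is positive since al < 1. So [s] is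
    not constant on the horizontal segment between them. *)
Lemma corner_points : [/\ 0 < x1 <= r1, 0 < y0 <= r1 & s (x1, y0) < s (- x1, y0)].
Proof.
have r10 : 0 < r1 by rewrite divr_gt0.
have c0 : 0 < cos (pi / 4 : R) by apply: cos_gt0_pihalf; apply/andP; split; move: pi0; lra.
have s0 : 0 < sin (pi / 4 : R) by apply: sin_gt0_pi; apply/andP; split; move: pi0; lra.
split; first by rewrite mulr_gt0// ler_piMr ?cos_le1// ltW.
  by rewrite mulr_gt0// ler_piMr ?sin_le1// ltW.
have -> : (- x1, y0) = polar r1 (pi - pi / 4).
  have sE : sin (pi - pi / 4) = sin (pi / 4) :> R by rewrite sinB sinpi cospi; ring.
  have cE : cos (pi - pi / 4) = - cos (pi / 4) :> R by rewrite cosB sinpi cospi; ring.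
  by rewrite /polar sE cE mulrN.
rewrite -[(x1, y0)]/(polar r1 (pi / 4)) !sing_polar; last first.
- by apply/andP; split; move: pi0; lra.
- by rewrite r10/= /r1; move: T0; lra.
- by apply/andP; split; move: pi0; lra.
- by rewrite r10/= /r1; move: T0; lra.
rewrite ltr_pM2l ?powR_gt0//.
have E1 (a p : R) : a * (p / 4) = a * p / 2 - a * p / 4 by field.
have E2 (a p : R) : a * (p - p / 4) = a * p / 2 + a * p / 4 by field.
rewrite E1 E2.
have ap0 : 0 < al * pi by rewrite mulr_gt0.
have ap1 : al * pi < pi by rewrite gtr_pMl.
move: (al * pi) ap0 ap1 => u u0 u1.
rewrite [ltRHS]sinD sinB -subr_gt0.
have -> : sin (u / 2) * cos (u / 4) + cos (u / 2) * sin (u / 4) -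
  (sin (u / 2) * cos (u / 4) - cos (u / 2) * sin (u / 4)) = 2 * (cos (u / 2) * sin (u / 4)) by ring.
rewrite mulr_gt0// mulr_gt0//.
  by apply: cos_gt0_pihalf; apply/andP; split; move: pi0; lra.
by apply: sin_gt0_pi; apply/andP; split; lra.
Qed.

(** A is a plateau that rises only near -x1 and falls only near x1, and B is concentrated near y0.
    There s lies above, respectively below, the mean value m, so that s - m and the x-derivative of
    A B never have opposite signs. *)
Lemma test_profile : exists (A B : R -> R) (m d r : R),
  [/\ 0 < d, 0 < r & 3 * r <= T] /\
  [/\ smooth1 A, smooth1 B,
    forall p, ~ (`|p.1| <= r /\ d <= p.2 <= 2 * r) -> A p.1 * B p.2 = 0,
    exists p, A p.1 * B p.2 != 0 &
    forall p, let D := 'D_1 A p.1 * B p.2 in 0 <= (s p - m) * D /\ (D != 0 -> s p != m)].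
Proof.
have [/andP[x10 x1r] /andP[y00 y0r] sxy] := corner_points.
pose m := (s (x1, y0) + s (- x1, y0)) / 2.
have m1 : s (x1, y0) < m by rewrite /m; lra.
have m2 : m < s (- x1, y0) by rewrite /m; lra.
have N1 : nbhs ((x1, y0) : plane R) [set q | s q < m].
  have cs : {for ((x1, y0) : plane R), continuous s} by apply: (sing_continuous hchi).
  apply: (cs [set x | x < m]).
  by apply: open_nbhs_nbhs; split => //; exact: open_lt.
have N2 : nbhs ((- x1, y0) : plane R) [set q | m < s q].
  have cs : {for ((- x1, y0) : plane R), continuous s} by apply: (sing_continuous hchi).
  apply: (cs [set x | m < x]).
  by apply: open_nbhs_nbhs; split => //; exact: open_gt.
have [d1 d10 D1] := plane_nbhs N1; have [d2 d20 D2] := plane_nbhs N2.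
(* Transitions of length e stay where s is on the right side of m, do not meet each other (e < x1),
   and keep the support above the axis (e < y0). *)
pose e := Num.min (Num.min d1 d2) (Num.min x1 y0) / 2.
have e0 : 0 < e by rewrite divr_gt0// !lt_min d10 d20 x10 y00.
have [ed1 ed2 ex ey] : [/\ e < d1, e < d2, e < x1 & e < y0].
  have h : 0 < Num.min (Num.min d1 d2) (Num.min x1 y0) by rewrite !lt_min d10 d20 x10 y00.
  have h2 : e < Num.min (Num.min d1 d2) (Num.min x1 y0) by rewrite /e ltr_pdivrMr// ltr_pMr// ltr1n.
  by move: h2; rewrite !lt_min => /andP[/andP[? ?] /andP[? ?]].
pose c := e^-1; have c0 : 0 < c by rewrite invr_gt0.
have ce : c * e = 1 by rewrite mulVf// gt_eqF.
pose u x := step (c * x + c * x1); pose v x := step (- c * x + c * x1).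
pose B y := step (c * y + (1 - c * y0)) * step (- c * y + (1 + c * y0)).
have su : smooth1 u by exact/smooth1_affine/step_smooth.
have sv : smooth1 v by exact/smooth1_affine/step_smooth.
have sB : smooth1 B by apply: smooth1M; exact/smooth1_affine/step_smooth.
have B0 y : 0 <= B y by rewrite mulr_ge0// step_ge0.
have BE y : B y != 0 -> `|y - y0| < e.
  rewrite mulf_eq0 negb_or => /andP[h1 h2].
  have k1 : 0 < c * y + (1 - c * y0) by rewrite ltNge; apply: contraNN h1 => /step_eq0 ->.
  have k2 : 0 < - c * y + (1 + c * y0) by rewrite ltNge; apply: contraNN h2 => /step_eq0 ->.
  rewrite ltr_norml -(ltr_pM2l c0) -(ltr_pM2l c0 (y - y0)) mulrN ce mulrBr.
  by apply/andP; split; lra.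
have dA x : is_derive x (1 : R) (fun x => u x * v x)
    (u x * (- c * 'D_1 (@step R) (- c * x + c * x1)) + v x * (c * 'D_1 (@step R) (c * x + c * x1))).
  apply: is_derive1M.
    have -> : u = (fun s => step (c * x1 + s * c)) by apply/funext => y; rewrite /u addrC [c * y]mulrC.
    apply: is_derive1_eq (is_derive1_affine c (c * x1) x (@step_smooth R)) _.
    by rewrite mulrC addrC [c * x]mulrC.
  have -> : v = (fun s => step (c * x1 + s * - c)) by apply/funext => y; rewrite /v addrC [- c * y]mulrC.
  apply: is_derive1_eq (is_derive1_affine (- c) (c * x1) x (@step_smooth R)) _.
  by rewrite mulrC addrC [- c * x]mulrC.
exists (fun x => u x * v x), B, m, (y0 - e), r1; split.
  by rewrite subr_gt0 ey divr_gt0//; split => //; rewrite /r1; move: T0; lra.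
split => //.
- exact: smooth1M.
- move=> p np; apply/eqP; apply: contra_notT np => h.
  have h1 : u p.1 != 0 by apply: contraNneq h => ->; rewrite !mul0r.
  have h2 : v p.1 != 0 by apply: contraNneq h => ->; rewrite mulr0 mul0r.
  have h3 : B p.2 != 0 by apply: contraNneq h => ->; rewrite mulr0.
  have k1 : 0 < c * p.1 + c * x1 by rewrite ltNge; apply: contraNN h1; rewrite /u => /step_eq0 ->.
  have k2 : 0 < - c * p.1 + c * x1 by rewrite ltNge; apply: contraNN h2; rewrite /v => /step_eq0 ->.
  have [b1 b2] : - e < p.2 - y0 /\ p.2 - y0 < e.
    by have := BE _ h3; rewrite ltr_norml => /andP.
  split; last by apply/andP; split; lra.
  apply: le_trans x1r; rewrite ler_norml -(ler_pM2l c0) -(ler_pM2l c0 p.1).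
  by apply/andP; split; lra.
- exists (0, y0) => /=; rewrite /u /v /B !mulr0 !add0r.
  have ce1 : 1 <= c * x1 by rewrite -ce ler_pM2l// ltW.
  rewrite !(step_eq1 ce1) !mul1r.
  by rewrite !step_eq1 ?mulr1 ?oner_neq0//; lra.
- move=> p; have [_ ->] := dA p.1; rewrite -/(B p.2) => D.
  have [D0|D0] := eqVneq D 0; first by rewrite D0 mulr0 lexx; split.
  have [h1 h2] : (u p.1 * (- c * 'D_1 (@step R) (- c * p.1 + c * x1)) +
    v p.1 * (c * 'D_1 (@step R) (c * p.1 + c * x1))) != 0 /\ B p.2 != 0.
    by move: D0; rewrite mulf_eq0 negb_or => /andP.
  have pe := BE _ h2.
  have cx1 : 1 <= c * x1 by rewrite -ce ler_pM2l// ltW.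
  have Bp : 0 < B p.2 by rewrite lt_neqAle eq_sym h2 B0.
  have [x0|x0] := leP p.1 0.
    have a1 : 1 <= - c * p.1 + c * x1 by rewrite mulNr -mulrN -[1]add0r lerD// mulr_ge0 ?oppr_ge0// ltW.
    have z2 : 'D_1 (@step R) (- c * p.1 + c * x1) = 0 by apply: step_derive0 => /andP[_]; rewrite ltNge a1.
    have v1 : v p.1 = 1 by exact: step_eq1.
    rewrite z2 v1 mulr0 mulr0 add0r mul1r in h1; rewrite /D z2 v1 mulr0 mulr0 add0r mul1r.
    have /andP[k1 k2] : 0 < c * p.1 + c * x1 < 1.
      by apply: contrapT => k; move: h1; rewrite (step_derive0 k) mulr0 eqxx.
    have sm : m < s p.
      apply: D2 => /=; last by rewrite distrC (lt_trans pe).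
      apply: lt_trans ed2; rewrite -(ltr_pM2l c0) ce -{1}(gtr0_norm c0) -normrM.
      by rewrite mulrBr mulrN -opprD normrN addrC gtr0_norm.
    split; last by rewrite gt_eqF.
    rewrite mulr_ge0 ?subr_ge0 ?(ltW sm)// mulr_ge0// mulr_ge0 ?(ltW c0)//.
    exact: step_derive_ge0.
  have a1 : 1 <= c * p.1 + c * x1 by rewrite -[1]add0r lerD// mulr_ge0// ltW.
  have z2 : 'D_1 (@step R) (c * p.1 + c * x1) = 0 by apply: step_derive0 => /andP[_]; rewrite ltNge a1.
  have v1 : u p.1 = 1 by exact: step_eq1.
  rewrite z2 v1 mulr0 mulr0 addr0 mul1r in h1; rewrite /D z2 v1 mulr0 mulr0 addr0 mul1r.
  have /andP[k1 k2] : 0 < - c * p.1 + c * x1 < 1.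
    by apply: contrapT => k; move: h1; rewrite (step_derive0 k) mulr0 eqxx.
  have sm : s p < m.
    apply: D1 => /=; last by rewrite distrC (lt_trans pe).
    apply: lt_trans ed1; rewrite -(ltr_pM2l c0) ce -{1}(gtr0_norm c0) -normrM.
    by rewrite mulrBr addrC -mulNr gtr0_norm.
  split; last by rewrite lt_eqF.
  rewrite mulNr mulNr mulrN -mulNr opprB mulr_ge0 ?subr_ge0 ?(ltW sm)// mulr_ge0// mulr_ge0 ?(ltW c0)//.
  exact: step_derive_ge0.
Qed.

(* Testing with [phi (2^n x)] and using the homogeneity of [s], the two sides of the integration by
   parts scale like [2^(n al)] and [1]; hence the left side vanishes, which a profile as in
   [test_profile] forbids. *)
Lemma sing_no_weak_deriv g : L2 Om s -> ~ is_weak_deriv Om (e1 R) s g.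
Proof.
move=> Ls [Lg sg]; have [A [B [m [d [r [[d0 r0 rT] [sA sB out [pt ptN] sign]]]]]]] := test_profile.
pose phi (n : nat) p := A (2 ^+ n * p.1) * B (2 ^+ n * p.2).
have two (n : nat) : 0 < (2 ^+ n : R) by rewrite exprn_gt0.
have two1 (n : nat) : 1 <= (2 ^+ n : R) by rewrite exprn_ege1// ler1n.
have sAn n : smooth1 (fun x => A (2 ^+ n * x)).
  by under eq_fun do rewrite -[2 ^+ n * _]addr0; exact: smooth1_affine.
have sBn n : smooth1 (fun x => B (2 ^+ n * x)).
  by under eq_fun do rewrite -[2 ^+ n * _]addr0; exact: smooth1_affine.
have inUp p : `|p.1| <= r /\ d <= p.2 <= 2 * r -> 0 < p.2 /\ radius p <= T.
  move=> [p1 /andP[p2 p3]]; have p20 : 0 < p.2 by exact: lt_le_trans p2.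
  split => //; apply: le_trans (radius_le p) _.
  by rewrite (gtr0_norm p20); move: rT p1 p3; lra.
have tphi n : test_function Om (phi n).
  split.
    exact: tensor_smooth (@tensor1 R (fun x => A (2 ^+ n * x)) (fun x => B (2 ^+ n * x)) (sAn n) (sBn n)).
  exists (`[- r / 2 ^+ n, r / 2 ^+ n] `*` `[d / 2 ^+ n, 2 * r / 2 ^+ n]); split.
  - by apply: compact_setX; exact: segment_compact.
  - move=> p [/= + +]; rewrite !in_itv/= !ler_pdivrMr// !ler_pdivlMr// => /andP[p1 p1'] /andP[p2 p2'].
    have [|q2 qr] := inUp (2 ^+ n *: p).
      rewrite -[(_ *: p).1]/(2 ^+ n * p.1) -[(_ *: p).2]/(2 ^+ n * p.2) ![2 ^+ n * _]mulrC.
      by rewrite ler_norml p1 p1' p2 p2'.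
    apply: upper_sector; first by move: q2; rewrite -[(_ *: p).2]/(2 ^+ n * p.2) pmulr_rgt0.
    apply: le_trans qr; rewrite radius_scale ?(ltW (two n))// ler_peMl//; exact: sqrtr_ge0.
  - move=> p np; rewrite /phi; apply: (out (2 ^+ n * p.1, 2 ^+ n * p.2)) => -[/= q1 /andP[q2 q3]].
    apply: np; split; rewrite /= in_itv/= !ler_pdivrMr// !ler_pdivlMr// ![_ * 2 ^+ n]mulrC ?q2//.
    by rewrite -ler_norml.
have dphi n p : 'D_(e1 R) (phi n) p = 2 ^+ n * ('D_1 A (2 ^+ n * p.1) * B (2 ^+ n * p.2)).
  have := @derive_tensor R (fun x => A (2 ^+ n * x)) (fun x => B (2 ^+ n * x)) (e1 R) p (sAn n) (sBn n).
  move=> /= E; etransitivity; first exact: E.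
  rewrite mul1r mul0r addr0 mulrA; congr (_ * _).
  have H := is_derive1_affine (2 ^+ n) 0 p.1 sA.
  have Ef : (fun x => A (2 ^+ n * x)) = (fun x => A (0 + x * 2 ^+ n)).
    by apply/funext => x; rewrite add0r mulrC.
  by rewrite Ef; have [_ E'] := H; etransitivity; [exact: E'|rewrite add0r mulrC [p.1 * _]mulrC].
pose D p := 'D_1 A p.1 * B p.2.
have DEp p : 'D_(e1 R) (phi 0%N) p = D p by rewrite dphi !expr0 !mul1r.
have DE : 'D_(e1 R) (phi 0%N) = D by apply/funext.
have td := test_derive (e1 R) (tphi 0%N); rewrite DE in td.
have D_out p : ~ (`|p.1| <= r /\ d <= p.2 <= 2 * r) -> D p = 0.
  move=> np; rewrite -DE; apply: (@smooth_support_derive _ _ (`[- r, r] `*` `[d, 2 * r])).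
  - by apply: compact_plane_closed; apply: compact_setX; exact: segment_compact.
  - move=> q nq; rewrite /phi !expr0 !mul1r; apply: out => -[q1 q2]; apply: nq.
    by split; rewrite /= in_itv/=// -ler_norml.
  - by move=> [/= + +]; rewrite !in_itv/= -ler_norml => p1 p2; apply: np.
pose F p := s p * D p; pose G p := phi 0%N p ^+ 2.
have Ld := test_L2 mO td.
have ext f : (forall p, ~ Om p -> f p = 0) -> itg Om f -> itg setT f.
  move=> f0 /(integrable_mkcond _ mO); rewrite /itg.
  rewrite (_ : (EFin \o f) \_ Om = EFin \o f)//; apply/funext => p; rewrite patchE.
  by case: ifPn => //; rewrite notin_setE => /f0 /= ->.
have F_out p : ~ Om p -> F p = 0 by move=> Op; rewrite /F (test_out td Op) mulr0.
have Fi : itg Om F by exact: L2M.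
have Fi' : itg setT F by exact: ext.
have Gi : itg setT G by exact: L2_itg (test_L2 measurableT (tphi 0%N)).
(* Substituting 2^n x, the left side is 2^(n al) 2^-n times the integral of F, and |phi_n| = 2^-n
   |phi_0|; the factors 2^-n cancel. *)
have I0 n : 2 `^ al ^+ n * `|int setT F| <= norm0 Om g * Num.sqrt (int setT G).
  have := sg _ (tphi n); rewrite ip_int.
  have t2 := test_derive (e1 R) (tphi n).
  have -> : int Om (fun p => s p * 'D_(e1 R) (phi n) p) =
      int setT (fun p => (2 `^ al ^+ n * 2 ^+ n) * (F \o aff (2 ^+ n) 0) p).
    rewrite /int Rintegral_restrict => [|p Op]; last by rewrite (test_out t2 Op) mulr0.
    apply: int_eq => p _; rewrite dphi /= /F -[aff _ _ p]/(2 ^+ n * p.1 + 0, 2 ^+ n * p.2 + 0) !addr0.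
    rewrite -[_ * B _]/(D (2 ^+ n * p.1, 2 ^+ n * p.2)).
    have [[q1 q2]|nq] := pselect (`|2 ^+ n * p.1| <= r /\ d <= 2 ^+ n * p.2 <= 2 * r); last first.
      by rewrite (D_out (2 ^+ n * p.1, 2 ^+ n * p.2))// !mulr0.
    have [_ qT] := inUp (2 ^+ n * p.1, 2 ^+ n * p.2) (conj q1 q2).
    have -> : s p = 2 `^ al ^+ n * s (2 ^+ n * p.1, 2 ^+ n * p.2).
      have -> : 2 `^ al ^+ n = (2 ^+ n)^-1 `^ (- al) :> R.
        rewrite -powR_mulrn ?powR_ge0// -powRrM -powR_invn// -powRrM.
        by congr (_ `^ _); ring.
      rewrite -(sing_scale om hchi _ _ qT) ?invr_gt0 ?invf_le1//.
      congr s; rewrite -[RHS]/((2 ^+ n)^-1 * (2 ^+ n * p.1), (2 ^+ n)^-1 * (2 ^+ n * p.2)).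
      by rewrite !mulKf ?gt_eqF// -surjective_pairing.
    by ring.
  have [Fa FE] := int_aff 0 (two n) Fi'; have [Ga GE] := int_aff 0 (two n) Gi.
  rewrite (intZ _ measurableT Fa) => E.
  have E1 : `|2 `^ al ^+ n * 2 ^+ n * int setT (F \o aff (2 ^+ n) 0)| = `|ip Om g (phi n)| by rewrite E normrN.
  have CS := L2_CS oOm Lg (test_L2 mO (tphi n)).
  have nE : norm0 Om (phi n) = (2 ^+ n)^-1 * Num.sqrt (int setT G).
    have -> : norm0 Om (phi n) = Num.sqrt (int setT (G \o aff (2 ^+ n) 0)).
      rewrite /norm0 ip_int; congr Num.sqrt.
      rewrite /int Rintegral_restrict => [|p Op]; last by rewrite (test_out (tphi n) Op) mulr0.
      apply: int_eq => p _; rewrite /= /G -[aff _ _ p]/(2 ^+ n * p.1 + 0, 2 ^+ n * p.2 + 0) !addr0.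
      by rewrite /phi !expr0 !mul1r expr2.
    rewrite GE sqrtrM ?sqr_ge0// sqrtr_sqr (gtr0_norm (two n)) mulrA mulVf ?mul1r// gt_eqF.
  rewrite FE normrM (gtr0_norm (exprn_gt0 2 (two n))).
  have b0 : 0 <= (2 `^ al : R) ^+ n by rewrite exprn_ge0// powR_ge0.
  rewrite !normrM (ger0_norm b0) (gtr0_norm (two n)) in E1.
  rewrite nE in CS; rewrite -E1 in CS.
  have := two n; move: CS; move: (2 ^+ n) (`|int _ _|) (Num.sqrt _) (norm0 _ _) => t x y z CS t0.
  apply: (@le_trans _ _ (t * (z * (t^-1 * y)))); last by rewrite mulrCA mulVKf ?gt_eqF.
  have -> : 2 `^ al ^+ n * (t ^+ 2 * x) = t * (2 `^ al ^+ n * t * x) by ring.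
  by rewrite ler_pM2l.
have IF : int setT F = 0.
  have b1 : 1 < 2 `^ al :> R.
    by rewrite /powR pnatr_eq0/= -[ltLHS]expR0 ltr_expR mulr_gt0// ln_gt0 ?ltr1n.
  have c : ((2 `^ al)^-1 ^+ k : R) @[k --> \oo] --> (0 : R).
    by apply: cvg_expr; rewrite ger0_norm ?invr_ge0 ?powR_ge0// invf_lt1// powR_gt0.
  apply/eqP; rewrite -normr_le0; apply: (@le0_eps _ _ (norm0 Om g * Num.sqrt (int setT G))).
    by rewrite mulr_ge0 ?sqrtr_ge0.
  move=> e e0; move: c => /cvgrPdist_lt /(_ e e0)[N _ /(_ N (leqnn N))].
  have bN : 0 < (2 `^ al : R) ^+ N by rewrite exprn_gt0// powR_gt0.
  rewrite /= sub0r normrN exprVn gtr0_norm ?invr_gt0// => /ltW eN.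
  have := I0 N; rewrite -ler_pdivlMl// mulrC => /le_trans; apply.
  by rewrite ler_wpM2l ?mulr_ge0 ?sqrtr_ge0.
(* D integrates to 0, so the nonnegative function (s - m) D does as well; D is then null, and by
   [test_poincare] so is the profile, which contradicts its continuity and its value at [pt]. *)
have [M [M0 pM p0]] := test_bounded (tphi 0%N); have [M' [_ DM _]] := test_bounded td.
have [DT D0] : itg setT D /\ int setT D = 0.
  have lip : forall p t, `|phi 0%N (p + t *: e1 R) - phi 0%N p| <= M' * `|t|.
    by apply: smooth_lip => [|p]; [case: (tphi 0%N)|rewrite DEp].
  apply: (slope_integral (test_measurable (tphi 0%N)) pM p0 lip (test_measurable td)).
  by apply: aeW => p; rewrite -DEp; exact: test_quot (tphi 0%N).
have Dn : int Om D = 0.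
  by rewrite -D0; apply: Rintegral_restrict => p Op; exact: test_out td Op.
have nD : null_on Om D.
  have Di : itg Om D by exact: (@integrableS _ M2 R mu setT Om).
  have E0 : int Om (fun p => F p - m * D p) = 0.
    rewrite intB//; last exact: itgZ.
    rewrite intZ// Dn mulr0 subr0 -IF; exact: Rintegral_restrict.
  have := (int_eq0P mO (itgB mO Fi (itgZ m mO Di)) _).2 E0.
  have FE p : F p - m * D p = (s p - m) * D p by rewrite /F mulrBl.
  move=> H; apply: aeS (H _) => [p zp /zp|p Op].
    rewrite FE => /eqP; rewrite mulf_eq0 subr_eq0 => /orP[sm|/eqP//].
    have [_ h] := sign p; have [//|Dp] := eqVneq (D p) 0.
    by move: (h Dp); rewrite sm.
  by rewrite FE; have [] := sign p.
have nphi : null_on Om (phi 0%N).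
  apply/(null_onP mO (test_L2 mO (tphi 0%N))).
  have := test_poincare oOm OmL L0 (tphi 0%N); rewrite DE.
  have -> : norm0 Om D = 0 by rewrite /norm0 ((null_onP mO Ld).1 nD) sqrtr0.
  rewrite mulr0 /norm0 => h; have : Num.sqrt (ip Om (phi 0%N) (phi 0%N)) == 0.
    by rewrite eq_le h sqrtr_ge0.
  by rewrite sqrtr_eq0 => h'; apply/eqP; rewrite eq_le h' ip_ge0.
have Opt : Om pt.
  have [|p2 pr] := inUp pt; last exact: upper_sector.
  by apply: contrapT => /out/eqP; rewrite (negbTE ptN).
move/eqP: ptN; apply.
have := null_on_continuous oOm Opt _ nphi; rewrite /phi !expr0 !mul1r; apply.
by apply: smooth_continuous; case: (tphi 0%N).
Qed.

End NotH1.

(** * The eigenvalue problems in Sobolev spaces *)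

Section Transfer.
Variable R : realType.
Local Notation M2 := (measurableTypeR R * measurableTypeR R)%type.
Local Notation meas2 D := (measurable (D : set M2)).
Variables (Om : set (plane R)) (L : R).
Hypotheses (oOm : open Om) (OmL : Om `<=` box L).
Let mO : meas2 Om. Proof. exact: open_measurable2. Qed.
Local Notation H := (elt (L2s oOm)).
Local Notation V := (elt (H10s oOm OmL)).
Local Notation ipH := (eip (oOm := oOm)).
Local Notation bV := (eb (oOm := oOm) (OmL := OmL)).
Local Notation nH := (snorm ipH).
Local Notation nV := (snorm bV).
Local Notation ioV := (io oOm OmL).

Lemma null_on_snorm (x : H) : null_on Om (val x) <-> nH x = 0.
Proof.
rewrite (null_onP mO (L2sP x)); split => [x0|/eqP]; first by rewrite /snorm -[ipH x x]/(ip Om (val x) (val x)) x0 sqrtr0.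
by rewrite (snorm_eq0 (eip_semi oOm)) => /eqP.
Qed.

Lemma val_sum n (k : 'I_n -> R) (x : 'I_n -> H) :
  val (\sum_i k i *: x i) = (fun p => \sum_i k i * val (x i) p).
Proof.
elim: n k x => [|n IH] k x.
  by rewrite big_ord0; apply/funext => p; rewrite big_ord0.
rewrite big_ord_recl val_lin IH; apply/funext => p; rewrite big_ord_recl.
by [].
Qed.

Lemma independent_indep n (u : 'I_n -> V) :
  independent Om (fun i => val (u i)) <-> indep ipH (fun i => ioV (u i)).
Proof.
by split => iu k k0 i; apply: (iu k); move: k0; rewrite -null_on_snorm val_sum.
Qed.

Variables (Vs : set (plane R -> R)) (xi : H).
Hypothesis VsH : Vs `<=` H10 Om.
Let W (v : V) := Vs (val v).

(** The dictionary between the concrete and the abstract problem: a(w, psi) is the product of [Q w]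
    with psi, because [norm0] squared is [ip xi xi]. *)
Lemma eigenpair_eigen l (sg u : V) :
  eigenpair Om Vs (val xi) l (val sg) (val u) <-> eigen ipH bV ioV W xi l sg u.
Proof.
have hs := eip_semi oOm.
have aE (w psi : V) : aform Om (val xi) (val w) (val psi) = ipH (dfl ipH xi (ioV w)) (ioV psi).
  rewrite /dfl (siBl hs) (siZl hs) /aform; congr (_ - _).
  rewrite -[LHS]/(ipH (cform Om (val xi) (val w) *: xi) (ioV psi)) (siZl hs); congr (_ * _).
  by rewrite /cform /norm0 sqr_sqrtr// ip_ge0.
have lE (v : V) : ip Om (l \*o val u) (val v) = l * ipH (ioV u) (ioV v).
  by rewrite -(siZl hs).
have nE : ~ null_on Om (val u) <-> ipH (ioV u) (ioV u) != 0.
  rewrite -(snorm_eq0 hs); split => [nu|/eqP nu]; last by move/(null_on_snorm (ioV u)).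
  by apply/eqP => /(null_on_snorm (ioV u)).
split=> [[Vsg Vu nu e1 e2]|[Wsg Wu nu e1 e2]]; split => //.
- exact/nE.
- by move=> psi Wp; have := e1 _ Wp; rewrite aE => /eqP; rewrite addrC subr_eq0 => /eqP.
- by move=> v Wv; rewrite -lE; exact: e2.
- exact/nE.
- move=> psi Vp; pose p : V := mkelt (F := H10s oOm OmL) (VsH Vp).
  by have := e1 p Vp; rewrite -aE => E; apply/eqP; rewrite addrC subr_eq0; apply/eqP.
- move=> v Vv; pose p : V := mkelt (F := H10s oOm OmL) (VsH Vv).
  by have := e2 p Vv; rewrite -lE.
Qed.

Lemma eigenvalues_in_eigs (J : set R) n :
  eigenvalues_in Om Vs (val xi) J n <-> eigs ipH bV ioV W xi J n.
Proof.
split=> [[l [sg [u [e iu]]]]|[l [sg [u [e iu]]]]].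
- have Hs i : H10 Om (sg i) by have [_ [/VsH]] := e i.
  have Hu i : H10 Om (u i) by have [_ [_ /VsH]] := e i.
  exists l, (fun i => mkelt (F := H10s oOm OmL) (Hs i)), (fun i => mkelt (F := H10s oOm OmL) (Hu i)).
  split => [i|]; last exact/independent_indep.
  by have [Ji ei] := e i; split => //; exact/eigenpair_eigen.
- exists l, (fun i => val (sg i)), (fun i => val (u i)); split => [i|].
    by have [Ji ei] := e i; split => //; exact/eigenpair_eigen.
  exact/independent_indep.
Qed.

Lemma nth_eigenvalue_nth_eig j l :
  nth_eigenvalue Om Vs (val xi) j l -> nth_eig ipH bV ioV j W xi l.
Proof.
move=> [[sg [u e]] e1 e2]; split.
- have [/VsH Hs /VsH Hu _ _ _] := e.
  exists (mkelt (F := H10s oOm OmL) Hs), (mkelt (F := H10s oOm OmL) Hu).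
  exact/eigenpair_eigen.
- exact/eigenvalues_in_eigs.
- by move/eigenvalues_in_eigs.
Qed.

End Transfer.

(** * Best approximation by Galerkin orthogonality *)

Section Cea.
Variable R : realType.
Variables (V : lmodType R) (b : V -> V -> R) (W : V -> Prop).
Hypothesis hb : semi_inner b.
Hypothesis Wlin : forall a x y, W x -> W y -> W (a *: x + y).

Lemma cea v p w : W p -> (forall z, W z -> b (v - p) z = 0) -> W w ->
  snorm b (v - p) <= snorm b (v - w).
Proof.
move=> Wp p0 Ww; have wp : W (w - p) by rewrite addrC -scaleN1r; exact: Wlin.
have E : b (v - p) (v - p) = b (v - p) (v - w).
  by rewrite -[RHS]addr0 -(p0 _ wp) -(siDr hb) addrA subrK.
have := CSn hb (v - p) (v - w); rewrite -E -(snormE hb) ger0_norm ?sqr_ge0// expr2.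
have [->|n0] := eqVneq (snorm b (v - p)) 0; first by rewrite snorm_ge0.
by rewrite ler_pM2l// lt_neqAle eq_sym n0 snorm_ge0.
Qed.

End Cea.

(** * Finite element spaces, Ritz projections and [eta0] *)

Section FiniteElements.
Variable R : realType.
Local Notation M2 := (measurableTypeR R * measurableTypeR R)%type.
Local Notation meas2 D := (measurable (D : set M2)).
Variables (Om : set (plane R)) (L : R).
Hypotheses (oOm : open Om) (OmL : Om `<=` box L) (L0 : 0 < L).
Let mO : meas2 Om. Proof. exact: open_measurable2. Qed.
Local Notation H := (elt (L2s oOm)).
Local Notation V := (elt (H10s oOm OmL)).
Local Notation ipH := (eip (oOm := oOm)).
Local Notation bV := (eb (oOm := oOm) (OmL := OmL)).
Local Notation nH := (snorm ipH).
Local Notation nV := (snorm bV).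
Local Notation ioV := (io oOm OmL).
Let hs := eip_semi oOm.
Let hb := eb_semi oOm OmL.

Lemma S0_lin T (k : R) f g : S0 Om T f -> S0 Om T g -> S0 Om T (k *: f + g).
Proof.
move=> [cf Hf af] [cg Hg ag]; split.
- by move=> p; apply: cvgD; [apply: cvgM; [exact: cvg_cst|exact: cf]|exact: cg].
- exact: (H10_lin oOm OmL).
- move=> K KT; have [a0 [a1 [a2 aE]]] := af K KT; have [c0 [c1 [c2 cE]]] := ag K KT.
  exists (k * a0 + c0), (k * a1 + c1), (k * a2 + c2) => p Kp.
  by rewrite -[LHS]/(k * f p + g p) aE// cE//; ring.
Qed.

Lemma S0_0 T : S0 Om T 0.
Proof.
split; first by move=> p; exact: cvg_cst.
- exact: (H10_0 oOm OmL).
- by move=> K KT; exists 0, 0, 0 => p _; rewrite !mul0r !addr0.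
Qed.

Variables (S : (plane R -> R) -> plane R -> R) (hS : poisson_operator Om S).
Definition solve (g : H) : V := mkelt (F := H10s oOm OmL) (proj1 (hS (L2sP g))).

Lemma solve_solver : solver ipH bV ioV (fun=> True) solve.
Proof.
split => // g v _; exact: (proj2 (hS (L2sP g)) _ (H10sP v)).
Qed.

Variables (T : mesh R) (P : (plane R -> R) -> plane R -> R) (hP : ritz_projection Om T P).
Lemma ritz_H10 (v : V) : H10 Om (P (val v)).
Proof. by have [[]] := hP (H10sP v). Qed.
Definition ritz (v : V) : V := mkelt (F := H10s oOm OmL) (ritz_H10 v).
Local Notation W := (fun v : V => S0 Om T (val v)).

Lemma ritz_in v : W (ritz v).
Proof. by have [] := hP (H10sP v). Qed.

Lemma ritz_orth v w : W w -> bV (v - ritz v) w = 0.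
Proof. by have [_ h] := hP (H10sP v); exact: h. Qed.

Lemma W_lin a (x y : V) : W x -> W y -> W (a *: x + y).
Proof. by move=> Wx Wy; exact: (S0_lin a Wx Wy). Qed.

Lemma ritz_best v w : W w -> nV (v - ritz v) <= nV (v - w).
Proof.
by move=> Ww; apply: (cea hb W_lin) => //; [exact: ritz_in|move=> z Wz; exact: ritz_orth].
Qed.

Let infs g := [set norm1 Om (S g \- psi) | psi in S0 Om T].
Let sups := [set inf (infs g) | g in [set g | L2 Om g /\ norm0 Om g = 1]].

Let infs_lb g : lbound (infs g) 0.
Proof. by move=> _ [psi _ <-]; exact: sqrtr_ge0. Qed.

Let infs0 g : infs g !=set0.
Proof. by exists (norm1 Om (S g \- 0)); exists 0 => //; exact: S0_0. Qed.

Lemma n1V_le v : snorm (@n1V R Om L oOm OmL) v <= (1 + 2 * L) * nV v.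
Proof. exact: (n1_le hs hb (mulr_gt0 (ltr0Sn _ _) L0) (H10_poincare L0)). Qed.

Let sups_ub : ubound sups ((1 + 2 * L) * (2 * L)).
Proof.
move=> _ [g [Lg g1] <-]; pose g' : H := mkelt (F := L2s oOm) Lg.
apply: le_trans (_ : norm1 Om (val (solve g' - 0)) <= _).
  by apply: ge_inf; [exists 0; exact: infs_lb|exists 0 => //; exact: S0_0].
rewrite norm1_n1V subr0; apply: le_trans (n1V_le _) _.
rewrite ler_pM2l; last by rewrite ltr_wpDr// mulr_ge0// ltW.
have := sol_bound hs hb (mulr_gt0 (ltr0Sn R 1) L0) (H10_poincare L0) solve_solver g'.
by rewrite (_ : nH g' = 1)// mulr1.
Qed.

Lemma eta0_ge0 : 0 <= eta0 Om S T.
Proof.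
(* Over an empty set [sup] is 0 by convention. *)
have [s0|/nonemptyPn s0] := pselect (sups !=set0); last by rewrite /eta0 -/sups s0 sup0.
have [x [g gP _]] := s0.
apply: le_trans (_ : inf (infs g) <= _); first exact: lb_le_inf.
by apply: ub_le_sup; [eexists; exact: sups_ub|exists g].
Qed.

Lemma eta0_le : eta0 Om S T <= (1 + 2 * L) * (2 * L).
Proof.
have [s0|/nonemptyPn s0] := pselect (sups !=set0).
  by apply: ge_sup => //; exact: sups_ub.
by rewrite /eta0 -/sups s0 sup0 !mulr_ge0 ?addr_ge0 ?mulr_ge0// ltW.
Qed.

(** After scaling to a unit [g]: the Ritz projection is the best approximation in energy, and the
    energy norm is below the H^1 norm in which [eta0] is defined. *)
Lemma eta0P (g : H) : nV (solve g - ritz (solve g)) <= eta0 Om S T * nH g.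
Proof.
have hS' := solve_solver.
have [g0|g0] := eqVneq (nH g) 0.
  rewrite g0 mulr0; have w0 : W 0 by exact: S0_0.
  apply: le_trans (ritz_best _ w0) _; rewrite subr0.
  by have := sol_bound hs hb (mulr_gt0 (ltr0Sn R 1) L0) (H10_poincare L0) hS' g; rewrite g0 mulr0.
pose k := nH g; pose g' : H := k^-1 *: g.
have k0 : 0 < k by rewrite lt_neqAle eq_sym g0 snorm_ge0.
have g1 : nH g' = 1 by rewrite (snormZ hs) ger0_norm ?invr_ge0 ?(ltW k0)// mulVf.
(* [solve] is homogeneous only up to null vectors, so the projection of [solve g] is compared with k
   times that of [solve g']. *)
have Sg : nV (solve g - k *: solve g') = 0.
  apply/eqP; rewrite (snorm_eq0 hb); apply/eqP; set z := _ - _.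
  rewrite {1}/z (siBl hb) (siZl hb) !(sol_eq hS')// (siZl hs).
  by rewrite mulrA mulfV ?mul1r ?subrr// gt_eqF.
have E : nV (solve g - k *: ritz (solve g')) = k * nV (solve g' - ritz (solve g')).
  rewrite -[k in RHS]ger0_norm ?(ltW k0)// -(snormZ hb) scalerBr.
  apply: (snorm_null_eq hb); rewrite opprB addrA subrK; exact: Sg.
have Wk : W (k *: ritz (solve g')).
  rewrite -[_ *: _]addr0; apply: W_lin; [exact: ritz_in|exact: S0_0].
apply: le_trans (ritz_best _ Wk) _; rewrite E mulrC ler_pM2r//.
apply: le_trans (_ : inf (infs (val g')) <= _); last first.
  apply: ub_le_sup; first by eexists; exact: sups_ub.
  by exists (val g') => //; split; [exact: L2sP|exact: g1].
apply: lb_le_inf => // _ [psi Wpsi <-].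
have Hpsi : H10 Om psi by case: Wpsi.
pose w : V := mkelt (F := H10s oOm OmL) Hpsi.
apply: le_trans (ritz_best (solve g') (Wpsi : W w)) _.
rewrite -[X in _ <= X](norm1_n1V (solve g' - w)); exact: n1V_ge1.
Qed.

End FiniteElements.

(** * The function [xi] is not null *)

Section XiNonzero.
Variable R : realType.
Variables (Om : set (plane R)) (L om tau rho : R) (chi : R -> R) (zeta : plane R -> R).
Hypotheses (oOm : open Om) (OmL : Om `<=` box L) (L0 : 0 < L).
Hypotheses (pi_om : pi < om) (tau01 : 0 < tau < 1) (rho0 : 0 < rho).
Hypotheses (hchi : cutoff tau rho chi) (hsector : sector_inside Om om rho).
Hypothesis Hz : H10 Om zeta.

Lemma origin_notin : ~ Om 0.
Proof.
have [_ bd] := hsector; have [|[_ n0] _] := bd 0; first by rewrite lexx ltW.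
have E : polar 0 0 = 0 :> plane R by rewrite /polar !mul0r.
by rewrite E in n0; apply: contra_not n0 => O0; rewrite (interior_id Om).1.
Qed.

Lemma sing_in_L2 : L2 Om (sing om chi).
Proof.
apply: (sing_L2 (L := L) _ tau01 rho0 hchi pi_om) => //; last exact: origin_notin.
- exact: lt_trans (pi_gt0 R) pi_om.
- exact: open_measurable2.
Qed.

(** Otherwise the singular function would equal -zeta almost everywhere and inherit its weak
    derivative, which [sing_no_weak_deriv] excludes. *)
Lemma xi_not_null : ~ null_on Om (sing om chi + zeta).
Proof.
move=> n0; have Ls := sing_in_L2; have mO := open_measurable2 oOm.
have Lz : L2 Om zeta by case: Hz => -[].
have [Lg zg] := H1_wd1 (proj1 Hz); set g := weak_deriv _ _ _ in Lg zg.
have LN (f : plane R -> R) : L2 Om f -> L2 Om (- f).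
  by move=> Lf; exact: (L2sP (- (mkelt (F := L2s oOm) Lf : elt (L2s oOm)))).
have ipN f h : L2 Om f -> L2 Om h -> ip Om (- f) h = - ip Om f h.
  move=> Lf Lh; exact: (siNl (eip_semi oOm) (mkelt (F := L2s oOm) Lf) (mkelt (F := L2s oOm) Lh)).
apply: (@sing_no_weak_deriv R Om L om tau rho chi oOm OmL L0 pi_om tau01 rho0 hchi hsector (- g) Ls).
split; first exact: LN.
move=> phi tp; have Lp := test_L2 mO tp; have Ld := test_L2 mO (test_derive (e1 R) tp).
rewrite (ipN _ _ Lg Lp) opprK.
transitivity (ip Om (- zeta) ('D_(e1 R) phi)).
  apply: (ip_nulll oOm) => //; first exact: LN.
  by apply: aeS n0 => p sp /sp; rewrite -[(_ - _) p]/(sing om chi p - - zeta p) opprK.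
by rewrite ipN// zg// opprK.
Qed.

End XiNonzero.

Theorem theorem3p2 (R : realType)
  (Om : set (plane R)) (om : R)
  (hOm : polygonal_domain Om) (hcorner : one_reentrant_corner Om om)
  (tau rho : R) (htau : 0 < tau < 1) (hrho : 0 < rho)
  (hsector : sector_inside Om om rho)
  (chi : R -> R) (hchi : cutoff tau rho chi)
  (zeta : plane R -> R) (hzeta : H10 Om zeta)
  (hzeta_eq : forall v, H10 Om v ->
     bform Om zeta v = ip Om (laplacian (sing om chi)) v)
  (xi : plane R -> R) (hxi : xi = sing om chi \+ zeta)
  (I : Type) (T : I -> mesh R) (hT : forall i, mesh_of Om (T i))
  (gamma : R) (hgamma : forall i, shape_regular gamma (T i))
  (zetah : I -> plane R -> R) (hzetah : forall i, S0 Om (T i) (zetah i))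
  (hzetah_eq : forall i vh, S0 Om (T i) vh ->
     bform Om (zetah i) vh = ip Om (laplacian (sing om chi)) vh)
  (xih : I -> plane R -> R) (hxih : forall i, xih i = zetah i \+ sing om chi)
  (P : I -> (plane R -> R) -> plane R -> R)
  (hP : forall i, ritz_projection Om (T i) (P i))
  (S : (plane R -> R) -> plane R -> R) (hS : poisson_operator Om S)
  (j : nat) (hj : (1 <= j)%N)
  (lambda : R) (hlambda : nth_eigenvalue Om (H10 Om) xi j lambda) :
  exists C h0 : R, [/\ 0 < C, 0 < h0 &
    forall (i : I) (lambdah : R) (sigmah uh : plane R -> R),
      mesh_size (T i) < h0 ->
      nth_eigenvalue Om (S0 Om (T i)) (xih i) j lambdah ->
      eigenpair Om (S0 Om (T i)) (xih i) lambdah sigmah uh ->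
      norm0 Om uh = 1 ->
      exists sigma u : plane R -> R,
        eigenpair Om (H10 Om) xi lambda sigma u /\
        let eta := eta0 Om S (T i) in
        let eu0 := norm0 Om (u \- uh) in
        let eu1 := norm1 Om (u \- uh) in
        let es0 := norm0 Om (sigma \- sigmah) in
        let es1 := norm1 Om (sigma \- sigmah) in
        let pu1 := norm1 Om (u \- P i u) in
        let ps0 := norm0 Om (sigma \- P i sigma) in
        let ps1 := norm1 Om (sigma \- P i sigma) in
        let exi := norm0 Om (xi \- xih i) in
        [/\ `|lambda - lambdah| <= C * (eta * (pu1 + ps1) + exi),
            eu0 <= C * (eta * (pu1 + ps1) + exi),
            eu1 <= C * (pu1 + ps0 + exi),
            es0 <= C * (eta * (pu1 + ps1) + exi)
          & es1 <= C * (eta * pu1 + ps1 + exi)]].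

Proof.
have [_ oOm _ bOm _] := hOm; have [L L0 OmL] := bounded_set_box bOm.
have [/andP[pi_om _] _ _] := hcorner.
have mO := open_measurable2 oOm.
have Ls : L2 Om (sing om chi) by exact: (sing_in_L2 oOm OmL L0 pi_om htau hrho hchi hsector).
have LD f g : L2 Om f -> L2 Om g -> L2 Om (f + g).
  by move=> Lf Lg; rewrite -[f]scale1r; exact: L2_lin.
have Lz : L2 Om zeta by case: hzeta => -[].
have Lxi : L2 Om xi by rewrite hxi; exact: LD.
have Hzh i : H10 Om (zetah i) by case: (hzetah i).
have Lxih i : L2 Om (xih i) by rewrite hxih; apply: LD => //; case: (Hzh i) => -[].
pose xi' : elt (L2s oOm) := mkelt (F := L2s oOm) Lxi.
pose xih' i : elt (L2s oOm) := mkelt (F := L2s oOm) (Lxih i).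
have hs := eip_semi oOm; have hb := eb_semi oOm OmL.
have Cp0 : 0 < 2 * L by rewrite mulr_gt0.
have xi0 : 0 < snorm (eip (oOm := oOm)) xi'.
  rewrite lt_neqAle snorm_ge0 andbT; apply/eqP => /esym/null_on_snorm /=.
  rewrite hxi; exact: (xi_not_null oOm OmL L0 pi_om htau hrho hchi hsector hzeta).
have S0H i : S0 Om (T i) `<=` H10 Om by move=> f [].
have dense (v : elt (H10s oOm OmL)) e : 0 < e -> exists2 h0, 0 < h0 & forall i, mesh_size (T i) < h0 ->
    snorm (eb (oOm := oOm) (OmL := OmL)) (v - ritz (hP i) v) <= e.
  move=> e0; have [h0 h00 hh] := fe_dense L0 gamma v e0.
  exists h0 => // i hi; have [w [Sw vw]] := hh _ (hT i) (hgamma i) hi.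
  exact: le_trans (ritz_best (hP i) v Sw) vw.
(* xi - xih = zeta - zetah is a Galerkin error: best approximation and density make its energy
   small, Poincare's inequality its L^2 norm. *)
have xcvg e : 0 < e -> exists2 h0, 0 < h0 & forall i, mesh_size (T i) < h0 ->
    snorm (eip (oOm := oOm)) (xi' - xih' i) <= e.
  move=> e0; pose z : elt (H10s oOm OmL) := mkelt (F := H10s oOm OmL) hzeta.
  have [h0 h00 hh] := fe_dense L0 gamma z (divr_gt0 e0 Cp0).
  exists h0 => // i hi; have [w [Sw vw]] := hh _ (hT i) (hgamma i) hi.
  pose zh : elt (H10s oOm OmL) := mkelt (F := H10s oOm OmL) (Hzh i).
  have E : val (xi' - xih' i) = val (io oOm OmL (z - zh)).
    rewrite -[LHS]/(xi - xih i) -[RHS]/(zeta - zetah i) hxi hxih.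
    apply/funext => p; rewrite -[LHS]/((sing om chi p + zeta p) - (zetah i p + sing om chi p)).
    by rewrite -[RHS]/(zeta p - zetah i p); ring.
  have -> : snorm (eip (oOm := oOm)) (xi' - xih' i) = snorm (eip (oOm := oOm)) (io oOm OmL (z - zh)).
    by rewrite /snorm /eip /eform E.
  apply: le_trans (H10_poincare L0 _) _; rewrite -ler_pdivlMl// mulrC; apply: le_trans vw.
  have orth (v : elt (H10s oOm OmL)) : S0 Om (T i) (val v) -> eb (z - zh) v = 0.
    move=> Wv; rewrite (siBl hb) -[eb z v]/(bform Om zeta (val v)) -[eb zh v]/(bform Om (zetah i) (val v)).
    apply/eqP; rewrite subr_eq0; apply/eqP.
    exact: etrans (hzeta_eq _ (H10sP v)) (esym (hzetah_eq i _ Wv)).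
  exact: (cea hb (@W_lin R Om L oOm OmL (T i)) (hzetah i : S0 Om (T i) (val zh)) orth Sw).
have rel e (e0 : 0 < e) := H10_rellich oOm OmL L0 e0.
have W1 i a x y := @W_lin R Om L oOm OmL (T i) a x y.
have le := fun i => eta0_le oOm OmL L0 hS (T i).
(* Every element of [V] satisfies the membership predicate of the continuous problem, which is
   thereby identified with the trivial predicate in [solve_solver]. *)
have TT : (fun v : elt (H10s oOm OmL) => H10 Om (val v)) = (fun=> True).
  by apply/funext => v; apply/propext; exact: (conj (fun=> Logic.I) (fun=> H10sP v)).
have lam' : nth_eig (eip (oOm := oOm)) (eb (oOm := oOm) (OmL := OmL)) (io oOm OmL) j (fun=> True) xi' lambda.
  by rewrite -TT; exact: (@nth_eigenvalue_nth_eig R Om L oOm OmL (H10 Om) xi').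
have [C [h0 [C0 h00 main]]] := mixed_eigenpair_error hs hb Cp0 (H10_poincare L0) rel
  (@eL2_complete R Om oOm) (solve_solver oOm OmL hS) xi0
  (size := fun i => mesh_size (T i)) (W := fun i v => S0 Om (T i) (val v))
  W1 (fun i => ritz_in (hP i)) (fun i => @ritz_orth R Om L oOm OmL (T i) (P i) (hP i))
  (fun i => eta0_ge0 oOm OmL L0 hS (T i))
  (fun i => eta0P OmL L0 hS (hP i)) le dense xcvg lam'.
exists C, h0; split => // i lamh sh uh hi nlamh esu uh1.
have Hs : H10 Om sh by have [[_ Hs _]] := esu.
have Hu : H10 Om uh by have [_ [_ Hu _]] := esu.
pose sh' : elt (H10s oOm OmL) := mkelt (F := H10s oOm OmL) Hs.
pose uh' : elt (H10s oOm OmL) := mkelt (F := H10s oOm OmL) Hu.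
have nl' := @nth_eigenvalue_nth_eig R Om L oOm OmL (S0 Om (T i)) (xih' i) (S0H i) j lamh nlamh.
have es' := (@eigenpair_eigen R Om L oOm OmL (S0 Om (T i)) (xih' i) (S0H i) lamh sh' uh').1 esu.
have [s [u [esu' [H1' H2' H3' H4' H5']]]] := main i lamh sh' uh' hi nl' es' uh1.
exists (val s), (val u); split.
  rewrite -TT in esu'.
  exact: ((@eigenpair_eigen R Om L oOm OmL (H10 Om) xi' (fun f Hf => Hf) lambda s u).2 esu').
split; [exact: H1'|exact: H2'|exact: H3'|exact: H4'|exact: H5'].
Qed.
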